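(* Let $D_\infty$ be the Ważewski dendrite of order $\infty$. The group $\mathrm{Homeo}(D_\infty)$ of all homeomorphisms of $D_\infty$, viewed as an abstract (discrete) group, is acyclic, that is, $\mathrm{H}_n(\mathrm{Homeo}(D_\infty),\mathbf{Z})=0$ for all $n>0$.
   Context: A dendrite is a locally connected continuum (non-empty compact connected metrizable space) containing no simple closed curve. A branch point of a dendrite $X$ is a point $x$ such that $X\setminus\{x\}$ has at least three connected components. The Ważewski dendrite $D_\infty$ is the dendrite, unique up to homeomorphism, such that: it is not a single point; for every branch point $x$ the complement of $x$ has (countably) infinitely many components; and every arc joining two distinct points contains a branch point in its interior. *)

(* Defs.v *)
From HB Require Import structures.
From mathcomp Require Import all_boot all_order all_algebra.
From mathcomp Require Import generic_quotient ring_quotient freeg.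
From mathcomp Require Import boolp classical_sets functions cardinality reals.
From mathcomp Require Import topology normedtype.
From mathcomp Require Import zify.

Set Implicit Arguments.
Unset Strict Implicit.
Unset Printing Implicit Defensive.

Import Order.TTheory GRing.Theory Num.Theory.
Import numFieldNormedType.Exports.

Local Open Scope classical_set_scope.
Local Open Scope ring_scope.

(* [f] and [g] restrict to mutually inverse homeomorphisms between the subspaces
   [A] and [B]; their values outside [A] and [B] are irrelevant. *)
Definition homeo_between (S T : topologicalType) (A : set S) (B : set T)
    (f : S -> T) (g : T -> S) : Prop :=
  [/\ set_fun A B f /\ set_fun B A g,
      {within A, continuous f}, {within B, continuous g},
      (forall x, A x -> g (f x) = x) & (forall y, B y -> f (g y) = y)].

Definition homeomorphic (S T : topologicalType) (A : set S) (B : set T) : Prop :=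
  exists f g, homeo_between A B f g.

Definition metrizable (R : realType) (X : topologicalType) : Prop :=
  exists M : metricType R, homeomorphic [set: X] [set: M].

Definition locally_connected (X : topologicalType) : Prop :=
  forall (x : X) (U : set X), nbhs x U ->
    exists V : set X, [/\ open V, V x, connected V & V `<=` U].

Definition continuum (R : realType) (X : topologicalType) : Prop :=
  [/\ [set: X] !=set0, compact [set: X], connected [set: X] & metrizable R X].

Definition circle (R : realType) : set (R * R) :=
  [set p | p.1 ^+ 2 + p.2 ^+ 2 = 1].

Definition simple_closed_curve (R : realType) (X : topologicalType)
    (C : set X) : Prop :=
  homeomorphic (@circle R) C.

Definition dendrite (R : realType) (X : topologicalType) : Prop :=
  [/\ continuum R X, locally_connected X &
      forall C : set X, ~ simple_closed_curve R C].

Definition components (X : topologicalType) (A : set X) : set (set X) :=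
  [set connected_component A x | x in A].

Definition branch_point (X : topologicalType) (x : X) : Prop :=
  exists C1 C2 C3 : set X,
    [/\ components (~` [set x]) C1, components (~` [set x]) C2,
        components (~` [set x]) C3 & [/\ C1 <> C2, C1 <> C3 & C2 <> C3]].

Definition arc (R : realType) (X : topologicalType) (a b : X)
    (A : set X) : Prop :=
  exists (f : R -> X) (g : X -> R),
    [/\ homeo_between `[0, 1 : R] A f g, f 0 = a & f 1 = b].

Definition wazewski_dendrite (R : realType) (X : topologicalType) : Prop :=
  [/\ dendrite R X,
      (exists x y : X, x <> y),
      (forall x : X, branch_point x ->
         (components (~` [set x]) #= [set: nat])%card) &
      (forall (a b : X) (A : set X), a <> b -> arc R a b A ->
         exists x : X, [/\ A x, x <> a, x <> b & branch_point x])].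

Definition is_homeo (X : topologicalType) : pred (X -> X) := fun f =>
  `[< continuous f /\
      exists g : X -> X, [/\ continuous g, cancel f g & cancel g f] >].

Record Homeo (X : topologicalType) := MkHomeo {
  homeo_fun :> X -> X;
  homeoP : is_homeo homeo_fun }.

HB.instance Definition _ (X : topologicalType) :=
  [isSub for @homeo_fun X].
HB.instance Definition _ (X : topologicalType) := [Choice of Homeo X by <:].

Section HomeoGroup.
Variable X : topologicalType.
Implicit Types f g h : Homeo X.

Lemma homeo_cont f : continuous f.
Proof. by have /asboolP[] := homeoP f. Qed.

Definition homeo_inv_fun f : X -> X :=
  projT1 (cid (proj2 (asboolW (homeoP f)))).

Lemma homeo_inv_funP f :
  [/\ continuous (homeo_inv_fun f), cancel f (homeo_inv_fun f)
    & cancel (homeo_inv_fun f) f].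
Proof. exact: (projT2 (cid (proj2 (asboolW (homeoP f))))). Qed.

Lemma homeo_one_subproof : is_homeo (@idfun X).
Proof.
apply/asboolP; split => [x|]; first exact: cvg_id.
by exists idfun; split => // x; exact: cvg_id.
Qed.

Definition homeo_one : Homeo X := MkHomeo homeo_one_subproof.

Lemma homeo_inv_subproof f : is_homeo (homeo_inv_fun f).
Proof.
have [fc fK Kf] := homeo_inv_funP f.
by apply/asboolP; split => //; exists f; split => //; exact: homeo_cont.
Qed.

Definition homeo_inv f : Homeo X := MkHomeo (homeo_inv_subproof f).

Lemma homeo_mul_subproof f g : is_homeo (f \o g).
Proof.
have [fc fK Kf] := homeo_inv_funP f; have [gc gK Kg] := homeo_inv_funP g.
apply/asboolP; split.
  by move=> x; apply: continuous_comp; exact: homeo_cont.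
exists (homeo_inv_fun g \o homeo_inv_fun f); split; try exact: can_comp.
by move=> x; apply: continuous_comp; [exact: fc | exact: gc].
Qed.

Definition homeo_mul f g : Homeo X := MkHomeo (homeo_mul_subproof f g).

Lemma homeo_mulA : associative homeo_mul.
Proof. by move=> f g h; exact: val_inj. Qed.

Lemma homeo_mul1 : left_id homeo_one homeo_mul.
Proof. by move=> f; exact: val_inj. Qed.

Lemma homeo_mulr1 : right_id homeo_one homeo_mul.
Proof. by move=> f; exact: val_inj. Qed.

Lemma homeo_mulV : left_inverse homeo_one homeo_inv homeo_mul.
Proof.
move=> f; apply/val_inj/funext => x /=.
by have [_ fK _] := homeo_inv_funP f; exact: fK.
Qed.

Lemma homeo_mulrV : right_inverse homeo_one homeo_inv homeo_mul.
Proof.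
move=> f; apply/val_inj/funext => x /=.
by have [_ _ Kf] := homeo_inv_funP f; exact: Kf.
Qed.

HB.instance Definition _ := isGroup.Build (Homeo X)
  homeo_mulA homeo_mul1 homeo_mulr1 homeo_mulV homeo_mulrV.

End HomeoGroup.

(* Inhomogeneous bar complex of [G] with trivial integer coefficients. *)

Section GroupHomology.
Variable G : groupType.

Definition bar_chain (n : nat) := {freeg (n.-tuple G) / int}.

HB.instance Definition _ n := GRing.Lmodule.on (bar_chain n).

(* With 0-based entries: face 0 drops the first entry, face n.+1 drops the last
   one, and face i for 0 < i < n.+1 multiplies entries i.-1 and i. *)
Definition bar_face (n : nat) (i : 'I_n.+2) (t : n.+1.-tuple G) : n.-tuple G :=
  [tuple (if j.+1 < i then nth 1 t j
          else if j.+1 == i then nth 1 t j * nth 1 t j.+1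
          else nth 1 t j.+1)%g%N | j < n].

Definition bar_diff (n : nat) : bar_chain n -> bar_chain n.-1 :=
  match n with
  | 0 => fun=> 0
  | m.+1 => fglift (fun t : m.+1.-tuple G =>
              \sum_(i < m.+2) (-1) ^+ i *: (<< bar_face i t >> : bar_chain m))
  end.

Arguments bar_diff : simpl never.

Lemma bar_diff_is_additive n : zmod_morphism (@bar_diff n).
Proof.
case: n => [|n] x y; first by rewrite /bar_diff subr0.
exact: lift_is_additive.
Qed.

HB.instance Definition _ n :=
  GRing.isZmodMorphism.Build (bar_chain n) (bar_chain n.-1) (@bar_diff n)
    (@bar_diff_is_additive n).

Lemma bar_diffU n (t : n.+1.-tuple G) :
  @bar_diff n.+1 << t >> =
    \sum_(i < n.+2) (-1) ^+ i *: (<< bar_face i t >> : bar_chain n).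
Proof. by rewrite /bar_diff liftU scale1r. Qed.

Let fc (i : nat) (g : nat -> G) (k : nat) : G :=
  (if k.+1 < i then g k else if k.+1 == i then g k * g k.+1 else g k.+1)%g%N.

Let tnth_bar_face n (i : 'I_n.+2) (t : n.+1.-tuple G) (k : 'I_n) :
  tnth (bar_face i t) k = fc i (nth 1%g t) k.
Proof. by rewrite tnth_mktuple. Qed.

Let nth_bar_face n (i : 'I_n.+2) (t : n.+1.-tuple G) (k : nat) :
  (k < n)%N -> nth 1%g (bar_face i t) k = fc i (nth 1%g t) k.
Proof. by move=> kn; rewrite -(tnth_bar_face i t (Ordinal kn)) (tnth_nth 1%g). Qed.

Lemma bar_faceK n (i : 'I_n.+3) (j : 'I_n.+2) (i' : 'I_n.+2) (j' : 'I_n.+3)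
    (t : n.+2.-tuple G) : (j < i)%N -> i' = i.-1 :> nat -> j' = j :> nat ->
  bar_face j (bar_face i t) = bar_face i' (bar_face j' t).
Proof.
move=> ji ei ej; apply: eq_from_tnth => k; have kn := ltn_ord k.
rewrite !tnth_bar_face [in LHS]/fc [in RHS]/fc !nth_bar_face
  ?ltnS ?(ltnW kn) // ei ej /fc.
case: (nat_of_ord i) ji => [//|i0] /= ji; set g := nth _ _.
by repeat (case: ifP => ?; try lia); rewrite ?mulgA.
Qed.

Let bar_diff_diffU n (t : n.+2.-tuple G) :
  @bar_diff n.+1 (@bar_diff n.+2 << t >>) = 0.
Proof.
rewrite bar_diffU raddf_sum.
under eq_bigr => i _ do rewrite raddfZsign /= bar_diffU scaler_sumr.
rewrite pair_bigA /=.
under eq_bigr => p _ do rewrite scalerA -exprD.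
rewrite (bigID (fun p : 'I_n.+3 * 'I_n.+2 => (p.2 < p.1)%N)) /=.
rewrite [X in X + _](reindex_onto
  (fun p : 'I_n.+3 * 'I_n.+2 => (fintype.lift ord0 p.2, inord p.1))
  (fun p : 'I_n.+3 * 'I_n.+2 => (inord p.2, inord p.1.-1))) /=; last first.
  move=> [i j] /= ji; have := ltn_ord i; have := ltn_ord j => hj hi.
  by congr pair; apply: val_inj; rewrite /= ?inordK // /bump ?inordK; lia.
apply/eqP; rewrite addr_eq0; apply/eqP; rewrite -sumrN; apply: eq_big.
  move=> [a b] /=; rewrite -leqNgt /bump /= add1n add0n ltnS.
  have ha := ltn_ord a; have hb := ltn_ord b.
  case: (leqP a b) => ab.
    rewrite inordK ?ab /=; last by lia.
    by apply/eqP; congr pair; apply: val_inj; rewrite /= inordK //; lia.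
  apply/negbTE; apply/negP => /andP[le_ab /eqP[/(congr1 val) /= ea _]].
  have hi := ltn_ord (inord a : 'I_n.+2).
  by rewrite inordK in ea; lia.
move=> [a b] /=; rewrite /bump /= add1n add0n ltnS => /andP[le_ab /eqP[ea _]].
have ea' : (inord a : 'I_n.+2) = a :> nat.
  have hi := ltn_ord (inord a : 'I_n.+2).
  by have := congr1 (nat_of_ord (n:=n.+3)) ea; rewrite inordK //; lia.
rewrite ea' addSn exprS mulN1r scaleNr addnC; congr (- (_ *: << _ >>)).
by apply: bar_faceK; rewrite /= ?/bump ?ea' //= ltnS -ea'.
Qed.

Lemma bar_diff_diff n (c : bar_chain n.+2) :
  bar_diff (bar_diff c : bar_chain n.+1) = 0.
Proof.
rewrite -(freeg_sumE c) !raddf_sum big1 // => t _.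
rewrite -[coeff t c]intz -freegU_mulz !raddfMz /=.
by rewrite bar_diff_diffU mul0rz.
Qed.

Definition bar_cycle (n : nat) : {pred bar_chain n} :=
  [pred c | bar_diff c == 0].

Lemma bar_cycle_zmod_closed n : zmod_closed (@bar_cycle n).
Proof.
split=> [|x y /eqP dx /eqP dy]; apply/eqP; first exact: raddf0.
by rewrite /= bar_diff_is_additive dx dy subr0.
Qed.

HB.instance Definition _ n :=
  GRing.isZmodClosed.Build (bar_chain n) (@bar_cycle n)
    (bar_cycle_zmod_closed n).

Record bar_cycles (n : nat) := MkBarCycle {
  bar_cycle_val :> bar_chain n;
  bar_cycleP : bar_cycle_val \in @bar_cycle n }.

HB.instance Definition _ n := [isSub for @bar_cycle_val n].
HB.instance Definition _ n := [Choice of bar_cycles n by <:].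
HB.instance Definition _ n :=
  [SubChoice_isSubZmodule of bar_cycles n by <:].

(* By [bar_diff_diff] every boundary is a cycle, so this is all of the image of
   the differential, viewed inside the group of cycles. *)
Definition bar_boundary (n : nat) : {pred bar_cycles n} := fun z =>
  `[< exists c : bar_chain n.+1, bar_diff c = val z >].

Lemma bar_boundary_zmod_closed n : zmod_closed (@bar_boundary n).
Proof.
split=> [|x y].
  by apply/asboolP; exists 0; rewrite raddf0.
move=> /asboolP[a ax] /asboolP[b by_]; apply/asboolP; exists (a - b).
by rewrite bar_diff_is_additive ax by_ raddfB.
Qed.

HB.instance Definition _ n :=
  GRing.isZmodClosed.Build (bar_cycles n) (@bar_boundary n)
    (bar_boundary_zmod_closed n).

Definition group_homology (n : nat) : zmodType := Quotient.quot (@bar_boundary n).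

End GroupHomology.

Definition acyclic (G : groupType) : Prop :=
  forall n : nat, (0 < n)%N -> forall h : group_homology G n, h = 0.

(* Main.v *)
(* Every homeomorphism is determined by its action on the set T of branch points, which is
   countable and dense, and by compactness every permutation of T preserving the relation
   "x lies on the arc from a to b" extends to a homeomorphism. Hence the group G is the
   automorphism group of a homogeneous dense tree T, in which back-and-forth produces
   automorphisms with prescribed finite behaviour.

   G acts on the complex of lists of points of T contained in an arc. This complex and its
   quotient by G, the complex of weak order types up to reversal, have no reduced
   cohomology, so it suffices that the stabilizers of such lists be acyclic. Such a
   stabilizer is a product of two groups: one permutes the cones that hang from the points
   of the list, the other acts on the open intervals between consecutive points together
   with what hangs from them. Each is shown acyclic by induction on the degree, by letting
   it act on a complex of generic auxiliary data (two-colourings of the cones, resp.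
   bi-infinite sequences cofinal in the intervals). The data split the group into commuting
   factors whose supports can be displaced to infinitely many disjoint copies; since the
   infinite product of the copies of an element g is conjugate to its own product with g,
   a single copy is homologically invisible. Homology is replaced throughout by cohomology
   with arbitrary coefficients. *)
From HB Require Import structures.
From mathcomp Require Import all_boot all_order all_algebra archimedean.
From mathcomp Require Import generic_quotient ring_quotient freeg.
From mathcomp Require Import boolp classical_sets functions cardinality reals.
From mathcomp Require Import topology normedtype sequences realfun.
From mathcomp Require Import zify lra.
Require Import Defs.
Import Order.TTheory GRing.Theory Num.Theory.
Import numFieldNormedType.Exports.

Set Implicit Arguments.
Unset Strict Implicit.
Unset Printing Implicit Defensive.

(** * Cochains and the bar complex *)

(** All subgroups share one bar resolution: cochains are functions on lists of elements of the
    ambient group, and restricting a class to a subgroup only weakens the invariance required of a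
    primitive. The obstacle is that the whole support of a group cannot be displaced inside that
    group, since an infinite product of disjoint copies needs room. Only a part of the group has
    room (one half of the cones, every other slab of an interval), and no invariant choice of such a
    part is available. Hence the complex of all choices: finitely many choices can always be joined
    to a further one, and the stabilizer of a choice is a product of parts that do have room.
    Displacement kills only the given class restricted to a part, and uses vanishing in lower
    degrees through a Kunneth argument. This forces the induction on the degree and the shape of
    [equivariant_vanishing], where vertex stabilizers need only kill the class at hand. Arbitrary
    coefficients rule out averaging over the reversal of an arc; in return they recover homology by
    one universal choice, chains modulo boundaries. *)

Local Open Scope ring_scope.

(* Normalisation of additive expressions over a [zmodType] (the tactic [ring]
   needs a commutative ring). *)
Inductive zexp := Zvar of nat | Zzero | Zadd of zexp & zexp | Zopp of zexp.

Fixpoint zcoef (e : zexp) (i : nat) : int :=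
  match e with
  | Zvar j => (i == j)%:R
  | Zzero => 0
  | Zadd a b => zcoef a i + zcoef b i
  | Zopp a => - zcoef a i
  end.

Fixpoint zeval (A : zmodType) (env : seq A) (e : zexp) : A :=
  match e with
  | Zvar j => nth 0 env j
  | Zzero => 0
  | Zadd a b => zeval env a + zeval env b
  | Zopp a => - zeval env a
  end.

Lemma zevalE (A : zmodType) (env : seq A) e :
  zeval env e = \sum_(i < size env) env`_i *~ zcoef e i.
Proof.
elim: e => [j||a IHa b IHb|a IHa] /=.
- case: (ltnP j (size env)) => [lt|le].
    rewrite (bigD1 (Ordinal lt)) //= eqxx mulr1z big1 ?addr0 // => i /eqP ne.
    by case: eqP => [e|]; [case: ne; apply: val_inj | rewrite mulr0z].
  rewrite nth_default // big1 // => i _.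
  by case: eqP => [e|]; rewrite ?mulr0z //; move: (ltn_ord i); rewrite e ltnNge le.
- by rewrite big1 // => i _; rewrite mulr0z.
- by rewrite IHa IHb -big_split; apply: eq_bigr => i _; rewrite mulrzDr.
- by rewrite IHa -sumrN; apply: eq_bigr => i _; rewrite mulrNz.
Qed.

Lemma zeval_eq (A : zmodType) (env : seq A) e1 e2 :
  all (fun i => zcoef e1 i == zcoef e2 i) (iota 0 (size env)) ->
  zeval env e1 = zeval env e2.
Proof.
move=> /allP h; rewrite !zevalE; apply: eq_bigr => i _.
by rewrite (eqP (h i _)) // mem_iota /=.
Qed.

Ltac zmod_find x env :=
  lazymatch env with
  | x :: _ => constr:(0%N)
  | _ :: ?env' => let n := zmod_find x env' in constr:(n.+1)
  end.
Ltac zmod_mem x env :=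
  lazymatch env with
  | nil => constr:(false)
  | x :: _ => constr:(true)
  | _ :: ?env' => zmod_mem x env'
  end.
Ltac zmod_env e env :=
  lazymatch e with
  | (?a + ?b)%R => let env' := zmod_env a env in zmod_env b env'
  | (- ?a)%R => zmod_env a env
  | 0%R => env
  | _ => lazymatch zmod_mem e env with
         | true => env
         | false => constr:(e :: env)
         end
  end.
Ltac zmod_reify e env :=
  lazymatch e with
  | (?a + ?b)%R => let x := zmod_reify a env in let y := zmod_reify b env in
                   constr:(Zadd x y)
  | (- ?a)%R => let x := zmod_reify a env in constr:(Zopp x)
  | 0%R => constr:(Zzero)
  | _ => let n := zmod_find e env in constr:(Zvar n)
  end.
Ltac zmod :=
  lazymatch goal with
  | |- @eq ?A ?x ?y =>
    let env := zmod_env x (@nil A) in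
    let env := zmod_env y env in
    let e1 := zmod_reify x env in
    let e2 := zmod_reify y env in
    refine (@zeval_eq _ env e1 e2 _); vm_compute; reflexivity
  end.

(** A choice operator that is a function of the predicate: extensionally equal predicates receive
    the same witness. This makes representatives of orbits, cosets and cones constant on their
    classes. *)
Lemma picker (T : Type) (t0 : T) :
  exists pick : (T -> Prop) -> T, forall P : T -> Prop, (exists x, P x) -> P (pick P).
Proof.
have [pick pickP] := @choice (T -> Prop) T
  (fun P x => (exists y, P y) -> P x) (fun P =>
    match pselect (exists y, P y) with
    | left e => let: ex_intro x px := e in ex_intro _ x (fun=> px)
    | right ne => ex_intro _ t0 (fun e => False_ind _ (ne e))
    end).
by exists pick.
Qed.

(** * The simplicial coboundary on lists and the prism homotopy *)

Section Cochains.
Variable A : zmodType.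

(** Deleting the head comes first and the other faces carry the opposite sign, so the recursion
    hides the alternating signs. Since [delta f [:: x] = f [::]], the complex is augmented: the
    empty list is a simplex of dimension -1. *)
Fixpoint delta (S : Type) (f : seq S -> A) (s : seq S) : A :=
  if s is x :: s' then f s' - delta (fun u => f (x :: u)) s' else 0.

Section Delta.
Variable S : Type.
Implicit Types (f g : seq S -> A) (s u : seq S).

(** Equality is asked only on the faces of [s], because most identities below hold for admissible
    lists only. *)
Lemma eq_delta_del f g s :
  (forall u1 x u2, s = u1 ++ x :: u2 -> f (u1 ++ u2) = g (u1 ++ u2)) ->
  delta f s = delta g s.
Proof.
elim: s f g => [//|x s IH] f g e /=.
have /= -> := e [::] x s erefl; congr (_ - _).
by apply: IH => u1 y u2 es; apply: (e (x :: u1) y u2); rewrite es.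
Qed.

Lemma eq_delta f g s :
  (forall u, (size u).+1 = size s -> f u = g u) -> delta f s = delta g s.
Proof.
move=> e; apply: eq_delta_del => u1 x u2 es; apply: e.
by rewrite es !size_cat /= addnS.
Qed.

Lemma delta0 s : delta (fun _ : seq S => 0) s = 0.
Proof. by elim: s => [//|x s IH] /=; rewrite IH subr0. Qed.

Lemma deltaD f g s : delta (fun u => f u + g u) s = delta f s + delta g s.
Proof.
by elim: s f g => [|x s IH] f g /=; rewrite ?addr0 // (IH (fun u => f (x :: u))); zmod.
Qed.

Lemma deltaN f s : delta (fun u => - f u) s = - delta f s.
Proof. by elim: s f => [|x s IH] f /=; rewrite ?oppr0 // IH opprD. Qed.

Lemma deltaB f g s : delta (fun u => f u - g u) s = delta f s - delta g s.
Proof. by rewrite deltaD deltaN. Qed.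

Lemma delta_const c s : delta (fun _ : seq S => c) s = if odd (size s) then c else 0.
Proof. by elim: s => [//|x s IH] /=; rewrite IH; case: odd; rewrite ?subr0 ?subrr. Qed.

Lemma delta_delta f s : delta (delta f) s = 0.
Proof.
elim: s f => [//|x s IH] f /=.
by rewrite (deltaB f) IH subr0 subrr.
Qed.

Definition sg (b : bool) (x : A) := if b then - x else x.

Lemma delta_sg b f s : delta (fun u => sg b (f u)) s = sg b (delta f s).
Proof. by case: b; rewrite /= ?deltaN. Qed.

Lemma delta_cat f u s : delta f (u ++ s) =
  delta (fun v => f (v ++ s)) u + sg (odd (size u)) (delta (fun v => f (u ++ v)) s).
Proof.
elim: u f => [|x u IH] f /=; first by rewrite add0r.
rewrite IH opprD addrA; congr (_ + _).
by case: odd; rewrite /= ?opprK.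
Qed.

End Delta.

Lemma delta_map (S S' : Type) (h : S -> S') (f : seq S' -> A) s :
  delta (fun u => f (map h u)) s = delta f (map h s).
Proof. by elim: s f => [//|x s IH] f /=; rewrite (IH (fun u => f (h x :: u))). Qed.

Lemma delta_swap (S S' : Type) (F : seq S -> seq S' -> A) u s :
  delta (fun v => delta (F v) s) u = delta (fun t => delta (F^~ t) u) s.
Proof.
elim: u F => [|x u IH] F /=; first by rewrite delta0.
by rewrite deltaB (IH (fun v => F (x :: v))).
Qed.

(** The subdivided prism between the images of a list under [phi] and [phi']; the recursion splits
    off the simplex that doubles the head. *)
Fixpoint prism (S S' : Type) (phi phi' : S -> S') (f : seq S' -> A) (s : seq S) : A :=
  if s is x :: s' then
    f (phi x :: phi' x :: map phi' s') - prism phi phi' (fun u => f (phi x :: u)) s'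
  else 0.

Section Prism.
Variables (S S' : Type) (phi phi' : S -> S').
Implicit Types (f g : seq S' -> A).
Local Notation prism := (prism phi phi').

Lemma prismB f g s : prism (fun u => f u - g u) s = prism f s - prism g s.
Proof.
elim: s f g => [|x s IH] f g /=; first by rewrite subr0.
by rewrite (IH (fun u => f (phi x :: u))); zmod.
Qed.

Lemma prismP f s : prism (delta f) s + delta (prism f) s =
  f (map phi' s) - f (map phi s).
Proof.
elim: s f => [|x s IH] f /=; first by rewrite subrr addr0.
rewrite (prismB f) (deltaB (fun u => f (phi x :: phi' x :: map phi' u))).
rewrite (delta_map phi' (fun u => f (phi x :: phi' x :: u))).
have := IH (fun u => f (phi x :: u)).
set p := prism (delta _) s; set q := delta (prism _) s => e.
set d := delta _ (map phi' s); set r := prism f s.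
set a := f (phi' x :: _); set c := f (phi x :: map phi' s) in e *.
have -> : a - (c - d) - (r - p) + (r - (d - q)) = a - c + (p + q) by zmod.
by rewrite e; zmod.
Qed.
End Prism.
End Cochains.

(** * Invariant cochains and coboundaries of subgroups *)

Section Subgroups.
Variable G : groupType.

Definition lmul (g h : G) : G := (g * h)%g.

Record subgrp (H : G -> Prop) : Prop := Subgrp {
  subgrp1 : H 1%g;
  subgrpM : forall g h, H g -> H h -> H (g * h)%g;
  subgrpV : forall g, H g -> H (g^-1)%g }.

(** Write [g] as an element of [H] times the chosen representative of its coset; the first factor is
    the retraction. It pulls cochains on lists of [H] back to lists of the ambient group. *)
Lemma retractionP (H : G -> Prop) : subgrp H ->
  exists r : G -> G, (forall g, H (r g)) /\ forall h g, H h -> r (h * g)%g = (h * r g)%g.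
Proof.
move=> sH; have [pick pickP] := picker (1%g : G).
pose cos g := fun x => exists2 h, H h & x = (h * g)%g.
have cosP g : cos g (pick (cos g)).
  by apply: pickP; exists g; exists 1%g; rewrite ?mul1g //; exact: subgrp1.
have cosE h g : H h -> cos (h * g)%g = cos g.
  move=> Hh; apply/funext => x; apply/propext; split=> -[k Hk ->].
    by exists (k * h)%g; rewrite ?mulgA //; exact: subgrpM.
  exists (k * h^-1)%g; first by apply: subgrpM => //; exact: subgrpV.
  by rewrite -mulgA (mulgA h^-1)%g mulVg mul1g.
exists (fun g => g * (pick (cos g))^-1)%g; split=> [g|h g Hh].
  have [h Hh ->] := cosP g.
  by rewrite invgM mulgA mulgV mul1g; exact: subgrpV.
by rewrite cosE // mulgA.
Qed.

Variable A : zmodType.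
Implicit Types (f b : seq G -> A) (H : G -> Prop).

Definition inv_under (H : G -> Prop) (f : seq G -> A) :=
  forall h s, H h -> f (map (lmul h) s) = f s.

Definition cocycle (S : Type) (f : seq S -> A) j := forall s, size s = j.+1 -> delta f s = 0.

Definition cobound H f j := exists2 b, inv_under H b & forall s, size s = j -> f s = delta b s.

(* Vanishing of [H^(j-1)(H; A)]: a list of length [j] is a simplex of dimension [j-1]. *)
Definition exact H j := forall f, inv_under H f -> cocycle f j -> cobound H f j.

Lemma inv_sub H H' f : (forall g, H g -> H' g) -> inv_under H' f -> inv_under H f.
Proof. by move=> sub fi h s /sub; exact: fi. Qed.

Lemma invB H f g : inv_under H f -> inv_under H g -> inv_under H (fun s => f s - g s).
Proof. by move=> fi gi h s Hh; rewrite fi // gi. Qed.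

Lemma coboundD H f g j : cobound H f j -> cobound H g j ->
  cobound H (fun s => f s + g s) j.
Proof.
move=> [b bi fb] [c ci gc]; exists (fun s => b s + c s) => [h s Hh|s sz].
  by rewrite bi // ci.
by rewrite deltaD fb // gc.
Qed.

Lemma coboundN H f j : cobound H f j -> cobound H (fun s => - f s) j.
Proof.
move=> [b bi fb]; exists (fun s => - b s) => [h s Hh|s sz]; first by rewrite bi.
by rewrite deltaN fb.
Qed.

Lemma coboundB H f g j : cobound H f j -> cobound H g j ->
  cobound H (fun s => f s - g s) j.
Proof. by move=> bf bg; apply: coboundD => //; exact: coboundN. Qed.

Lemma eq_cobound H f g j : (forall s, size s = j -> f s = g s) -> cobound H f j ->
  cobound H g j.
Proof. by move=> e [b bi fb]; exists b => // s sz; rewrite -e // fb. Qed.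

Lemma cobound_sub H H' f j : (forall g, H g -> H' g) -> cobound H' f j -> cobound H f j.
Proof. by move=> sub [b bi fb]; exists b => //; exact: inv_sub bi. Qed.

(** [delta] multiplies a constant by 0 or 1 according to the parity of the length, so a constant
    cocycle is zero or its own primitive. *)
Lemma cobound_const H (c : A) j : (0 < j)%N -> cocycle (fun _ : seq G => c) j ->
  cobound H (fun=> c) j.
Proof.
move=> j0 cc; have := cc (nseq j.+1 1%g) (size_nseq _ _).
rewrite delta_const size_nseq /=; case: ifPn => oj e.
  by exists (fun=> 0) => // s _; rewrite delta0.
by exists (fun=> c) => // s sz; rewrite delta_const sz; move: oj; rewrite negbK => ->.
Qed.

Lemma cocycle_map (S S' : Type) (phi : S -> S') (f : seq S' -> A) j :
  cocycle f j -> cocycle (fun s => f (map phi s)) j.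
Proof. by move=> fc s sz; rewrite delta_map fc // size_map. Qed.

Lemma cocycleB (S : Type) (f g : seq S -> A) j :
  cocycle f j -> cocycle g j -> cocycle (fun s => f s - g s) j.
Proof. by move=> fc gc s sz; rewrite deltaB fc // gc // subr0. Qed.

(** Homotopy invariance: two maps equivariant along a common assignment of [k] to [h] pull [f] back
    to cohomologous cochains, because the prism between them is invariant. *)
Lemma prism_cobound (H K : G -> Prop) (phi phi' : G -> G) f j :
  (forall h, H h -> exists2 k, K k & forall g,
     phi (h * g)%g = (k * phi g)%g /\ phi' (h * g)%g = (k * phi' g)%g) ->
  inv_under K f -> cocycle f j ->
  cobound H (fun s => f (map phi' s) - f (map phi s)) j.
Proof.
move=> eqv fi fc; exists (prism phi phi' f) => [h s Hh|s sz].
  have [k Kk e] := eqv h Hh.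
  have e' g : phi' (h * g)%g = (k * phi' g)%g by have [] := e g.
  have {}e g : phi (h * g)%g = (k * phi g)%g by have [] := e g.
  have fE : (fun u => f (map (lmul k) u)) = f by apply/funext => u; exact: fi.
  rewrite -[in RHS]fE; elim: s (f) => [//|x s IH] f1 /=.
  rewrite e e' -!map_comp (eq_map (f := phi' \o lmul h) (g := lmul k \o phi')) //.
  by congr (_ - _); exact: (IH (fun u => f1 ((k * phi x)%g :: u))).
rewrite -prismP.
have -> : prism phi phi' (delta f) s = 0; last by rewrite add0r.
have {}fc u : size u = j.+1 -> delta f u = 0 by exact: fc.
elim: s j (delta f) sz fc => [//|x s IH] [//|j] f1 /= [sz] fc.
rewrite fc /= ?size_map ?sz // (IH j) ?subrr // => u su.
by rewrite fc //= su.
Qed.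

End Subgroups.

(** * The equivariant double complex of a group action *)

Section EquivariantBicomplex.
Variables (G : groupType) (A : zmodType) (H : G -> Prop) (sH : subgrp H).
Variables (V : Type) (act : G -> V -> V) (Y : seq V -> Prop).
Hypotheses (act1 : forall v, act 1%g v = v)
  (actM : forall g h v, H g -> H h -> act (g * h)%g v = act g (act h v)).
Hypotheses (Ydel : forall u1 x u2, Y (u1 ++ x :: u2) -> Y (u1 ++ u2))
  (Yact : forall h u, H h -> Y u -> Y (map (act h) u)).

Implicit Types (F : seq V -> seq G -> A) (u : seq V) (s : seq G).

(** Equality of lists makes this the pointwise stabilizer. *)
Definition stab u (h : G) := H h /\ map (act h) u = u.

Definition inv2 F := forall h u s, H h -> F (map (act h) u) (map (lmul h) s) = F u s.

Definition invV (f : seq V -> A) := forall h u, H h -> f (map (act h) u) = f u.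

Lemma map_actM g h u : H g -> H h -> map (act (g * h)%g) u = map (act g) (map (act h) u).
Proof. by move=> Hg Hh; rewrite -map_comp; apply: eq_map => v /=; exact: actM. Qed.

Lemma map_act1 u : map (act 1%g) u = u.
Proof. by rewrite (eq_map act1) map_id. Qed.

Lemma map_actK h u : H h -> map (act h^-1%g) (map (act h) u) = u.
Proof. by move=> Hh; rewrite -map_actM ?mulVg ?map_act1 //; exact: (subgrpV sH). Qed.

Lemma inv2B F F' : inv2 F -> inv2 F' -> inv2 (fun u s => F u s - F' u s).
Proof. by move=> Fi Fi' h u s Hh; rewrite Fi // Fi'. Qed.

Lemma inv2_dh F : inv2 F -> inv2 (fun u s => delta (F^~ s) u).
Proof.
move=> Fi h u s Hh; rewrite -delta_map.
by apply: eq_delta => v _; exact: Fi.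
Qed.

Lemma inv2_dv F : inv2 F -> inv2 (fun u s => delta (F u) s).
Proof.
move=> Fi h u s Hh; rewrite -delta_map.
by apply: eq_delta => v _; exact: Fi.
Qed.

Lemma inv2_stab F u : inv2 F -> inv_under (stab u) (F u).
Proof. by move=> Fi h s [Hh e]; rewrite -{1}e; exact: Fi. Qed.

Lemma eq_dh u (f g : seq V -> A) :
  Y u -> (forall v, Y v -> (size v).+1 = size u -> f v = g v) -> delta f u = delta g u.
Proof.
move=> Yu e; apply: eq_delta_del => u1 x u2 eu; apply: e.
  by apply: (@Ydel u1 x u2); rewrite -eu.
by rewrite eu !size_cat /= addnS.
Qed.

(** Shapiro's lemma: an equivariant cochain is determined over one representative of each orbit,
    where only invariance under the stabilizer matters. A primitive chosen there is transported
    along the orbit. *)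
Lemma columns i j F : inv2 F ->
  (forall u, Y u -> size u = i -> cobound (stab u) (F u) j) ->
  exists2 E, inv2 E & forall u s, Y u -> size u = i -> size s = j -> F u s = delta (E u) s.
Proof.
move=> Fi FE.
have [picku pickuP] := picker ([::] : seq V).
have [pickh pickhP] := picker (1%g : G).
pose orb u := fun w => exists2 h, H h & w = map (act h) u.
pose r u := picku (orb u).
have rP u : orb u (r u) by apply: pickuP; exists u, 1%g; [exact: (subgrp1 sH) | rewrite map_act1].
pose t u := pickh (fun h => H h /\ u = map (act h) (r u)).
have tP u : H (t u) /\ u = map (act (t u)) (r u).
  apply: (pickhP (fun h => H h /\ u = map (act h) (r u))).
  have [h Hh e] := rP u; exists (h^-1)%g; split; first exact: (subgrpV sH).
  by rewrite e map_actK.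
have rE h u : H h -> r (map (act h) u) = r u.
  move=> Hh; congr picku; apply/funext => w; apply/propext; split=> -[k Hk ->].
    by exists (k * h)%g; [exact: (subgrpM sH) | rewrite map_actM].
  exists (k * h^-1)%g; first by apply: (subgrpM sH) => //; exact: (subgrpV sH).
  by rewrite map_actM ?map_actK //; exact: (subgrpV sH).
have /choice[b bP] u : exists b : seq G -> A, Y u -> size u = i ->
    inv_under (stab u) b /\ forall s, size s = j -> F u s = delta b s.
  have [[Yu ui]|nY] := pselect (Y u /\ size u = i); last first.
    by exists (fun=> 0) => Yu ui; case: nY.
  by have [b bi Fb] := FE u Yu ui; exists b.
have Yr u : Y u -> Y (r u) by move=> Yu; have [h Hh ->] := rP u; exact: Yact.
have sr u : size (r u) = size u by have [h Hh ->] := rP u; rewrite size_map.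
exists (fun u s => if `[< Y u /\ size u = i >] then b (r u) (map (lmul (t u)^-1%g) s) else 0).
  move=> h u s Hh; rewrite size_map; have [Ht et] := tP u.
  have := tP (map (act h) u); set t' := t (map (act h) u) => -[Ht' et'].
  have -> : `[< Y (map (act h) u) /\ size u = i >] = `[< Y u /\ size u = i >].
    apply/asbool_equiv_eq; split=> -[Yu ui]; split => //; last exact: Yact.
    by rewrite -(@map_actK h u) //; apply: Yact => //; exact: (subgrpV sH).
  case: asboolP => // -[Yu ui]; rewrite rE // -map_comp.
  have [bi _] := bP _ (Yr u Yu) (etrans (sr u) ui).
  (* The transporters chosen for [u] and for its translate by [h] differ by [k], which stabilizes
     the representative; the invariance of [b (r u)] absorbs it. *)
  set k := (t'^-1 * h * t u)%g.
  rewrite -(bi k (map (lmul (t u)^-1) s)%g) -?map_comp; last first.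
    split; first by do !apply: (subgrpM sH) => //; exact: (subgrpV sH).
    rewrite !map_actM -?et //; try exact: (subgrpV sH); last by apply: (subgrpM sH) => //; exact: (subgrpV sH).
    by rewrite [in LHS]et' rE // map_actK.
  by congr b; apply: eq_map => x /=; rewrite /lmul /k -!mulgA (mulgA (t u)) mulgV mul1g.
move=> u s Yu ui sj; have [Ht et] := tP u.
have -> : `[< Y u /\ size u = i >] by apply/asboolP.
have [bi bE] := bP _ (Yr u Yu) (etrans (sr u) ui).
rewrite delta_map -bE ?size_map // -[RHS](Fi (t u)) // -et -map_comp.
by congr F; rewrite -[LHS]map_id; apply: eq_map => x /=; rewrite /lmul mulgA mulgV mul1g.
Qed.

Definition row_exact i := forall f : seq V -> A,
  (forall u, Y u -> size u = i.+1 -> delta f u = 0) ->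
  exists b, forall u, Y u -> size u = i -> f u = delta b u.

(** The group acts freely on nonempty lists [s], so row primitives are taken at lists whose head
    retracts to 1 and transported equivariantly by [k s]. *)
Lemma rows i j F : row_exact i -> inv2 F ->
  (forall u s, Y u -> size u = i.+1 -> size s = j.+1 -> delta (F^~ s) u = 0) ->
  exists2 E, inv2 E & forall u s, Y u -> size u = i -> size s = j.+1 ->
    F u s = delta (E^~ s) u.
Proof.
move=> rE Fi Fc; have [r [Hr rM]] := retractionP sH.
have /choice[b bP] s : exists b : seq V -> A, size s = j.+1 ->
    forall u, Y u -> size u = i -> F u s = delta b u.
  have [sj|ns] := eqVneq (size s) j.+1; last by exists (fun=> 0) => e; rewrite e eqxx in ns.
  have [u v Yu|b bP] := rE (F^~ s); first exact: Fc.
  by exists b.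
pose k s := r (head 1%g s).
exists (fun u s => if s is [::] then 0 else
  b (map (lmul (k s)^-1%g) s) (map (act (k s)^-1%g) u)).
  move=> h u [//|x s] Hh /=; rewrite /k /= /lmul rM // -!map_comp invgM.
  congr b; last first.
    apply: eq_map => v /=; rewrite -actM -?mulgA ?mulVg ?mulg1 //.
    by apply: (subgrpM sH); exact: (subgrpV sH).
  rewrite !mulgA -!(mulgA (r x)^-1%g) mulVg mul1g; congr cons.
  by apply: eq_map => y /=; rewrite !mulgA -!(mulgA (r x)^-1%g) mulVg mul1g.
move=> u s Yu ui sj; case: s sj => [//|x s] sj.
set s0 := x :: s in sj *; have Hk : H (k s0)^-1%g by apply: (subgrpV sH) => //; exact: Hr.
transitivity (delta (fun u => b (map (lmul (k s0)^-1%g) s0) (map (act (k s0)^-1%g) u)) u).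
  by rewrite (@delta_map A _ _ (act _) (b _)) -bP ?size_map //; [rewrite Fi | exact: Yact].
by [].
Qed.

(* Collapse of the spectral sequence of the bicomplex of equivariant functions on
   [V^k x G^l], as an explicit zigzag. *)
Section Zigzag.
Variables (n : nat) (a : seq G -> A) (v0 : V).
Hypotheses (ai : inv_under H a) (ac : cocycle a n.+1) (Yv0 : Y [:: v0]).
Hypothesis rowsE : forall i, (0 < i)%N -> row_exact i.

(** A staircase: [y k] lives on pairs of lists of lengths k+1 and n-k, and each step trades a
    vertical coboundary for a horizontal one. *)
Definition zigzag (y : nat -> seq V -> seq G -> A) m :=
  [/\ forall k, inv2 (y k),
      forall u s, Y u -> size u = 1%N -> size s = n.+1 -> a s = delta (y 0 u) s &
      forall k u s, (k < m)%N -> Y u -> size u = k.+2 -> size s = (n - k)%N ->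
        delta (y k.+1 u) s = delta ((y k)^~ s) u].

(** The obstruction to each further step is a class, in length at most n, of the stabilizer of a
    list with at least two entries, hence zero. The first step needs only that [a] itself restrict
    to a coboundary. *)
Lemma zigzag_exists :
  (forall u, Y u -> size u = 1%N -> cobound (stab u) a n.+1) ->
  (forall u j, Y u -> (1 < size u)%N -> (0 < j <= n)%N -> exact A (stab u) j) ->
  forall m, (m <= n)%N -> exists y, zigzag y m.
Proof.
move=> aE sE; elim=> [|m IH] mn.
  have [|y yi ay] := @columns 1 n.+1 (fun=> a) _ aE; first by move=> h u s; exact: ai.
  by exists (fun=> y); split.
have [|y [yi y0 yS]] := IH; first exact: ltnW.
have [|u Yu su|e ei eE] := @columns m.+2 (n - m) (fun u s => delta ((y m)^~ s) u).
- exact: inv2_dh.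
- apply: sE => //; rewrite ?su //.
    by rewrite subn_gt0 mn leq_subr.
    exact: (inv2_stab (inv2_dh (yi m))).
  move=> s ss; rewrite -(delta_swap (y m)).
  case: m {IH} => [|m] in mn yS su ss *.
    rewrite (@eq_dh u _ (fun=> a s)) ?delta_const ?su // => v Yv [sv].
    by rewrite -y0 // ss subn0.
  rewrite (@eq_dh u _ (delta ((y m)^~ s))) ?delta_delta // => v Yv.
  rewrite su => -[sv]; rewrite yS //.
  by rewrite ss; lia.
exists (fun k => if (k <= m)%N then y k else e); split=> [k||k u s km Yu su ss].
- by case: ifP.
- by move=> u s Yu su ss; exact: y0.
- rewrite ltnS in km; rewrite km; case: ltnP => [km'|mk]; first exact: yS.
  have ekm : k = m by apply/eqP; rewrite eqn_leq km.
  by subst k; rewrite eE.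
Qed.

(** An equivariant primitive of the last term is pushed back up the staircase by exactness of the
    rows. At the empty list, the augmentation, it becomes a primitive of [a]. *)
Lemma zigzag_cobound y (b : seq V -> seq G -> A) : zigzag y n -> inv2 b ->
  (forall u, Y u -> size u = n.+1 -> y n u [::] = delta (b^~ [::]) u) ->
  cobound H a n.+1.
Proof.
move=> [yi y0 yS] bi yn.
have {bi yn} : forall m, (m <= n)%N -> exists E E', [/\ inv2 E, inv2 E' &
    forall u s, Y u -> size u = (n - m).+1 -> size s = m ->
      y (n - m)%N u s = delta (E^~ s) u + delta (E' u) s].
  elim=> [|m IH] mn.
    exists b, (fun _ _ => 0); split=> // u [|//] Yu; rewrite subn0 => su _.
    by rewrite addr0 yn.
  have [E [E' [Ei Ei' yE]]] := IH (ltnW mn).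
  have nm : (n - m)%N = (n - m.+1).+1 by lia.
  have [||u s Yu su ss|D Di DE] := @rows (n - m.+1).+1 m
      (fun u s => y (n - m.+1)%N u s - delta (E u) s).
  - exact: rowsE.
  - by apply: inv2B => //; exact: inv2_dv.
  - rewrite (deltaB (fun u => y _ u s)) -yS //; try lia.
    rewrite delta_swap -nm; apply/eqP; rewrite subr_eq0; apply/eqP.
    have -> : delta (y (n - m)%N u) s =
        delta (fun t => delta (E^~ t) u + delta (E' u) t) s.
      by apply: eq_delta => t; rewrite ss => -[st]; rewrite yE // su nm.
    by rewrite deltaD delta_delta addr0.
  exists D, E; split=> // u s Yu su ss; rewrite -DE //; zmod.
move=> /(_ n (leqnn n)) [E [E' [Ei Ei' yE]]]; rewrite subnn in yE.
exists (E [::]) => [h s Hh|s ss]; first exact: (Ei h [::]).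
rewrite (y0 [:: v0]) //.
rewrite (@eq_delta _ _ _ (fun t => E [::] t + delta (E' [:: v0]) t)) => [|t]; last first.
  by rewrite ss => -[st]; rewrite yE //= subr0.
by rewrite deltaD delta_delta addr0.
Qed.

(** Vertex stabilizers need only kill the class [a], a weak demand that displacement can meet.
    Longer lists need vanishing of their stabilizers in lower degrees, and the last hypothesis is
    exactness of the invariant cochains at the end of the staircase. *)
Lemma equivariant_vanishing :
  (forall u, Y u -> size u = 1%N -> cobound (stab u) a n.+1) ->
  (forall u j, Y u -> (1 < size u)%N -> (0 < j <= n)%N -> exact A (stab u) j) ->
  (forall f, invV f -> (forall u, Y u -> size u = n.+2 -> delta f u = 0) ->
     exists2 b, invV b & forall u, Y u -> size u = n.+1 -> f u = delta b u) ->
  cobound H a n.+1.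
Proof.
move=> aE sE bE; have [y yz] := zigzag_exists aE sE (leqnn n).
have [yi y0 yS] := yz.
have [||b bi yb] := bE ((y n)^~ [::]).
- by move=> h u Hh; have := yi n h u [::] Hh.
- move=> u Yu su; have := @delta_swap A _ _ (y n) u [:: 1%g].
  rewrite /= subr0 => <-.
  case: n yS y0 su => [|m] yS y0 su.
    rewrite (@eq_dh u _ (fun=> a [:: 1%g])) ?delta_const ?su // => v Yv [sv].
    by rewrite (y0 v) //= subr0.
  rewrite (@eq_dh u _ (delta ((y m)^~ [:: 1%g]))) ?delta_delta // => v Yv.
  by rewrite su => -[sv]; rewrite -yS //= ?subr0 ?subSnn.
by apply: (@zigzag_cobound y (fun u _ => b u)) => // h u s; exact: bi.
Qed.

End Zigzag.
End EquivariantBicomplex.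

Lemma row_exact_cone (A : zmodType) (V : Type) (Y : seq V -> Prop) (v0 : V) i :
  (forall u, Y u -> Y (v0 :: u)) -> row_exact A Y i.
Proof.
move=> Yv f fc; exists (fun u => f (v0 :: u)) => u Yu su.
by have /= /eqP := fc (v0 :: u) (Yv u Yu) (congr1 S su); rewrite subr_eq0 => /eqP.
Qed.

(** * Products of commuting subgroups *)

Lemma cobound_sg (G : groupType) (A : zmodType) (H : G -> Prop) (f : seq G -> A) c j :
  cobound H f j -> cobound H (fun s => sg c (f s)) j.
Proof. by case: c => // ?; exact: coboundN. Qed.

Section Kunneth.
Variables (G : groupType) (A : zmodType) (P Q H : G -> Prop).
Hypotheses (sP : subgrp P) (sQ : subgrp Q).
Hypothesis commPQ : forall p q, P p -> Q q -> (p * q = q * p)%g.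
Hypothesis PQ1 : forall g, P g -> Q g -> g = 1%g.
Hypothesis HE : forall g, H g <-> exists p q, [/\ P p, Q q & g = (p * q)%g].

Lemma sub_prodl p : P p -> H p.
Proof.
move=> Pp; apply/HE; exists p, 1%g.
by rewrite mulg1; split => //; exact: (subgrp1 sQ).
Qed.

Lemma sub_prodr q : Q q -> H q.
Proof.
move=> Qq; apply/HE; exists 1%g, q.
by rewrite mul1g; split => //; exact: (subgrp1 sP).
Qed.

Lemma prodM p q p' q' : P p -> Q q -> P p' -> Q q' ->
  (p * q * (p' * q') = (p * p') * (q * q'))%g.
Proof. by move=> Pp Qq Pp' Qq'; rewrite -!mulgA (mulgA q) -(commPQ Pp' Qq) -!mulgA. Qed.

Lemma subgrp_prod : subgrp H.
Proof.
split=> [|g h|g].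
- exact/sub_prodl/(subgrp1 sP).
- move=> /HE[p [q [Pp Qq ->]]] /HE[p' [q' [Pp' Qq' ->]]]; apply/HE.
  exists (p * p')%g, (q * q')%g.
  by rewrite prodM //; split => //; [exact: (subgrpM sP) | exact: (subgrpM sQ)].
- move=> /HE[p [q [Pp Qq ->]]]; apply/HE; exists p^-1%g, q^-1%g.
  rewrite invgM commPQ; try exact: (subgrpV sP); try exact: (subgrpV sQ).
  by split => //; [exact: (subgrpV sP) | exact: (subgrpV sQ)].
Qed.

Lemma prod_uniq p q p' q' : P p -> Q q -> P p' -> Q q' -> (p * q = p' * q')%g ->
  p = p' /\ q = q'.
Proof.
move=> Pp Qq Pp' Qq' e.
have e' : (p'^-1 * p = q' * q^-1)%g.
  by rewrite -[LHS]mulg1 -(mulgV q) mulgA -(mulgA p'^-1)%g e !mulgA mulVg mul1g.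
have p1 : (p'^-1 * p = 1)%g.
  apply: PQ1; first by apply: (subgrpM sP) => //; exact: (subgrpV sP).
  by rewrite e'; apply: (subgrpM sQ) => //; exact: (subgrpV sQ).
have ep : p = p' by rewrite -[p]mul1g -(mulgV p') -mulgA p1 mulg1.
split=> //; move: e; rewrite ep => e.
by rewrite -[q]mul1g -(mulVg p') -mulgA e mulgA mulVg mul1g.
Qed.

Lemma prod_projP : exists p q : G -> G,
  [/\ forall g, H g -> [/\ P (p g), Q (q g) & g = (p g * q g)%g],
      forall a b, P a -> Q b -> p (a * b)%g = a /\ q (a * b)%g = b,
      forall g h, H g -> H h -> p (g * h)%g = (p g * p h)%g &
      forall g h, H g -> H h -> q (g * h)%g = (q g * q h)%g].
Proof.
have /choice[f fP] g : exists pq : G * G, H g -> [/\ P pq.1, Q pq.2 & g = (pq.1 * pq.2)%g].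
  have [/HE[p [q pq]]|nH] := pselect (H g); first by exists (p, q).
  by exists (1%g, 1%g).
have pq a b : P a -> Q b -> (f (a * b)%g).1 = a /\ (f (a * b)%g).2 = b.
  move=> Pa Qb; have [|Pa' Qb' e] := fP (a * b)%g; first by apply/HE; exists a, b.
  by have [] := prod_uniq Pa Qb Pa' Qb' e.
have fM g h : H g -> H h -> (f (g * h)%g).1 = ((f g).1 * (f h).1)%g /\
    (f (g * h)%g).2 = ((f g).2 * (f h).2)%g.
  move=> /fP[Pg Qg {1 3}->] /fP[Ph Qh {1 3}->]; rewrite prodM //.
  by apply: pq; [exact: (subgrpM sP) | exact: (subgrpM sQ)].
exists (fun g => (f g).1), (fun g => (f g).2); split=> // [g h Hg Hh|g h Hg Hh].
  by have [] := fM g h Hg Hh.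
by have [] := fM g h Hg Hh.
Qed.

(** [H] acts through its factor [Q] by translation, with all stabilizers equal to [P], and the
    zigzag turns [a] into a cocycle [beta] of [Q]. The inflation [al] of [beta] has a zigzag with
    the same end, so [a] and [al] differ by a coboundary, and [al] is controlled by the restriction
    of [a] to [Q]. *)
Lemma kunneth n (a : seq G -> A) : (forall j, (0 < j <= n)%N -> exact A P j) ->
  inv_under H a -> cocycle a n.+1 -> cobound P a n.+1 -> cobound Q a n.+1 ->
  cobound H a n.+1.
Proof.
move=> eP ai ac aP aQ; have sH := subgrp_prod.
have [pp [pq [ppqP pqE _ qM]]] := prod_projP.
have qQ b : Q b -> pq b = b.
  by move=> Qb; have [] := pqE 1%g b (subgrp1 sP) Qb; rewrite mul1g.
have qP p : P p -> pq p = 1%g.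
  by move=> Pp; have [] := pqE p 1%g Pp (subgrp1 sQ); rewrite mulg1.
pose act g v := (pq g * v)%g.
pose Y (u : seq G) := True.
have act1 v : act 1%g v = v by rewrite /act qQ ?mul1g //; exact: (subgrp1 sQ).
have actM g h v : H g -> H h -> act (g * h)%g v = act g (act h v).
  by move=> Hg Hh; rewrite /act qM // mulgA.
have Ydel u1 x u2 : Y (u1 ++ x :: u2) -> Y (u1 ++ u2) by [].
have Yact h u : H h -> Y u -> Y (map (act h) u) by [].
have stabE u : (0 < size u)%N -> stab H act u = P.
  case: u => [//|v u] _; apply/funext => g; apply/propext; split=> [[Hg /= [e _]]|Pg].
    have [Pg _ ->] := ppqP g Hg; suff -> : pq g = 1%g by rewrite mulg1.
    by rewrite -[LHS](mulgK v) (e : (pq g * v)%g = v) mulgV.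
  split; first exact: sub_prodl.
  by rewrite (eq_map (g := id)) ?map_id // => w; rewrite /act qP // mul1g.
have sE u : Y u -> size u = 1%N -> cobound (stab H act u) a n.+1.
  by move=> _ su; rewrite stabE ?su.
have cE u j : Y u -> (1 < size u)%N -> (0 < j <= n)%N -> exact A (stab H act u) j.
  by move=> _ su jn; rewrite stabE ?(ltnW su) //; exact: eP.
have rE i : (0 < i)%N -> row_exact A Y i by move=> _; exact: (row_exact_cone (v0 := 1%g)).
have [y yz] := zigzag_exists sH act1 actM Ydel Yact ai sE cE (leqnn n).
have [yi y0 yS] := yz.
pose beta u := y n u [::].
have bi h u : Q h -> beta (map (lmul h) u) = beta u.
  move=> Qh; rewrite -[RHS](yi n h u [::] (sub_prodr Qh)) /beta /=; congr (y n).
  by apply: eq_map => v; rewrite /act /lmul qQ.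
have bc : cocycle beta n.+1.
  move=> u su; have := @delta_swap A _ _ (y n) u [:: 1%g].
  rewrite /= subr0 => <-.
  case: n y0 yS su {eP ac aP aQ sE cE yz beta bi} => [|m] y0 yS su.
    rewrite (@eq_delta _ _ _ (fun=> a [:: 1%g])) ?delta_const ?su // => v [sv].
    by rewrite (y0 v) //= subr0.
  rewrite (@eq_delta _ _ _ (delta ((y m)^~ [:: 1%g]))) ?delta_delta // => v.
  by rewrite su => -[sv]; rewrite -yS //= ?subr0 ?subSnn.
have [r [Hr rM]] := retractionP sH.
pose ev g := pq (r g).
have evM h g : H h -> ev (h * g)%g = act h (ev g) by move=> Hh; rewrite /ev rM // qM.
(* The signs cancel those that [delta_cat] produces on joined lists, and are normalized so that [y'
   n u [::]] is exactly [beta u]. *)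
pose e := fix e k := if k is k'.+1 then ~~ odd k' (+) e k' else false.
pose y' k u s := sg (e n (+) e k) (beta (u ++ map ev s)) : A.
have y'i k : inv2 H act (y' k).
  move=> h u s Hh; congr sg; rewrite -(bi (pq h) (u ++ _)); last by have [] := ppqP h Hh.
  by rewrite map_cat -!map_comp; congr (beta (_ ++ _)); apply: eq_map => x /=; exact: evM.
pose al s := sg (e n) (beta (map ev s)) : A.
have y'0 u s : size u = 1%N -> size s = n.+1 -> al s = delta (y' 0 u) s.
  case: u => [//|v [|//]] _ ss; rewrite /y' delta_sg /= addbF; congr sg.
  rewrite (delta_map ev (fun t => beta (v :: t))).
  by have := bc (v :: map ev s); rewrite /= size_map ss => /(_ erefl)/eqP; rewrite subr_eq0 => /eqP.
have y'S k u s : (k < n)%N -> size u = k.+2 -> size s = (n - k)%N ->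
    delta (y' k.+1 u) s = delta ((y' k)^~ s) u.
  move=> kn su ss; rewrite /y' !delta_sg.
  have := bc (u ++ map ev s); rewrite size_cat size_map su ss.
  have -> : (k.+2 + (n - k) = n.+2)%N by lia.
  move=> /(_ erefl); rewrite delta_cat su -(delta_map ev (fun t => beta (u ++ t))).
  set d1 := delta _ u; set d2 := delta _ s => /eqP; rewrite addr_eq0 => /eqP ->.
  have -> : e k.+1 = ~~ odd k (+) e k by [].
  by rewrite /= negbK; case: (e n); case: (e k); case: (odd k); rewrite /= ?opprK.
have ali : inv_under H al.
  move=> h s Hh; rewrite /al -(bi (pq h) (map ev s)); last by have [] := ppqP h Hh.
  by rewrite -!map_comp; congr (sg _ (beta _)); apply: eq_map => x /=; exact: evM.
have alc : cocycle al n.+1.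
  by move=> s ss; rewrite /al delta_sg (delta_map ev beta) bc ?size_map //; case: (e n); rewrite /= ?oppr0.
have aal : cobound H (fun s => a s - al s) n.+1.
  apply: (@zigzag_cobound G A H sH G act Y actM Yact n _ 1%g I rE
    (fun k u s => y k u s - y' k u s) (fun _ _ => 0)) => //.
  - split=> [k|u s Yu su ss|k u s kn Yu su ss]; first exact: inv2B.
      by rewrite deltaB -y'0 // -y0.
    by rewrite deltaB (deltaB (fun u => y k u s)) y'S // yS.
  - by move=> u Yu su; rewrite delta0 /y' cats0 addbb /= subrr.
(* On [Q] the map [ev] is homotopic to the identity, so up to sign [beta] is cohomologous to [al],
   hence to [a]. *)
have betaQ : cobound Q beta n.+1.
  have alQ : cobound Q al n.+1.
    apply: (eq_cobound _ (coboundB aQ (cobound_sub sub_prodr aal))) => s _; zmod.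
  have evQ : cobound Q (fun s => beta (map ev s) - beta (map id s)) n.+1.
    apply: (prism_cobound (K := Q)) => // h Qh; exists h => // g; split=> //.
    by rewrite evM ?/act ?qQ //; exact: sub_prodr.
  have := coboundB (cobound_sg (e n) alQ) evQ; apply: eq_cobound => s _.
  by rewrite map_id /al; case: (e n); rewrite /= ?opprK; zmod.
have alH : cobound H al n.+1.
  have [b bQ bE] := betaQ; apply: cobound_sg.
  exists (fun s => b (map ev s)) => [h s Hh|s ss].
    rewrite -(bQ (pq h) (map ev s)); last by have [] := ppqP h Hh.
    by rewrite -!map_comp; congr b; apply: eq_map => x /=; exact: evM.
  by rewrite delta_map -bE // size_map.
by apply: (eq_cobound _ (coboundD aal alH)) => s _; rewrite subrK.
Qed.

Lemma exact_prod n : (forall j, (0 < j <= n)%N -> exact A P j) ->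
  (forall j, (0 < j <= n)%N -> exact A Q j) -> forall j, (0 < j <= n)%N -> exact A H j.
Proof.
move=> eP eQ [//|j] jn f fi fc; apply: kunneth => //.
- by move=> i /andP[i0 ij]; apply: eP; rewrite i0 (leq_trans ij) // ltnW.
- by apply: eP => //; exact: inv_sub sub_prodl fi.
- by apply: eQ => //; exact: inv_sub sub_prodr fi.
Qed.
End Kunneth.

(* If [k * psi k] is conjugate to [psi k] and the two factors commute, then a class
   restricts to [K] as its own restriction plus itself minus itself. *)
Lemma mitosis (G : groupType) (A : zmodType) (K H : G -> Prop) (psi : G -> G) (w : G) n
    (a : seq G -> A) :
  subgrp K -> subgrp H -> (forall k, K k -> H k) ->
  (forall k, K k -> H (psi k)) ->
  (forall k k', K k -> K k' -> psi (k * k')%g = (psi k * psi k')%g) ->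
  (forall k k', K k -> K k' -> (k * psi k' = psi k' * k)%g) ->
  (forall k k', K k -> K k' -> k = psi k' -> k = 1%g) ->
  H w -> (forall k, K k -> (k * psi k = w^-1 * psi k * w)%g) ->
  (forall j, (0 < j <= n)%N -> exact A K j) ->
  inv_under H a -> cocycle a n.+1 -> cobound K a n.+1.
Proof.
move=> sK sH KH psiH psiM comm triv Hw conj eK ai ac.
have psi1 : psi 1%g = 1%g.
  have e := psiM _ _ (subgrp1 sK) (subgrp1 sK); rewrite mulg1 in e.
  by rewrite -[LHS]mul1g -{1}(mulVg (psi 1%g)) -mulgA -e mulVg.
have psiV k : K k -> psi k^-1%g = (psi k)^-1%g.
  move=> Kk; have Kk' := subgrpV sK Kk.
  by rewrite -[LHS]mulg1 -(mulgV (psi k)) mulgA -psiM // mulVg psi1 mul1g.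
(* The displaced copy [D] commutes with [K] and meets it trivially, so the Kunneth argument applies
   to their product [L]. *)
pose D g := exists2 k, K k & g = psi k.
have sD : subgrp D.
  split=> [|_ _ [k Kk ->] [k' Kk' ->]|_ [k Kk ->]].
  - by exists 1%g; rewrite ?psi1 //; exact: (subgrp1 sK).
  - by exists (k * k')%g; rewrite ?psiM //; exact: (subgrpM sK).
  - by exists k^-1%g; rewrite ?psiV //; exact: (subgrpV sK).
pose L g := exists p q, [/\ K p, D q & g = (p * q)%g].
have cKD p q : K p -> D q -> (p * q = q * p)%g by move=> Kp [k Kk ->]; exact: comm.
have tKD g : K g -> D g -> g = 1%g by move=> Kg [k Kk]; exact: triv.
have LE g : L g <-> exists p q, [/\ K p, D q & g = (p * q)%g] by [].
have KL := sub_prodl sD LE; have DL := sub_prodr sK LE.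
have sL := subgrp_prod sK sD cKD LE.
have LH g : L g -> H g.
  by move=> [p [q [Kp [k Kk ->] ->]]]; apply: (subgrpM sH); [exact: KH | exact: psiH].
have [pK [pD [pP pE pKM pDM]]] := prod_projP sK sD cKD tKD LE.
have [r [Lr rM]] := retractionP sL.
have [rK [KrK rKM]] := retractionP sK.
pose e1 g := pK (r g); pose e2 g := pD (r g).
have e1M h g : L h -> e1 (h * g)%g = (pK h * e1 g)%g by move=> Lh; rewrite /e1 rM // pKM.
have e2M h g : L h -> e2 (h * g)%g = (pD h * e2 g)%g by move=> Lh; rewrite /e2 rM // pDM.
have pKK k : K k -> pK k = k /\ pD k = 1%g.
  by move=> Kk; have := pE k 1%g Kk (subgrp1 sD); rewrite mulg1.
have pDD d : D d -> pK d = 1%g /\ pD d = d.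
  by move=> Dd; have := pE 1%g d (subgrp1 sK) Dd; rewrite mul1g.
have LK g : L g -> K (pK g) by move=> /pP[].
have LD g : L g -> D (pD g) by move=> /pP[].
pose a1 s := a (map e1 s); pose a2 s := a (map e2 s).
have a1i : inv_under L a1.
  move=> h s Lh; rewrite /a1 -(ai (pK h) (map e1 s)); last exact/KH/LK.
  by rewrite -!map_comp; congr a; apply: eq_map => x /=; exact: e1M.
have a2i : inv_under L a2.
  move=> h s Lh; rewrite /a2 -(ai (pD h) (map e2 s)); last exact/LH/DL/LD.
  by rewrite -!map_comp; congr a; apply: eq_map => x /=; exact: e2M.
have prismH (J : G -> Prop) phi phi' : (forall h, J h -> exists2 k, H k & forall g,
     phi (h * g)%g = (k * phi g)%g /\ phi' (h * g)%g = (k * phi' g)%g) ->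
  cobound J (fun s => a (map phi' s) - a (map phi s)) n.+1.
  by move=> h; exact: (prism_cobound h ai ac).
have cst J : cobound J (fun s : seq G => a (map (fun=> 1%g) s)) n.+1.
  have cE (s : seq G) : map (fun=> 1%g : G) s = nseq (size s) 1%g.
    by elim: s => //= _ s ->.
  have cc : cocycle (fun _ : seq G => a (nseq n.+1 1%g)) n.+1.
    move=> s ss; have := ac (map (fun=> 1%g) s); rewrite size_map => /(_ ss) <-.
    rewrite -(delta_map (fun=> 1%g)); apply: eq_delta => v; rewrite ss => -[sv].
    by rewrite cE sv.
  apply: (eq_cobound _ (cobound_const J (ltn0Sn n) cc)) => s ss.
  by rewrite cE ss.
(* [a1] and [a2] are pullbacks along the two projections of [L]. On each factor one of them agrees
   with [a] and the other is constant, up to coboundaries, so the difference dies on both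
   factors. *)
have aL : cobound L (fun s => a s - a1 s - a2 s) n.+1.
  apply: (kunneth sK sD cKD tKD LE eK) => //.
  - by apply: invB => //; apply: invB => //; exact: inv_sub LH ai.
  - by do 2 (apply: cocycleB; last exact: cocycle_map).
  - have h1 : cobound K (fun s => a (map id s) - a (map e1 s)) n.+1.
      apply: prismH => h Kh; exists h; first exact: KH.
      by move=> g; rewrite e1M ?(pKK h Kh).1 //; exact: KL.
    have h2 : cobound K (fun s => a (map e2 s) - a (map (fun=> 1%g) s)) n.+1.
      apply: prismH => h Kh; exists 1%g; first exact: (subgrp1 sH).
      by move=> g; rewrite e2M ?(pKK h Kh).2 ?mul1g //; exact: KL.
    have := coboundB (coboundB h1 h2) (cst K); apply: eq_cobound => s _.
    by rewrite map_id /a1 /a2; zmod.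
  - have h1 : cobound D (fun s => a (map id s) - a (map e2 s)) n.+1.
      apply: prismH => h Dh; exists h; first exact/LH/DL.
      by move=> g; rewrite e2M ?(pDD h Dh).2 //; exact: DL.
    have h2 : cobound D (fun s => a (map e1 s) - a (map (fun=> 1%g) s)) n.+1.
      apply: prismH => h Dh; exists 1%g; first exact: (subgrp1 sH).
      by move=> g; rewrite e1M ?(pDD h Dh).1 ?mul1g //; exact: DL.
    have := coboundB (coboundB h1 h2) (cst D); apply: eq_cobound => s _.
    by rewrite map_id /a1 /a2; zmod.
have [b bi bE] := aL.
(* Pulled back along [k * psi k], the class of [a] is its restriction to [K] plus its pullback along
   [psi]; by conjugation with [w] it is also the latter alone. *)
pose mu g := (rK g * psi (rK g))%g.
have muM k g : K k -> mu (k * g)%g = (k * psi k * mu g)%g.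
  move=> Kk; rewrite /mu rKM // psiM // -!mulgA; congr (_ * _)%g.
  by rewrite !mulgA (comm (rK g) k).
have Lmu k : K k -> L (k * psi k)%g.
  by move=> Kk; exists k, (psi k); split=> //; exists k.
have pmu k : K k -> pK (k * psi k)%g = k /\ pD (k * psi k)%g = psi k.
  by move=> Kk; apply: pE => //; exists k.
have h0 : cobound K (fun s => a (map mu s) - a1 (map mu s) - a2 (map mu s)) n.+1.
  exists (fun s => b (map mu s)) => [k s Kk|s ss]; last by rewrite delta_map -bE // size_map.
  rewrite -(bi (k * psi k)%g (map mu s)); last exact: Lmu.
  by rewrite -!map_comp; congr b; apply: eq_map => x /=; exact: muM.
have h1 : cobound K (fun s => a (map (e1 \o mu) s) - a (map id s)) n.+1.
  apply: prismH => k Kk; exists k; first exact: KH.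
  by move=> g; rewrite /= muM // e1M ?(pmu k Kk).1 //; exact: Lmu.
have h2 : cobound K (fun s => a (map (e2 \o mu) s) - a (map (psi \o rK) s)) n.+1.
  apply: prismH => k Kk; exists (psi k); first exact: psiH.
  by move=> g; rewrite /= muM // e2M ?(pmu k Kk).2 ?rKM ?psiM //; exact: Lmu.
have h3 : cobound K (fun s => a (map (fun g => psi (rK g) * w)%g s) -
    a (map (psi \o rK) s)) n.+1.
  apply: prismH => k Kk; exists (psi k); first exact: psiH.
  by move=> g; rewrite /= rKM // psiM // !mulgA.
have muw s : a (map mu s) = a (map (fun g => psi (rK g) * w)%g s).
  rewrite -[RHS](ai w^-1%g); last exact: (subgrpV sH).
  by rewrite -map_comp; congr a; apply: eq_map => g; rewrite /= /mu conj // /lmul mulgA.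
apply: (eq_cobound _ (coboundB (coboundB (coboundB h3 h0) h1) h2)) => s _.
by rewrite muw /a1 /a2 -!map_comp map_id; zmod.
Qed.

(** * Invariant contractions assembled from partial ones *)

Lemma cat_size_inj (T : Type) (s1 s2 t1 t2 : seq T) :
  size s1 = size t1 -> s1 ++ s2 = t1 ++ t2 -> s1 = t1 /\ s2 = t2.
Proof.
elim: s1 t1 => [|x s1 IH] [|y t1] //= [st] [-> e].
by have [-> ->] := IH t1 st e.
Qed.

Section LocalContraction.
Variables (A : zmodType) (V N : Type) (n0 : N).
Variables (Y : seq V -> Prop) (E : seq V -> seq V -> Prop).
Variable k : N -> (seq V -> A) -> seq V -> A.
Implicit Types (F : seq V -> A) (s u : seq V) (L : seq (seq V)).

Definition inv_rel F := forall s s', E s s' -> F s = F s'.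

Hypothesis Ydel : forall u1 x u2, Y (u1 ++ x :: u2) -> Y (u1 ++ u2).
Hypothesis Esize : forall s s', E s s' -> size s = size s'.
Hypothesis Edelta : forall F, inv_rel F -> inv_rel (delta F).
Hypothesis Ek : forall n F, inv_rel F -> inv_rel (k n F).
Hypothesis kB : forall n F F' s, k n (fun u => F u - F' u) s = k n F s - k n F' s.
Hypothesis kdep : forall n s, Y s -> exists L,
  (forall u, List.In u L -> Y u /\ size u = (size s).+1) /\
  forall F F', (forall u, List.In u L -> F u = F' u) -> k n F s = k n F' s.
Hypothesis kgood : forall L, (forall u, List.In u L -> Y u) -> exists n,
  forall u, List.In u L -> forall F, inv_rel F -> F u = k n (delta F) u + delta (k n F) u.

(* A contraction assembled, by induction on the length, from the partial
   contractions [k n]: [h(s) = fill_n(s - h(ds))] with [n] good for the finitely many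
   lists involved. *)
Lemma local_contraction : exists H : (seq V -> A) -> seq V -> A,
  [/\ forall F, inv_rel F -> inv_rel (H F),
      forall F s, Y s -> (forall u, Y u -> size u = (size s).+1 -> F u = 0) -> H F s = 0 &
      forall F s, inv_rel F -> Y s -> F s = H (delta F) s + delta (H F) s].
Proof.
have [pick pickP] := picker n0.
(* An index is good for [s] if [k n] contracts at [s] and also, after applying [Hm], on the boundary
   of [s]. *)
pose P (Hm : (seq V -> A) -> seq V -> A) s n := forall F, inv_rel F ->
  F s = k n (delta F) s + delta (k n F) s /\
  delta (Hm (k n (delta F))) s = delta (Hm (fun u => F u - delta (k n F) u)) s.
pose H := fix H (m : nat) {struct m} : (seq V -> A) -> seq V -> A :=
  if m is m'.+1 then fun F s =>
    k (pick (P (H m') s)) F s - delta (H m' (k (pick (P (H m') s)) F)) s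
  else fun _ _ => 0.
have HB m F F' s : H m (fun u => F u - F' u) s = H m F s - H m F' s.
  elim: m F F' s => [|m IH] F F' s /=; first by rewrite subrr.
  rewrite kB; set n := pick _.
  have -> : delta (H m (k n (fun u => F u - F' u))) s =
      delta (fun u => H m (k n F) u - H m (k n F') u) s.
    apply: eq_delta => u _; rewrite -IH; congr H; apply/funext => v; exact: kB.
  by rewrite deltaB; zmod.
have HI m F : inv_rel F -> inv_rel (H m F).
  elim: m F => [//|m IH] F FI s s' ss' /=.
  have IB F1 F2 : inv_rel F1 -> inv_rel F2 -> inv_rel (fun u => F1 u - F2 u).
    by move=> i1 i2 t t' tt'; rewrite (i1 _ _ tt') (i2 _ _ tt').
  (* Goodness is tested on invariant functions only, so related lists define the same predicate and
     [pick] returns the same index for both. *)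
  have -> : P (H m) s = P (H m) s'.
    have e F' : inv_rel F' -> F' s = F' s' by move=> /(_ _ _ ss').
    apply/funext => n; apply/propext.
    have eq1 F' : inv_rel F' -> k n (delta F') s + delta (k n F') s =
        k n (delta F') s' + delta (k n F') s'.
      move=> Fi; rewrite (e (k n (delta F'))); last exact/Ek/Edelta.
      by rewrite (e (delta (k n F'))) //; exact/Edelta/Ek.
    have eq2 F' : inv_rel F' -> delta (H m (k n (delta F'))) s =
        delta (H m (k n (delta F'))) s'.
      by move=> Fi; apply: (e (delta _)); apply/Edelta/IH/Ek/Edelta.
    have eq3 F' : inv_rel F' -> delta (H m (fun u => F' u - delta (k n F') u)) s =
        delta (H m (fun u => F' u - delta (k n F') u)) s'.
      by move=> Fi; apply: (e (delta _)); apply/Edelta/IH/IB => //; exact/Edelta/Ek.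
    by split=> h F' Fi; have := h F' Fi; rewrite (e F') // eq1 // eq2 // eq3.
  set n := pick _; rewrite (Ek n FI ss'); congr (_ - _).
  exact: (Edelta (IH _ (Ek n FI))).
(* Finite dependence serves twice: it yields the vanishing clause, and it reduces the existence of a
   good index to [kgood], which handles finitely many lists. *)
have Hdep m s : Y s -> exists L, (forall u, List.In u L -> Y u /\ size u = (size s).+1) /\
    forall F F', (forall u, List.In u L -> F u = F' u) -> H m F s = H m F' s.
  elim: m s => [|m IH] s Ys; first by exists [::].
  rewrite /=; set n := pick _.
  have [L1 [L1Y L1P]] := kdep n Ys.
  have kL L r : (forall u, List.In u L -> Y u /\ size u = r) -> exists L',
      (forall u, List.In u L' -> Y u /\ size u = r.+1) /\
      forall F F', (forall u, List.In u L' -> F u = F' u) ->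
      forall u, List.In u L -> k n F u = k n F' u.
    elim: L => [|u L IHL] LY; first by exists [::].
    have [|L' [LY' LP']] := IHL; first by move=> v vL; apply: LY; right.
    have [Yu su] := LY u (or_introl erefl).
    have [L'' [LY'' LP'']] := kdep n Yu.
    exists (L' ++ L''); split=> [v /List.in_app_iff[/LY'//|/LY'']|F F' e v [<-|vL]].
    - by rewrite su.
    - by apply: LP'' => w wL; apply: e; apply/List.in_app_iff; right.
    - by apply: LP' => // w wL; apply: e; apply/List.in_app_iff; left.
  have [L2 [L2Y L2P]] : exists L, (forall u, List.In u L -> Y u /\ size u = (size s).+1) /\
      forall F F', (forall u, List.In u L -> F u = F' u) ->
      delta (H m (k n F)) s = delta (H m (k n F')) s.
    have fc : forall s1 s2, s = s1 ++ s2 -> exists L,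
        (forall u, List.In u L -> Y u /\ size u = (size s).+1) /\
        forall F F', (forall u, List.In u L -> F u = F' u) ->
        forall u1 x u2, s = u1 ++ x :: u2 -> (size s1 <= size u1)%N ->
        H m (k n F) (u1 ++ u2) = H m (k n F') (u1 ++ u2).
      move=> s1 s2; elim: s2 s1 => [|x s2 IHs] s1 es.
        exists [::]; split=> // F F' _ u1 x u2 eu.
        by move: es; rewrite eu cats0 => <-; rewrite size_cat /= leqNgt addnS ltnS leq_addr.
      have [|L [LY LP]] := IHs (rcons s1 x); first by rewrite es -cats1 -catA.
      have Yf : Y (s1 ++ s2) by apply: (@Ydel _ x); rewrite -es.
      have [L3 [L3Y L3P]] := IH _ Yf.
      have sf : (size (s1 ++ s2)).+1 = size s by rewrite es !size_cat /= addnS.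
      have [|L4 [L4Y L4P]] := kL L3 (size s); first by move=> u /L3Y; rewrite sf.
      exists (L ++ L4); split=> [u /List.in_app_iff[/LY|/L4Y]//|F F' e u1 y u2 eu].
      rewrite leq_eqVlt => /orP[/eqP e1|lt]; last first.
        apply: (LP F F' _ u1 y u2 eu); last by rewrite size_rcons.
        by move=> w wL; apply: e; apply/List.in_app_iff; left.
      have [e2 e3] : s1 = u1 /\ x :: s2 = y :: u2.
        by apply: cat_size_inj => //; rewrite -es -eu.
      have -> : u1 ++ u2 = s1 ++ s2 by case: e3 => _ ->; rewrite e2.
      apply: L3P; apply: L4P => w wL; apply: e; apply/List.in_app_iff; right.
      exact: wL.
    have [L [LY LP]] := fc [::] s erefl.
    exists L; split=> // F F' e; apply: eq_delta_del => u1 x u2 eu.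
    exact: (LP F F' e u1 x u2 eu).
  exists (L1 ++ L2); split=> [u /List.in_app_iff[/L1Y|/L2Y]//|F F' e].
  congr (_ - _).
    by apply: L1P => w wL; apply: e; apply/List.in_app_iff; left.
  by apply: L2P => w wL; apply: e; apply/List.in_app_iff; right.
exists (fun F s => H (size s).+1 F s); split.
- by move=> F FI s s' ss'; rewrite (Esize ss'); exact: HI.
- move=> F s Ys F0; have [L [LY LP]] := Hdep (size s).+1 s Ys.
  rewrite (LP F (fun=> 0)) => [|u /LY[Yu su]]; last exact: F0.
  transitivity (H (size s).+1 (fun u => (0 : A) - 0) s).
    by congr H; apply/funext => u; rewrite subr0.
  by rewrite (HB _ (fun=> 0) (fun=> 0)) subrr.
suff key m F s : size s = m -> inv_rel F -> Y s ->
    F s = H m.+1 (delta F) s + delta (H m F) s.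
  move=> F s FI Ys; rewrite [LHS](key (size s)) //; congr (_ + _).
  by apply: eq_delta => u ->.
elim: m F s => [|m IH] F s sm FI Ys.
  case: s sm Ys => // _ Ys; rewrite [LHS]/= addr0.
  have : P (H 0) [::] (pick (P (H 0) [::])).
    apply: pickP; have [|n' n'P] := kgood (L := [:: [::]]); first by move=> u [<-|//].
    by exists n' => F' Fi; split=> //; apply: n'P => //; left.
  by move=> /(_ F FI)[-> _]; rewrite /= subr0 addr0.
pose n := pick (P (H m.+1) s).
have -> : H m.+2 (delta F) s = k n (delta F) s - delta (H m.+1 (k n (delta F))) s by [].
have : P (H m.+1) s n.
  apply: pickP.
  have [L [LY LP]] : exists L, (forall u, List.In u L -> Y u) /\
      forall F F', (forall u, List.In u L -> F u = F' u) ->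
      delta (H m.+1 F) s = delta (H m.+1 F') s.
    have fc : forall s1 s2, s = s1 ++ s2 -> exists L,
        (forall u, List.In u L -> Y u) /\
        forall F F', (forall u, List.In u L -> F u = F' u) ->
        forall u1 x u2, s = u1 ++ x :: u2 -> (size s1 <= size u1)%N ->
        H m.+1 F (u1 ++ u2) = H m.+1 F' (u1 ++ u2).
      move=> s1 s2; elim: s2 s1 => [|x s2 IHs] s1 es.
        exists [::]; split=> // F1 F2 _ u1 x u2 eu.
        by move: es; rewrite eu cats0 => <-; rewrite size_cat /= leqNgt addnS ltnS leq_addr.
      have [|L [LY LP]] := IHs (rcons s1 x); first by rewrite es -cats1 -catA.
      have Yf : Y (s1 ++ s2) by apply: (@Ydel _ x); rewrite -es.
      have [L3 [L3Y L3P]] := Hdep m.+1 _ Yf.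
      exists (L ++ L3); split=> [u /List.in_app_iff[/LY//|/L3Y[]//]|F1 F2 e u1 y u2 eu].
      rewrite leq_eqVlt => /orP[/eqP e1|lt]; last first.
        apply: (LP F1 F2 _ u1 y u2 eu); last by rewrite size_rcons.
        by move=> w wL; apply: e; apply/List.in_app_iff; left.
      have [e2 e3] : s1 = u1 /\ x :: s2 = y :: u2.
        by apply: cat_size_inj => //; rewrite -es -eu.
      have -> : u1 ++ u2 = s1 ++ s2 by case: e3 => _ ->; rewrite e2.
      by apply: L3P => w wL; apply: e; apply/List.in_app_iff; right.
    have [L [LY LP]] := fc [::] s erefl.
    exists L; split=> // F1 F2 e; apply: eq_delta_del => u1 x u2 eu.
    exact: (LP F1 F2 e u1 x u2 eu).
  have [|n' n'P] := kgood (L := s :: L); first by move=> u [<-|/LY].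
  exists n' => F' Fi; split; first by apply: n'P => //; left.
  by apply: LP => u uL; rewrite [in RHS](n'P u _ F' Fi) ?addrK //; right.
move=> /(_ F FI)[e1 e2]; rewrite {}e2 [LHS]e1.
have FkI : inv_rel (k n F) by exact: Ek.
have -> : delta (H m.+1 (fun u => F u - delta (k n F) u)) s =
    delta (H m.+1 F) s - delta (k n F) s.
  rewrite (@eq_delta_del _ _ _ (fun t => H m.+1 F t - (k n F t - delta (H m (k n F)) t))).
    by rewrite deltaB (deltaB (k n F)) delta_delta subr0.
  move=> u1 x u2 es; rewrite HB; congr (_ - _).
  apply/eqP; rewrite eq_sym subr_eq; apply/eqP; apply: IH => //.
    by move: sm; rewrite es !size_cat /= addnS => -[].
  by apply: (@Ydel _ x); rewrite -es.
by zmod.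
Qed.
End LocalContraction.

(** * From cohomology with all coefficients to the homology of the bar complex *)

Lemma delta_sum (A : zmodType) (S : Type) (f : seq S -> A) s :
  delta f s = \sum_(i < size s) sg (odd i) (f (take i s ++ drop i.+1 s)).
Proof.
elim: s f => [|x s IH] f /=; first by rewrite big_ord0.
rewrite big_ord_recl /= drop0 IH -sumrN; congr (_ + _); apply: eq_bigr => i _.
by rewrite /= /bump /= add1n /=; case: (odd i); rewrite /= ?opprK.
Qed.

Section BarComplex.
Variables (G : groupType) (n : nat).

Definition bar_bdry : {pred bar_chain G n} := fun c =>
  `[< exists b : bar_chain G n.+1, bar_diff b = c >].

Lemma bar_bdry_zmod_closed : zmod_closed bar_bdry.
Proof.
split=> [|x y]; first by apply/asboolP; exists 0; rewrite raddf0.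
move=> /asboolP[a ax] /asboolP[b yb]; apply/asboolP; exists (a - b).
by rewrite bar_diff_is_additive ax yb.
Qed.

HB.instance Definition _ :=
  GRing.isZmodClosed.Build (bar_chain G n) bar_bdry bar_bdry_zmod_closed.

(** The universal coefficient group: a chain maps to zero in it exactly when it is a boundary. *)
Definition bar_coker : zmodType := Quotient.quot bar_bdry.

End BarComplex.

Local Open Scope quotient_scope.

Section HomologyVanishing.
Variable G : groupType.

(** Passage from homogeneous to inhomogeneous simplices. It is constant on orbits of left
    translation, and [partials] is the section of lists starting at 1. *)
Definition ratios (s : seq G) : seq G :=
  if s is x :: s' then pairmap (fun a b => a^-1 * b)%g x s' else [::].

Lemma size_ratios s : size (ratios s) = (size s).-1.
Proof. by case: s => //= x s; rewrite size_pairmap. Qed.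

Lemma ratios_lmul h s : ratios (map (lmul h) s) = ratios s.
Proof.
case: s => //= x s; elim: s x => //= y s IH x; rewrite IH; congr cons.
by rewrite /lmul invgM !mulgA -(mulgA _ h^-1%g) mulVg mulg1.
Qed.

Lemma nth_ratios s i : (i.+1 < size s)%N ->
  nth 1%g (ratios s) i = ((nth 1 s i)^-1 * nth 1 s i.+1)%g.
Proof.
case: s => //= x s; rewrite ltnS => lt; rewrite (nth_pairmap 1%g) //.
Qed.

Lemma nth_del (s : seq G) i j : (i < size s)%N ->
  nth 1%g (take i s ++ drop i.+1 s) j = nth 1%g s (if (j < i)%N then j else j.+1).
Proof.
move=> lt; rewrite nth_cat size_take lt; case: ltnP => ji; first by rewrite nth_take.
by rewrite nth_drop; congr nth; lia.
Qed.

Lemma size_del (s : seq G) i : (i < size s)%N ->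
  size (take i s ++ drop i.+1 s) = (size s).-1.
Proof. by move=> lt; rewrite size_cat size_take lt size_drop; lia. Qed.

Definition tup n (s : seq G) : n.-tuple G := [tuple nth 1%g s i | i < n].

Lemma tup_face n (i : 'I_n.+2) s : size s = n.+2 ->
  tup n (ratios (take i s ++ drop i.+1 s)) = bar_face i (tup n.+1 (ratios s)).
Proof.
move=> ss; have ilt : (i < size s)%N by rewrite ss.
apply: eq_from_tnth => j; have jn := ltn_ord j; rewrite [LHS]tnth_mktuple [RHS]tnth_mktuple.
have nt k : (k < n.+1)%N -> nth 1%g (tup n.+1 (ratios s)) k = nth 1%g (ratios s) k.
  by move=> kn; rewrite -(tnth_nth 1%g _ (Ordinal kn)) tnth_mktuple.
have [j1 j2] : (j < n.+1)%N /\ (j.+1 < n.+1)%N by split; lia.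
rewrite nth_ratios ?size_del ?ss // !nth_del // (nt _ j1) (nt _ j2).
rewrite (nth_ratios (s := s) (i := j)) ?ss // (nth_ratios (s := s) (i := j.+1)) ?ss //.
case: (ltngtP j.+1 i) => [lt|lt|e].
- by [].
- by [].
- by rewrite !mulgA -(mulgA _ (nth _ _ j.+1)) mulgV mulg1.
Qed.

Definition partials (s : seq G) : seq G := 1%g :: scanl (fun a b => a * b)%g 1%g s.

Lemma partials_ratios s : (0 < size s)%N -> s = map (lmul (head 1%g s)) (partials (ratios s)).
Proof.
case: s => //= x s _; rewrite /lmul mulg1; congr cons.
suff h a : s = map (lmul (x * a^-1)%g)
    (scanl (fun a b => a * b)%g a (pairmap (fun a b => a^-1 * b)%g x s)).
  by rewrite {1}(h 1%g) invg1 mulg1.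
elim: s x a => //= y s IH x a; congr cons.
  by rewrite /lmul !mulgA -(mulgA _ a^-1%g) mulVg mulg1 mulgV mul1g.
rewrite {1}(IH y (a * (x^-1 * y))%g); apply: eq_map => z.
by rewrite /lmul !invgM invgK !mulgA mulgV mul1g.
Qed.

Lemma ratios_partials s : ratios (partials s) = s.
Proof.
rewrite /partials /=; elim: s (1%g : G) => //= x s IH a; rewrite IH; congr cons.
by rewrite mulgA mulVg mul1g.
Qed.

Lemma size_partials s : size (partials s) = (size s).+1.
Proof. by rewrite /= size_scanl. Qed.

Lemma tupE n (t : n.-tuple G) : tup n t = t.
Proof. by apply: eq_from_tnth => i; rewrite tnth_mktuple (tnth_nth 1%g). Qed.

Lemma val_tup n s : size s = n -> tval (tup n s) = s.
Proof.
move=> ss; apply: (@eq_from_nth _ 1%g); first by rewrite size_tuple.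
move=> i; rewrite size_tuple => lt.
by rewrite -(tnth_nth 1%g _ (Ordinal lt)) tnth_mktuple.
Qed.

(** Apply the hypothesis to the tautological cocycle with values in chains modulo boundaries. An
    invariant primitive makes the projection [pi] factor through the differential, so [pi] kills
    every cycle. *)
Theorem acyclic_of_exact :
  (forall (A : zmodType) j, (0 < j)%N -> exact A (fun _ : G => True) j) -> acyclic G.
Proof.
move=> eG [//|n] _ h.
pose A := bar_coker G n.+1; pose pi : bar_chain G n.+1 -> A := \pi_A.
have piB x y : pi (x - y) = pi x - pi y by exact: pi_is_zmod_morphism.
have pi0 c : pi c = 0 -> exists b : bar_chain G n.+2, bar_diff b = c.
  move=> pc; apply/asboolP; rewrite -[c]subr0.
  have : c == 0 %[mod A] by apply/eqP; rewrite -/(pi c) pc -(subrr (pi 0)) -piB subrr.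
  by rewrite -Quotient.idealrBE.
have pi_b b : pi (bar_diff (b : bar_chain G n.+2)) = 0.
  apply/eqP; rewrite -(subrr (pi 0)) -piB subrr.
  suff : bar_diff b == 0 %[mod A] by [].
  by rewrite -Quotient.idealrBE subr0; apply/asboolP; exists b.
pose u m (s : seq G) : bar_chain G m := << tup m (ratios s) >>.
have ud m s : size s = m.+2 -> bar_diff (u m.+1 s) = delta (u m) s.
  move=> ss; rewrite bar_diffU delta_sum ss; apply: eq_bigr => i _.
  rewrite /u tup_face // -signr_odd; case: (odd i).
    by rewrite expr1 scaleN1r.
  by rewrite expr0 scale1r.
have deltapi s f : delta (fun t => pi (f t)) s = pi (delta f s) :> A.
  elim: s f => [|x s IH] f /=; first by rewrite -(subrr (0 : bar_chain G n.+1)) piB subrr.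
  by rewrite piB IH.
pose f s : A := pi (u n.+1 s).
have fi : inv_under (fun _ : G => True) f by move=> g s _; rewrite /f /u ratios_lmul.
have fc : cocycle f n.+2 by move=> s ss; rewrite deltapi -ud // pi_b.
have [b bi bE] := eG A n.+2 isT f fi fc.
pose psi0 (t : n.-tuple G) : zmodule A := b (partials t).
pose psi : bar_chain G n -> zmodule A := fglift psi0.
have psiB x y : psi (x - y) = psi x - psi y by exact: lift_is_additive.
have deltapsi s h' : delta (fun t => psi (h' t)) s = psi (delta h' s) :> A.
  elim: s h' => [|x s IH] h' /=; first by rewrite -(subrr (0 : bar_chain G n)) psiB subrr.
  by rewrite psiB IH.
have psiE s : size s = n.+1 -> psi (u n s) = b s.
  move=> ss; rewrite /psi liftU scale1r /psi0 val_tup ?size_ratios ?ss //.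
  by rewrite [in RHS](partials_ratios (s := s)) ?ss // bi.
have piE (c : bar_chain G n.+1) : pi c = psi (bar_diff c).
  pose psi' (x : bar_chain G n.+1) : A := pi x - psi (bar_diff x).
  suff : psi' c = 0 by move/eqP; rewrite subr_eq0 => /eqP.
  have psi'B x y : psi' (x - y) = psi' x - psi' y.
    by rewrite /psi' piB bar_diff_is_additive psiB; zmod.
  have psi'0 : psi' 0 = 0 by rewrite -[X in psi' X](subrr 0) psi'B subrr.
  have psi'N x : psi' (- x) = - psi' x by rewrite -[X in psi' X]sub0r psi'B psi'0 sub0r.
  have psi'D x y : psi' (x + y) = psi' x + psi' y by rewrite -[X in psi' (x + X)]opprK psi'B psi'N opprK.
  have psi't t : psi' << t >> = 0.
    have st : size (partials t) = n.+2 by rewrite size_partials size_tuple.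
    have -> : << t >> = u n.+1 (partials t) by rewrite /u ratios_partials tupE.
    rewrite /psi' -/(f _) bE // ud // -deltapsi; apply/eqP; rewrite subr_eq0; apply/eqP.
    by apply: eq_delta => v; rewrite st => -[sv]; rewrite psiE.
  have psi'M x (m : nat) : psi' (x *+ m) = psi' x *+ m.
    by elim: m => [|m IH]; rewrite ?mulr0n // !mulrS psi'D IH.
  rewrite -(freeg_sumE c); elim/big_ind: _ => // [x y hx hy|t _]; first by rewrite psi'D hx hy addr0.
  rewrite -[coeff t c]intz -freegU_mulz; case: (coeff t c) => m.
    by rewrite -pmulrn psi'M psi't mul0rn.
  by rewrite NegzE mulrNz psi'N -pmulrn psi'M psi't mul0rn oppr0.
rewrite -[h]reprK; set z := repr h.
have /eqP zc : val z \in @bar_cycle G n.+1 := bar_cycleP z.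
have [c cz] : exists c : bar_chain G n.+2, bar_diff c = val z.
  by apply: pi0; rewrite piE zc -[X in psi X](subrr 0) psiB subrr.
have /eqP -> : z == 0 %[mod group_homology G n.+1].
  by rewrite -Quotient.idealrBE subr0; apply/asboolP; exists c.
by rewrite -(subrr (0 : bar_cycles G n.+1)) pi_is_zmod_morphism subrr.
Qed.
End HomologyVanishing.

Local Close Scope quotient_scope.

(** * Arcs in dendrites *)

Local Open Scope classical_set_scope.

(** The metric is a bare function tied to the existing neighbourhoods, so the topology of [X] is
    never replaced. *)
Record metric_on (R : realType) (X : topologicalType) (d : X -> X -> R) : Prop := MetricOn {
  d_xx : forall x, d x x = 0;
  d_eq : forall x y, d x y = 0 -> x = y;
  d_sym : forall x y, d x y = d y x;
  d_tri : forall y x z, d x z <= d x y + d y z;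
  d_nbhs : forall x (O : set X), nbhs x O <-> exists2 e, 0 < e & forall y, d x y < e -> O y }.

Lemma metrizable_metric (R : realType) (X : topologicalType) :
  metrizable R X -> exists d : X -> X -> R, metric_on d.
Proof.
move=> [M [f [g [_ fc gc gf _]]]].
have {}fc := (continuous_subspace_setT f).2 fc; have {}gc := (continuous_subspace_setT g).2 gc.
exists (fun x y => mdist (f x) (f y)); split.
- by move=> x; exact: mdistxx.
- move=> x y /mdist_positivity e; rewrite -(gf x I) -(gf y I); congr g; exact: e.
- by move=> x y; exact: metric_sym.
- by move=> y x z; exact: metric_triangle.
- move=> x O; split=> [Ox|[e e0 eO]].
    have : nbhs (f x) (g @^-1` O) by have := gc (f x) O; rewrite (gf x I); apply.
    move=> /nbhs_ballP[e /= e0 eP]; exists e => // y xy.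
    by rewrite -(gf y I); apply: eP; rewrite ballEmdist.
  have : nbhs x (f @^-1` (ball (f x) e)) by have := fc x (ball (f x) e); apply; exact: nbhsx_ballx.
  by apply: filterS => y; rewrite /= ballEmdist; exact: eO.
Qed.

(** * Paths in compact locally connected metric spaces *)

Section MetricSpace.
Variables (R : realType) (X : topologicalType) (d : X -> X -> R).
Hypothesis dm : metric_on d.

Lemma d_ge0 x y : 0 <= d x y.
Proof.
have := d_tri dm y x x; rewrite (d_xx dm) (d_sym dm y x); lra.
Qed.

Lemma d_ball x e : 0 < e -> nbhs x [set y | d x y < e].
Proof. by move=> e0; apply/(d_nbhs dm); exists e. Qed.

Lemma d_hausdorff : hausdorff_space X.
Proof.
move=> p q pq; apply: (d_eq dm); apply/eqP; rewrite eq_le d_ge0 andbT leNgt; apply/negP => h.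
have h2 : 0 < d p q / 2 by lra.
have [x [/= px qx]] := pq _ _ (d_ball p h2) (d_ball q h2).
have := d_tri dm x p q; rewrite (d_sym dm x q); lra.
Qed.

Lemma d_le0 x y : (forall e, 0 < e -> d x y <= e) -> x = y.
Proof.
move=> h; apply: (d_eq dm); apply/eqP; rewrite eq_le d_ge0 andbT.
by apply/ler_addgt0Pl => e e0; rewrite addr0; exact: h.
Qed.

Lemma d_continuous (f : R -> X) : (forall t e, 0 < e -> exists2 h, 0 < h &
  forall s, `|s - t| < h -> d (f t) (f s) < e) -> continuous f.
Proof.
move=> h t O /(d_nbhs dm)[e e0 eO]; have [r r0 rP] := h t e e0.
apply/nbhs_ballP; exists r => // s ts; apply/eO/rP.
by rewrite distrC.
Qed.

Lemma continuous_d (f : R -> X) t e : continuous f -> 0 < e ->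
  exists2 h, 0 < h & forall s, `|s - t| < h -> d (f t) (f s) < e.
Proof.
move=> fc e0; have /nbhs_ballP[h h0 hP] := fc t _ (d_ball (f t) e0).
by exists h => // s st; apply: hP; rewrite /ball /= distrC.
Qed.

(** The points reachable from [x] form a subset both open and closed in [K]. *)
Lemma connected_chain (K : set X) (r : X -> X -> Prop) x y : connected K ->
  (forall z, K z -> exists2 V, nbhs z V & forall w, V w -> r z w /\ r w z) -> K x -> K y ->
  exists n (c : nat -> X), [/\ c 0%N = x, c n = y, forall i, (i <= n)%N -> K (c i) &
    forall i, (i < n)%N -> r (c i) (c i.+1)].
Proof.
move=> Kc rP Kx Ky.
have /choice[V VP] z : exists V, K z -> nbhs z V /\ forall w, V w -> r z w /\ r w z.
  have [Kz|n] := pselect (K z); last by exists setT.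
  by have [V h1 h2] := rP z Kz; exists V.
pose S z := exists n (c : nat -> X), [/\ c 0%N = x, c n = z, forall i, (i <= n)%N -> K (c i) &
    forall i, (i < n)%N -> r (c i) (c i.+1)].
have SK z : S z -> K z by move=> [n [c [_ <- h _]]]; exact: h.
have Sx : S x by exists 0%N, (fun=> x); split.
have step z w : S z -> K w -> r z w -> S w.
  move=> [n [c [c0 cn cK cr]]] Kw zw.
  exists n.+1, (fun i => if (i <= n)%N then c i else w); split=> [||i _|i].
  - by rewrite leq0n.
  - by rewrite ltnn.
  - by case: ifP => // h; exact: cK.
  - rewrite ltnS => ilen; rewrite ilen; case: ltnP => [h|nlei]; first exact: cr.
    by have -> : i = n; [apply/eqP; rewrite eqn_leq ilen | rewrite cn].
suff e : K = S by have : S y by rewrite -e.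
apply/esym; apply: Kc; first by exists x.
  exists (\bigcup_(z in S) (V z)°).
    by apply: bigcup_open => z _; exact: open_interior.
  apply/seteqP; split=> [z Sz|z [Kz [w Sw /interior_subset wz]]].
    split; first exact: SK.
    by exists z => //; have [] := VP z (SK z Sz).
  by apply: (step w) => //; have [_ h] := VP w (SK w Sw); have [] := h z wz.
exists (~` (\bigcup_(z in K `\` S) (V z)°)).
  by apply: open_closedC; apply: bigcup_open => z _; exact: open_interior.
apply/seteqP; split=> [z Sz|z [Kz n]].
  split; first exact: SK.
  move=> [w [Kw nSw] /interior_subset wz]; apply: nSw; apply: (step z) => //.
  by have [_ h] := VP w Kw; have [] := h z wz.
have [//|nS] := pselect (S z); case: n; exists z => //.
by have [] := VP z Kz.
Qed.

Hypotheses (Xc : compact [set: X]) (lc : locally_connected X).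

Lemma compact_seq (u : nat -> X) : exists y, forall e n, 0 < e -> exists2 m, (n <= m)%N & d (u m) y < e.
Proof.
have [|y [_ yP]] := Xc (fmap_proper_filter u eventually_filter); first exact: filterT.
exists y => e n e0.
have h : (u @ \oo) [set z | exists2 m, (n <= m)%N & z = u m].
  by exists n => // m /= nm; exists m.
have [z [/= [m nm ->] yz]] := yP _ _ h (d_ball y e0).
by exists m => //; rewrite (d_sym dm).
Qed.

Definition small e (K : set X) := connected K /\ forall p q, K p -> K q -> d p q < e.
Definition link e x y := exists K, [/\ small e K, K x & K y].

Lemma link_refl e x : 0 < e -> link e x x.
Proof.
move=> e0; exists [set x]; split=> //; split; first exact: connected1.
by move=> p q -> ->; rewrite (d_xx dm).
Qed.

Lemma link_near e x : 0 < e -> exists2 V, nbhs x V & forall y, V y -> link e x y /\ link e y x.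
Proof.
move=> e0; have e2 : 0 < e / 2 by lra.
have [V [oV Vx Vc Ve]] := lc (d_ball x e2).
have sV : small e V.
  split=> // p q /Ve /= px /Ve /= qx; have := d_tri dm x p q; rewrite (d_sym dm p x); lra.
exists V; first exact: open_nbhs_nbhs.
by move=> y Vy; split; exists V.
Qed.

Definition linked e (P : nat) (c : nat -> X) := forall i, (i < P)%N -> link e (c i) (c i.+1).

(** All links are subdivided into the same number [N] of steps, short ones padded by repetition, so
    that index [j] of the finer chain lies over index [j %/ N] of the coarser one. *)
Lemma refine e e' P c : 0 < e -> 0 < e' -> linked e P c ->
  exists (N : nat) (c' : nat -> X), [/\ (0 < N)%N, linked e' (P * N) c', c' 0%N = c 0%N, c' (P * N)%N = c P &
    forall j, (j <= P * N)%N -> d (c (j %/ N)%N) (c' j) < e].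
Proof.
move=> e0 e'0 cl.
have /choice[nc ncP] i : exists nc : nat * (nat -> X), nc.2 0%N = c i /\ ((i < P)%N ->
    [/\ nc.2 nc.1 = c i.+1, forall k, (k <= nc.1)%N -> d (c i) (nc.2 k) < e &
      forall k, (k < nc.1)%N -> link e' (nc.2 k) (nc.2 k.+1)]).
  have [iP|_] := boolP (i < P)%N; last by exists (0%N, fun=> c i).
  have [K [[Kc Kd] Ki Ki1]] := cl i iP.
  have [|n [c' [h1 h2 h3 h4]]] := @connected_chain K (link e') (c i) (c i.+1) Kc _ Ki Ki1.
    by move=> z _; exact: link_near.
  by exists (n, c') => /=; split=> // _; split=> // k /h3; exact: Kd.
pose N := (\max_(i < P) (nc i).1).+1.
have nN i : (i < P)%N -> ((nc i).1 < N)%N.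
  by move=> iP; rewrite ltnS; exact: (@leq_bigmax _ (fun i : 'I_P => (nc i).1) (Ordinal iP)).
pose c' j := (nc (j %/ N)%N).2 (minn (j %% N) (nc (j %/ N)%N).1).
have c'N i : c' (i * N)%N = c i by rewrite /c' mulnK // modnMl min0n; have [] := ncP i.
exists N, c'; split=> //.
- move=> j jPN; have iP : (j %/ N < P)%N by rewrite ltn_divLR.
  have [_ /(_ iP)[h1 h2 h3]] := ncP (j %/ N)%N; have nNi := nN _ iP.
  have [rN|rN] := ltnP (j %% N).+1 N.
    have e1 : (j.+1 %/ N = j %/ N)%N /\ (j.+1 %% N = (j %% N).+1)%N.
      have -> : j.+1 = (j %/ N * N + (j %% N).+1)%N by rewrite addnS -divn_eq.
      by rewrite divnMDl // modnMDl (divn_small rN) (modn_small rN) addn0.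
    rewrite /c' e1.1 e1.2; have [rn|] := boolP (j %% N < (nc (j %/ N)%N).1)%N.
      by rewrite (minn_idPl (ltnW rn)) (minn_idPl rn); exact: h3.
    by rewrite -leqNgt => rn; rewrite (minn_idPr rn) (minn_idPr (leqW rn)); exact: link_refl.
  have e1 : j.+1 = ((j %/ N).+1 * N)%N.
    rewrite {1}(divn_eq j N) -addnS mulSn addnC; congr (_ + _)%N.
    by apply/eqP; rewrite eqn_leq rN ltn_mod.
  rewrite e1 c'N /c' (minn_idPr _) ?h1; first exact: link_refl.
  by rewrite -ltnS (leq_trans nNi).
- by have := c'N 0%N; rewrite mul0n.
- move=> j; rewrite leq_eqVlt => /orP[/eqP ->|jPN]; first by rewrite mulnK // c'N (d_xx dm).
  have iP : (j %/ N < P)%N by rewrite ltn_divLR.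
  have [_ /(_ iP)[_ h2 _]] := ncP (j %/ N)%N; apply: h2; exact: geq_minr.
Qed.

Definition path_in (O : set X) x y := exists f : R -> X,
  [/\ continuous f, f 0 = x, f 1 = y & forall t, 0 <= t <= 1 -> O (f t)].

Definition clamp (t : R) : R := Num.max 0 (Num.min 1 t).

Lemma clamp_itv t : 0 <= clamp t <= 1.
Proof. by rewrite /clamp le_max lexx /= ge_max ler01 ge_min lexx. Qed.

Lemma clamp_id t : 0 <= t <= 1 -> clamp t = t.
Proof. by move=> /andP[h0 h1]; rewrite /clamp (min_idPr h1) (max_idPr h0). Qed.

Lemma clamp_dist s t : `|clamp s - clamp t| <= `|s - t|.
Proof.
have h1 := ler_norm (s - t); have h2 := ler_norm (t - s); rewrite distrC in h2.
have h3 := normr_ge0 (s - t).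
rewrite ler_norml /clamp; case: (leP 1 s) => hs; case: (leP 1 t) => ht.
- by case: leP => h; apply/andP; split; lra.
- by case: (leP 0 1) => h; case: (leP 0 t) => h'; apply/andP; split; lra.
- by case: (leP 0 1) => h; case: (leP 0 s) => h'; apply/andP; split; lra.
- by case: (leP 0 s) => h; case: (leP 0 t) => h'; apply/andP; split; lra.
Qed.

Lemma truncn_divn (x : R) (N : nat) : 0 <= x -> (0 < N)%N -> (Num.truncn (x * N%:R) %/ N = Num.truncn x)%N.
Proof.
move=> x0 N0; have xN0 : 0 <= x * N%:R by rewrite mulr_ge0.
have /andP[h1 h2] := truncn_itv x0; have /andP[h3 h4] := truncn_itv xN0.
have N0' : 0 < N%:R :> R by rewrite ltr0n.
apply/eqP; rewrite eqn_leq -ltnS ltn_divLR // leq_divRL //; apply/andP; split.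
  by rewrite -(ltr_nat R) natrM; apply: (le_lt_trans h3); rewrite ltr_pM2r.
rewrite -ltnS -(ltr_nat R) natrM; apply: (le_lt_trans _ h4).
by rewrite ler_pM2r.
Qed.

(** The path is a limit of ever finer chains. At time [t] each chain is read at the integer part of
    [t] times its length; since the lengths divide one another, consecutive readings are close. *)
Lemma path_near e x : 0 < e -> exists2 V, nbhs x V & forall y, V y -> path_in [set z | d x z < e] x y.
Proof.
(* A distance below e/4 from [x] to the coarsest chain plus the geometric tail e/2 stays below
   [e]. *)
move=> e0; pose eps n := e / 4 / 2 ^+ n : R.
have eps0 n : 0 < eps n by rewrite /eps !divr_gt0 ?exprn_gt0 //; lra.
have epsS n : eps n = 2 * eps n.+1.
  have : (2 : R) ^+ n != 0 by rewrite expf_neq0 //; lra.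
  by rewrite /eps exprS => h; rewrite invfM; lra.
have [V Vx VP] := link_near x (eps0 0%N).
exists V => // y /VP[xy _].
pose st : Type := (nat * (nat -> X))%type.
pose ok n (s : st) := [/\ (0 < s.1)%N, linked (eps n) s.1 s.2, s.2 0%N = x & s.2 s.1 = y].
have /choice[nx nxP] (ns : nat * st) : exists Ns : nat * st, ok ns.1 ns.2 ->
    [/\ ok ns.1.+1 Ns.2, (0 < Ns.1)%N, Ns.2.1 = (ns.2.1 * Ns.1)%N &
      forall j, (j <= Ns.2.1)%N -> d (ns.2.2 (j %/ Ns.1)%N) (Ns.2.2 j) < eps ns.1].
  case: ns => n [P c]; have [[/= P0 cl c0 cP]|h] := pselect (ok n (P, c)); last by exists (0%N, (0%N, fun=> x)).
  have [N [c' [N0 cl' c0' cP' cd]]] := refine (eps0 n) (eps0 n.+1) cl.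
  exists (N, ((P * N)%N, c')) => _ /=; split=> //; split=> //=; first by rewrite muln_gt0 P0.
    by rewrite c0'.
  by rewrite cP'.
pose S := fix S n := if n is n'.+1 then (nx (n', S n')).2 else (1%N, fun i => if i is 0%N then x else y).
have Sok n : ok n (S n).
  elim: n => [|n IH]; last by have [] := nxP (n, S n) IH.
  by split=> //= -[|//] _.
pose N n := (nx (n, S n)).1.
have N0 n : (0 < N n)%N by have [] := nxP (n, S n) (Sok n).
have PS n : (S n.+1).1 = ((S n).1 * N n)%N by have [] := nxP (n, S n) (Sok n).
have cS n j : (j <= (S n.+1).1)%N -> d ((S n).2 (j %/ N n)%N) ((S n.+1).2 j) < eps n.
  by have [_ _ _ h] := nxP (n, S n) (Sok n); exact: h.
pose idx n t := Num.truncn (clamp t * (S n).1%:R).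
have ct t : 0 <= clamp t by have /andP[] := clamp_itv t.
have ct0 n t : 0 <= clamp t * (S n).1%:R by rewrite mulr_ge0.
have idx_le n t : (idx n t <= (S n).1)%N.
  have /andP[h _] := truncn_itv (ct0 n t); rewrite -(ler_nat R); apply: (le_trans h).
  by have /andP[_ h'] := clamp_itv t; rewrite ler_piMl.
have idxS n t : (idx n.+1 t %/ N n)%N = idx n t.
  by rewrite /idx PS natrM mulrA truncn_divn.
pose u t n := (S n).2 (idx n t).
have uS t n : d (u t n) (u t n.+1) < eps n by rewrite /u -idxS; apply: cS; exact: idx_le.
have uD t n k : d (u t n) (u t (n + k)%N) <= 2 * eps n - 2 * eps (n + k)%N.
  elim: k => [|k IH]; first by rewrite addn0 (d_xx dm); lra.
  have := d_tri dm (u t (n + k)%N) (u t n) (u t (n + k.+1)%N).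
  have := uS t (n + k)%N; rewrite addnS; have := epsS (n + k)%N; lra.
have /choice[f fP] t : exists z, forall n, d (u t n) z <= 2 * eps n.
  have [z zP] := compact_seq (u t); exists z => n; apply/ler_addgt0Pr => h h0.
  have [m nm mz] := zP h n h0; have := uD t n (m - n)%N; rewrite subnKC //.
  have := d_tri dm (u t m) (u t n) z; have := eps0 m; lra.
have eps_lim h : 0 < h -> exists n, eps n < h.
  move=> h0; have /cvgrPdist_lt/(_ h h0)[n _ /(_ n (leqnn n))] : eps n @[n --> \oo] --> (0 : R).
    have -> : eps = (fun n => e / 4 * (2^-1) ^+ n) by apply/funext => n; rewrite /eps exprVn.
    rewrite -[X in _ --> X](mulr0 (e / 4)); apply: cvgMr; apply: cvg_expr.
    by rewrite ger0_norm; lra.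
  by rewrite /= sub0r normrN gtr0_norm ?eps0 // => nh; exists n.
have flim t z : (forall n, d (u t n) z <= 2 * eps n) -> f t = z.
  move=> zP; apply: d_le0 => h h0; have [|n nh] := eps_lim (h / 4); first by lra.
  have := d_tri dm (u t n) (f t) z; have := zP n; have := fP t n; rewrite (d_sym dm (f t) (u t n)); lra.
exists f; split.
- apply: d_continuous => t h h0; have [|n nh] := eps_lim (h / 5); first by lra.
  have [P0 cl _ _] := Sok n; have P0' : 0 < (S n).1%:R :> R by rewrite ltr0n.
  exists ((S n).1%:R^-1); first by rewrite invr_gt0.
  move=> s; rewrite -(ltr_pM2r P0') mulVf ?gt_eqF // => st1.
  have st2 : `|clamp s * (S n).1%:R - clamp t * (S n).1%:R| < 1.
    rewrite -mulrBl normrM (gtr0_norm P0'); apply: le_lt_trans st1.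
    by rewrite ler_pM2r // clamp_dist.
  have h1 : d (u t n) (u s n) < eps n.
    have /andP[k1 k2] := truncn_itv (ct0 n s); have /andP[k3 k4] := truncn_itv (ct0 n t).
    move: st2; rewrite ltr_norml => /andP[st2 st3].
    rewrite /u; move: (idx_le n s) (idx_le n t); rewrite /idx; move: k1 k2 k3 k4.
    set i := Num.truncn _; set j := Num.truncn _ => k1 k2 k3 k4 iP jP.
    rewrite -natr1 in k2; rewrite -natr1 in k4.
    have n2 (m : nat) : m.+2%:R = m%:R + 2 :> R by rewrite -addn2 natrD.
    have ij : (i <= j.+1)%N by rewrite -ltnS -(ltr_nat R) n2; lra.
    have ji : (j <= i.+1)%N by rewrite -ltnS -(ltr_nat R) n2; lra.
    have [eij|nij] := eqVneq i j; first by rewrite eij (d_xx dm).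
    have [ij'|ji'] : (j = i.+1)%N \/ (i = j.+1)%N by lia.
      have [K [[_ Kd] K1 K2]] : link (eps n) ((S n).2 i) ((S n).2 i.+1) by apply: cl; rewrite -ij'.
      by rewrite ij'; exact: Kd.
    have [K [[_ Kd] K1 K2]] : link (eps n) ((S n).2 j) ((S n).2 j.+1) by apply: cl; rewrite -ji'.
    by rewrite ji'; exact: Kd.
  have := d_tri dm (u t n) (f t) (f s); have := d_tri dm (u s n) (u t n) (f s).
  have := fP t n; have := fP s n; rewrite (d_sym dm (f t) (u t n)); lra.
- apply: flim => n; have [_ _ h _] := Sok n.
  by rewrite /u /idx clamp_id ?mul0r ?truncn0 ?h ?(d_xx dm) ?lexx ?ler01 // mulr_ge0 // ltW.
- apply: flim => n; have [_ _ _ h] := Sok n.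
  by rewrite /u /idx clamp_id ?mul1r ?natrK ?h ?(d_xx dm) ?lexx ?ler01 // mulr_ge0 // ltW.
- move=> t _ /=; have := fP t 0%N; have := d_tri dm (u t 0%N) x (f t).
  have : d x (u t 0%N) < eps 0%N.
    have [K [[_ Kd] Kx Ky]] := xy; rewrite /u /=; case: (idx 0%N t) => [|k]; exact: Kd.
  have -> : eps 0%N = e / 4 by rewrite /eps expr0 divr1.
  lra.
Qed.

End MetricSpace.

(** * Compactness, and monotone functions on the line *)

Lemma directed_compact (T : topologicalType) (I : Type) (D : set I) (K : I -> set T) (S : set T) :
  compact S -> D !=set0 -> (forall i, D i -> closed (K i)) -> (forall i, D i -> S `&` K i !=set0) ->
  (forall i j, D i -> D j -> exists2 k, D k & K k `<=` K i `&` K j) ->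
  exists2 p, S p & forall i, D i -> K i p.
Proof.
move=> Sc [i0 Di0] Kc KS dir.
pose F := filter_from D (fun i => S `&` K i).
have FF : ProperFilter F.
  apply: filter_from_proper => //; apply: filter_from_filter; first by exists i0.
  move=> i j Di Dj; have [k Dk kij] := dir i j Di Dj; exists k => // p [Sp /kij[? ?]].
  by split; split.
have [|p [Sp pc]] := Sc F FF; first by exists i0 => // p [].
exists p => // i Di; apply: (Kc i Di) => O Op.
have [|q [[_ Kq] Oq]] := pc (S `&` K i) O _ Op; first by exists i.
by exists q.
Qed.

(** A continuous map from a compact set to a Hausdorff space is closed, hence a quotient map onto
    its image. *)
Lemma compact_factor (S Y Z : topologicalType) (K : set S) (F : S -> Y) (h : S -> Z) (k : Y -> Z) :
  hausdorff_space Y -> compact K -> continuous F -> continuous h ->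
  (forall t, K t -> k (F t) = h t) -> {within F @` K, continuous k}.
Proof.
move=> Yh Kc Fc hc kF; apply/subspace_continuousP => _ [t0 Kt0 <-] W.
rewrite nbhsE => -[O [oO Oy] OW].
have cK : compact (K `&` ~` (h @^-1` O)).
  by apply: compact_closedI => //; apply: open_closedC; apply: open_comp => // x _; exact: hc.
have cF : closed (F @` (K `&` ~` (h @^-1` O))).
  apply: (compact_closed Yh); apply: continuous_compact cK; exact: continuous_subspaceT.
have : nbhs (F t0) (~` (F @` (K `&` ~` (h @^-1` O)))).
  apply: open_nbhs_nbhs; split; first exact: closed_openC.
  by move=> [t [Kt nt] e]; apply: nt => /=; rewrite -kF // e.
apply: filterS => y n [t Kt ty]; apply: OW; have [//|no] := pselect (O (k y)).
by case: n; exists t => //; split=> //= ho; apply: no; rewrite -ty kF.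
Qed.

Lemma within_comp (S Y Z : topologicalType) (B : set Y) (g : S -> Y) (k : Y -> Z) :
  {within B, continuous k} -> continuous g -> (forall s, B (g s)) -> continuous (fun s => k (g s)).
Proof.
move=> /subspace_continuousP kc gc gB s O Oks.
have h : nbhs s (g @^-1` [set y | B y -> O (k y)]) := gc s _ (kc (g s) (gB s) O Oks).
by apply: filterS h => s' /=; apply; exact: gB.
Qed.

Section RealLine.
Variable R : realType.

Lemma compact_max (A : set R) : compact A -> A !=set0 -> exists2 m, A m & forall x, A x -> x <= m.
Proof.
move=> Ac A0; apply: (@directed_compact R R A (fun x => [set y | x <= y]) A) => //.
- by move=> x Ax; exists x; split=> //=.
- move=> x y Ax Ay; case: (leP x y) => xy; [exists y => // z /= yz|exists x => // z /= yz].
    by split=> //=; exact: le_trans yz.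
  by split=> //=; exact: le_trans (ltW xy) yz.
Qed.

Lemma compact_min (A : set R) : compact A -> A !=set0 -> exists2 m, A m & forall x, A x -> m <= x.
Proof.
move=> Ac A0; apply: (@directed_compact R R A (fun x => [set y | y <= x]) A) => //.
- by move=> x Ax; exists x; split=> //=.
- move=> x y Ax Ay; case: (leP x y) => xy; [exists x => // z /= zx|exists y => // z /= zy].
    by split=> //=; exact: le_trans xy.
  by split=> //=; exact: le_trans (ltW xy).
Qed.

Lemma affine_continuous (a b : R) : continuous (fun t : R => a * t + b).
Proof. by move=> t; apply: cvgD; [apply: cvgMr; exact: cvg_id | exact: cvg_cst]. Qed.

Lemma clamp_continuous : continuous (@clamp R).
Proof.
move=> t O /nbhs_ballP[e e0 eO]; apply/nbhs_ballP; exists e => // s ts.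
by apply: eO; apply: le_lt_trans ts; exact: clamp_dist.
Qed.

Lemma real_continuous (f : R -> R) : (forall t e, 0 < e -> exists2 h, 0 < h &
  forall s, `|s - t| < h -> `|f s - f t| < e) -> continuous f.
Proof.
move=> h t O /nbhs_ballP[e e0 eO]; have [r r0 rP] := h t e e0.
apply/nbhs_ballP; exists r => // s ts; apply: eO; rewrite /ball /= distrC; apply: rP.
by rewrite distrC.
Qed.

Lemma continuous_real (f : R -> R) t e : continuous f -> 0 < e -> exists2 h, 0 < h &
  forall s, `|s - t| < h -> `|f s - f t| < e.
Proof.
move=> fc e0; have /nbhs_ballP[h h0 hP] := fc t _ (nbhsx_ballx (f t) e e0).
by exists h => // s st; rewrite distrC; apply: hP; rewrite /ball /= distrC.
Qed.

(** A series with weights [2^-n], defined as the supremum of its increasing partial sums. The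
    geometric tail gives continuity; a single increasing term survives because all terms are
    monotone. *)
Lemma weighted_sum (M : nat -> R -> R) : (forall n t, 0 <= M n t <= 1) ->
  (forall n, continuous (M n)) -> (forall n s t, s <= t -> M n s <= M n t) ->
  exists h : R -> R, [/\ continuous h, forall s t, s <= t -> h s <= h t,
    forall s t, (forall n, M n s = M n t) -> h s = h t &
    forall s t n, s <= t -> M n s < M n t -> h s < h t].
Proof.
move=> M01 Mc Mm; pose S N t := \sum_(n < N) M n t / 2 ^+ n.
have p2 n : 0 < (2 : R) ^+ n by rewrite exprn_gt0.
have S1 N t : S N.+1 t = S N t + M N t / 2 ^+ N by rewrite /S big_ord_recr.
have SN N k t : S N t <= S (N + k)%N t <= S N t + 2 / 2 ^+ N - 2 / 2 ^+ (N + k).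
  elim: k => [|k IH]; first by rewrite addn0; apply/andP; split; lra.
  rewrite addnS S1; have := M01 (N + k)%N t => /andP[m0 m1].
  have h0 : 0 <= M (N + k)%N t / 2 ^+ (N + k) by rewrite divr_ge0 // ltW.
  have h1 : M (N + k)%N t / 2 ^+ (N + k) <= 1 / 2 ^+ (N + k) by rewrite ler_pM2r // invr_gt0.
  have h2 : 2 / 2 ^+ (N + k).+1 = 1 / 2 ^+ (N + k) :> R.
    by rewrite exprS invfM mulrA divff ?mul1r //; lra.
  rewrite h2; move: IH => /andP[i1 i2]; apply/andP; split; lra.
pose h t := sup [set S N t | N in setT].
have hS t : has_sup [set S N t | N in setT].
  split; first by exists (S 0%N t); exists 0%N.
  exists 2 => _ [N _ <-]; have := SN 0%N N t; rewrite add0n expr0 /S big_ord0 => /andP[_].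
  have : 0 < 2 / (2 : R) ^+ N by rewrite divr_gt0.
  by rewrite -/(S N t); lra.
have h_ge N t : S N t <= h t by apply: sup_upper_bound => //; exists N.
have h_le N t : h t <= S N t + 2 / 2 ^+ N.
  apply: ge_sup; first by exists (S 0%N t); exists 0%N.
  move=> _ [N' _ <-]; case: (leqP N' N) => nn.
    have := SN N' (N - N')%N t; rewrite subnKC // => /andP[k1 _].
    have : 0 < 2 / (2 : R) ^+ N by rewrite divr_gt0.
    lra.
  have := SN N (N' - N)%N t; rewrite subnKC; last exact: ltnW.
  move=> /andP[_ k1]; have : 0 < 2 / (2 : R) ^+ N' by rewrite divr_gt0.
  lra.
have tail (e : R) : 0 < e -> exists N, 2 / 2 ^+ N < e.
  move=> e0; have /cvgrPdist_lt/(_ e e0)[N _ /(_ N (leqnn N))] : (fun n => 2 / 2 ^+ n : R) n @[n --> \oo] --> (0 : R).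
    rewrite -[X in _ --> X](mulr0 2); apply: cvgMr.
    under eq_fun do rewrite -exprVn.
    by apply: cvg_expr; rewrite ger0_norm; lra.
  by rewrite /= sub0r normrN gtr0_norm ?divr_gt0 // => nh; exists N.
have Sc N : continuous (S N).
  elim: N => [|N IH] t.
    have -> : S 0%N = cst 0 by apply/funext => s; rewrite /S big_ord0.
    exact: cvg_cst.
  have -> : S N.+1 = (fun t => S N t + M N t / 2 ^+ N) by apply/funext => s; rewrite S1.
  by apply: cvgD; [exact: IH | apply: cvgMl; exact: Mc].
have Sm N s t : s <= t -> S N s <= S N t.
  move=> st; apply: ler_sum => n _; rewrite ler_pM2r ?invr_gt0 //; exact: Mm.
have le_eps (a b : R) : (forall N, a <= b + 2 / 2 ^+ N) -> a <= b.
  move=> hab; apply/ler_addgt0Pr => e e0; have [N Ne] := tail e e0; have := hab N; lra.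
exists h; split.
- apply: real_continuous => t e e0; have [|N Ne] := tail (e / 2); first by lra.
  have [|r r0 rP] := continuous_real t (Sc N) (e := e / 2); first by lra.
  exists r => // s /rP; have := h_ge N s; have := h_le N s; have := h_ge N t; have := h_le N t.
  by rewrite !ltr_norml => ? ? ? ? /andP[? ?]; apply/andP; split; lra.
- move=> s t st; apply: le_eps => N; have := Sm N s t st; have := h_le N s; have := h_ge N t; lra.
- move=> s t e; congr (sup _); apply/seteqP; split=> _ [N _ <-]; exists N => //;
    by apply: eq_bigr => n _; rewrite e.
- move=> s t n st mn.
  have gap N : (n < N)%N -> S N s + (M n t - M n s) / 2 ^+ n <= S N t.
    move=> nN; rewrite /S (bigD1 (Ordinal nN)) //= [X in _ <= X](bigD1 (Ordinal nN)) //=.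
    have : \sum_(i < N | i != Ordinal nN) M i s / 2 ^+ i <= \sum_(i < N | i != Ordinal nN) M i t / 2 ^+ i.
      by apply: ler_sum => i _; rewrite ler_pM2r ?invr_gt0 //; exact: Mm.
    rewrite mulrBl; lra.
  have g0 : 0 < (M n t - M n s) / 2 ^+ n by rewrite divr_gt0 ?subr_gt0.
  have [|N Ne] := tail ((M n t - M n s) / 2 ^+ n / 2); first by lra.
  have := gap (N + n.+1)%N; rewrite addnS ltnS leq_addl => /(_ isT).
  rewrite -addnS; have := h_ge (N + n.+1)%N t; have := h_le (N + n.+1)%N s.
  have : 2 / 2 ^+ (N + n.+1) <= 2 / 2 ^+ N :> R.
    rewrite ler_pM2l // lef_pV2 ?posrE //; apply: ler_weXn2l; [lra | exact: leq_addr].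
  lra.
Qed.

End RealLine.

(** * From paths to injective arcs *)

Section Arcs.
Variables (R : realType) (X : topologicalType) (d : X -> X -> R).
Hypothesis dm : metric_on d.

Lemma glue_continuous (f g : R -> X) c : continuous f -> continuous g -> f c = g c ->
  continuous (fun t => if t <= c then f t else g t).
Proof.
move=> fc gc fg; apply: (d_continuous dm) => t e e0.
have [r1 r10 h1] := continuous_d dm t fc e0; have [r2 r20 h2] := continuous_d dm t gc e0.
case: (ltrgtP t c) => tc.
- exists (Num.min r1 (c - t)); first by rewrite lt_min r10 subr_gt0.
  move=> s; rewrite lt_min ltr_norml (ltr_norml _ (c - t)) => /andP[/andP[a1 a2] /andP[a3 a4]].
  by rewrite ifT; [apply: h1; rewrite ltr_norml a1 | lra].
- exists (Num.min r2 (t - c)); first by rewrite lt_min r20 subr_gt0.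
  move=> s; rewrite lt_min ltr_norml (ltr_norml _ (t - c)) => /andP[/andP[a1 a2] /andP[a3 a4]].
  by rewrite ifF; [apply: h2; rewrite ltr_norml a1 | apply/negbTE; rewrite -ltNge; lra].
- exists (Num.min r1 r2); first by rewrite lt_min r10.
  move=> s; rewrite lt_min => /andP[a1 a2]; case: ifP => _; first exact: h1.
  by rewrite tc fg -tc; exact: h2.
Qed.

Lemma path_refl (O : set X) x : O x -> path_in R O x x.
Proof. by move=> Ox; exists (fun=> x); split=> // t; exact: cvg_cst. Qed.

Lemma path_sub (O O' : set X) x y : O `<=` O' -> path_in R O x y -> path_in R O' x y.
Proof. by move=> s [f [fc f0 f1 fO]]; exists f; split=> // t /fO/s. Qed.

Lemma affine_comp (f : R -> X) a b : continuous f -> continuous (fun t : R => f (a * t + b)).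
Proof.
move=> fc t; exact: (continuous_comp (@affine_continuous R a b t) (fc _)).
Qed.

Lemma clamp_comp (Y : topologicalType) (f : R -> Y) : continuous f -> continuous (fun t : R => f (clamp t)).
Proof. by move=> fc t; exact: (continuous_comp (@clamp_continuous R t) (fc _)). Qed.

Lemma clamp_le (a b : R) : a <= b -> clamp a <= clamp b.
Proof.
move=> ab; rewrite /clamp; case: (leP 1 a) => h1; case: (leP 1 b) => h2; first by [].
- by exfalso; lra.
- by case: (leP 0 a) => h3; case: (leP 0 1) => h4; lra.
- by case: (leP 0 a) => h3; case: (leP 0 b) => h4; lra.
Qed.

Lemma path_sym (O : set X) x y : path_in R O x y -> path_in R O y x.
Proof.
move=> [f [fc f0 f1 fO]]; exists (fun t => f (-1 * t + 1)); split.
- exact: affine_comp.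
- by rewrite mulr0 add0r.
- by rewrite mulr1 addNr.
- by move=> t /andP[t0 t1]; apply: fO; apply/andP; split; lra.
Qed.

Lemma path_trans (O : set X) y x z : path_in R O x y -> path_in R O y z -> path_in R O x z.
Proof.
move=> [f [fc f0 f1 fO]] [g [gc g0 g1 gO]].
exists (fun t => if t <= 1 / 2 then f (2 * t + 0) else g (2 * t + -1)); split.
- apply: glue_continuous; [exact: affine_comp | exact: affine_comp |].
  have -> : 2 * (1 / 2) + 0 = 1 :> R by lra.
  have -> : 2 * (1 / 2) + -1 = 0 :> R by lra.
  by rewrite f1 g0.
- by rewrite ifT ?mulr0 ?addr0 //; lra.
- rewrite ifF; last by apply/negbTE; rewrite -ltNge; lra.
  by have -> : 2 * 1 + -1 = 1 :> R by lra.
- move=> t /andP[t0 t1]; case: ifP => [h|/negbT]; first by apply: fO; apply/andP; split; lra.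
  by rewrite -ltNge => h; apply: gO; apply/andP; split; lra.
Qed.

Lemma open_path (U : set X) x y : compact [set: X] -> locally_connected X ->
  open U -> connected U -> U x -> U y -> path_in R U x y.
Proof.
move=> Xc lc oU cU Ux Uy.
have [|n [c [c0 cn _ cr]]] := @connected_chain X U (path_in R U) x y cU _ Ux Uy.
  move=> z Uz; have /(d_nbhs dm)[e e0 eU] : nbhs z U by exact: open_nbhs_nbhs.
  have [V Vz VP] := path_near dm Xc lc z e0; exists V => // w /VP zw.
  have zw' : path_in R U z w by exact: path_sub zw.
  by split=> //; exact: path_sym.
suff h i : (i <= n)%N -> path_in R U x (c i) by rewrite -cn; exact: h.
elim: i => [_|i IH lin]; first by rewrite c0; exact: path_refl.
apply: path_trans (cr i lin); apply: IH; exact: ltnW.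
Qed.

Section Monotone.
Variable f : R -> X.
Hypothesis fc : continuous f.

Let itv (a b : R) : set R := [set t | a <= t <= b].

Lemma itvE a b : itv a b = `[a, b]%classic.
Proof. by apply/seteqP; split=> t; rewrite /itv /= in_itv. Qed.

Lemma itv_compact a b : compact (itv a b).
Proof. by rewrite itvE; exact: segment_compact. Qed.

Lemma itv_closed a b : closed (itv a b).
Proof. by apply: compact_closed; [exact: Rhausdorff | exact: itv_compact]. Qed.

(* The complement of [K] is a union of open intervals on which the path [f] runs along a
   loop; freezing [f] there for a minimal [K] makes it monotone. *)
Record good_set (K : set R) : Prop := GoodSet {
  gs_closed : closed K;
  gs_itv : K `<=` itv 0 1;
  gs_0 : K 0;
  gs_1 : K 1;
  gs_gap : forall u v, K u -> K v -> u < v -> (forall t, u < t -> t < v -> ~ K t) -> f u = f v }.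

Lemma good_compact K a b : good_set K -> compact (K `&` itv a b).
Proof. move=> gK; rewrite setIC; apply: compact_closedI; [exact: itv_compact | exact: gs_closed]. Qed.

Lemma good_last K t : good_set K -> 0 <= t -> exists l, [/\ K l, l <= t & forall k, K k -> k <= t -> k <= l].
Proof.
move=> gK t0; have [|l [Kl /andP[l0 lt1]] lP] := compact_max (good_compact (a := 0) (b := t) gK).
  by exists 0; split; [exact: gs_0 | rewrite /itv /= lexx].
exists l; split=> // k Kk kt; apply: lP; split=> //; rewrite /itv /= kt andbT.
by have /andP[] := gs_itv gK Kk.
Qed.

Lemma good_first K t : good_set K -> t <= 1 -> exists l, [/\ K l, t <= l & forall k, K k -> t <= k -> l <= k].
Proof.
move=> gK t1; have [|l [Kl /andP[l0 lt1]] lP] := compact_min (good_compact (a := t) (b := 1) gK).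
  by exists 1; split; [exact: gs_1 | rewrite /itv /= lexx t1].
exists l; split=> // k Kk kt; apply: lP; split=> //; rewrite /itv /= kt /=.
by have /andP[] := gs_itv gK Kk.
Qed.

(** By compactness a gap of the intersection is, up to small margins, already free of points of one
    member; the equality of [f] at the ends of a gap of that member passes to the limit. *)
Lemma good_chain (A : set (set R)) : A !=set0 -> (forall K, A K -> good_set K) ->
  (forall K K', A K -> A K' -> K `<=` K' \/ K' `<=` K) -> good_set (fun t => forall K, A K -> K t).
Proof.
move=> A0 gA tot; split.
- move=> t tc K AK; apply: (gs_closed (gA K AK)) => O Ot.
  by have [s [/(_ K AK) Ks Os]] := tc O Ot; exists s.
- by move=> t Kt; have [K AK] := A0; apply: (gs_itv (gA K AK)); exact: Kt.
- by move=> K AK; exact: (gs_0 (gA K AK)).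
- by move=> K AK; exact: (gs_1 (gA K AK)).
move=> u v Ku Kv uv gap; apply: (d_le0 dm) => e e0; have e2 : 0 < e / 2 by lra.
have [r1 r10 h1] := continuous_d dm u fc e2; have [r2 r20 h2] := continuous_d dm v fc e2.
(* A third of the gap: the midpoint then lies between the two margins. *)
pose r := Num.min (Num.min r1 r2) (v - u) / 3.
have [rr1 rr2 rr3] : [/\ r * 3 <= r1, r * 3 <= r2 & r * 3 <= v - u].
  by rewrite /r divfK ?pnatr_eq0 // !ge_min !lexx !orbT.
have r0 : 0 < r by rewrite /r divr_gt0 // !lt_min r10 r20 subr_gt0.
have [K AK KP] : exists2 K, A K & forall t, u + r <= t -> t <= v - r -> ~ K t.
  have [//|no] := pselect (exists2 K, A K & forall t, u + r <= t -> t <= v - r -> ~ K t).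
  have [|||t /andP[t1 t2] tK] := @directed_compact _ _ A (fun K => K) (itv (u + r) (v - r)) (@itv_compact _ _) A0.
  - by move=> K AK; exact: (gs_closed (gA K AK)).
  - move=> K AK; have [//|n] := pselect (itv (u + r) (v - r) `&` K !=set0).
    case: no; exists K => // t t1 t2 Kt; apply: n; exists t; split=> //.
    by rewrite /itv /= t1.
  - move=> K K' AK AK'; have [h|h] := tot K K' AK AK'; [exists K => //|exists K' => //] => t Kt.
      by split=> //; exact: h.
    by split=> //; exact: h.
  - by exfalso; apply: (gap t _ _ tK); lra.
have gK := gA K AK; have /andP[u0 u1] := gs_itv gK (Ku K AK); have /andP[v0 v1] := gs_itv gK (Kv K AK).
pose m := (u + v) / 2.
have [|l [Kl lm lP]] := good_last (t := m) gK; first by rewrite /m; lra.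
have [|k [Kk km kP]] := good_first (t := m) gK; first by rewrite /m; lra.
have ul : u <= l by apply: lP; [exact: Ku | rewrite /m; lra].
have kv : k <= v by apply: kP; [exact: Kv | rewrite /m; lra].
have lr : l < u + r by rewrite ltNge; apply/negP => h; apply: (KP l) => //; move: lm; rewrite /m; lra.
have kr : v - r < k by rewrite ltNge; apply/negP => h; apply: (KP k) => //; move: km; rewrite /m; lra.
have flk : f l = f k.
  apply: (gs_gap gK Kl Kk); first by move: rr3; lra.
  move=> t lt1 tk Kt; have [tm|mt] := leP t m; first by have := lP t Kt tm; lra.
  by have := kP t Kt (ltW mt); lra.
have d1 : d (f u) (f l) < e / 2 by apply: h1; rewrite ltr_norml; lra.
have d2 : d (f v) (f k) < e / 2 by apply: h2; rewrite ltr_norml; lra.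
have := d_tri dm (f l) (f u) (f v); rewrite {2}flk (d_sym dm (f k)); lra.
Qed.

Lemma minimal_good : exists2 K, good_set K & forall K', good_set K' -> K' `<=` K -> K `<=` K'.
Proof.
pose T := {K | good_set K}.
have g01 : good_set (itv 0 1).
  split=> //; first exact: itv_closed.
  - by rewrite /itv /= lexx ler01.
  - by rewrite /itv /= lexx ler01.
  move=> u v /andP[u0 u1] /andP[v0 v1] uv gap; case: (gap ((u + v) / 2)); try lra.
  by rewrite /itv /=; apply/andP; split; lra.
have [||||[K gK] KP] := @Zorn T (fun s t => `[< sval t `<=` sval s >]).
- by move=> s; apply/asboolP.
- by move=> r s t /asboolP h1 /asboolP h2; apply/asboolP => x /h2/h1.
- move=> [s gs] [t gt] /asboolP /= h1 /asboolP /= h2; have e : s = t by apply/seteqP; split.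
  by subst t; congr exist; exact: Prop_irrelevance.
- move=> A tot; have [[s0 As0]|n] := pselect (A !=set0); last first.
    by exists (exist _ _ g01) => s As; case: n; exists s.
  have [|K [s As <-]|K K' [s As <-] [t At <-]|] := @good_chain (fun K => exists2 s, A s & sval s = K).
  + by exists (sval s0), s0.
  + exact: svalP.
  + by have [/asboolP|/asboolP] := tot s t As At; [right | left].
  move=> gap; set K := fun t => _ in gap; have gK : good_set K.
    by apply: good_chain => [|K' [s As <-]|K1 K2 [s As <-] [t At <-]];
      [by exists (sval s0), s0 | exact: svalP |
       by have [/asboolP|/asboolP] := tot s t As At; [right | left]].
  exists (exist _ K gK) => s As; apply/asboolP => x /=; apply.
  by exists s.
exists K => // K' gK' K'K; have := KP (exist _ K' gK').
by move=> /(_ (asboolT K'K)) /(congr1 sval) /= ->.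
Qed.

(** [F] reads [f] at the last point of a minimal good set. If [f] agreed at two points of that set
    with a third between them, the open interval could be removed, against minimality; so the fibres
    of [F] are intervals. *)
Lemma monotone_path : exists F : R -> X, [/\ continuous F, F 0 = f 0, F 1 = f 1,
  forall t, exists2 s, 0 <= s <= 1 & F t = f s &
  forall s r t, 0 <= s -> s <= r -> r <= t -> t <= 1 -> F s = F t -> F r = F s].
Proof.
have [K gK Kmin] := minimal_good.
have /choice[la laP] t : exists l, [/\ K l, l <= clamp t & forall k, K k -> k <= clamp t -> k <= l].
  by apply: good_last => //; have /andP[] := clamp_itv t.
have lam s t : clamp s <= clamp t -> la s <= la t.
  by move=> st; have [_ _ h] := laP t; have [Ks ls _] := laP s; apply: h => //; exact: le_trans st.
have gapE a b : K a -> K b -> a < b -> f a = f b -> forall t, a < t -> t < b -> ~ K t.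
  move=> Ka Kb ab fab t at_ tb Kt.
  have gK' : good_set (K `&` ~` [set t | a < t < b]).
    split.
    - apply: closedI; first exact: gs_closed.
      apply: open_closedC; rewrite (_ : [set t | a < t < b] = `]a, b[%classic); first exact: interval_open.
      by apply/seteqP; split=> x /=; rewrite in_itv.
    - by move=> x [/(gs_itv gK)].
    - split; first exact: gs_0; move=> /= /andP[h _].
      by have /andP[] := gs_itv gK Ka; lra.
    - split; first exact: gs_1; move=> /= /andP[_ h].
      by have /andP[] := gs_itv gK Kb; lra.
    - move=> u v [Ku nu] [Kv nv] uv gap.
      have [[k [Kk uk kv]]|n] := pselect (exists k, [/\ K k, u < k & k < v]); last first.
        by apply: (gs_gap gK) => // k uk kv Kk; apply: n; exists k.
      have /andP[ak kb] : a < k < b.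
        have [//|nk] := pselect (a < k < b); case: (gap k uk kv).
        by split.
      have ua : u = a.
        apply/eqP; rewrite eq_le; apply/andP; split.
          by rewrite leNgt; apply/negP => au; apply: nu => /=; apply/andP; split; lra.
        rewrite leNgt; apply/negP => ua; apply: (gap a) => //; [lra|].
        by split=> //= /andP[]; rewrite ltxx.
      have vb : v = b.
        apply/eqP; rewrite eq_le; apply/andP; split; last first.
          by rewrite leNgt; apply/negP => bv; apply: nv => /=; apply/andP; split; lra.
        rewrite leNgt; apply/negP => bv; apply: (gap b) => //; [lra|].
        by split=> //= /andP[_]; rewrite ltxx.
      by rewrite ua vb.
  have [|_] := Kmin _ gK' _ t Kt; first by move=> x [].
  by apply => /=; rewrite at_.
have K01 t : K t -> 0 <= t <= 1 by move=> /(gs_itv gK).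
pose F t := f (la t).
have Fmid s t : clamp s <= clamp t -> F s = F t \/ exists s' t',
    [/\ clamp s <= s' <= clamp t, clamp s <= t' <= clamp t, F s = f s' & F t = f t'].
  move=> st; have [Ks ls hs] := laP s; have [Kt lt1 ht] := laP t.
  have [ts|st'] := leP (la t) (clamp s).
    by left; rewrite /F; congr f; apply/eqP; rewrite eq_le lam //= hs.
  right; have [|k [Kk sk kP]] := good_first (t := clamp s) gK; first by have /andP[] := clamp_itv s.
  exists k, (la t); split=> //.
  - by rewrite sk (le_trans (kP _ Kt (ltW st'))).
  - by rewrite (ltW st').
  - rewrite /F; have [lk|kl] := ltP (la s) k.
      apply: (gs_gap gK) => // x lx xk Kx; have [xs|sx] := leP x (clamp s).
        by have := hs x Kx xs; lra.
      by have := kP x Kx (ltW sx); lra.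
    by congr f; apply/eqP; rewrite eq_le kl (le_trans ls).
exists F; split.
- apply: (d_continuous dm) => t e e0; have e2 : 0 < e / 2 by lra.
  have [r r0 rP] := continuous_d dm (clamp t) fc e2; exists r => // s st.
  have cst : `|clamp s - clamp t| < r by apply: le_lt_trans st; exact: clamp_dist.
  have near x : clamp s <= x <= clamp t \/ clamp t <= x <= clamp s -> d (f (clamp t)) (f x) < e / 2.
    by move=> h; apply: rP; move: cst; rewrite !ltr_norml => /andP[h1 h2]; apply/andP; case: h => /andP[h3 h4]; split; lra.
  have fin x y : d (f (clamp t)) (f x) < e / 2 -> d (f (clamp t)) (f y) < e / 2 -> d (f x) (f y) < e.
    by move=> h1 h2; have := d_tri dm (f (clamp t)) (f x) (f y); rewrite (d_sym dm (f x) (f (clamp t))); lra.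
  have [ts|st'] := leP (clamp t) (clamp s).
    have [->|[t' [s' [h1 h2 -> ->]]]] := Fmid t s ts; first by rewrite (d_xx dm).
    by apply: fin; apply: near; right.
  have [->|[s' [t' [h1 h2 -> ->]]]] := Fmid s t (ltW st'); first by rewrite (d_xx dm).
  by apply: fin; apply: near; left.
- rewrite /F; have [K0 l0 _] := laP 0; congr f; move: l0; rewrite clamp_id ?lexx ?ler01 //.
  by have /andP[] := K01 _ K0; lra.
- rewrite /F; have [K1 l1 h1] := laP 1; congr f; apply/eqP; rewrite eq_le.
  have /andP[_ ->] := K01 _ K1; apply: h1; first exact: gs_1.
  by rewrite clamp_id // ler01 lexx.
- by move=> t; have [Kt _ _] := laP t; exists (la t) => //; exact: K01.
- move=> s r t s0 sr rt t1 e.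
  have cs : clamp s = s by rewrite clamp_id //; apply/andP; split; lra.
  have cr : clamp r = r by rewrite clamp_id //; apply/andP; split; lra.
  have ct : clamp t = t by rewrite clamp_id //; apply/andP; split; lra.
  have h1 : la s <= la r by apply: lam; rewrite cs cr.
  have h2 : la r <= la t by apply: lam; rewrite cr ct.
  have [Ks _ _] := laP s; have [Kr _ _] := laP r; have [Kt _ _] := laP t.
  have [e1|n1] := eqVneq (la r) (la s); first by rewrite /F e1.
  have [e2|n2] := eqVneq (la r) (la t); first by rewrite e /F e2.
  have l1 : la s < la r by rewrite lt_neqAle eq_sym n1.
  have l2 : la r < la t by rewrite lt_neqAle n2.
  by case: (gapE (la s) (la t) Ks Kt (lt_trans l1 l2) e (la r)).
Qed.

End Monotone.

Lemma uniformly_continuous (F : R -> X) e : continuous F -> 0 < e ->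
  exists2 h, 0 < h & forall s t, 0 <= s <= 1 -> `|t - s| < h -> d (F s) (F t) < e.
Proof.
move=> Fc e0; have e2 : 0 < e / 2 by lra.
have near : forall x : R, `[0, 1]%classic x -> \forall x' \near x & h \near (0 : R)^'+,
    forall y, `|y - x'| < h -> d (F x') (F y) < e.
  move=> x _; have [r r0 rP] := continuous_d dm x Fc e2; have r2 : 0 < r / 2 by lra.
  exists (ball x (r / 2), [set h | h < r / 2]).
    by split; [exact: nbhsx_ballx | exact: nbhs_right_lt].
  move=> [x' h] [/= xx' hr] y yx'; rewrite /ball /= distrC in xx'.
  have h1 : d (F x) (F x') < e / 2 by apply: rP; lra.
  have h2 : d (F x) (F y) < e / 2.
    apply: rP; have := ler_normD (y - x') (x' - x); rewrite addrA subrK; lra.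
  have := d_tri dm (F x) (F x') (F y); rewrite (d_sym dm (F x') (F x)); lra.
have hn := (compact_near_coveringP (`[0, 1]%classic : set R)).1 (@segment_compact R 0 1) R (0^'+)
  (fun h x => forall y, `|y - x| < h -> d (F x) (F y) < e) _ near.
have [h [h0 hP]] := filter_ex (filterI (nbhs_right_gt (0 : R)) (hn _)).
by exists h => // s t s01; apply: hP; rewrite /= in_itv.
Qed.

Lemma maxmin_dist (q x s t : R) :
  `|Num.max q (Num.min x s) - Num.max q (Num.min x t)| <= `|s - t|.
Proof.
have n1 := ler_norm (s - t); have n2 := ler_norm (t - s); rewrite distrC in n2.
have n3 := normr_ge0 (s - t).
case: (leP x s) => c1; case: (leP x t) => c2; rewrite ?subrr ?normr0 // ler_norml.
- by case: (leP q x) => c3; case: (leP q t) => c4; apply/andP; split; lra.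
- by case: (leP q s) => c3; case: (leP q x) => c4; apply/andP; split; lra.
- by case: (leP q s) => c3; case: (leP q t) => c4; apply/andP; split; lra.
Qed.

(** For [t] beyond [q], [M t] is the supremum of [r] between [q] and [t]. Clamping lets the supremum
    range over all reals, an index set that does not vary with [t]. *)
Lemma running_max (r : R -> R) q : (forall t, 0 <= r t <= 1) ->
  (forall e, 0 < e -> exists2 h, 0 < h & forall s t, `|s - t| < h -> `|r s - r t| < e) ->
  exists M : R -> R, [/\ continuous M, forall t, 0 <= M t <= 1, forall s t, s <= t -> M s <= M t,
    forall t, t <= q -> M t = r q &
    (forall t, q <= t -> r t <= M t) /\
    forall t c, (forall s, r (Num.max q (Num.min s t)) <= c) -> M t <= c].
Proof.
move=> r01 ru; pose S t := [set r (Num.max q (Num.min s t)) | s in setT].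
have S0 t : S t !=set0 by exists (r (Num.max q (Num.min 0 t))), 0.
have Ss t : has_sup (S t).
  by split=> //; exists 1 => _ [s _ <-]; have /andP[] := r01 (Num.max q (Num.min s t)).
have ge t s : r (Num.max q (Num.min s t)) <= sup (S t) by apply: sup_upper_bound => //; exists s.
have le t c : (forall s, r (Num.max q (Num.min s t)) <= c) -> sup (S t) <= c.
  by move=> h; apply: ge_sup => // _ [s _ <-].
exists (fun t => sup (S t)); split=> [||||].
- apply: real_continuous => t e e0; have [|h h0 hP] := ru (e / 2); first by lra.
  have key s t' : `|s - t'| < h -> sup (S s) <= sup (S t') + e / 2.
    move=> st; apply: le => x; have := ge t' x.
    have : `|r (Num.max q (Num.min x s)) - r (Num.max q (Num.min x t'))| < e / 2.
      by apply: hP; apply: le_lt_trans st; exact: maxmin_dist.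
    rewrite ltr_norml => /andP[? ?]; lra.
  exists h => // s st; have := key s t st; have := key t s; rewrite distrC => /(_ st).
  by rewrite ltr_norml => k1 k2; apply/andP; split; lra.
- move=> t; apply/andP; split; first by apply: (le_trans _ (ge t 0)); have /andP[] := r01 (Num.max q (Num.min 0 t)).
  by apply: le => s; have /andP[] := r01 (Num.max q (Num.min s t)).
- move=> s t st; apply: le => x; have := ge t (Num.min x s).
  by rewrite -minA (min_idPl st).
- move=> t tq; apply/eqP; rewrite eq_le; apply/andP; split.
    by apply: le => s; rewrite (max_idPl _) // ge_min tq orbT.
  by have := ge t t; rewrite minxx (max_idPl tq).
- split=> [t qt|t c]; last exact: le.
  by have := ge t t; rewrite minxx (max_idPr qt).
Qed.

(* Reparametrizing a monotone path by a function that is constant exactly on its fibres. *)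
Lemma path_arc (f : R -> X) : continuous f -> f 0 <> f 1 -> exists al : R -> X,
  [/\ continuous al, al 0 = f 0, al 1 = f 1,
   forall s t, 0 <= s <= 1 -> 0 <= t <= 1 -> al s = al t -> s = t &
   forall t, exists2 s, 0 <= s <= 1 & al t = f s].
Proof.
move=> fc f01; have [F0 [F0c F00 F01 F0r F0m]] := monotone_path fc.
pose F t := F0 (clamp t).
have Fc : continuous F by exact: clamp_comp.
have Fu e : 0 < e -> exists2 h, 0 < h & forall s t, `|s - t| < h -> d (F s) (F t) < e.
  move=> e0; have [h h0 hP] := uniformly_continuous F0c e0; exists h => // s t st.
  apply: hP; first exact: clamp_itv.
  by apply: le_lt_trans st; rewrite (distrC s); exact: clamp_dist.
have Fm s r t : s <= r -> r <= t -> F s = F t -> F r = F s.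
  move=> sr rt; apply: F0m; try exact: clamp_le.
  - by have /andP[] := clamp_itv s.
  - by have /andP[] := clamp_itv t.
pose qs n : R := if (unpickle n : option rat) is Some r then ratr r else 0.
pose rho n t := Num.min 1 (d (F (qs n)) (F t)).
have rho01 n t : 0 <= rho n t <= 1 by rewrite /rho le_min ler01 (d_ge0 dm) ge_min lexx.
have rhou n e : 0 < e -> exists2 h, 0 < h & forall s t, `|s - t| < h -> `|rho n s - rho n t| < e.
  move=> e0; have [h h0 hP] := Fu e e0; exists h => // s t /hP st.
  have := d_tri dm (F s) (F (qs n)) (F t); have := d_tri dm (F t) (F (qs n)) (F s).
  rewrite (d_sym dm (F t) (F s)) /rho => h1 h2; rewrite ltr_norml.
  by case: (leP 1 _) => c1; case: (leP 1 _) => c2; apply/andP; split; lra.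
(* The running maximum of the truncated distance to [F q], [q] rational, stalls while [F] is
   constant. For [q] just after [s], where [F] is still close to [F s], it separates [s] from any
   later [t] with a different value. *)
have /choice[M MP] n := @running_max (rho n) (qs n) (rho01 n) (rhou n).
have [|||h [hc hm heq hlt]] := @weighted_sum R M.
- by move=> n t; have [_ h _ _ _] := MP n; exact: h.
- by move=> n; have [h _ _ _ _] := MP n.
- by move=> n s t st; have [_ _ h _ _] := MP n; exact: h.
have hF s t : s <= t -> F s = F t -> h s = h t.
  move=> st e; apply: heq => n; have [_ M01 Mm Mq [Mge Mle]] := MP n.
  apply/eqP; rewrite eq_le Mm //=; apply: Mle => x; set y := Num.max _ _.
  have Ms0 : 0 <= M n s by have /andP[] := M01 s.
  have rho0 z : F z = F (qs n) -> rho n z = 0 by move=> ez; rewrite /rho ez (d_xx dm) (min_idPr ler01).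
  have rhoE z z' : F z = F z' -> rho n z = rho n z' by move=> ez; rewrite /rho ez.
  have [yq|qy] := leP y (qs n).
    by rewrite (_ : y = qs n) ?rho0 //; apply/eqP; rewrite eq_le yq le_max lexx.
  have ye : y = Num.min x t by move: qy; rewrite /y; case: (leP (qs n)) => //; rewrite ltxx.
  have yt : y <= t by rewrite ye ge_min lexx orbT.
  have [ys|sy] := leP y s.
    by apply: le_trans (Mm _ _ ys); apply: Mge; exact: ltW.
  have eys : F y = F s by apply: (Fm s y t) => //; exact: ltW.
  have [sq|qs'] := ltP s (qs n).
    by rewrite rho0 // eys; apply/esym; apply: (Fm s (qs n) t) => //; [exact: ltW | exact: le_trans (ltW qy) yt].
  by rewrite (rhoE y s) //; exact: Mge.
have hFlt s t : s < t -> F s <> F t -> h s < h t.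
  move=> st nF; have dpos : 0 < d (F s) (F t).
    by rewrite lt_neqAle (d_ge0 dm) andbT eq_sym; apply/eqP => /(d_eq dm).
  have [r r0 rP] := continuous_d dm s Fc dpos.
  have [|q qi] := @rat_in_itvoo R s (Num.min (s + r) t); first by rewrite lt_min st andbT; lra.
  move: qi; rewrite in_itv /= lt_min => /andP[sq /andP[qr qt]].
  have qE : qs (pickle q) = ratr q by rewrite /qs pickleK.
  have [_ M01 Mm Mq [Mge Mle]] := MP (pickle q).
  apply: (hlt s t (pickle q)); first exact: ltW.
  rewrite (Mq s); last by rewrite qE ltW.
  have -> : rho (pickle q) (qs (pickle q)) = 0 by rewrite /rho (d_xx dm) (min_idPr ler01).
  apply: (lt_le_trans _ (Mge t _)); last by rewrite qE ltW.
  rewrite /rho lt_min ltr01 lt_neqAle (d_ge0 dm) andbT eq_sym qE /=; apply/eqP => /(d_eq dm) eqt.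
  by have := rP (ratr q); rewrite ltr_norml eqt ltxx => /(_ ltac:(apply/andP; split; lra)).
have hFE s t : h s = h t -> F s = F t.
  move=> e; apply/eqP; apply/negPn/negP => /eqP n; case: (ltrgtP s t) => st.
  - by have := hFlt s t st n; rewrite e ltxx.
  - by have := hFlt t s st (nesym n); rewrite e ltxx.
  - by apply: n; rewrite st.
have F0E : F 0 = f 0 by rewrite /F clamp_id ?lexx ?ler01.
have F1E : F 1 = f 1 by rewrite /F clamp_id ?lexx ?ler01.
have h01 : h 0 < h 1 by apply: hFlt; [exact: ltr01 | rewrite F0E F1E].
have /choice[k kP] y : exists x, forall t, h t = y -> F t = x.
  have [[t ty]|n] := pselect (exists t, h t = y); last by exists (F 0) => t ty; case: n; exists t.
  by exists (F t) => t' t'y; apply: hFE; rewrite ty.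
have kh t : k (h t) = F t by apply/esym; exact: kP.
have kc : {within h @` `[0, 1]%classic, continuous k}.
  by apply: (compact_factor (h := F)) => //; exact: segment_compact.
pose g (s : R) := (h 1 - h 0) * clamp s + h 0.
have gc : continuous g.
  exact: (clamp_comp (@affine_continuous R (h 1 - h 0) (h 0))).
have gB s : (h @` `[0, 1]%classic) (g s).
  have /andP[s0 s1] := clamp_itv s.
  have p1 : 0 <= (h 1 - h 0) * clamp s by apply: mulr_ge0 => //; lra.
  have p2 : (h 1 - h 0) * clamp s <= h 1 - h 0 by rewrite ger_pMr // subr_gt0.
  have [|||c c01 cE] := @IVT R h 0 1 (g s).
  - exact: ler01.
  - exact: continuous_subspaceT.
  - rewrite (min_idPl (ltW h01)) (max_idPr (ltW h01)) /g; apply/andP; split; lra.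
  by exists c.
exists (fun s => k (g s)); split.
- exact: within_comp kc gc gB.
- by rewrite /g clamp_id ?lexx ?ler01 // mulr0 add0r kh.
- by rewrite /g clamp_id ?lexx ?ler01 // mulr1 subrK kh.
- move=> s t s01 t01; have [u _ uE] := gB s; have [v _ vE] := gB t.
  rewrite -uE -vE !kh => e; have : g s = g t.
    by rewrite -uE -vE; case: (leP u v) => uv; [exact: hF | apply/esym; apply: hF => //; exact: ltW].
  rewrite /g !clamp_id // => /addIr/mulfI; apply.
  by rewrite subr_eq0 gt_eqF.
- move=> t; have [u _ <-] := gB t; rewrite kh /F; exact: F0r.
Qed.

End Arcs.

(** Both images are the quotient of one compact set by the same relation. *)
Lemma same_fibres_homeo (S Y Z : topologicalType) (K : set S) (F : S -> Y) (h : S -> Z) :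
  hausdorff_space Y -> hausdorff_space Z -> compact K -> K !=set0 -> continuous F -> continuous h ->
  (forall s t, K s -> K t -> (F s = F t <-> h s = h t)) -> homeomorphic (F @` K) (h @` K).
Proof.
move=> hY hZ Kc [t0 Kt0] Fc hc fib.
have /choice[f fP] y : exists z, forall t, K t -> F t = y -> h t = z.
  have [[t [Kt ty]]|n] := pselect (exists t, K t /\ F t = y); last first.
    by exists (h t0) => t Kt ty; case: n; exists t.
  by exists (h t) => s Ks sy; apply/fib => //; rewrite ty.
have /choice[g gP] z : exists y, forall t, K t -> h t = z -> F t = y.
  have [[t [Kt tz]]|n] := pselect (exists t, K t /\ h t = z); last first.
    by exists (F t0) => t Kt ty; case: n; exists t.
  by exists (F t) => s Ks sz; apply/fib => //; rewrite tz.
have fF t : K t -> f (F t) = h t by move=> Kt; apply/esym; exact: fP.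
have gh t : K t -> g (h t) = F t by move=> Kt; apply/esym; exact: gP.
exists f, g; split.
- by split=> _ [t Kt <-]; [rewrite fF //; exists t | rewrite gh //; exists t].
- exact: compact_factor hY Kc Fc hc fF.
- exact: compact_factor hZ Kc hc Fc gh.
- by move=> _ [t Kt <-]; rewrite fF // gh.
- by move=> _ [t Kt <-]; rewrite gh // fF.
Qed.

(** * Simple closed curves from pairs of arcs *)

Section Circle.
Variable R : realType.

(* [circle_param] runs once around the circle as [t] goes from [-1] to [1]; [sroot] is the
   signed square root of [|t|]. *)
Definition sroot (t : R) := Num.sqrt t - Num.sqrt (- t).
Definition circle_param (t : R) : R * R := (1 - 2 * `|t|, 2 * sroot t * Num.sqrt (1 - `|t|)).

Lemma sroot_sq t : sroot t ^+ 2 = `|t|.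
Proof.
rewrite /sroot; case: (lerP 0 t) => t0.
  by rewrite (ler0_sqrtr (a := - t)) ?subr0 ?sqr_sqrtr ?ger0_norm // oppr_le0.
rewrite (ler0_sqrtr (a := t)) ?(ltW t0) // sub0r sqrrN sqr_sqrtr ?ltr0_norm //; lra.
Qed.

Lemma srootN t : sroot (- t) = - sroot t.
Proof. by rewrite /sroot opprK opprB. Qed.

Lemma cont_comp (S Y Z : topologicalType) (f : S -> Y) (g : Y -> Z) :
  continuous f -> continuous g -> continuous (fun x => g (f x)).
Proof. by move=> fc gc x; exact: (continuous_comp (fc x) (gc _)). Qed.

Lemma sroot_continuous : continuous sroot.
Proof.
have sc : continuous (@Num.sqrt R) := @sqrt_continuous R.
have -> : sroot = (fun t => Num.sqrt t - Num.sqrt (- 1 * t + 0)).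
  by apply/funext => t; rewrite /sroot mulN1r addr0.
have h : continuous (fun t : R => Num.sqrt (- 1 * t + 0)) by exact: (cont_comp (@affine_continuous R _ _) sc).
by move=> t; apply: cvgB; [exact: sc | exact: h].
Qed.

Lemma circle_param_continuous : continuous circle_param.
Proof.
have sc : continuous (@Num.sqrt R) := @sqrt_continuous R.
have nc : continuous (fun t : R => `|t|) := @norm_continuous R R.
have c1 (a b : R) : continuous (fun t : R => a * `|t| + b) by exact: (cont_comp nc (@affine_continuous R a b)).
have h1 : continuous (fun t : R => 1 - 2 * `|t|).
  by have -> : (fun t : R => 1 - 2 * `|t|) = (fun t => - 2 * `|t| + 1); [apply/funext => t; lra | exact: c1].
have h3 : continuous (fun t : R => Num.sqrt (- 1 * `|t| + 1)) by exact: (cont_comp (c1 _ _) sc).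
have h2 : continuous (fun t : R => 2 * sroot t * Num.sqrt (1 - `|t|)).
  have -> : (fun t : R => 2 * sroot t * Num.sqrt (1 - `|t|)) =
      (fun t => (2 * sroot t) * Num.sqrt (- 1 * `|t| + 1)).
    by apply/funext => t; congr (_ * Num.sqrt _); lra.
  by move=> t; apply: cvgM; [apply: cvgMr; exact: sroot_continuous | exact: h3].
move=> t; exact: (cvg_pair (h1 t) (h2 t)).
Qed.

Lemma circle_paramE : circle_param @` [set t | -1 <= t <= 1] = @circle R.
Proof.
apply/seteqP; split=> [_ [t /= /andP[t1 t2] <-]|[x y] /= xy].
  have n1 : `|t| <= 1 by rewrite ler_norml t1.
  rewrite /circle /circle_param /= !exprMn sroot_sq sqr_sqrtr ?subr_ge0 //.
  by rewrite !expr2; set n := `|t|; nra.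
rewrite /circle /= in xy.
have x1 : x ^+ 2 <= 1 by rewrite -xy lerDl sqr_ge0.
have /andP[xl xu] : -1 <= x <= 1 by rewrite -ler_norml -(expr1n _ 2) -ler_sqr ?nnegrE // -?normrX ?expr1n // ger0_norm ?sqr_ge0.
pose s := (1 - x) / 2.
have s0 : 0 <= s by rewrite /s; lra.
have s1 : s <= 1 by rewrite /s; lra.
have ys : (2 * Num.sqrt s * Num.sqrt (1 - s)) ^+ 2 = y ^+ 2.
  rewrite !exprMn !sqr_sqrtr ?subr_ge0 //; rewrite /s; move: xy; rewrite !expr2; nra.
have srs : sroot s = Num.sqrt s by rewrite /sroot (ler0_sqrtr (a := - s)) ?subr0 // oppr_le0.
have yabs : `|y| = 2 * Num.sqrt s * Num.sqrt (1 - s).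
  have p0 : 0 <= 2 * Num.sqrt s * Num.sqrt (1 - s) by rewrite !mulr_ge0 ?sqrtr_ge0.
  by apply/eqP; rewrite -(eqrXn2 (n := 2)) // real_normK ?num_real // ys.
have [y0|y0] := lerP 0 y.
  exists s; first by apply/andP; split; lra.
  rewrite /circle_param (ger0_norm s0) srs -yabs ger0_norm // /s; congr pair; lra.
exists (- s); first by apply/andP; split; lra.
rewrite /circle_param normrN (ger0_norm s0) srootN srs mulrN mulNr -yabs ltr0_norm // opprK /s.
by congr pair; lra.
Qed.

Lemma circle_param_inj s t : -1 <= s <= 1 -> -1 <= t <= 1 ->
  (circle_param s = circle_param t <-> s = t \/ `|s| = 1 /\ `|t| = 1).
Proof.
move=> s1 t1; split=> [[e1 e2]|[->//|[es et]]]; last first.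
  by rewrite /circle_param es et subrr sqrtr0 !mulr0.
have est : `|s| = `|t| by lra.
have /orP[/eqP|/eqP e] : (s == t) || (s == - t) by rewrite -eqr_norm2 est eqxx.
  by left.
have /eqP : 2 * (sroot t * Num.sqrt (1 - `|t|)) = 0.
  by move: e2; rewrite est e srootN; lra.
have nt : `|t| <= 1 by rewrite ler_norml.
rewrite mulf_eq0 pnatr_eq0 /= mulf_eq0 sqrtr_eq0 subr_le0 => /orP[/eqP h|h].
  left; have := sroot_sq t; rewrite h expr0n /= => /esym/eqP; rewrite normr_eq0 => /eqP t0.
  by rewrite e t0 oppr0.
by right; rewrite est; split; apply/eqP; rewrite eq_le nt.
Qed.
End Circle.

Section Curves.
Variables (R : realType) (X : topologicalType) (d : X -> X -> R).
Hypothesis dm : metric_on d.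
Let hX := d_hausdorff dm.

Definition inj_arc (al : R -> X) := continuous al /\
  forall s t, 0 <= s <= 1 -> 0 <= t <= 1 -> al s = al t -> s = t.

Definition arc_set (al : R -> X) : set X := al @` [set t | 0 <= t <= 1].

Lemma unit_compact : compact [set t : R | 0 <= t <= 1].
Proof. by have := @segment_compact R 0 1; rewrite set_itvE. Qed.

Lemma arc_set_compact al : continuous al -> compact (arc_set al).
Proof. by move=> ac; apply: continuous_compact unit_compact; exact: continuous_subspaceT. Qed.

Lemma arc_set_connected al : continuous al -> connected (arc_set al).
Proof.
move=> ac; apply: connected_continuous_connected; last exact: continuous_subspaceT.
by have := @segment_connected R 0 1; rewrite set_itvE.
Qed.

Lemma inj_arc_arc al : inj_arc al -> arc R (al 0) (al 1) (arc_set al).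
Proof.
move=> [ac ai].
have /choice[g gP] x : exists t, arc_set al x -> 0 <= t <= 1 /\ al t = x.
  have [[t t01 tx]|n] := pselect (arc_set al x); first by exists t.
  by exists 0 => /n.
have ga t : 0 <= t <= 1 -> g (al t) = t.
  by move=> t01; have [|g01 e] := gP (al t); [exists t | exact: ai].
exists al, g; split=> //; split.
- split=> x; first by rewrite /= in_itv /= => xi; exists x.
  by move=> /gP[x01 _]; rewrite /= in_itv.
- exact: continuous_subspaceT.
- apply: (compact_factor hX unit_compact ac (h := id)); first by move=> t; exact: cvg_id.
  exact: ga.
- by move=> t; rewrite /= in_itv /=; exact: ga.
- by move=> x /gP[].
Qed.

(** Running back along [b] on [-1, 0] and out along [a] on [0, 1] identifies only the times -1 and
    1, exactly as [circle_param] does. *)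
Lemma circle_curve (a b : R -> X) : inj_arc a -> inj_arc b -> a 0 = b 0 -> a 1 = b 1 ->
  (forall s t, 0 <= s <= 1 -> 0 <= t <= 1 -> a s = b t -> s = t /\ (s = 0 \/ s = 1)) ->
  exists C : set X, simple_closed_curve R C.
Proof.
move=> [ac ai] [bc bi] ab0 ab1 ab.
pose h (t : R) := if t <= 0 then b (-1 * t + 0) else a (1 * t + 0).
have hc : continuous h.
  apply: (glue_continuous dm); [exact: affine_comp | exact: affine_comp |].
  by rewrite !mulr0 !addr0 ab0.
have hneg t : t <= 0 -> h t = b `|t| by move=> t0; rewrite /h t0 addr0 mulN1r ler0_norm.
have hpos t : 0 <= t -> h t = a `|t|.
  move=> t0; rewrite /h; case: ifP => t0'; last by rewrite addr0 mul1r ger0_norm.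
  have -> : t = 0 by apply/eqP; rewrite eq_le t0 t0'.
  by rewrite mulr0 addr0 normr0 ab0.
exists (h @` [set t | -1 <= t <= 1]); rewrite /simple_closed_curve -circle_paramE.
apply: same_fibres_homeo => //.
- by have := @segment_compact R (-1) 1; rewrite set_itvE.
- by exists 0 => /=; apply/andP; split; lra.
- exact: circle_param_continuous.
move=> s t /= s1 t1; rewrite circle_param_inj //.
have ns : 0 <= `|s| <= 1 by rewrite normr_ge0 ler_norml.
have nt : 0 <= `|t| <= 1 by rewrite normr_ge0 ler_norml.
split.
  move=> [->//|[es et]].
  have h1 x : `|x| = 1 -> h x = a 1.
    by move=> ex; case: (leP x 0) => x0; [rewrite hneg // ex ab1 | rewrite hpos ?ex // ltW].
  by rewrite !h1.
case: (leP s 0) => s0; case: (leP t 0) => t0.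
- by rewrite !hneg // => /(bi _ _ ns nt); rewrite !ler0_norm // => /oppr_inj ->; left.
- rewrite hneg // hpos ?ltW // => /esym /(ab _ _ nt ns)[e [e0|e1]]; last by right; rewrite -e e1.
  by move: e0 => /eqP; rewrite normr_eq0 => /eqP e0; rewrite e0 ltxx in t0.
- rewrite hpos ?ltW // hneg // => /(ab _ _ ns nt)[e [e0|e1]]; last by right; rewrite -e e1.
  by move: e0 => /eqP; rewrite normr_eq0 => /eqP e0; rewrite e0 ltxx in s0.
- rewrite !hpos ?ltW // => /(ai _ _ ns nt); rewrite !gtr0_norm // => ->; by left.
Qed.

Lemma sub_arc (al : R -> X) u v : inj_arc al -> 0 <= u <= 1 -> 0 <= v <= 1 -> u != v ->
  inj_arc (fun t => al ((v - u) * t + u)) /\ forall t, 0 <= t <= 1 -> 0 <= (v - u) * t + u <= 1.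
Proof.
move=> [ac ai] /andP[u0 u1] /andP[v0 v1] uv.
have rng t : 0 <= t <= 1 -> 0 <= (v - u) * t + u <= 1.
  move=> /andP[t0 t1]; have -> : (v - u) * t + u = v * t + u * (1 - t) by lra.
  by apply/andP; split; nra.
split=> //; split; first exact: affine_comp.
move=> s t s01 t01 /(ai _ _ (rng s s01) (rng t t01)) /addIr /mulfI; apply.
by rewrite subr_eq0 eq_sym.
Qed.

(** Around [c] take the largest open interval on which [al] avoids [be]. The piece of [al] over it
    and the piece of [be] between its ends meet only at these ends. *)
Lemma two_arcs (al be : R -> X) c : inj_arc al -> inj_arc be -> al 0 = be 0 -> al 1 = be 1 ->
  0 <= c <= 1 -> ~ arc_set be (al c) -> exists C : set X, simple_closed_curve R C.
Proof.
move=> ia ib ab0 ab1 /andP[c0 c1] nc; have [ac ai] := ia; have [bc bi] := ib.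
have cB : closed (al @^-1` arc_set be).
  apply: closed_comp; first by move=> t _; exact: ac.
  by apply: (compact_closed hX); exact: arc_set_compact.
have cmp x y : compact ([set t | x <= t <= y] `&` al @^-1` arc_set be).
  apply: compact_closedI => //; by have := @segment_compact R x y; rewrite set_itvE.
have [|u [/= /andP[u0 uc] [p p01 pu]] uP] := compact_max (cmp 0 c).
  by exists 0; split; [rewrite /= lexx | exists 0; rewrite /= ?lexx ?ler01].
have [|v [/= /andP[cv v1] [q q01 qv]] vP] := compact_min (cmp c 1).
  by exists 1; split; [rewrite /= lexx c1 | exists 1; rewrite /= ?lexx ?ler01].
have uc' : u < c by rewrite lt_neqAle uc andbT; apply/eqP => e; apply: nc; rewrite -e; exists p.
have cv' : c < v by rewrite lt_neqAle cv andbT; apply/eqP => e; apply: nc; rewrite e; exists q.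
have u01 : 0 <= u <= 1 by apply/andP; split; lra.
have v01 : 0 <= v <= 1 by apply/andP; split; lra.
have uv : u != v by rewrite lt_eqF //; lra.
have pq : p != q.
  apply/eqP => e; case/eqP: uv; apply: ai => //; by rewrite -pu -qv e.
have [ia' ra] := sub_arc ia u01 v01 uv; have [ib' rb] := sub_arc ib p01 q01 pq.
apply: (circle_curve ia' ib'); rewrite ?mulr0 ?mulr1 ?add0r ?subrK //.
move=> s t s01 t01 e.
have /andP[s0 s1] := s01.
have Bs : arc_set be (al ((v - u) * s + u)) by exists ((q - p) * t + p); rewrite ?e //; exact: rb.
have sx : (v - u) * s + u <= u \/ v <= (v - u) * s + u.
  case: (leP ((v - u) * s + u) c) => h.
    by left; apply: uP; split=> //=; have /andP[-> _] := ra s s01.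
  by right; apply: vP; split=> //=; have /andP[_ ->] := ra s s01; rewrite andbT ltW.
have vu : 0 < v - u by lra.
have bij x y : 0 <= x <= 1 -> 0 <= y <= 1 -> be ((q - p) * x + p) = be ((q - p) * y + p) -> x = y.
  by have [_ h] := ib'; exact: h.
have [s0'|s1'] : s = 0 \/ s = 1 by case: sx => h; [left | right]; nra.
  split; last by left.
  rewrite s0'; apply: bij; rewrite ?lexx ?ler01 // -e s0' !mulr0 !add0r.
  by rewrite pu.
split; last by right.
rewrite s1'; apply: bij; rewrite ?lexx ?ler01 // -e s1' !mulr1 !subrK.
by rewrite qv.
Qed.

End Curves.

(** * Separation by points as a betweenness relation *)

Section Separation.
Variable X : topologicalType.
Implicit Types t x y z s : X.

(* The negation of [same t x y] says that [t] lies on the arc from [x] to [y], endpoints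
   included, because the component of [x] is empty when [x = t]. *)
Definition same t x y := connected_component (~` [set t]) x y.

Lemma same_refl t x : x <> t -> same t x x.
Proof. exact: connected_component_refl. Qed.

Lemma same_sym t x y : same t x y -> same t y x.
Proof. exact: connected_component_sym. Qed.

Lemma same_trans t y x z : same t x y -> same t y z -> same t x z.
Proof. exact: connected_component_trans. Qed.

Lemma same_ner t x y : same t x y -> y <> t.
Proof. exact: connected_component_sub. Qed.

Lemma same_nel t x y : same t x y -> x <> t.
Proof. by move/same_sym/same_ner. Qed.

Lemma same_conn (K : set X) t x y : connected K -> ~ K t -> K x -> K y -> same t x y.
Proof.
move=> Kc Kt Kx Ky; apply: (connected_component_max Kx _ Kc Ky) => z Kz zt.
by apply: Kt; rewrite -zt.
Qed.

Hypotheses (hX : hausdorff_space X) (lc : locally_connected X) (Xk : connected [set: X]).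

Lemma neq_open t : open (~` [set t]).
Proof. by rewrite openC; exact: accessible_closed_set1 (hausdorff_accessible hX) t. Qed.

Lemma same_open t x : open (same t x).
Proof.
rewrite openE => y xy; have yt := same_ner xy.
have [|V [oV Vy Vc Vt]] := lc (x := y) (U := ~` [set t]).
  by apply: open_nbhs_nbhs; split; [exact: neq_open | exact: yt].
apply: (filterS _ (open_nbhs_nbhs (conj oV Vy))) => z Vz.
by apply: (same_trans xy); apply: (same_conn Vc) => // /Vt; apply.
Qed.

Definition cell t x := same t x `|` [set t].

Lemma cell_closed t x : closed (cell t x).
Proof.
have -> : cell t x = ~` \bigcup_(y in [set y | y <> t /\ ~ same t x y]) same t y.
  apply/seteqP; split=> [z [xz|->] [y /= [yt nxy] yz]|z nz].
  - by apply: nxy; apply: (same_trans xz); exact: same_sym.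
  - by have := same_ner yz.
  have [->|zt] := pselect (z = t); first by right.
  left; apply: contrapT => nxz; apply: nz; exists z => //=; exact: same_refl.
by rewrite closedC; apply: bigcup_open => y _; exact: same_open.
Qed.

(** The point [t] is in the closure of the component, which would otherwise be open and closed in a
    connected space. *)
Lemma cell_connected t x : x <> t -> connected (cell t x).
Proof.
move=> xt; have -> : cell t x = closure (same t x).
  apply/seteqP; split=> [y [xy|->]|]; first exact: subset_closure.
    apply: contrapT => nt.
    have cS : closed (same t x).
      move=> z zc; have [//|zt] : cell t x z.
        by apply: (@cell_closed t x); apply: closure_subset zc => w; left.
      by case: nt; move: zc; rewrite zt.
    have e : same t x = [set: X].
      apply: Xk; first by exists x; exact: same_refl.
        by exists (same t x); rewrite ?setTI //; exact: same_open.
      by exists (same t x); rewrite ?setTI.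
    by have : same t x t by [rewrite e]; move/same_ner.
  move=> y yc; apply: (@cell_closed t x); apply: closure_subset yc => w; by left.
by apply: connected_closure; exact: component_connected.
Qed.

(** The closed cell of [x] at [t] is connected, contains [x] and [t], and misses [s]. Most axioms of
    betweenness below rest on this exchange. *)
Lemma same_swap x t s : x <> t -> s <> t -> ~ same t x s -> same s x t.
Proof.
move=> xt st nxs; apply: (same_conn (cell_connected xt)); [| left; exact: same_refl | by right].
by case.
Qed.

Lemma btw_trans o x y z : ~ same x o y -> ~ same y o z -> ~ same x o z.
Proof.
move=> xy yz xz; have ox := same_nel xz; have zx := same_ner xz.
have [e|yx] := pselect (y = x); first by rewrite e in yz.
have h1 := same_swap ox yx xy.
have h2 : same y z x by apply: same_swap => // h; apply: xy; exact: same_trans h.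
by apply: yz; apply: (same_trans h1); exact: same_sym.
Qed.

Lemma btw_anti o x y : ~ same x o y -> ~ same y o x -> x = y.
Proof.
move=> xy yx; apply: contrapT => ne.
have [e|ox] := pselect (o = x); first by apply: yx; rewrite e; exact: same_refl.
by apply: yx; apply: same_swap => // e; apply: ne.
Qed.

Lemma btw_tree o x y z : ~ same x o z -> ~ same y o z -> ~ same x o y \/ ~ same y o x.
Proof.
move=> xz yz; have [xy|] := pselect (same x o y); last by left.
right=> yx; have [e|zx] := pselect (z = x); first by apply: yz; rewrite e.
have h : same y z x.
  apply: same_swap => //; first exact: same_ner xy.
  by move=> h; apply: xz; apply: (same_trans xy); exact: same_sym.
by apply: yz; apply: (same_trans yx); exact: same_sym.
Qed.

Lemma btw_split o a b x : ~ same x a b -> ~ same x o a \/ ~ same x o b.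
Proof.
move=> nab; have [oa|] := pselect (same x o a); last by left.
by right=> ob; apply: nab; apply: same_trans ob; exact: same_sym.
Qed.

Definition median a b c m := [/\ ~ same m c a, ~ same m c b & ~ same m a b].

(** With [o] as root, betweenness from [o] is an order; this makes the median of [a], [b] and [o]
    the meet of [a] and [b]. *)
Lemma median_meet o a b p z : median a b o p -> ~ same z o a -> ~ same z o b -> ~ same z o p.
Proof.
move=> [poa pob pab] zoa zob zop; have oz := same_nel zop; have pz := same_ner zop.
have zpa : ~ same z p a by move=> h; apply: zoa; exact: same_trans h.
have zpb : ~ same z p b by move=> h; apply: zob; exact: same_trans h.
have [e|az] := pselect (a = z); have [e'|bz] := pselect (b = z).
- by apply: pab; rewrite e e'; apply: same_refl => /esym.
- apply: pab; rewrite e; apply: same_sym; apply: same_swap => // h; apply: zpb; exact: same_sym.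
- apply: pab; rewrite e'; apply: same_swap => // h; apply: zpa; exact: same_sym.
- have h1 : same p a z by apply: same_swap => // h; apply: zpa; exact: same_sym.
  have h2 : same p b z by apply: same_swap => // h; apply: zpb; exact: same_sym.
  by apply: pab; apply: (same_trans h1); exact: same_sym.
Qed.

Lemma median_uniq a b c m m' : median a b c m -> median a b c m' -> m = m'.
Proof.
move=> h h'; apply: (btw_anti (o := c)).
  by case: h => h1 h2 _; exact: median_meet h' h1 h2.
by case: h' => h1 h2 _; exact: median_meet h h1 h2.
Qed.

(** The arc from [a] to [b] consists of the points above the meet [m] on one of the two branches.
    Hence the order rooted at [o] determines the whole betweenness. *)
Lemma btw_median o a b m x : median a b o m ->
  (~ same x a b <-> ~ same m o x /\ (~ same x o a \/ ~ same x o b)).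
Proof.
move=> [moa mob mab]; split=> [xab|[mox xoab] xab].
  split; last exact: btw_split.
  move=> mox; have xm := same_ner mox.
  have mxa : ~ same m x a by move=> h; apply: moa; exact: same_trans h.
  have mxb : ~ same m x b by move=> h; apply: mob; exact: same_trans h.
  have h c : ~ same m x c -> same x c m \/ c = m.
    move=> nc; have [e|cm] := pselect (c = m); first by right.
    by left; apply: same_swap => // h; apply: nc; exact: same_sym.
  case: (h a mxa) => [ha|e]; case: (h b mxb) => [hb|e'].
  - by apply: xab; apply: (same_trans ha); exact: same_sym.
  - by apply: xab; rewrite e'.
  - by apply: xab; rewrite e; exact: same_sym.
  - by apply: xab; rewrite e e'; apply: same_refl => /esym.
have ax := same_nel xab; have bx := same_ner xab.
have [xoa xob] : ~ same x o a /\ ~ same x o b.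
  by case: xoab => h; split=> // h'; apply: h; apply: (same_trans h'); first exact: same_sym.
have [e|mx] := pselect (m = x); first by rewrite e in mab.
have h : ~ same x m a /\ ~ same x m b.
  have [e|om] := pselect (o = m); first by rewrite -e.
  have xom : same x o m by apply: same_swap => // /esym.
  by split=> h; [apply: xoa | apply: xob]; exact: same_trans h.
have h1 : same m a x by apply: same_swap => // h'; case: h => h _; apply: h; exact: same_sym.
have h2 : same m b x by apply: same_swap => // h'; case: h => _ h; apply: h; exact: same_sym.
by apply: mab; apply: (same_trans h1); exact: same_sym.
Qed.

Lemma btw_between o x y z : ~ same x o y -> x <> y -> z <> x -> z <> y -> ~ same z x y ->
  ~ same x o z /\ ~ same z o y.
Proof.
move=> xoy xy zx zy zxy; split=> h.
  have h1 : same x y z by apply: same_swap => [/esym|/esym|/same_sym] //.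
  by apply: xoy; apply: (same_trans h); exact: same_sym.
have oz := same_nel h.
have h1 : same x o z.
  apply: same_swap => // [/esym //|h']; apply: zxy; exact: (same_trans (same_sym h') h).
have h2 : same x y z by apply: same_swap => [/esym|/esym|/same_sym] //.
by apply: xoy; apply: (same_trans h1); exact: same_sym.
Qed.

Lemma btw_branch o a x y z : ~ same a x o -> ~ same a x y -> x <> a ->
  ~ same a o z -> z <> a -> ~ same z o x -> ~ same z o y -> False.
Proof.
move=> axo axy xa aoz za zox zoy.
have zo : o <> a -> same z o a by move=> oa; apply: same_swap => //.
have [e|ya] := pselect (y = a).
  have [e'|/zo oa] := pselect (o = a); last by apply: zoy; rewrite e.
  by apply: zoy; rewrite e e'; apply: same_refl => /esym.
have zoa : ~ same z a o -> o = a.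
  by move=> h; apply: contrapT => /zo /same_sym.
have [azx|azx] := pselect (same a z x).
  have ay : same z y a by apply: same_swap => // h; apply: axy; apply: same_sym; exact: same_trans azx.
  apply: zoy; have [->|/zo oa] := pselect (o = a); first exact: same_sym.
  by apply: (same_trans oa); exact: same_sym.
have ax : same z x a by apply: same_swap => // h; apply: azx; exact: same_sym.
apply: zox; have [->|/zo oa] := pselect (o = a); first exact: same_sym.
by apply: (same_trans oa); exact: same_sym.
Qed.

Lemma branchP t : branch_point t <-> exists x y z, [/\ x <> t, y <> t & z <> t] /\
  [/\ ~ same t x y, ~ same t x z & ~ same t y z].
Proof.
split=> [[C1 [C2 [C3 [[x xt <-] [y yt <-] [z zt <-] [xy xz yz]]]]]|[x [y [z [[xt yt zt] [xy xz yz]]]]]].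
  exists x, y, z; split=> //; split=> h; [apply: xy | apply: xz | apply: yz];
    exact: same_connected_component h.
exists (same t x), (same t y), (same t z); split.
- by exists x.
- by exists y.
- by exists z.
have h a b : b <> t -> ~ same t a b -> same t a <> same t b.
  by move=> bt nab e; apply: nab; rewrite e; exact: same_refl.
by split; apply: h.
Qed.

Lemma median_branch a b c m : median a b c m -> m <> a -> m <> b -> m <> c -> branch_point m.
Proof.
move=> [ca cb ab] ma mb mc; apply/branchP; exists a, b, c.
by split; split=> h; [case: ma | case: mb | case: mc | case: ab | case: ca; exact: same_sym | case: cb; exact: same_sym].
Qed.

End Separation.

(** * Arcs and medians in a dendrite *)

Section DendriteArcs.
Variables (R : realType) (X : topologicalType) (d : X -> X -> R).
Hypothesis dm : metric_on d.
Hypotheses (Xc : compact [set: X]) (Xk : connected [set: X]) (lc : locally_connected X).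
Hypothesis no_circle : forall C : set X, ~ simple_closed_curve R C.
Let hX := d_hausdorff dm.

Lemma arc_in (U : set X) x y : open U -> connected U -> U x -> U y -> x <> y ->
  exists al : R -> X, [/\ inj_arc al, al 0 = x, al 1 = y & arc_set al `<=` U].
Proof.
move=> oU cU Ux Uy xy; have [f [fc f0 f1 fU]] := open_path dm Xc lc oU cU Ux Uy.
have [|al [ac a0 a1 ai af]] := path_arc dm fc; first by rewrite f0 f1.
exists al; split=> //; rewrite ?a0 ?a1 // => _ [t _ <-].
by have [s s01 ->] := af t; exact: fU.
Qed.

(** If [al c] did not separate the ends, their common component would be open and connected, hence
    contain a second arc missing [al c], and the two arcs would yield a circle. *)
Lemma arc_sep (al : R -> X) c : inj_arc al -> 0 < c < 1 -> ~ same (al c) (al 0) (al 1).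
Proof.
move=> ia /andP[c0 c1] h.
have c01 : 0 <= c <= 1 by rewrite !ltW.
have o01 : 0 <= (0 : R) <= 1 by rewrite lexx ler01.
have i01 : 0 <= (1 : R) <= 1 by rewrite lexx ler01.
have ne : al 0 <> al 1 by move/(ia.2 _ _ o01 i01)/eqP; rewrite eq_sym oner_eq0.
have [||be [ib b0 b1 bU]] := arc_in (same_open hX lc (al c) (al 0)) _ _ h ne.
- exact: component_connected.
- exact: same_refl (same_nel h).
have [|C] := two_arcs dm ia ib (esym b0) (esym b1) c01; last exact: no_circle.
by move/bU/same_ner.
Qed.

Lemma sep_arc (al : R -> X) z : continuous al -> ~ same z (al 0) (al 1) -> arc_set al z.
Proof.
move=> ac; apply: contra_notP => nz; apply: (same_conn (arc_set_connected ac) nz).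
  by exists 0; rewrite //= lexx ler01.
by exists 1; rewrite //= lexx ler01.
Qed.

Lemma arc_setE (al : R -> X) z : inj_arc al -> arc_set al z <-> ~ same z (al 0) (al 1).
Proof.
move=> ia; split; last exact: sep_arc ia.1.
move=> [t /andP[t0 t1] <-].
have [->|tn0] := eqVneq t 0; first by move/same_nel.
have [->|tn1] := eqVneq t 1; first by move/same_ner.
by apply: arc_sep => //; rewrite !lt_neqAle t0 t1 eq_sym tn0 tn1.
Qed.

Lemma arc_between (x y : X) : x <> y -> exists al : R -> X, [/\ inj_arc al, al 0 = x & al 1 = y].
Proof.
by move=> xy; have [al [? ? ? _]] := arc_in openT Xk (I : [set: X] x) (I : [set: X] y) xy; exists al.
Qed.

Lemma btw_closed a b : closed [set x : X | ~ same x a b].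
Proof.
have [->|ab] := pselect (a = b).
  have -> : [set x : X | ~ same x b b] = [set b].
    apply/seteqP; split=> [x /= h|x ->]; last by move/same_ner.
    by apply: contrapT => n; apply: h; apply: same_refl => /esym.
  exact: accessible_closed_set1 (hausdorff_accessible hX) b.
have [al [ia a0 a1]] := arc_between ab.
have -> : [set x : X | ~ same x a b] = arc_set al.
  by apply/seteqP; split=> x; rewrite -a0 -a1; move/(arc_setE x ia).
by apply: (compact_closed hX); apply: arc_set_compact ia.1.
Qed.

Lemma btw_connected a b : connected [set x : X | ~ same x a b].
Proof.
have [->|ab] := pselect (a = b).
  have -> : [set x : X | ~ same x b b] = [set b]; last exact: connected1.
  apply/seteqP; split=> [x /= h|x ->]; last by move/same_ner.
  by apply: contrapT => n; apply: h; apply: same_refl => /esym.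
have [al [ia a0 a1]] := arc_between ab.
have -> : [set x : X | ~ same x a b] = arc_set al.
  by apply/seteqP; split=> x; rewrite -a0 -a1; move/(arc_setE x ia).
exact: arc_set_connected ia.1.
Qed.

(** Without a median the arc from [a] to [b] would be the disjoint union of its closed traces on the
    arcs from [c] to [a] and from [c] to [b], against connectedness. *)
Lemma median_exists (a b c : X) : exists m, median a b c m.
Proof.
apply: contrapT => n.
have e : [set x : X | ~ same x a b] `&` [set x : X | ~ same x c a] = [set x : X | ~ same x a b].
  apply: btw_connected.
  - by exists a; split; [move/same_nel | move/same_ner].
  - exists (~` [set x : X | ~ same x c b]); first by rewrite openC; exact: btw_closed.
    apply/seteqP; split=> [x [/= h h']|x [/= h h']]; split=> //=.
      by move=> h2; apply: n; exists x.
    by have [//|/h'] := btw_split c h.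
  - by exists [set x : X | ~ same x c a] => //; exact: btw_closed.
have : ([set x : X | ~ same x a b] `&` [set x : X | ~ same x c a]) b by rewrite e /= => /same_ner.
by case=> h h'; apply: n; exists b; split=> // /same_ner.
Qed.

End DendriteArcs.

(** * Density and countability of the branch points *)

Section CompactDense.
Variables (R : realType) (X : topologicalType) (d : X -> X -> R).
Hypothesis dm : metric_on d.
Hypothesis Xc : compact [set: X].

Lemma finite_net e : 0 < e -> exists l : seq X, forall x, exists2 y, y \in l & d y x < e.
Proof.
move=> e0; apply: contrapT => n.
pose B y : set X := interior [set x | d y x < e].
pose K (l : seq X) : set X := ~` \bigcup_(y in [set y | y \in l]) B y.
have [|||l l' _ _|p _ pK] := @directed_compact X (seq X) setT K setT Xc.
- by exists [::].
- by move=> l _; rewrite closedC; apply: bigcup_open => y _; exact: open_interior.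
- move=> l _; have [x xl] : exists x, forall y, y \in l -> ~ d y x < e.
    apply: contrapT => h; apply: n; exists l => x; apply: contrapT => h'.
    by apply: h; exists x => y yl yx; apply: h'; exists y.
  by exists x; split=> // -[y /= yl /interior_subset yx]; exact: (xl y).
- exists (l ++ l') => // x xK; split=> -[y /= yl By]; apply: xK; exists y => //=;
    by rewrite mem_cat yl ?orbT.
apply: (pK [:: p] I); exists p; first by rewrite /= mem_head.
by apply/(d_nbhs dm); exists e.
Qed.

Lemma dense_sequence : exists u : nat -> option X, forall O : set X, open O -> O !=set0 ->
  exists n x, u n = Some x /\ O x.
Proof.
have /choice[l lP] (n : nat) : exists l : seq X, forall x, exists2 y, y \in l & d y x < n.+1%:R^-1.
  by apply: finite_net; rewrite invr_gt0 ltr0n.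
exists (fun n => if unpickle n is Some (m, k) then ohead (drop k (l m)) else None).
move=> O oO [x Ox]; have /(d_nbhs dm)[e e0 eO] : nbhs x O by exact: open_nbhs_nbhs.
have [m me] : exists m, m.+1%:R^-1 < e :> R.
  by exists (Num.truncn e^-1); rewrite -[ltRHS]invrK ltf_pV2 ?posrE ?invr_gt0 ?truncnS_gt ?ltr0n.
have [y yl yx] := lP m x.
exists (pickle (m, index y (l m))), y; rewrite pickleK; split.
  by rewrite (drop_nth y) ?index_mem //= nth_index.
by apply: eO; rewrite (d_sym dm); exact: lt_trans me.
Qed.

End CompactDense.

Section Wazewski.
Variables (R : realType) (X : topologicalType).
Hypothesis hX : wazewski_dendrite R X.

Let den : dendrite R X. Proof. by case: hX. Qed.
Lemma waz_compact : compact [set: X]. Proof. by case: den => -[]. Qed.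
Lemma waz_connected : connected [set: X]. Proof. by case: den => -[]. Qed.
Lemma waz_lc : locally_connected X. Proof. by case: den. Qed.
Let ncirc : forall C : set X, ~ simple_closed_curve R C. Proof. by case: den. Qed.
Lemma waz_metric : exists d : X -> X -> R, metric_on d.
Proof. by case: den => -[_ _ _ /metrizable_metric]. Qed.
Lemma waz_hausdorff : hausdorff_space X.
Proof. by have [d dm] := waz_metric; exact: d_hausdorff dm. Qed.

Let Xk := waz_connected. Let Xc := waz_compact. Let lc := waz_lc. Let hd := waz_hausdorff.

Lemma cut (a b : X) : a <> b -> exists z, [/\ branch_point z, z <> a, z <> b & ~ same z a b].
Proof.
move=> ab; have [d dm] := waz_metric.
have [al [ia a0 a1]] := arc_between dm Xc Xk lc ab.
have wz := inj_arc_arc dm ia; rewrite a0 a1 in wz.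
have [_ _ _ /(_ a b (arc_set al) ab wz)[z [az za zb bz]]] := hX; exists z; split=> //.
by have := (arc_setE dm Xc lc ncirc z ia).1 az; rewrite a0 a1.
Qed.

Lemma waz_median (a b c : X) : exists m, median a b c m.
Proof. by have [d dm] := waz_metric; exact: (median_exists dm Xc Xk lc ncirc). Qed.

(** A connected neighbourhood with two points contains every point separating them, in particular a
    branch point; a one-point neighbourhood would be open and closed. *)
Lemma open_branch (O : set X) : open O -> O !=set0 -> exists2 z, O z & branch_point z.
Proof.
move=> oO [x Ox]; have [V [oV Vx Vc VO]] := lc (open_nbhs_nbhs (conj oO Ox)).
have [[y [Vy yx]]|n] := pselect (exists y, V y /\ x <> y).
  have [z [bz zx zy zxy]] := cut yx; exists z => //; apply: VO.
  by apply: contrapT => nz; apply: zxy; exact: same_conn Vc nz Vx Vy.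
have eV : V = [set x].
  by apply/seteqP; split=> [y Vy|y -> //]; apply: contrapT => /= yx; apply: n; exists y; split=> // /esym.
have [_ [a [b ab]] _ _] := hX.
have e : V = [set: X].
  apply: Xk; first by exists x.
    by exists V; rewrite ?setTI.
  exists V; rewrite ?setTI // eV; exact: accessible_closed_set1 (hausdorff_accessible hd) x.
have h y : y = x by have : V y by [rewrite e]; rewrite eV.
by case: ab; rewrite (h a) (h b).
Qed.

Lemma branch_avoid (a : X) (l : seq X) : branch_point a ->
  exists x, [/\ branch_point x, x <> a & forall y, y \in l -> ~ same a x y].
Proof.
move=> ba; have [_ _ /(_ a ba) inf _] := hX.
have [x [xa xl]] : exists x, x <> a /\ forall y, y \in l -> ~ same a x y.
  apply: contrapT => n; apply: infinite_nat; rewrite -(eq_finite_set inf).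
  apply: (@sub_finite_set _ _ [set same a y | y in [set` l]]); last exact: finite_image (finite_seq l).
  move=> C [x xa <-]; apply: contrapT => n'; apply: n; exists x; split=> // y yl xy.
  by apply: n'; exists y => //; apply/esym; exact: same_connected_component xy.
have [z xz bz] := open_branch (same_open hd lc a x) (ex_intro _ x (same_refl xa)).
exists z; split=> //; first exact: same_ner xz.
by move=> y /xl nxy zy; apply: nxy; exact: same_trans zy.
Qed.

(** A branch point is the median of any three points in distinct components of its complement. Taken
    from a dense sequence, their three indices determine it. *)
Lemma branch_countable : countable [set x : X | branch_point x].
Proof.
have [d dm] := waz_metric; have [u uP] := dense_sequence dm Xc.
have uS t x : x <> t -> exists n, exists2 y, u n = Some y & same t x y.
  move=> xt; have [n [y [uy xy]]] := uP _ (same_open hd lc t x) (ex_intro _ x (same_refl xt)).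
  by exists n, y.
have /choice[c cP] t : exists c : nat * nat * nat, branch_point t ->
    exists x y z, [/\ u c.1.1 = Some x, u c.1.2 = Some y, u c.2 = Some z & median x y z t].
  have [bt|] := pselect (branch_point t); last by exists (0%N, 0%N, 0%N).
  have /branchP[x [y [z [[/uS[n [x' ux xx]] /uS[m [y' uy yy]] /uS[k [z' uz zz]]] [xy xz yz]]]]] := bt.
  exists (n, m, k) => _; exists x', y', z'; split=> //=.
  have tr p q p' q' : same t p p' -> same t q q' -> ~ same t p q -> ~ same t p' q'.
    move=> pp qq n1 h; apply: n1; apply: (same_trans pp); apply: (same_trans h).
    exact: same_sym.
  by split; [apply: (tr _ _ _ _ zz xx) | apply: (tr _ _ _ _ zz yy) | apply: (tr _ _ _ _ xx yy)] => // /same_sym.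
apply/countable_injP; exists (fun t => pickle (c t)) => s t; rewrite !inE => bs bt.
move/(pcan_inj pickleK) => e.
have [x [y [z [ux uy uz ms]]]] := cP s bs; have [x' [y' [z' [ux' uy' uz' mt]]]] := cP t bt.
move: ux' uy' uz'; rewrite -e ux uy uz => -[ex] [ey] [ez].
by move: mt; rewrite -ex -ey -ez; exact: median_uniq ms.
Qed.

Lemma branch_enum : exists (T : countType) (i : T -> X), injective i /\
  forall x, branch_point x <-> exists n, i n = x.
Proof.
have /countable_injP[f fi] := branch_countable.
pose P (n : nat) := `[< exists2 x, branch_point x & f x = n >].
have /choice[i iP] (n : {n | P n}) : exists x, branch_point x /\ f x = val n.
  by have /asboolP[x bx fx] := valP n; exists x.
exists ({n | P n} : countType), i; split=> [m n e|x].
  by apply: val_inj; rewrite -(iP m).2 -(iP n).2 e.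
split=> [bx|[n <-]]; last exact: (iP n).1.
have Pf : P (f x) by apply/asboolP; exists x.
exists (exist _ (f x) Pf); apply: fi; rewrite ?inE //; first exact: (iP _).1.
exact: (iP _).2.
Qed.

End Wazewski.

Local Close Scope classical_set_scope.
Local Close Scope ring_scope.

(** * Homogeneous dense trees *)

(** The order of the branch points seen from [o]. Density reflects branch points inside arcs, and
    [mt_branch] the infinite valence: at any [a] some cone avoids a given finite list. *)
Record mtree (T : eqType) (le : T -> T -> Prop) (o : T) : Prop := MTree {
  mt_refl : forall x, le x x;
  mt_anti : forall x y, le x y -> le y x -> x = y;
  mt_trans : forall y x z, le x y -> le y z -> le x z;
  mt_root : forall x, le o x;
  mt_tree : forall x y z, le x z -> le y z -> le x y \/ le y x;
  mt_meet : forall x y, exists m, [/\ le m x, le m y & forall z, le z x -> le z y -> le z m];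
  mt_dense : forall x y, le x y -> x <> y ->
    exists z, [/\ le x z, le z y, z <> x & z <> y];
  mt_branch : forall a (l : seq T), exists x, [/\ le a x, x <> a &
    forall y z, y \in l -> le a z -> z <> a -> le z x -> le z y -> False] }.

(** * Back-and-forth on finite meet-closed isomorphisms *)

Section BackAndForth.

Definition is_meet (T : eqType) (le : T -> T -> Prop) (x y m : T) :=
  [/\ le m x, le m y & forall z, le z x -> le z y -> le z m].

Lemma is_meetC (T : eqType) (le : T -> T -> Prop) x y m :
  is_meet le x y m -> is_meet le y x m.
Proof. by case=> mx my h; split => // z zy zx; exact: h. Qed.

Lemma is_meet_le (T : eqType) (le : T -> T -> Prop) o x y :
  mtree le o -> le x y -> is_meet le x y x.
Proof. by move=> mt xy; split => //; exact: (mt_refl mt). Qed.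

Variables (T1 T2 : countType) (le1 : T1 -> T1 -> Prop) (le2 : T2 -> T2 -> Prop).
Variables (o1 : T1) (o2 : T2).

(** Closure under meets ensures that a new point attaches to the domain at a single place. *)
Definition piso (p : seq (T1 * T2)) :=
  [/\ (o1, o2) \in p,
      forall u v, u \in p -> v \in p -> (le1 u.1 v.1 <-> le2 u.2 v.2) &
      forall u v, u \in p -> v \in p -> exists w,
        [/\ w \in p, is_meet le1 u.1 v.1 w.1 & is_meet le2 u.2 v.2 w.2]].

Hypotheses (mt1 : mtree le1 o1) (mt2 : mtree le2 o2).

Lemma piso_cons p u :
  piso p ->
  (forall v, v \in p -> (le1 u.1 v.1 <-> le2 u.2 v.2)) ->
  (forall v, v \in p -> (le1 v.1 u.1 <-> le2 v.2 u.2)) ->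
  (forall v, v \in p -> exists w,
     [/\ w \in u :: p, is_meet le1 u.1 v.1 w.1 & is_meet le2 u.2 v.2 w.2]) ->
  piso (u :: p).
Proof.
move=> [op pP pM] h1 h2 hM; split; first by rewrite inE op orbT.
  move=> v w; rewrite !inE => /orP[/eqP ->|vp] /orP[/eqP ->|wp].
  - by split=> _; [exact: (mt_refl mt2) | exact: (mt_refl mt1)].
  - exact: h1.
  - exact: h2.
  - exact: pP.
move=> v w; rewrite ![in X in X -> _]inE => /orP[/eqP ->|vp] /orP[/eqP ->|wp].
- exists u; split; first exact: mem_head.
    exact: (is_meet_le mt1 (mt_refl mt1 _)).
  exact: (is_meet_le mt2 (mt_refl mt2 _)).
- exact: hM.
- by have [z [zp /is_meetC z1 /is_meetC z2]] := hM v vp; exists z.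
- by have [z [zp z1 z2]] := pM v w vp wp; exists z; rewrite inE zp orbT.
Qed.

(** A new point below the domain has a least domain point [q] above it, by closure under meets, and
    a greatest one [r] below it, by linearity of initial segments. Its image is placed between
    theirs by density. *)
Lemma piso_below p x y : piso p -> y \in p -> le1 x y.1 ->
  exists x', piso ((x, x') :: p).
Proof.
move=> pp yp xy; have [op pP pM] := pp.
have [[v [vp vx]]|nx] := pselect (exists v, v \in p /\ v.1 = x).
  exists v.2; rewrite -vx -surjective_pairing; apply: piso_cons => // [w wp|w wp|w wp].
  - exact: pP.
  - exact: pP.
  - by have [z [zp z1 z2]] := pM v w vp wp; exists z; rewrite inE zp orbT.
have nle v : v \in p -> x <> v.1 by move=> vp e; case: nx; exists v.
have [q [qp xq] qmin] : exists2 q, q \in p /\ le1 x q.1 &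
    forall v, v \in p -> le1 x v.1 -> le1 q.1 v.1.
  suff h (s : seq (T1 * T2)) : {subset s <= p} -> exists2 q, q \in p /\ le1 x q.1 &
      forall v, v \in s -> le1 x v.1 -> le1 q.1 v.1 by apply: (h p) => ?.
  elim: s => [_|v s IH sp]; first by exists y.
  have [|q [qp xq] qm] := IH; first by move=> w ws; apply: sp; rewrite inE ws orbT.
  have vp : v \in p by apply: sp; exact: mem_head.
  have [xv|nxv] := pselect (le1 x v.1); last first.
    by exists q => // w; rewrite inE => /orP[/eqP ->|ws] // xw; exact: qm.
  have [w [wp [wq wv w1] _]] := pM q v qp vp.
  exists w; first by split=> //; exact: w1.
  move=> z; rewrite inE => /orP[/eqP ->|zs] // xz.
  exact: (mt_trans mt1 wq (qm _ zs xz)).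
have [r [rp rx] rmax] : exists2 r, r \in p /\ le1 r.1 x &
    forall v, v \in p -> le1 v.1 x -> le1 v.1 r.1.
  suff h (s : seq (T1 * T2)) : {subset s <= p} -> exists2 r, r \in p /\ le1 r.1 x &
      forall v, v \in s -> le1 v.1 x -> le1 v.1 r.1 by apply: (h p) => ?.
  elim: s => [_|v s IH sp]; first by exists (o1, o2) => //; split => //; exact: (mt_root mt1).
  have [|r [rp rx] rm] := IH; first by move=> w ws; apply: sp; rewrite inE ws orbT.
  have vp : v \in p by apply: sp; exact: mem_head.
  have [vx|nvx] := pselect (le1 v.1 x); last first.
    by exists r => // w; rewrite inE => /orP[/eqP ->|ws] // wx; exact: rm.
  have [rv|vr] := mt_tree mt1 rx vx.
    exists v => // w; rewrite inE => /orP[/eqP ->|ws] wx; first exact: (mt_refl mt1).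
    exact: (mt_trans mt1 (rm _ ws wx)).
  by exists r => // w; rewrite inE => /orP[/eqP ->|ws] // wx; exact: rm.
have rq : le2 r.2 q.2 by apply/pP => //; exact: (mt_trans mt1 rx).
have rq' : r.2 <> q.2.
  move=> e; apply: (nle r rp); apply: (mt_anti mt1) => //.
  by apply: (mt_trans mt1 xq); apply/pP => //; rewrite e; exact: (mt_refl mt2).
have [x' [rx' xq' nr nq]] := mt_dense mt2 rq rq'.
have wP v : v \in p -> le1 x v.1 \/ exists w, [/\ w \in p, is_meet le1 q.1 v.1 w.1,
    is_meet le2 q.2 v.2 w.2, le1 w.1 r.1 & ~ le1 x v.1].
  move=> vp; have [|nxv] := pselect (le1 x v.1); [by left | right].
  have [w [wp [wq wv w1] w2]] := pM q v qp vp.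
  exists w; split=> //; apply: rmax => //.
  have [//|xw] := mt_tree mt1 wq xq.
  by case: nxv; exact: (mt_trans mt1 xw).
exists x'; apply: piso_cons => // v vp /=.
- split=> [xv|xv'].
    by apply: (mt_trans mt2 xq'); apply/pP => //; exact: qmin.
  have [//|[w [wp _ [wq wv w2] wr _]]] := wP v vp.
  case: nr; apply: (mt_anti mt2) => //.
  by apply: (mt_trans mt2 (w2 _ xq' xv')); apply/pP.
- split=> [vx|vx'].
    by apply: (mt_trans mt2 _ rx'); apply/pP => //; exact: rmax.
  have vq : le1 v.1 q.1 by apply/pP => //; exact: (mt_trans mt2 vx').
  have [//|xv] := mt_tree mt1 vq xq.
  case: nq; apply: (mt_anti mt2) => //; apply: (mt_trans mt2 _ vx').
  by apply/pP => //; exact: qmin.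
- have [xv|[w [wp [wq wv w1] [wq' wv' w2] wr nxv]]] := wP v vp.
    exists (x, x'); split; first exact: mem_head.
      exact: (is_meet_le mt1).
    apply: (is_meet_le mt2) => /=; apply: (mt_trans mt2 xq'); apply/pP => //; exact: qmin.
  exists w; split; first by rewrite inE wp orbT.
    split=> // [|z zx zv]; first exact: (mt_trans mt1 wr).
    by apply: w1 => //; exact: (mt_trans mt1 zx).
  split=> // [|z zx zv].
    by apply: (mt_trans mt2 _ rx'); apply/pP.
  by apply: w2 => //; exact: (mt_trans mt2 zx).
Qed.

Lemma piso_extend p x : piso p ->
  exists p', [/\ piso p', {subset p <= p'} & exists x', (x, x') \in p'].
Proof.
move=> pp; have [[y [yp xy]]|nb] := pselect (exists y, y \in p /\ le1 x y.1).
  have [x' px] := piso_below pp yp xy; exists ((x, x') :: p); split=> //.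
    by move=> v vp; rewrite inE vp orbT.
  by exists x'; exact: mem_head.
have [m [mx [y0 y0p my0] mm]] : exists m, [/\ le1 m x, exists2 y0, y0 \in p & le1 m y0.1 &
    forall v z, v \in p -> le1 z x -> le1 z v.1 -> le1 z m].
  suff h (s : seq (T1 * T2)) : {subset s <= p} -> exists m, [/\ le1 m x, exists2 y0, y0 \in p & le1 m y0.1 &
      forall v z, v \in s -> le1 z x -> le1 z v.1 -> le1 z m] by apply: (h p) => ?.
  elim: s => [_|v s IH sp].
    exists o1; split => //; first exact: (mt_root mt1).
    by have [op _ _] := pp; exists (o1, o2) => //; exact: (mt_root mt1).
  have [|m [mx [y yp my] mm]] := IH; first by move=> w ws; apply: sp; rewrite inE ws orbT.
  have vp : v \in p by apply: sp; exact: mem_head.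
  have [n [nx nv nn]] := mt_meet mt1 x v.1.
  have [mn|nm] := mt_tree mt1 mx nx.
    exists n; split=> //; first by exists v.
    move=> w z; rewrite inE => /orP[/eqP ->|ws] zx zw; first exact: nn.
    exact: (mt_trans mt1 (mm _ _ ws zx zw)).
  exists m; split=> //; first by exists y.
  move=> w z; rewrite inE => /orP[/eqP ->|ws] zx zw; last exact: mm zw.
  exact: (mt_trans mt1 (nn _ zx zw)).
have [m' pp1] := piso_below pp y0p my0; set p1 := (m, m') :: p in pp1.
have [_ pP pM] := pp1.
have m1 : (m, m') \in p1 by exact: mem_head.
have xm : x <> m by move=> e; apply: nb; exists y0; rewrite e.
have nb1 v : v \in p1 -> ~ le1 x v.1.
  rewrite inE => /orP[/eqP -> /= xm'|vp xv]; last by apply: nb; exists v.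
  by apply: xm; exact: (mt_anti mt1).
have {}mm v z : v \in p1 -> le1 z x -> le1 z v.1 -> le1 z m.
  by rewrite inE => /orP[/eqP -> //|vp]; exact: mm.
have [x' [mx' nxm' x'b]] := mt_branch mt2 m' [seq v.2 | v <- p1].
have {}x'b v z : v \in p1 -> le2 z x' -> le2 z v.2 -> le2 z m'.
  move=> vp zx zv; have [mz|//] := mt_tree mt2 mx' zx.
  have [-> //|nz] := eqVneq z m'; first exact: (mt_refl mt2).
  have := x'b v.2 z (map_f _ vp) mz _ zx zv.
  by case; exact/eqP.
exists ((x, x') :: p1); split; last by exists x'; exact: mem_head.
  apply: piso_cons => // v vp /=.
  - split=> [/(nb1 v vp)//|xv]; case: nxm'; apply: (mt_anti mt2) => //.
    by apply: (x'b v) => //; exact: (mt_refl mt2).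
  - split=> [vx|vx].
      apply: (mt_trans mt2 _ mx'); apply/(pP v (m, m')) => //.
      by apply: (mm v) => //; exact: (mt_refl mt1).
    apply: (mt_trans mt1 _ mx); apply/(pP v (m, m')) => //.
    by apply: (x'b v) => //; exact: (mt_refl mt2).
  - have [w [wp [wm wv w1] [wm' wv' w2]]] := pM (m, m') v m1 vp.
    exists w; split; first by rewrite inE wp orbT.
      split=> // [|z zx zv]; first exact: (mt_trans mt1 wm).
      by apply: w1 => //; exact: (mm v).
    split=> // [|z zx zv]; first exact: (mt_trans mt2 wm').
    by apply: w2 => //; exact: (x'b v).
by move=> v vp; rewrite !inE vp !orbT.
Qed.

End BackAndForth.

Lemma piso_swap (T1 T2 : countType) (le1 : T1 -> T1 -> Prop) (le2 : T2 -> T2 -> Prop) o1 o2 p :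
  piso le1 le2 o1 o2 p -> piso le2 le1 o2 o1 [seq (v.2, v.1) | v <- p].
Proof.
move=> [op pP pM]; split=> [|u v|u v].
- by apply/mapP; exists (o1, o2).
- by move=> /mapP[u' up ->] /mapP[v' vp ->] /=; split=> /pP; apply.
move=> /mapP[u' up ->] /mapP[v' vp ->] /=.
have [w [wp h1 h2]] := pM u' v' up vp; exists (w.2, w.1); split=> //.
by apply/mapP; exists w.
Qed.

Lemma back_and_forth (T1 T2 : countType) (le1 : T1 -> T1 -> Prop)
    (le2 : T2 -> T2 -> Prop) o1 o2 p :
  mtree le1 o1 -> mtree le2 o2 -> piso le1 le2 o1 o2 p ->
  exists f g, [/\ cancel f g, cancel g f, forall x y, le1 x y <-> le2 (f x) (f y) &
    forall u, u \in p -> f u.1 = u.2].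
Proof.
move=> mt1 mt2 pp.
pose good := piso le1 le2 o1 o2.
have /choice[e eP] (np : nat * seq (T1 * T2)) : exists p', good np.2 -> [/\ good p',
    {subset np.2 <= p'}, forall x, unpickle np.1 = Some x -> exists y, (x, y) \in p' &
    forall y, unpickle np.1 = Some y -> exists x, (x, y) \in p'].
  case: np => n q /=.
  have [gq|ngq] := pselect (good q); last by exists q.
  have [q1 [g1 s1 h1]] : exists q1, [/\ good q1, {subset q <= q1} &
      forall x, unpickle n = Some x -> exists y, (x, y) \in q1].
    case en: (unpickle n : option T1) => [x|]; last by exists q; split.
    have [q1 [g1 s1 [y xy]]] := piso_extend mt1 mt2 x gq.
    by exists q1; split=> // _ [<-]; exists y.
  case en: (unpickle n : option T2) => [y|]; last by exists q1 => _; split.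
  have [q2 [/piso_swap g2 s2 [x xy]]] := piso_extend mt2 mt1 y (piso_swap g1).
  have s12 : {subset q1 <= [seq (v.2, v.1) | v <- q2]}.
    move=> v vq; apply/mapP; exists (v.2, v.1); last by case: v {vq}.
    by apply: s2; apply/mapP; exists v.
  exists [seq (v.2, v.1) | v <- q2] => _; split=> //.
  - by move=> v /s1/s12.
  - by move=> z /h1[w /s12]; exists w.
  - by move=> _ [<-]; exists x; apply/mapP; exists (y, x).
pose P := fix P n := if n is n'.+1 then e (n', P n') else p.
have PS n : good (P n).
  by elim: n => // n IH; have [] := eP (n, P n) IH.
have Psub m n : (m <= n)%N -> {subset P m <= P n}.
  move=> /subnK <-; elim: (n - m)%N => // k IH v /IH vP.
  by have [_ s _ _] := eP (k + m, P (k + m))%N (PS _); exact: s.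
have /choice[f fP] x : exists y, exists n, (x, y) \in P n.
  have [_ _ h _] := eP (pickle x, P (pickle x)) (PS _).
  by have [y xy] := h x (pickleK _); exists y, (pickle x).+1.
have /choice[g gP] y : exists x, exists n, (x, y) \in P n.
  have [_ _ _ h] := eP (pickle y, P (pickle y)) (PS _).
  by have [x xy] := h y (pickleK _); exists x, (pickle y).+1.
have up u v m n : u \in P m -> v \in P n -> (le1 u.1 v.1 <-> le2 u.2 v.2).
  move=> um vn; have [_ h _] := PS (maxn m n).
  by apply: h; [exact: (Psub m) (leq_maxl _ _) _ um | exact: (Psub n) (leq_maxr _ _) _ vn].
have inj1 u v m n : u \in P m -> v \in P n -> u.1 = v.1 -> u.2 = v.2.
  move=> um vn e12; apply: (mt_anti mt2).
    by apply/(up _ _ _ _ um vn); rewrite e12; exact: (mt_refl mt1).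
  by apply/(up _ _ _ _ vn um); rewrite e12; exact: (mt_refl mt1).
have inj2 u v m n : u \in P m -> v \in P n -> u.2 = v.2 -> u.1 = v.1.
  move=> um vn e12; apply: (mt_anti mt1).
    by apply/(up _ _ _ _ um vn); rewrite e12; exact: (mt_refl mt2).
  by apply/(up _ _ _ _ vn um); rewrite e12; exact: (mt_refl mt2).
exists f, g; split.
- move=> x; have [n h1] := fP x; have [m h2] := gP (f x).
  exact: (inj2 _ _ _ _ h2 h1).
- move=> y; have [n h1] := gP y; have [m h2] := fP (g y).
  exact: (inj1 _ _ _ _ h2 h1).
- move=> x y; have [n h1] := fP x; have [m h2] := fP y.
  exact: (up _ _ _ _ h1 h2).
- move=> u uP; have [n h] := fP u.1.
  exact: (inj1 _ _ _ 0%N h uP).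
Qed.

(* A chain issuing from the root is a meet-closed set. *)
Lemma chain_piso (T1 T2 : countType) (le1 : T1 -> T1 -> Prop) (le2 : T2 -> T2 -> Prop) o1 o2
    (p : seq (T1 * T2)) :
  mtree le1 o1 -> mtree le2 o2 -> (o1, o2) \in p ->
  (forall u v, u \in p -> v \in p -> le1 u.1 v.1 \/ le1 v.1 u.1) ->
  (forall u v, u \in p -> v \in p -> le1 u.1 v.1 <-> le2 u.2 v.2) ->
  piso le1 le2 o1 o2 p.
Proof.
move=> mt1 mt2 op tot iso; split=> // u v up vp.
have [uv|vu] := tot u v up vp.
  exists u; split=> //; first exact: (is_meet_le mt1).
  by apply: (is_meet_le mt2) => //; apply/iso.
exists v; split=> //; apply/is_meetC; first exact: (is_meet_le mt1).
by apply: (is_meet_le mt2) => //; apply/iso.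
Qed.

(* [G] acts on [T]; its elements fixing the root [o] are exactly the automorphisms of
   the rooted tree. *)
Record tree_action (T : countType) (le : T -> T -> Prop) (o : T) (G : groupType)
    (act : G -> T -> T) : Prop := TreeAction {
  ta_tree : mtree le o;
  ta_1 : forall x, act 1%g x = x;
  ta_M : forall g h x, act (g * h)%g x = act g (act h x);
  ta_faithful : forall g h, (forall x, act g x = act h x) -> g = h;
  ta_le : forall g x y, act g o = o -> le x y -> le (act g x) (act g y);
  ta_realize : forall f f', cancel f f' -> cancel f' f ->
    (forall x y, le x y <-> le (f x) (f y)) -> exists g, forall x, act g x = f x }.

(** * Automorphisms with prescribed supports *)

Section TreeAction.
Variables (T : countType) (le : T -> T -> Prop) (o : T) (G : groupType) (act : G -> T -> T).
Hypothesis ta : tree_action le o act.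
Let mt := ta_tree ta.
Let act1 := ta_1 ta.
Let actM := ta_M ta.
Let faithful := ta_faithful ta.

Implicit Types (g h k : G) (x y z : T) (Z R : T -> Prop).

Lemma actK g x : act g^-1%g (act g x) = x.
Proof. by rewrite -actM mulVg act1. Qed.

Lemma actVK g x : act g (act g^-1%g x) = x.
Proof. by rewrite -actM mulgV act1. Qed.

Lemma act_inj g x y : act g x = act g y -> x = y.
Proof. by move=> e; rewrite -(actK g x) e actK. Qed.

Lemma act_V g x : act g x = x -> act g^-1%g x = x.
Proof. by move=> e; rewrite -{1}e actK. Qed.

Lemma le_act g x y : act g o = o -> (le (act g x) (act g y) <-> le x y).
Proof.
move=> go; split; last exact: (ta_le ta).
by move=> /(ta_le ta (act_V go)); rewrite !actK.
Qed.

Definition Fix Z g := forall x, Z x -> act g x = x.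

Lemma subgrp_Fix Z : subgrp (Fix Z).
Proof.
split=> [x _|g h gZ hZ x Zx|g gZ x Zx]; first exact: act1.
- by rewrite actM hZ // gZ.
- by apply: act_V; exact: gZ.
Qed.

Lemma Fix_sub Z Z' g : (forall x, Z x -> Z' x) -> Fix Z' g -> Fix Z g.
Proof. by move=> s h x /s; exact: h. Qed.

(* Automorphisms with pairwise disjoint supports can be pasted: the order relation
   only involves two points at a time. *)
Lemma paste (I : Type) (R : I -> T -> Prop) (h : I -> G) :
  (forall i j x, R i x -> R j x -> i = j) ->
  (forall i, act (h i) o = o) ->
  (forall i x, ~ R i x -> act (h i) x = x) ->
  exists g, (forall i x, R i x -> act g x = act (h i) x) /\
    forall x, (forall i, ~ R i x) -> act g x = x.
Proof.
move=> disj ho supp.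
have /choice[c cP] x : exists c : option I,
    if c is Some i then R i x else forall i, ~ R i x.
  have [[i Ri]|n] := pselect (exists i, R i x); first by exists (Some i).
  by exists None => i Ri; apply: n; exists i.
pose F (e : I -> G) x := if c x is Some i then act (e i) x else x.
have cR i x : R i x -> c x = Some i.
  by move=> Ri; have := cP x; case: (c x) => [j /(disj _ _ _ Ri) ->//|/(_ i)].
have RK i x (e : G) : (forall y, ~ R i y -> act e y = y) -> R i x -> R i (act e x).
  move=> es Ri; have [//|nR] := pselect (R i (act e x)).
  have e2 := es _ nR; have ex : act e x = x by exact: (@act_inj e).
  by rewrite ex in nR.
have suppV i x : ~ R i x -> act (h i)^-1%g x = x by move=> n; apply: act_V; exact: supp.
have FK e e' : (forall i x, ~ R i x -> act (e i) x = x) ->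
    (forall i x, act (e' i) (act (e i) x) = x) -> cancel (F e) (F e').
  move=> es ee x; rewrite /F; have := cP x; case E: (c x) => [i|] Rx; last by rewrite E.
  by rewrite (cR i) ?ee //; apply: RK => // y; exact: es.
have K1 := FK h (fun i => (h i)^-1%g) supp (fun i x => actK _ _).
have K2 := FK (fun i => (h i)^-1%g) h suppV (fun i x => actVK _ _).
have Fle e x y : (forall i, act (e i) o = o) -> (forall i x, ~ R i x -> act (e i) x = x) ->
    le x y -> le (F e x) (F e y).
  move=> eo es xy; rewrite /F.
  case Ex: (c x) (cP x) => [i|] Rx; case Ey: (c y) (cP y) => [j|] Ry //.
  - have [eij|nij] := pselect (i = j); first by rewrite eij; apply/le_act.
    have ex : act (e j) (act (e i) x) = act (e i) x.
      by apply: (es) => Rj; apply: nij; apply: (disj i j _ (RK _ _ _ (es i) Rx)).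
    rewrite -ex; apply/le_act => //; rewrite -(es i y); first exact/le_act.
    by move=> Ri; apply: nij; exact: (disj i j y).
  - by rewrite -(es i y) //; apply/le_act.
  - by rewrite -(es j x) //; apply/le_act.
have hVo i : act (h i)^-1%g o = o by exact: act_V.
have [||x y|g gP] := ta_realize ta (f := F h) (f' := F (fun i => (h i)^-1%g)) => //.
  split; first exact: Fle.
  by move=> /(Fle (fun i => (h i)^-1%g) _ _ hVo suppV); rewrite !K1.
exists g; split=> [i x Ri|x nR]; rewrite gP /F; first by rewrite (cR i).
by case E: (c x) (cP x) => [i|//] /nR.
Qed.

(** When [g] is replaced by the identity off [R], only comparisons across the boundary of [R] are at
    risk; the last hypothesis protects them. *)
Lemma restrict R g : act g o = o ->
  (forall x, R x <-> R (act g x)) ->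
  (forall x y, R x -> ~ R y -> (le x y <-> le (act g x) y) /\ (le y x <-> le y (act g x))) ->
  exists h, [/\ act h o = o, forall x, R x -> act h x = act g x &
    forall x, ~ R x -> act h x = x].
Proof.
move=> go gR gle.
have gRV x : R x <-> R (act g^-1%g x) by have := gR (act g^-1%g x); rewrite actVK => -[]; split.
pose F e x := if pselect (R x) then act e x else x.
have Fr e x : R x -> F e x = act e x by rewrite /F; case: pselect.
have Fn e x : ~ R x -> F e x = x by rewrite /F; case: pselect.
have K1 : cancel (F g) (F g^-1%g).
  move=> x; have [Rx|nR] := pselect (R x); last by rewrite !Fn.
  by rewrite (Fr g) // Fr ?actK //; exact: (proj1 (gR x)).
have K2 : cancel (F g^-1%g) (F g).
  move=> x; have [Rx|nR] := pselect (R x); last by rewrite !Fn.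
  by rewrite (Fr g^-1%g) // Fr ?actVK //; exact: (proj1 (gRV x)).
have [||x y|h hP] := ta_realize ta (f := F g) (f' := F g^-1%g) => //.
  have [Rx|nx] := pselect (R x); have [Ry|ny] := pselect (R y).
  - by rewrite !Fr //; exact: (iff_sym (le_act _ _ go)).
  - by rewrite Fr // Fn //; exact: (proj1 (gle x y Rx ny)).
  - by rewrite Fn // Fr //; exact: (proj2 (gle y x Ry nx)).
  - by rewrite !Fn.
exists h; split=> [|x Rx|x nR]; rewrite hP; [|exact: Fr|exact: Fn].
have [Ro|no] := pselect (R o); first by rewrite Fr.
by rewrite Fn.
Qed.

Lemma disjoint_supports_commute R R' g h :
  (forall x, R x -> R' x -> False) ->
  (forall x, ~ R x -> act g x = x) -> (forall x, ~ R' x -> act h x = x) ->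
  (g * h = h * g)%g.
Proof.
move=> disj gs hs; apply: faithful => x; rewrite !actM.
have st (S : T -> Prop) k y : (forall z, ~ S z -> act k z = z) -> S y -> S (act k y).
  move=> ks Sy; have [//|n] := pselect (S (act k y)).
  by have := ks _ n => /(@act_inj k) e; rewrite e in n.
have [Rx|nR] := pselect (R x).
  have n1 : ~ R' x by move=> /(disj _ Rx).
  have n2 : ~ R' (act g x) by apply: disj; exact: st.
  by rewrite (hs x) // (hs _ n2).
rewrite (gs x) //; have [R'x|nR'] := pselect (R' x).
  by rewrite gs // => /disj; apply; exact: st.
by rewrite hs // gs.
Qed.

(** Every comparison between [R1] and [R2] passes through a point of [Z], which is fixed; so an
    element of the stabilizer can be cut off outside [R1] without breaking the order. *)
Lemma Fix_prod Z R1 R2 : Z o -> (forall x, [\/ Z x, R1 x | R2 x]) ->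
  (forall x, Z x -> R1 x -> False) -> (forall x, Z x -> R2 x -> False) ->
  (forall x, R1 x -> R2 x -> False) ->
  (forall g x, Fix Z g -> R1 x -> R1 (act g x)) ->
  (forall g x, Fix Z g -> R2 x -> R2 (act g x)) ->
  (forall x y, R1 x -> R2 y -> le x y -> exists c, [/\ Z c, le x c & le c y]) ->
  (forall x y, R1 x -> R2 y -> le y x -> exists c, [/\ Z c, le y c & le c x]) ->
  forall g, Fix Z g <-> exists p q,
    [/\ Fix (fun x => ~ R1 x) p, Fix (fun x => ~ R2 x) q & g = (p * q)%g].
Proof.
move=> Zo cov Z1 Z2 disj inv1 inv2 il ir g; split=> [gZ|[p [q [pf qf -> x Zx]]]]; last first.
  by rewrite actM (qf x) ?(pf x) //; [move=> /(Z1 x Zx) | move=> /(Z2 x Zx)].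
have gVZ := subgrpV (subgrp_Fix Z) gZ.
have go := gZ o Zo.
have rel x y : R1 x -> ~ R1 y ->
    (le x y <-> le (act g x) y) /\ (le y x <-> le y (act g x)).
  move=> Rx nRy; case: (cov y) => // [Zy|R2y].
    by rewrite -{2 4}(gZ y Zy); split; split=> /le_act; apply.
  have Rgx := inv1 g x gZ Rx.
  (split; split) => h; [move: (il _ _ Rx R2y h)|move: (il _ _ Rgx R2y h)
    |move: (ir _ _ Rx R2y h)|move: (ir _ _ Rgx R2y h)] => -[c [Zc h1 h2]].
  - by apply: (mt_trans mt _ h2); rewrite -(gZ c Zc); apply/le_act.
  - by apply: (mt_trans mt _ h2); apply/(le_act _ _ go); rewrite (gZ c Zc).
  - by apply: (mt_trans mt h1); rewrite -(gZ c Zc); apply/le_act.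
  - by apply: (mt_trans mt h1); apply/(le_act _ _ go); rewrite (gZ c Zc).
have [|p [po pR pn]] := @restrict R1 g go _ rel.
  move=> x; split; first exact: inv1.
  by move=> /(inv1 _ _ gVZ); rewrite actK.
exists p, (p^-1 * g)%g; split=> // [x nR2|]; last by rewrite mulgA mulgV mul1g.
rewrite actM; case: (cov x) => // [Zx|R1x].
  by rewrite gZ //; apply: act_V; apply: pn => /(Z1 x Zx).
by rewrite -pR // actK.
Qed.

(* Elements moving [R] to pairwise disjoint sets [w R, w^2 R, ...] make the group of
   elements supported in [R] homologically invisible in any group containing them. *)
Section Displacement.
Variables (A : zmodType) (K H : G -> Prop) (R : T -> Prop) (w : G).
Hypotheses (sK : subgrp K) (sH : subgrp H) (KH : forall k, K k -> H k).
Hypothesis Hauto : forall g, H g -> act g o = o.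
Hypothesis Ksupp : forall k x, K k -> ~ R x -> act k x = x.
Hypothesis Hw : H w.

Definition shifted i x := R (iter i (act w^-1%g) x).

Hypothesis shift_disj : forall i j x, shifted i x -> shifted j x -> i = j.
Hypothesis Hclosed : forall k g, K k ->
  (forall i x, shifted i.+1 x ->
     act g x = iter i.+1 (act w) (act k (iter i.+1 (act w^-1%g) x))) ->
  (forall x, (forall i, ~ shifted i.+1 x) -> act g x = x) -> H g.

Lemma iterK i x : iter i (act w^-1%g) (iter i (act w) x) = x.
Proof. by elim: i x => //= i IH x; rewrite -iterS iterSr actK IH. Qed.

Lemma iterVK i x : iter i (act w) (iter i (act w^-1%g) x) = x.
Proof. by elim: i x => //= i IH x; rewrite -iterS iterSr actVK IH. Qed.

Lemma displaced_cobound n (a : seq G -> A) :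
  (forall j, (0 < j <= n)%N -> exact A K j) ->
  inv_under H a -> cocycle a n.+1 -> cobound K a n.+1.
Proof.
move=> eK ai ac.
have wo := Hauto Hw.
have iw i (e : G) : act e o = o -> iter i (act e) o = o by move=> eo; elim: i => //= i ->.
have Kst k x : K k -> R x -> R (act k x).
  move=> Kk Rx; have [//|nx] := pselect (R (act k x)).
  by have := Ksupp Kk nx => /(@act_inj k) e; rewrite e in nx.
(* [psi k] is the infinite product of the conjugates of [k] by the positive powers of [w], pasted
   together since their supports are disjoint. *)
have /choice[psi psiP] k : exists g, K k ->
    (forall i x, shifted i.+1 x ->
      act g x = iter i.+1 (act w) (act k (iter i.+1 (act w^-1%g) x))) /\
    (forall x, (forall i, ~ shifted i.+1 x) -> act g x = x).
  have [Kk|nK] := pselect (K k); last by exists 1%g.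
  have actX (e : G) i x : act (e ^+ i)%g x = iter i (act e) x.
    by elim: i => [|i IH]; rewrite ?expg0 ?act1 // expgS actM IH.
  have [|i|i x nR|g [g1 g2]] := @paste nat (fun i => shifted i.+1)
      (fun i => (w ^+ i.+1 * k * w^-1 ^+ i.+1)%g).
  - by move=> i j x h1 h2; have := shift_disj h1 h2 => -[].
  - rewrite !actM !actX !iw //; last by apply: act_V.
    by rewrite (Hauto (KH Kk)) iw.
  - by rewrite !actM !actX Ksupp // iterVK.
  - exists g => _; split=> // i x /g1 ->.
    by rewrite !actM !actX.
have psi1 k i x : K k -> shifted i.+1 x ->
    act (psi k) x = iter i.+1 (act w) (act k (iter i.+1 (act w^-1%g) x)).
  by move=> Kk; have [h _] := psiP k Kk; exact: h.
have psi2 k x : K k -> (forall i, ~ shifted i.+1 x) -> act (psi k) x = x.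
  by move=> Kk; have [_ h] := psiP k Kk; exact: h.
have psi_st k i x : K k -> shifted i.+1 x -> shifted i.+1 (act (psi k) x).
  by move=> Kk sx; rewrite (psi1 _ i) // /shifted iterK; exact: Kst.
have dec x : (exists i, shifted i.+1 x) \/ forall i, ~ shifted i.+1 x.
  have [h|nx] := pselect (exists i, shifted i.+1 x); [by left | right=> i si].
  by apply: nx; exists i.
apply: (@mitosis G A K H psi w n a sK sH KH) => //.
- by move=> k Kk; have [h1 h2] := psiP k Kk; exact: (Hclosed Kk).
- move=> k k' Kk Kk'; apply: faithful => x; rewrite actM.
  have Kkk := subgrpM sK Kk Kk'.
  have [[i si]|ns] := dec x; last by rewrite !psi2.
  have si' := psi_st k' i x Kk' si.
  by rewrite (psi1 (k * k')%g i) // (psi1 k i) // (psi1 k' i) // iterK actM.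
- move=> k k' Kk Kk'; apply: (@disjoint_supports_commute R (fun x => exists i, shifted i.+1 x)).
  + by move=> x Rx [i si]; have := @shift_disj 0%N i.+1 x Rx si.
  + by move=> x; exact: Ksupp.
  + by move=> x ns; apply: psi2 => // i si; apply: ns; exists i.
- move=> k k' Kk Kk' e; apply: faithful => x; rewrite act1.
  have [Rx|nR] := pselect (R x); last exact: Ksupp.
  by rewrite e psi2 // => i si; have := @shift_disj 0%N i.+1 x Rx si.
(* Conjugation by [w] shifts the copies by one position, which brings in [k] itself at position
   0. *)
- move=> k Kk; apply: faithful => x; rewrite !actM.
  have shw i : shifted i.+1 (act w x) = shifted i x by rewrite /shifted iterSr actK.
  have [Rx|nR] := pselect (R x).
    rewrite (psi2 k x) // => [|i si]; last by have := @shift_disj 0%N i.+1 x Rx si.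
    by rewrite (psi1 k 0%N) ?shw //= !actK.
  have [[i si]|ns] := dec x.
    have e1 : iter i.+2 (act w^-1%g) (act w x) = iter i.+1 (act w^-1%g) x.
      by rewrite iterSr actK.
    rewrite (psi1 k i.+1 (act w x)) ?shw // e1 (iterS i.+1) actK (psi1 k i x) // Ksupp //.
    move=> R'; have := @shift_disj 0%N i.+1 _ R'.
    by rewrite /shifted iterK => /(_ (Kst _ _ Kk si)).
  rewrite (psi2 k x) // Ksupp // (psi2 k (act w x)) ?actK // => i.
  by rewrite shw; case: i => [//|i]; exact: ns.
Qed.
End Displacement.
End TreeAction.

(** * Infinite sets, cones and homogeneity *)

Definition unbounded (T : eqType) (P : T -> Prop) := forall l : seq T, exists2 y, P y & y \notin l.

Lemma unbounded_enum (T : countType) (P : T -> Prop) : unbounded P ->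
  exists (f : T -> nat) (f' : nat -> T),
    (forall x, P x -> f' (f x) = x) /\ forall n, P (f' n) /\ f (f' n) = n.
Proof.
move=> uP; pose X : set T := P.
have /card_set_bijP[f [_ finj fsurj]] : (X #= @setT nat)%card.
  apply: eq_card_nat; first exact: countableP.
  move=> /finite_seqP[l lP]; have [x Px] := uP l.
  have : X x by []. 
  by rewrite lP /= => ->.
have /choice[f' f'P] n : exists x, P x /\ f x = n.
  by have [x Px <-] := fsurj n I; exists x.
exists f, f'; split=> // x Px; have [Px' e] := f'P (f x).
by apply: finj => //; rewrite inE.
Qed.

Lemma unbounded_bij (T U : countType) (P : T -> Prop) (Q : U -> Prop) :
  unbounded P -> unbounded Q -> exists (f : T -> U) (f' : U -> T),
    (forall x, P x -> Q (f x) /\ f' (f x) = x) /\ (forall y, Q y -> P (f' y) /\ f (f' y) = y).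
Proof.
move=> /unbounded_enum[f [f' [fK f'P]]] /unbounded_enum[g [g' [gK g'P]]].
exists (g' \o f), (f' \o g); split=> [x Px|y Qy] /=.
  by have [Qg ->] := g'P (f x); rewrite fK.
by have [Pf ->] := f'P (g y); rewrite gK.
Qed.

Section ConesAndHomogeneity.
Variables (T : countType) (le : T -> T -> Prop) (o : T) (G : groupType) (act : G -> T -> T).
Hypothesis ta : tree_action le o act.
Let mt := ta_tree ta.

Definition lt x y := le x y /\ x <> y.

(* [x] and [y] lie in the same component of the complement of [a], above [a]. *)
Definition cone a x y := exists z, [/\ lt a z, le z x & le z y].

Lemma lt_le_trans y x z : lt x y -> le y z -> lt x z.
Proof.
move=> [xy nxy] yz; split; first exact: (mt_trans mt xy).
by move=> e; apply: nxy; apply: (mt_anti mt) => //; rewrite e.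
Qed.

Lemma le_lt_trans y x z : le x y -> lt y z -> lt x z.
Proof.
move=> xy [yz nyz]; split; first exact: (mt_trans mt xy).
by move=> e; apply: nyz; apply: (mt_anti mt) => //; rewrite -e.
Qed.

Lemma lt_irr x : ~ lt x x. Proof. by case. Qed.

Lemma lt_nle x y : lt x y -> ~ le y x.
Proof. by move=> [xy n] yx; apply: n; exact: (mt_anti mt). Qed.

Lemma le_lt_or_eq x y : le x y -> lt x y \/ x = y.
Proof. by move=> xy; have [|n] := pselect (x = y); [right | left]. Qed.

Lemma coneC a x y : cone a x y -> cone a y x.
Proof. by move=> [z [az zx zy]]; exists z. Qed.

Lemma cone_lt a x y : cone a x y -> lt a x.
Proof. by move=> [z [az zx _]]; exact: lt_le_trans zx. Qed.

Lemma cone_le a x y : lt a x -> le x y -> cone a x y.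
Proof. by move=> ax xy; exists x; split=> //; exact: (mt_refl mt). Qed.

Lemma cone_refl a x : lt a x -> cone a x x.
Proof. by move=> ax; apply: cone_le => //; exact: (mt_refl mt). Qed.

Lemma cone_trans a y x z : cone a x y -> cone a y z -> cone a x z.
Proof.
move=> [u [au ux uy]] [v [av vy vz]].
have [uv|vu] := mt_tree mt uy vy.
  by exists u; split=> //; exact: (mt_trans mt uv).
by exists v; split=> //; exact: (mt_trans mt vu).
Qed.

Lemma lt_act g x y : act g o = o -> lt x y -> lt (act g x) (act g y).
Proof.
move=> go [xy n]; split; first exact/(le_act ta _ _ go).
by move=> /(act_inj ta).
Qed.

Lemma cone_act g a x y : act g o = o -> cone a x y -> cone (act g a) (act g x) (act g y).
Proof.
move=> go [z [az zx zy]]; exists (act g z).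
by split; [exact: lt_act | exact/(le_act ta _ _ go) | exact/(le_act ta _ _ go)].
Qed.

Lemma homogeneous (p : seq (T * T)) : (o, o) \in p ->
  (forall u v, u \in p -> v \in p -> le u.1 v.1 \/ le v.1 u.1) ->
  (forall u v, u \in p -> v \in p -> le u.1 v.1 <-> le u.2 v.2) ->
  exists g, act g o = o /\ forall u, u \in p -> act g u.1 = u.2.
Proof.
move=> op tot iso.
have [f [f' [fK fK' fle fp]]] := back_and_forth mt mt (chain_piso mt mt op tot iso).
have [g gP] := ta_realize ta fK fK' fle.
by exists g; split=> [|u up]; rewrite gP; [exact: (fp _ op) | exact: fp].
Qed.

Lemma homogeneous2 a x y : lt a x -> lt a y ->
  exists g, [/\ act g o = o, act g a = a & act g x = y].
Proof.
move=> ax ay.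
have [|||g [go gp]] := @homogeneous [:: (o, o); (a, a); (x, y)].
- exact: mem_head.
- have r := mt_root mt; have [[ax' _] [ay' _]] := (ax, ay).
  by move=> u v; rewrite !inE => /or3P[] /eqP -> /or3P[] /eqP -> /=; auto; left; exact: (mt_refl mt).
- have r := mt_root mt; have rf := mt_refl mt.
  have [[ax' _] [ay' _]] := (ax, ay).
  have ox : le x o <-> le y o.
    split=> h; [case: (lt_nle ax)|case: (lt_nle ay)]; exact: (mt_trans mt h).
  have xa : le x a <-> le y a by split=> h; [case: (lt_nle ax h)|case: (lt_nle ay h)].
  by move=> u v; rewrite !inE => /or3P[] /eqP -> /or3P[] /eqP -> /=;
     first [exact: ox | exact: xa | by split; auto].
exists g; split=> //.
  by apply: (gp (a, a)); rewrite !inE eqxx orbT.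
by apply: (gp (x, y)); rewrite !inE eqxx !orbT.
Qed.

End ConesAndHomogeneity.

(** * Star families and the permutation of cones *)

Section StarFamilies.
Variables (T : countType) (le : T -> T -> Prop) (o : T) (G : groupType) (act : G -> T -> T).
Hypothesis ta : tree_action le o act.
Let mt := ta_tree ta.
Local Notation lt := (lt le).
Local Notation cone := (cone le).

Section Families.
Variables (W : T -> Prop) (base : T -> T).

(* [W] is a union of cones; [base x] is the vertex of the cone of [x]. Each colour class
   consists of infinitely many cones with a common vertex. *)
Record star_family (Col : Type) (kap : T -> Col) : Prop := StarFamily {
  sf_base : forall x, W x -> lt (base x) x;
  sf_cone : forall x y, W x -> cone (base x) x y -> [/\ W y, base y = base x & kap y = kap x];
  sf_col : forall x y, W x -> W y -> kap x = kap y -> base x = base y;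
  sf_inf : forall x (l : seq T), W x -> exists y,
    [/\ W y, kap y = kap x & forall z, z \in l -> ~ cone (base x) z y];
  sf_le : forall x y, W x -> W y -> le x y -> base x = base y }.

Definition star_group (Col : Type) (kap : T -> Col) (g : G) :=
  (forall x, ~ W x -> act g x = x) /\ forall x, W x -> kap (act g x) = kap x.

Variables (Col : Type) (kap : T -> Col).
Hypothesis sf : star_family kap.

Lemma sf_root : ~ W o.
Proof. by move=> /(sf_base sf)/(lt_nle ta); apply; exact: (mt_root mt). Qed.

Lemma supp_W g x : (forall x, ~ W x -> act g x = x) -> W x -> W (act g x).
Proof.
move=> gW Wx; have [//|n] := pselect (W (act g x)).
by have := gW _ n => /(act_inj ta) e; rewrite e in n.
Qed.

Lemma subgrp_star : subgrp (star_group kap).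
Proof.
split=> [|g h [gW gk] [hW hk]|g [gW gk]].
- by split=> x _; rewrite (ta_1 ta).
- split=> x Wx; first by rewrite (ta_M ta) hW // gW.
  by rewrite (ta_M ta) gk ?hk //; exact: supp_W.
- have gVW x : ~ W x -> act g^-1%g x = x by move=> n; apply: (act_V ta); exact: gW.
  by split=> // x Wx; rewrite -(gk (act g^-1%g x)) ?(actVK ta) //; exact: supp_W.
Qed.

Lemma star_fix_root g : star_group kap g -> act g o = o.
Proof. by move=> [gW _]; apply: gW; exact: sf_root. Qed.

Lemma star_base g x : star_group kap g -> W x -> base (act g x) = base x.
Proof. by move=> [gW gk] Wx; apply: (sf_col sf) => //; [exact: supp_W | exact: gk]. Qed.

Lemma sf_cone_le x y : W x -> W y -> le x y -> cone (base x) x y.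
Proof. by move=> Wx Wy xy; apply: (cone_le ta) => //; exact: (sf_base sf). Qed.

Lemma sf_base_notW x : W x -> ~ W (base x).
Proof.
move=> Wx Wb; have [bx _] := sf_base sf Wx.
by have := sf_le sf Wb Wx bx => e; have := sf_base sf Wb; rewrite e; exact: lt_irr.
Qed.

Lemma sf_up x y : W x -> le x y -> W y.
Proof.
by move=> Wx xy; have [] := sf_cone sf Wx (cone_le ta (sf_base sf Wx) xy).
Qed.

Lemma sf_down x y : W x -> ~ W y -> (le y x <-> le y (base x)).
Proof.
move=> Wx nWy; have [bx nbx] := sf_base sf Wx.
split=> [yx|yb]; last exact: (mt_trans mt yb).
have [//|by_] := mt_tree mt yx bx.
have [lb|e] := le_lt_or_eq by_; last by rewrite e; exact: (mt_refl mt).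
have c : cone (base x) x y by exists y; split=> //; exact: (mt_refl mt).
by case: nWy; have [] := sf_cone sf Wx c.
Qed.

(** [pick] is applied to the cone of [x] as a predicate, hence gives the same representative for all
    points of that cone. *)
Lemma crepP : exists r : T -> T, (forall x, W x -> [/\ W (r x), cone (base x) x (r x),
     base (r x) = base x, kap (r x) = kap x & r (r x) = r x]) /\
   forall x y, W x -> W y -> base x = base y -> (r x = r y <-> cone (base x) x y).
Proof.
have [pick pickP] := picker o.
pose r x := pick (cone (base x) x).
have rP x : W x -> cone (base x) x (r x).
  move=> Wx; apply: (pickP (cone (base x) x)); exists x.
  by apply: (cone_refl ta); exact: (sf_base sf).
have rE x y : W x -> W y -> base x = base y -> cone (base x) x y -> r x = r y.
  move=> Wx Wy bxy xy; rewrite /r -bxy; congr pick; apply/funext => z; apply/propext.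
  split=> h; first exact: (cone_trans ta (coneC xy)).
  exact: (cone_trans ta xy).
have r1 x : W x -> [/\ W (r x), base (r x) = base x & kap (r x) = kap x].
  by move=> Wx; have [] := sf_cone sf Wx (rP x Wx).
exists r; split=> [x Wx|x y Wx Wy bxy].
  have [Wr br kr] := r1 x Wx; split=> //; first exact: rP.
  by apply/esym; apply: rE => //; exact: rP.
split=> [e|]; last exact: rE.
apply: (cone_trans ta (rP x Wx)); rewrite e bxy.
exact: (coneC (rP y Wy)).
Qed.

(** Cones at a common vertex are isomorphic by [homogeneous2]. Each cone is moved by one such
    element, and since comparable points of [W] lie in one cone, the pieces glue. *)
Lemma lift_perm_cones (r pi pi' : T -> T) :
  (forall x, W x -> [/\ W (r x), cone (base x) x (r x), base (r x) = base x,
     kap (r x) = kap x & r (r x) = r x]) ->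
  (forall x y, W x -> W y -> base x = base y -> (r x = r y <-> cone (base x) x y)) ->
  (forall b, W b -> r b = b ->
     [/\ W (pi b), r (pi b) = pi b, base (pi b) = base b & pi' (pi b) = b]) ->
  (forall b, W b -> r b = b ->
     [/\ W (pi' b), r (pi' b) = pi' b, base (pi' b) = base b & pi (pi' b) = b]) ->
  exists g, (forall x, ~ W x -> act g x = x) /\ (forall x, W x -> r (act g x) = pi (r x)).
Proof.
move=> rP rE piP pi'P.
have /choice[e eP] b : exists e, W b -> r b = b ->
    [/\ act e o = o, act e (base b) = base b & act e b = pi b].
  have [[Wb rb]|n] := pselect (W b /\ r b = b); last by exists 1%g => Wb rb; case: n.
  have [Wp rp bp _] := piP b Wb rb.
  have bb := sf_base sf Wb; have := sf_base sf Wp; rewrite bp => bpb.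
  by have [g [g1 g2 g3]] := homogeneous2 ta bb bpb; exists g.
pose F x := if pselect (W x) then act (e (r x)) x else x.
pose F' x := if pselect (W x) then act (e (pi' (r x)))^-1%g x else x.
have Fr x : W x -> F x = act (e (r x)) x by rewrite /F; case: pselect.
have Fn x : ~ W x -> F x = x by rewrite /F; case: pselect.
have F'r x : W x -> F' x = act (e (pi' (r x)))^-1%g x by rewrite /F'; case: pselect.
have F'n x : ~ W x -> F' x = x by rewrite /F'; case: pselect.
have FW x : W x -> [/\ W (F x), base (F x) = base x & r (F x) = pi (r x)].
  move=> Wx; have [Wr cr br _ rr] := rP x Wx.
  have [e1 e2 e3] := eP _ Wr rr; have [Wp rp bp _] := piP _ Wr rr.
  have c : cone (base (pi (r x))) (pi (r x)) (F x).
    rewrite bp br Fr // -e3 -{1}br -{1}e2 br.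
    by apply: (coneC); apply: (cone_act ta e1).
  have [WF bF _] := sf_cone sf Wp c.
  split=> //; first by rewrite bF bp.
  by rewrite -[RHS]rp; apply/esym; apply/rE; rewrite ?bF.
have F'W x : W x -> [/\ W (F' x), base (F' x) = base x & r (F' x) = pi' (r x)].
  move=> Wx; have [Wr cr br _ rr] := rP x Wx.
  have [Wp rp bp pp] := pi'P _ Wr rr.
  have [e1 e2 e3] := eP _ Wp rp.
  have c : cone (base (pi' (r x))) (pi' (r x)) (F' x).
    have e2' : act (e (pi' (r x))) (base x) = base x by rewrite -br -bp.
    have e3' : act (e (pi' (r x)))^-1%g (r x) = pi' (r x) by rewrite -{2}pp -e3 (actK ta).
    have := cone_act ta (act_V ta e1) cr.
    by rewrite (act_V ta e2') e3' bp br F'r // => /coneC.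
  have [WF bF _] := sf_cone sf Wp c.
  split=> //; first by rewrite bF bp.
  by rewrite -[RHS]rp; apply/esym; apply/rE; rewrite ?bF.
have K1 : cancel F F'.
  move=> x; have [Wx|n] := pselect (W x); last by rewrite Fn // F'n.
  have [WF bF rF] := FW x Wx; have [Wr cr br _ rr] := rP x Wx.
  have [_ _ _ pp] := piP _ Wr rr.
  by rewrite F'r // rF pp Fr // (actK ta).
have K2 : cancel F' F.
  move=> x; have [Wx|n] := pselect (W x); last by rewrite F'n // Fn.
  have [WF bF rF] := F'W x Wx.
  by rewrite Fr // rF F'r // (actVK ta).
have Fle x y : le x y <-> le (F x) (F y).
  have [Wx|nx] := pselect (W x); last first.
    rewrite (Fn x) //; have [Wy|ny] := pselect (W y); last by rewrite Fn.
    have [WF bF _] := FW y Wy.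
    by split=> /sf_down h; apply/sf_down => //; [rewrite bF | rewrite -bF]; exact: h.
  have [WF bF rF] := FW x Wx; have [Wr cr br _ rr] := rP x Wx.
  have [e1 _ _] := eP _ Wr rr.
  have [Wy|ny] := pselect (W y); last first.
    by rewrite (Fn y) //; split=> /sf_up h; case: ny; exact: h.
  have [WFy bFy rFy] := FW y Wy; have [Wry cry bry _ rry] := rP y Wy.
  split=> xy.
    have bxy := sf_le sf Wx Wy xy.
    have rxy : r x = r y by apply/rE => //; exact: sf_cone_le.
    by rewrite !Fr // -rxy; apply/(le_act ta _ _ e1).
  have bxy : base x = base y by rewrite -bF -bFy; exact: (sf_le sf).
  have : r (F x) = r (F y) by apply/rE => //; [rewrite bF bFy | exact: sf_cone_le].
  rewrite rF rFy => /(congr1 pi').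
  have [_ _ _ ->] := piP _ Wr rr; have [_ _ _ ->] := piP _ Wry rry => rxy.
  by move: xy; rewrite !Fr // -rxy => /(le_act ta _ _ e1).
have [g gP] := ta_realize ta K1 K2 Fle.
exists g; split=> [x n|x Wx]; rewrite gP; first exact: Fn.
by have [] := FW x Wx.
Qed.

End Families.
End StarFamilies.

(** * Generic two-colourings of cones *)

Section GenericColourings.
Variables (T : countType) (le : T -> T -> Prop) (o : T) (G : groupType) (act : G -> T -> T).
Hypothesis ta : tree_action le o act.
Let mt := ta_tree ta.
Local Notation lt := (lt le).
Local Notation cone := (cone le).
Variables (W : T -> Prop) (base : T -> T) (Col : Type) (kap : T -> Col).
Hypothesis sf : star_family le W base kap.

Definition ev (u : seq (T -> bool)) (x : T) : seq bool := [seq B x | B <- u].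

(** Independence: every word of bits occurs on infinitely many cones of every colour class, so
    refining the colours gives a star family again. [ge_out] normalizes colourings off [W], so that
    they are determined by their values on [W]. *)
Record generic (u : seq (T -> bool)) : Prop := Generic {
  ge_cone : forall x y, W x -> cone (base x) x y -> ev u y = ev u x;
  ge_inf : forall x (bits : seq bool) (l : seq T), W x -> size bits = size u ->
    exists y, [/\ W y, kap y = kap x, ev u y = bits & forall z, z \in l -> ~ cone (base x) z y];
  ge_out : forall x, ~ W x -> ev u x = nseq (size u) false }.

Definition refined (u : seq (T -> bool)) (x : T) : Col * seq bool := (kap x, ev u x).

Lemma generic_star u : generic u -> star_family le W base (refined u).
Proof.
move=> gu; split.
- exact: (sf_base sf).
- move=> x y Wx c; have [Wy by_ ky] := sf_cone sf Wx c.
  by rewrite /refined ky (ge_cone gu Wx c).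
- by move=> x y Wx Wy [e _]; exact: (sf_col sf).
- move=> x l Wx.
  have [|y [Wy ky ey h]] := @ge_inf _ gu x (ev u x) l Wx; first by rewrite size_map.
  by exists y; split=> //; rewrite /refined ky ey.
- exact: (sf_le sf).
Qed.

Lemma generic_nil : generic [::].
Proof.
split=> // x [|//] l Wx _; have [y [Wy ky h]] := sf_inf sf l Wx.
by exists y.
Qed.

Lemma generic_del u1 B u2 : generic (u1 ++ B :: u2) -> generic (u1 ++ u2).
Proof.
move=> gu; have evE x : ev (u1 ++ B :: u2) x = ev u1 x ++ B x :: ev u2 x.
  by rewrite /ev map_cat.
have evE' x : ev (u1 ++ u2) x = ev u1 x ++ ev u2 x by rewrite /ev map_cat.
have cut (s1 s2 t1 t2 : seq bool) b b' : size s1 = size t1 ->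
    s1 ++ b :: s2 = t1 ++ b' :: t2 -> s1 ++ s2 = t1 ++ t2.
  by move=> ss /(cat_size_inj ss)[-> [_ ->]].
split=> [x y Wx c|x bits l Wx sb|x nW].
- have := ge_cone gu Wx c; rewrite !evE !evE'; apply: cut.
  by rewrite !size_map.
- have [|y [Wy ky ey h]] := @ge_inf _ gu x (take (size u1) bits ++ true :: drop (size u1) bits) l Wx.
    rewrite size_cat in sb; rewrite !size_cat /= size_drop size_takel sb ?leq_addr //.
    by lia.
  exists y; split=> //; rewrite evE in ey.
  rewrite evE' (cut _ _ _ _ _ _ _ ey) ?cat_take_drop //.
  by rewrite size_map size_takel // sb size_cat leq_addr.
- have := ge_out gu nW; rewrite evE evE' !size_cat !nseqD /=.
  by apply: cut; rewrite size_map size_nseq.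
Qed.

Definition colact (g : G) (B : T -> bool) : T -> bool := fun x => B (act g^-1%g x).

Lemma ev_colact g u x : ev (map (colact g) u) x = ev u (act g^-1%g x).
Proof. by rewrite /ev -map_comp. Qed.

Local Notation Gam := (star_group act W kap).

Lemma generic_act g u : Gam g -> generic u -> generic (map (colact g) u).
Proof.
move=> Hg gu; have sGam := subgrp_star ta W kap.
have HgV := subgrpV sGam Hg.
have go := star_fix_root ta sf HgV.
have [gVW gVk] := HgV; have [gW gk] := Hg.
have Wg x : W x -> W (act g x) by exact: (supp_W ta gW).
have WgV x : W x -> W (act g^-1%g x) by exact: (supp_W ta gVW).
split=> [x y Wx c|x bits l Wx sb|x nW].
- have [Wy by_ _] := sf_cone sf Wx c.
  rewrite !ev_colact; apply: (ge_cone gu) => //; first exact: WgV.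
  rewrite (star_base ta sf HgV) //.
  have nb := sf_base_notW sf Wx; rewrite -(gVW (base x) nb).
  exact: (cone_act ta go).
- rewrite size_map in sb.
  have [y [Wy ky ey h]] := @ge_inf _ gu x bits [seq act g^-1%g z | z <- l] Wx sb.
  exists (act g y); split.
  + exact: Wg.
  + by rewrite gk.
  + by rewrite ev_colact (actK ta).
  + move=> z zl c; apply: (h (act g^-1%g z)); first exact: map_f.
    have := cone_act ta go c; rewrite (actK ta) gVW //.
    exact: (sf_base_notW sf Wx).
- by rewrite ev_colact size_map gVW // (ge_out gu).
Qed.

(* Enumerating all tasks (list of [L], point, prescribed colours, cones to avoid, colour)
   produces a colouring splitting every colour class of every list of [L]. *)
Lemma generic_extend (L : seq (seq (T -> bool))) : (forall u, List.In u L -> generic u) ->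
  exists B, forall u, List.In u L -> generic (B :: u).
Proof.
move=> gL.
(* The task [(i, x, bits, l, b)] asks for a cone coloured like [x], with word [bits] under the
   [i]-th list and away from the cones of [l], to receive the new bit [b]. *)
pose task : Type := (nat * T * seq bool * seq T * bool)%type.
pose valid (t : task) := let: (i, x, bits, l, b) := t in
  [/\ (i < size L)%N, W x & size bits = size (nth [::] L i)].
pose ok (t : task) (h : seq T) y := let: (i, x, bits, l, b) := t in
  [/\ W y, kap y = kap x, ev (nth [::] L i) y = bits &
    forall z, z \in l ++ h -> ~ cone (base x) z y].
have inL i : (i < size L)%N -> generic (nth [::] L i).
  move=> iL; apply: gL; elim: L i iL {valid ok} => [//|u L IH] [|i] /= iL; first by left.
  by right; exact: IH.
have /choice[c cP] (th : task * seq T) : exists y, valid th.1 -> ok th.1 th.2 y.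
  case: th => [[[[[i x] bits] l] b] h].
  have [[iL Wx sb]|n] := pselect (valid (i, x, bits, l, b)); last by exists o => /= v; case: n.
  by have [y hy] := ge_inf (inL i iL) (l ++ h) Wx sb; exists y.
pose t n : option task := unpickle n.
pose y h n := if t n is Some tk then c (tk, h) else o.
(* The answer to a valid task avoids the cones of all earlier answers, so no cone is asked to carry
   two bits. *)
pose hist := fix hist n := if n is n'.+1 then y (hist n') n' :: hist n' else [::].
pose Y n := y (hist n) n.
have Yhist m n : (m < n)%N -> Y m \in hist n.
  elim: n => // n IH; rewrite ltnS leq_eqVlt => /orP[/eqP ->|/IH h] /=.
    exact: mem_head.
  by rewrite inE h orbT.
pose on n := if t n is Some tk then valid tk /\ tk.2 = true else False.
have YP n tk : t n = Some tk -> valid tk -> ok tk (hist n) (Y n).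
  by move=> tn vt; rewrite /Y /y tn; exact: (cP (tk, hist n)).
have onW n : on n -> W (Y n).
  rewrite /on; case E: (t n) => [[[[[i x] bits] l] b]|//] [vt _].
  by have [] := YP n _ E vt.
(* Answers to tasks with [b = true] colour their cones; every other cone gets the bit false. *)
pose B x := `[< W x /\ exists n, on n /\ cone (base x) x (Y n) >].
have Bcone x z : W x -> cone (base x) x z -> B z = B x.
  move=> Wx cxz; have [Wz bz _] := sf_cone sf Wx cxz.
  apply/asbool_equiv_eq; rewrite bz; split=> -[_ [n [on_n cn]]]; split=> //; exists n; split=> //.
    exact: (cone_trans ta cxz).
  exact: (cone_trans ta (coneC cxz)).
exists B => u uL; have gu := gL u uL.
have [i iL iu] : exists2 i, (i < size L)%N & nth [::] L i = u.
  elim: L uL {gL valid ok inL c cP t y hist Y Yhist on YP onW B Bcone} => [//|v L IH] [->|/IH[i iL e]].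
    by exists 0%N.
  by exists i.+1.
split=> [x z Wx cxz|x [//|b bits] l Wx [sb]|x nW] /=.
- by rewrite (ge_cone gu Wx cxz) (Bcone x).
- pose tk : task := (i, x, bits, l, b).
  have tn : t (pickle tk) = Some tk by rewrite /t pickleK.
  have vt : valid tk by split=> //; rewrite iu.
  set n := pickle tk in tn; have [WY kY eY hY] := YP n _ tn vt.
  have bY : base (Y n) = base x by exact: (sf_col sf).
  exists (Y n); split=> //; last by move=> z zl; apply: hY; rewrite mem_cat zl.
  congr cons; last by rewrite -eY iu.
  have [bt|bf] := boolP b.
    apply/asboolP; split=> //; exists n; split; first by rewrite /on tn.
    by apply: (cone_refl ta); exact: (sf_base sf).
  apply/asboolP => -[_ [m [om cm]]].
  have WYm := onW m om.
  have [_ bm _] := sf_cone sf WY cm.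
  case: (ltngtP m n) => [mn|nm|e].
  + have := hY (Y m); rewrite mem_cat (Yhist m n mn) orbT => /(_ isT); apply.
    by rewrite -bY; exact: coneC.
  + move: om; rewrite /on; case E: (t m) => [[[[[i' x'] bits'] l'] b']|//] [vt' _].
    have [_ k' _ h'] := YP m _ E vt'; have [_ Wx' _] := vt'.
    have := h' (Y n); rewrite mem_cat (Yhist n m nm) orbT => /(_ isT); apply.
    by rewrite -(sf_col sf WYm Wx' k') bm.
  + by move: om; rewrite e /on tn => -[_ /= bt]; rewrite bt in bf.
- rewrite (ge_out gu nW) /=; congr cons.
  by apply/asboolP => -[].
Qed.

End GenericColourings.

(** * Acyclicity of the groups that permute cones *)

Section StarGroupsAcyclic.
Variables (T : countType) (le : T -> T -> Prop) (o : T) (G : groupType) (act : G -> T -> T).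
Hypothesis ta : tree_action le o act.
Let mt := ta_tree ta.
Local Notation lt := (lt le).
Local Notation cone := (cone le).
Variable A : zmodType.

Section OneFamily.
Variables (W : T -> Prop) (base : T -> T) (Col : Type) (kap : T -> Col).
Hypothesis sf : star_family le W base kap.
Local Notation Gam := (star_group act W kap).
Local Notation gen := (generic le W base kap).

Lemma colact1 B : colact act 1%g B = B.
Proof. by apply/funext => x; rewrite /colact invg1 (ta_1 ta). Qed.

Lemma colactM g h B : colact act (g * h)%g B = colact act g (colact act h B).
Proof. by apply/funext => x; rewrite /colact invgM (ta_M ta). Qed.

Lemma ev_inj (u u' : seq (T -> bool)) : size u = size u' -> ev u =1 ev u' -> u = u'.
Proof.
move=> suu' evE; apply: (@eq_from_nth _ (fun=> false)) => // i iu; apply/funext => x.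
have := congr1 (fun s => nth false s i) (evE x).
by rewrite /ev !(nth_map (fun=> false)) -?suu'.
Qed.

(** The stabilizer is a star group on the same [W] and [base] with finer colours, so an induction
    over all star families applies to it. *)
Lemma stab_colact u : gen u -> stab Gam (colact act) u = star_group act W (refined kap u).
Proof.
move=> gu; apply/funext => g; apply/propext; split=> [[[gW gk] gu']|[gW gku]].
  split=> // x Wx; rewrite /refined gk //; congr pair.
  by rewrite -[in LHS]gu' ev_colact (actK ta).
have gk x : W x -> kap (act g x) = kap x by move=> /gku[].
have sGam := subgrp_star ta W (refined kap u).
have [_ gVku] : star_group act W (refined kap u) g^-1%g by apply: (subgrpV sGam).
split; first by split.
apply: ev_inj => [|x]; rewrite ?size_map // ev_colact.
have [/gVku[]//|nW] := pselect (W x).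
by rewrite (act_V ta (gW x nW)).
Qed.

(** Corresponding refined colour classes of [u] and [u'] both consist of infinitely many cones; a
    bijection of cones, class by class, lifts to an automorphism. *)
Lemma generic_transitive u u' : gen u -> gen u' -> size u = size u' ->
  exists2 g, Gam g & map (colact act g) u = u'.
Proof.
move=> gu gu' suu'.
have [r [rP rE]] := crepP ta sf.
have r1 x : W x -> [/\ W (r x), base (r x) = base x, kap (r x) = kap x & r (r x) = r x].
  by move=> /rP[? _ ? ? ?].
have rev v : gen v -> forall x, W x -> ev v (r x) = ev v x.
  by move=> gv x Wx; have [_ c _ _ _] := rP x Wx; exact: (ge_cone gv Wx c).
pose C v (c : Col * seq bool) b := [/\ W b, r b = b & refined kap v b = c].
have Cunb v c x : gen v -> W x -> kap x = c.1 -> size c.2 = size v -> unbounded (C v c).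
  move=> gv Wx kx sc l.
  have [y [Wy ky ey h]] := ge_inf gv l Wx sc.
  have [Wr br kr rr] := r1 y Wy.
  exists (r y); first by split=> //; rewrite /refined kr ky kx rev // ey; case: (c).
  apply/negP => rl; apply: (h _ rl).
  have bxy : base x = base y by apply: (sf_col sf).
  by rewrite bxy; apply: coneC; have [] := rP y Wy.
have /choice[f fP] (c : Col * seq bool) : exists ff : (T -> T) * (T -> T),
    (forall x, C u c x -> C u' c (ff.1 x) /\ ff.2 (ff.1 x) = x) /\
    (forall y, C u' c y -> C u c (ff.2 y) /\ ff.1 (ff.2 y) = y).
  have [[x [Wx [kx sc]]]|n] := pselect (exists x, W x /\ kap x = c.1 /\ size c.2 = size u).
    have sc' : size c.2 = size u' by rewrite -suu'.
    have [f [f' [h1 h2]]] := unbounded_bij (Cunb u c x gu Wx kx sc) (Cunb u' c x gu' Wx kx sc').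
    by exists (f, f').
  exists (id, id); split=> x [Wx _ e]; case: n; exists x; split=> //; rewrite -e; split=> //=.
    by rewrite size_map.
  by rewrite size_map.
pose pi b := (f (refined kap u b)).1 b.
pose pi' b := (f (refined kap u' b)).2 b.
have piP b : W b -> r b = b -> [/\ W (pi b), r (pi b) = pi b,
    refined kap u' (pi b) = refined kap u b & pi' (pi b) = b].
  move=> Wb rb; have [h _] := fP (refined kap u b).
  have [|[W' r' e'] pp] := h b; first by split.
  by split=> //; rewrite /pi' e'.
have pi'P b : W b -> r b = b -> [/\ W (pi' b), r (pi' b) = pi' b,
    refined kap u (pi' b) = refined kap u' b & pi (pi' b) = b].
  move=> Wb rb; have [_ h] := fP (refined kap u' b).
  have [|[W' r' e'] pp] := h b; first by split.
  by split=> //; rewrite /pi e'.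
have [b Wb rb|b Wb rb|g [gW gr]] := lift_perm_cones ta sf rP rE (pi := pi) (pi' := pi').
- have [W' r' [ek _] pp] := piP b Wb rb; split=> //; exact: (sf_col sf).
- have [W' r' [ek _] pp] := pi'P b Wb rb; split=> //; exact: (sf_col sf).
have Wg x : W x -> W (act g x) by exact: (supp_W ta gW).
have key x : W x -> refined kap u' (act g x) = refined kap u x.
  move=> Wx; have [Wr br kr rr] := r1 x Wx.
  have [Wr' br' kr' rr'] := r1 _ (Wg x Wx).
  have [_ _ e _] := piP _ Wr rr.
  rewrite /refined -kr' -(rev u') //; last exact: Wg.
  rewrite gr //; have := e; rewrite /refined => ->.
  by rewrite kr rev.
exists g; first by split=> // x /key[].
have evE x : ev (map (colact act g) u) x = ev u' x.
  rewrite ev_colact; have [Wx|nW] := pselect (W x).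
    have gVW y : ~ W y -> act g^-1%g y = y by move=> n; apply: (act_V ta); exact: gW.
    have [_ <-] := key _ (supp_W ta gVW Wx).
    by rewrite (actVK ta).
  by rewrite (act_V ta (gW x nW)) (ge_out gu nW) (ge_out gu' nW) suu'.
by apply: ev_inj => //; rewrite size_map.
Qed.

(** A new colouring can be prepended to finitely many generic lists at a time, but in general no
    single one suits all lists; [local_contraction] bridges this. No invariance is required here,
    whence the empty relation. *)
Lemma generic_row_exact i : row_exact A gen i.
Proof.
pose k (B : T -> bool) (F : seq (T -> bool) -> A) u := if `[< gen (B :: u) >] then F (B :: u) else 0%R.
have [|||||||H [_ H0 HP]] := @local_contraction A (T -> bool) (T -> bool) (fun=> false) gen
    (fun _ _ => False) k.
- by move=> u1 B u2; exact: generic_del.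
- by move=> s s' [].
- by move=> F _ s s' [].
- by move=> B F _ s s' [].
- by move=> B F F' s; rewrite /k; case: asboolP; rewrite ?subrr.
- move=> B s gs; have [gB|nB] := pselect (gen (B :: s)); last first.
    by exists [::]; split=> // F F' _; rewrite /k; case: asboolP.
  exists [:: B :: s]; split=> [u [<-|//]|F F' e]; first by split.
  by rewrite /k; case: asboolP => // _; apply: e; left.
- move=> L gL; have [B BP] := generic_extend ta sf gL.
  exists B => u uL F _; have gB := BP u uL; rewrite /k.
  case: asboolP => // _ /=.
  rewrite (_ : delta (fun u => if `[< gen (B :: u) >] then F (B :: u) else 0%R) u =
    delta (fun u => F (B :: u)) u) ?subrK //.
  apply: eq_delta_del => u1 x u2 e; case: asboolP => // n; case: n.
  by apply: (@generic_del _ _ _ _ _ _ (B :: u1) x u2); rewrite /= -e.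
move=> f fc; exists (H f) => u gu su.
rewrite [LHS](HP f u) // H0 ?add0r // => v gv sv; apply: fc => //.
by rewrite sv su.
Qed.

Lemma generic_exists n : exists2 u, gen u & size u = n.
Proof.
elim: n => [|n [u gu <-]]; first by exists [::] => //; exact: generic_nil.
have [|B BP] := generic_extend ta sf (L := [:: u]); first by move=> v [<-|].
by exists (B :: u) => //; apply: BP; left.
Qed.

(** By transitivity an invariant cochain is constant on generic lists of a given length, so
    exactness is a matter of parity. *)
Lemma generic_bottom n (f : seq (T -> bool) -> A) : invV Gam (colact act) f ->
  (forall u, gen u -> size u = n.+2 -> delta f u = 0%R) ->
  exists2 b, invV Gam (colact act) b & forall u, gen u -> size u = n.+1 -> f u = delta b u.
Proof.
move=> fi fc; have [u0 gu0 su0] := generic_exists n.+1.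
have fE u : gen u -> size u = n.+1 -> f u = f u0.
  by move=> gu su; have [|g Hg <-] := generic_transitive gu0 gu; [rewrite su0 | rewrite fi].
have [v gv sv] := generic_exists n.+2.
have := fc v gv sv; rewrite (@eq_delta_del _ _ _ (fun=> f u0)).
  rewrite delta_const sv; case: ifP => on e.
    by exists (fun=> 0%R) => // u gu su; rewrite delta0 fE.
  exists (fun=> f u0) => // u gu su; rewrite delta_const su fE //.
  by move: on; rewrite /= negbK => ->.
move=> u1 B u2 ev0; apply: fE; first by apply: (@generic_del _ _ _ _ _ _ _ B); rewrite -ev0.
by move: sv; rewrite ev0 !size_cat /= addnS => -[].
Qed.


Lemma generic_half B b : gen [:: B] -> star_family le (fun x => W x /\ B x = b) base kap.
Proof.
move=> gB; split.
- by move=> x [Wx _]; exact: (sf_base sf).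
- move=> x y [Wx Bx] c; have [Wy by_ ky] := sf_cone sf Wx c.
  by have [By] := ge_cone gB Wx c; rewrite By.
- by move=> x y [Wx _] [Wy _]; exact: (sf_col sf).
- move=> x l [Wx Bx]; have [y [Wy ky [By] h]] := @ge_inf _ _ _ _ _ _ _ gB x [:: b] l Wx erefl.
  by exists y.
- by move=> x y [Wx _] [Wy _]; exact: (sf_le sf).
Qed.

Lemma generic_split B : gen [:: B] -> forall g, star_group act W (refined kap [:: B]) g <->
  exists p q, [/\ star_group act (fun x => W x /\ B x = true) kap p,
                  star_group act (fun x => W x /\ B x = false) kap q & g = (p * q)%g].
Proof.
move=> gB g; have sfr := generic_star sf gB.
have sGam := subgrp_star ta W (refined kap [:: B]).
split=> [Hg|[p [q [[pW pk] [qW qk] ->]]]].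
  have [gW gk] := Hg; have [gVW gVk] := subgrpV sGam Hg.
  have go := star_fix_root ta sfr Hg.
  have Wg x : W x -> W (act g x) by exact: (supp_W ta gW).
  have Bg x : W x -> B (act g x) = B x by move=> /gk[].
  have [|x y [Wx Bx] nRy|p [_ p1 p2]] := @restrict _ _ _ _ _ ta (fun x => W x /\ B x = true) g go.
  - move=> x; split=> [[Wx Bx]|[Wx Bx]]; first by split; [exact: Wg | rewrite Bg].
    have Wx' : W x by rewrite -(actK ta g x); exact: (supp_W ta gVW).
    by split=> //; rewrite -Bg.
  - have bg : base (act g x) = base x by exact: (star_base ta sfr Hg).
    have [Wy|nWy] := pselect (W y); last first.
      split; first by split=> /(sf_up ta sf) h; case: nWy; apply: h => //; exact: Wg.
      have h1 := sf_down ta sf Wx nWy; have h2 := sf_down ta sf (Wg x Wx) nWy.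
      by rewrite h1 h2 bg.
    have key z v : W z -> W v -> le z v -> B v = B z.
      by move=> Wz Wv zv; have [] := ge_cone gB Wz (sf_cone_le ta sf Wz Wv zv).
    have By : B y <> true by move=> By; apply: nRy.
    have Bgx := Bg x Wx; have Wgx := Wg x Wx.
    by split; split=> /key h; case: By; [rewrite h | rewrite h ?Bgx | rewrite -h | rewrite -h ?Bgx].
  exists p, (p^-1 * g)%g; split; last by rewrite mulgA mulgV mul1g.
    split=> [//|x [Wx Bx]]; rewrite p1 //; by have [] := gk x Wx.
  split=> [x nx|x [Wx Bx]].
    rewrite (ta_M ta); have [Wx|nW] := pselect (W x).
      case Bx: (B x); last by case: nx.
      by rewrite -p1 ?(actK ta).
    by rewrite gW // (act_V ta) // p2 // => -[].
  rewrite (ta_M ta) (act_V ta); first by have [] := gk x Wx.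
  by apply: p2 => -[_]; rewrite Bg // Bx.
have Bp x : W x /\ B x = true -> W (act p x) /\ B (act p x) = true.
  exact: (@supp_W _ _ _ _ _ ta (fun x => W x /\ B x = true) p x pW).
have Bq x : W x /\ B x = false -> W (act q x) /\ B (act q x) = false.
  exact: (@supp_W _ _ _ _ _ ta (fun x => W x /\ B x = false) q x qW).
split=> [x nW|x Wx]; first by rewrite (ta_M ta) qW ?pW // => -[].
rewrite /refined (ta_M ta) /=; case E: (B x).
  by rewrite qW ?E => [|[]//]; rewrite (pk x) //; have [_ ->] := Bp x (conj Wx E).
have [W' B'] := Bq x (conj Wx E).
by rewrite pW ?B' => [|[_]]; rewrite ?B' // qk.
Qed.

(** The cones of a colour are laid out in [int * nat]: the half with bit [b] fills row 0 and the
    other half fills all other rows. Then [w] moves every row to the next one, and [L] reads the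
    row. *)
Lemma half_displaced B b : gen [:: B] -> exists2 w, Gam w & exists L : T -> int,
  (forall x, W x -> L (act w x) = (L x + 1)%R) /\ forall x, W x -> B x = b -> L x = 0%R.
Proof.
move=> gB; have [r [rP rE]] := crepP ta sf.
have r1 x : W x -> [/\ W (r x), base (r x) = base x, kap (r x) = kap x & r (r x) = r x].
  by move=> /rP[? _ ? ? ?].
have rB x : W x -> B (r x) = B x.
  by move=> Wx; have [_ c _ _ _] := rP x Wx; have [] := ge_cone gB Wx c.
pose C c x := [/\ W x, r x = x & kap x = c].
have Cunb c x b' : W x -> kap x = c -> unbounded (fun y => C c y /\ B y = b').
  move=> Wx kx l; have [y [Wy ky [By] h]] := @ge_inf _ _ _ _ _ _ _ gB x [:: b'] l Wx erefl.
  have [Wr br kr rr] := r1 y Wy.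
  exists (r y); first by split; [split=> //; rewrite kr ky | rewrite rB].
  apply/negP => rl; apply: (h _ rl).
  have bxy : base x = base y by apply: (sf_col sf).
  by rewrite bxy; apply: coneC; have [] := rP y Wy.
have U0 : unbounded (fun p : int * nat => p.1 = 0%R).
  move=> l; exists (0%R, (\max_(p <- l) p.2).+1) => //.
  apply/negP => h; have := @leq_bigmax_seq _ l xpredT (fun p => p.2) _ h isT.
  by rewrite ltnn.
have U1 : unbounded (fun p : int * nat => p.1 <> 0%R).
  move=> l; exists (1%R, (\max_(p <- l) p.2).+1) => //.
  apply/negP => h; have := @leq_bigmax_seq _ l xpredT (fun p => p.2) _ h isT.
  by rewrite ltnn.
have /choice[f fP] c : exists ff : (T -> int * nat) * (int * nat -> T), (exists2 x, W x & kap x = c) ->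
    [/\ forall x, C c x -> ff.2 (ff.1 x) = x, forall p, C c (ff.2 p) /\ ff.1 (ff.2 p) = p &
      forall x, C c x -> B x = b -> (ff.1 x).1 = 0%R].
  have [[x Wx kx]|n] := pselect (exists2 x, W x & kap x = c); last first.
    by exists (fun=> (0%R, 0%N), fun=> o) => h; case: n.
  have [f [f' [fK f'K]]] := unbounded_bij (Cunb c x b Wx kx) U0.
  have [g [g' [gK g'K]]] := unbounded_bij (Cunb c x (~~ b) Wx kx) U1.
  exists ((fun y => if B y == b then f y else g y), (fun p => if p.1 == 0%R then f' p else g' p)) => _ /=.
  split=> [y Cy|p|y Cy e]; last by rewrite e eqxx; have [] := fK y (conj Cy e).
    have [e|ne] := eqVneq (B y) b; first by have [-> ->] := fK y (conj Cy e); rewrite eqxx.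
    have e : B y = ~~ b by move: ne; case: (B y); case: (b).
    by have [h ->] := gK y (conj Cy e); rewrite (introF eqP h).
  case: eqP => [e|e].
    by have [[h1 h2] h3] := f'K p e; rewrite h2 eqxx.
  by have [[h1 h2] h3] := g'K p e; rewrite h2 (_ : (~~ b == b) = false) //; case: (b).
pose pi (s : int) x := (f (kap x)).2 ((((f (kap x)).1 x).1 + s)%R, ((f (kap x)).1 x).2).
have piP s x : W x -> r x = x -> [/\ W (pi s x), r (pi s x) = pi s x, base (pi s x) = base x,
    (f (kap x)).1 (pi s x) = ((((f (kap x)).1 x).1 + s)%R, ((f (kap x)).1 x).2) & kap (pi s x) = kap x].
  move=> Wx rx; have [|f1 f2 f3] := fP (kap x); first by exists x.
  have [[W' r' k'] e] := f2 ((((f (kap x)).1 x).1 + s)%R, ((f (kap x)).1 x).2).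
  by split=> //; exact: (sf_col sf).
have piK s s' x : (s + s' = 0)%R -> W x -> r x = x -> pi s' (pi s x) = x.
  move=> ss Wx rx; have [W' r' b' e k'] := piP s x Wx rx.
  rewrite {1}/pi k' e /= -addrA ss addr0 -surjective_pairing.
  by have [|f1 _ _] := fP (kap x); [exists x | rewrite f1].
have [x Wx rx|x Wx rx|w [wW wr]] := lift_perm_cones ta sf rP rE (pi := pi 1%R) (pi' := pi (-1)%R).
- by have [? ? ? _ _] := piP 1%R x Wx rx; split=> //; apply: piK.
- by have [? ? ? _ _] := piP (-1)%R x Wx rx; split=> //; apply: piK.
have Ww x : W x -> W (act w x) by exact: (supp_W ta wW).
have kw x : W x -> kap (act w x) = kap x.
  move=> Wx; have [Wr br kr rr] := r1 x Wx; have [Wr' br' kr' rr'] := r1 _ (Ww x Wx).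
  by have [_ _ _ _ e] := piP 1%R _ Wr rr; rewrite -kr' wr // e kr.
exists w; first by split.
exists (fun x => ((f (kap x)).1 (r x)).1); split=> [x Wx|x Wx Bx].
  have [Wr br kr rr] := r1 x Wx; rewrite kw // wr //.
  by have [_ _ _ e _] := piP 1%R _ Wr rr; rewrite -kr e.
have [Wr br kr rr] := r1 x Wx.
have [|_ _ ->] // := fP (kap x); first by exists x.
by rewrite rB.
Qed.

(** The row function of [half_displaced] separates the translates of the half under the powers of
    [w], so the half is displaced inside the full star group. *)
Lemma star_half_cobound B b n (a : seq G -> A) : gen [:: B] ->
  (forall j, (0 < j <= n)%N -> exact A (star_group act (fun x => W x /\ B x = b) kap) j) ->
  inv_under Gam a -> cocycle a n.+1 ->
  cobound (star_group act (fun x => W x /\ B x = b) kap) a n.+1.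
Proof.
move=> gB eK ai ac; have [w Hw [L [Lw L0]]] := half_displaced b gB.
have sGam := subgrp_star ta W kap.
have [wW wk] := Hw; have [wVW wVk] := subgrpV sGam Hw.
have Ww x : W x -> W (act w x) by exact: (supp_W ta wW).
have WwV x : W x -> W (act w^-1%g x) by exact: (supp_W ta wVW).
pose R x := W x /\ B x = b.
have shL i x : shifted act R w i x -> W x /\ L x = Posz i.
  elim: i x => [|i IH] x; first by move=> [Wx Bx]; rewrite L0.
  rewrite /shifted iterSr => /IH[W' L']; rewrite -(actVK ta w x); split; first exact: Ww.
  by rewrite Lw // L' -addn1 PoszD.
have KH k : star_group act R kap k -> Gam k.
  move=> [kW kk]; split=> [x nW|x Wx]; first by apply: kW => -[].
  have [Rx|nR] := pselect (R x); first exact: kk.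
  by rewrite kW.
apply: (displaced_cobound ta (R := R) (w := w) (subgrp_star ta R kap) sGam KH _ _ Hw _ _ eK ai ac).
- by move=> g; exact: (star_fix_root ta sf).
- by move=> k x [kW _]; exact: kW.
- by move=> i j x /shL[_ e] /shL[_]; rewrite e => -[].
have iterw i (e : G) x : (forall y, W y -> W (act e y)) -> (forall y, W y -> kap (act e y) = kap y) ->
    W x -> W (iter i (act e) x) /\ kap (iter i (act e) x) = kap x.
  move=> eW ek Wx; elim: i => [//|i [IH1 IH2]] /=.
  by split; [exact: eW | rewrite ek].
move=> k g Kk g1 g2; have [kW kk] := KH k Kk; split=> [x nW|x Wx].
  by apply: g2 => i /shL[].
have [[i si]|n'] := pselect (exists i, shifted act R w i.+1 x); last first.
  by rewrite g2 // => i si; apply: n'; exists i.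
rewrite (g1 i) //.
have [W1 k1] := iterw i.+1 w^-1%g x WwV wVk Wx.
have W2 : W (act k (iter i.+1 (act w^-1%g) x)) by exact: (supp_W ta kW).
by have [_ ->] := iterw i.+1 w _ Ww wk W2; rewrite kk.
Qed.

End OneFamily.

(** The induction runs over all families and colour types at once, since stabilizers refine the
    colours. The stabilizer of a single colouring is a product of two halves, each displaceable in
    the whole group; longer lists involve lower degrees only. *)
Theorem star_group_exact n (W : T -> Prop) (base : T -> T) (Col : Type) (kap : T -> Col) :
  star_family le W base kap -> forall j, (0 < j <= n)%N -> exact A (star_group act W kap) j.
Proof.
elim: n W base Col kap => [|n IH] W base Col kap sf j; first by case: j.
rewrite [X in _ && X]leq_eqVlt ltnS => /andP[j0 /orP[/eqP ej|jn]]; last by apply: (IH W base) => //; rewrite j0.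
rewrite {}ej => a ai ac {j j0}; have sGam := subgrp_star ta W kap.
have [u0 gu0 su0] := generic_exists sf 1%N.
case: u0 gu0 su0 => [//|B [|//]] gB _.
apply: (equivariant_vanishing sGam (act := colact act) (Y := generic le W base kap) _ _ _ _ ai gB) => //.
- exact: colact1.
- by move=> g h B' _ _; exact: colactM.
- by move=> u1 x u2; exact: generic_del.
- by move=> g u Hg; exact: (generic_act ta sf).
- by move=> i _; exact: (generic_row_exact sf).
- move=> [//|B' [|//]] gB' _; rewrite (stab_colact gB').
  have stb b := generic_half sf b gB'.
  have eb b : forall j, (0 < j <= n)%N -> exact A (star_group act (fun x => W x /\ B' x = b) kap) j.
    exact: IH (stb b).
  have KH b k : star_group act (fun x => W x /\ B' x = b) kap k ->
      star_group act W kap k.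
    move=> [kW kk]; split=> [x nW|x Wx]; first by apply: kW => -[].
    have [Rx|nR] := pselect (W x /\ B' x = b); first exact: kk.
    by rewrite kW.
  apply: (kunneth (subgrp_star ta _ kap) (subgrp_star ta _ kap) _ _ (generic_split sf gB')
            (eb true)) => //.
  + move=> p q [pW _] [qW _].
    apply: (disjoint_supports_commute ta (R := fun x => W x /\ B' x = true)
      (R' := fun x => W x /\ B' x = false)) => //.
    by move=> x [_ ->] [].
  + move=> g [pW _] [qW _]; apply: (ta_faithful ta) => x; rewrite (ta_1 ta).
    by have [[_ Bx]|n'] := pselect (W x /\ B' x = true); [apply: qW; rewrite Bx => -[] | apply: pW].
  + apply: inv_sub ai => g [gW gk]; split=> // x /gk; by case.
  + exact: (star_half_cobound sf gB' (eb true)).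
  + exact: (star_half_cobound sf gB' (eb false)).
- move=> u i gu _ i0; rewrite (stab_colact gu); exact: IH (generic_star sf gu) i i0.
- move=> f fi fc; exact: (generic_bottom sf fi fc).
Qed.

End StarGroupsAcyclic.

(** * Intervals of the tree and bi-infinite sequences in them *)

Lemma int_step (X : Type) (lt : X -> X -> Prop) (s : int -> X) :
  (forall x y z, lt x y -> lt y z -> lt x z) ->
  (forall z, lt (s z) (s (z + 1)%R)) -> forall i j, (i < j)%R -> lt (s i) (s j).
Proof.
move=> tr st i j ij.
have [k ->] : exists k : nat, j = (i + k.+1%:R)%R by exists (`|j - i|.-1)%N; lia.
elim: k => [|k IH]; first exact: st.
by rewrite -addn1 natrD addrA; exact: tr IH (st _).
Qed.

Lemma int_seq (X : Type) (x0 : X) (Q : X -> Prop) (U D : nat -> X -> X -> Prop) : Q x0 ->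
  (forall k x, Q x -> exists2 y, Q y & U k x y) ->
  (forall k x, Q x -> exists2 y, Q y & D k y x) ->
  exists s : int -> X, [/\ forall z, Q (s z), forall k : nat, U k (s k) (s k.+1) &
    forall k : nat, D k (s (- k.+1%:R)%R) (s (- k%:R)%R)].
Proof.
move=> Q0 hU hD.
have /choice[u uP] (kx : nat * X) : exists y, Q kx.2 -> Q y /\ U kx.1 kx.2 y.
  have [Qx|n] := pselect (Q kx.2); last by exists x0.
  by have [y] := hU kx.1 _ Qx; exists y.
have /choice[d dP] (kx : nat * X) : exists y, Q kx.2 -> Q y /\ D kx.1 y kx.2.
  have [Qx|n] := pselect (Q kx.2); last by exists x0.
  by have [y] := hD kx.1 _ Qx; exists y.
pose up := fix up n := if n is n'.+1 then u (n', up n') else x0.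
pose dn := fix dn n := if n is n'.+1 then d (n', dn n') else x0.
have Qu n : Q (up n) by elim: n => //= n IH; have [] := uP (n, up n) IH.
have Qd n : Q (dn n) by elim: n => //= n IH; have [] := dP (n, dn n) IH.
exists (fun z => match z with Posz n => up n | Negz n => dn n.+1 end); split.
- by case.
- by move=> k; have [] := uP (k, up k) (Qu k).
- move=> k; have -> : (- k.+1%:R)%R = Negz k by lia.
  have [] := dP (k, dn k) (Qd k).
  case: k => [|k]; first by [].
  by have -> : (- k.+1%:R)%R = Negz k by lia.
Qed.

Section Pieces.
Variables (T : countType) (le : T -> T -> Prop) (o : T) (G : groupType) (act : G -> T -> T).
Hypothesis ta : tree_action le o act.
Let mt := ta_tree ta.
Local Notation lt := (lt le).
Local Notation cone := (cone le).

Lemma lt_trans y x z : lt x y -> lt y z -> lt x z.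
Proof. by move=> xy [yz _]; exact: (lt_le_trans ta xy yz). Qed.

Lemma homogeneous_path (p : seq (T * T)) :
  path (fun u v => `[< lt u.1 v.1 /\ lt u.2 v.2 >]) (o, o) p ->
  exists g, act g o = o /\ forall u, u \in p -> act g u.1 = u.2.
Proof.
set R := fun u v => _ => pp.
have Rtr : transitive R.
  move=> v u w /asboolP[h1 h2] /asboolP[h3 h4]; apply/asboolP.
  by split; [exact: lt_trans h3 | exact: lt_trans h4].
have tri : forall u v, u \in (o, o) :: p -> v \in (o, o) :: p -> [\/ u = v, R u v | R v u].
  elim: p (o, o) pp => [|w p IH] x /=.
    by move=> _ u v; rewrite !inE => /eqP -> /eqP ->; constructor.
  move=> /andP[xw wp] u v.
  have h : all (R x) (w :: p) by apply: (order_path_min Rtr); rewrite /= xw.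
  rewrite 2!(in_cons x) => /orP[/eqP ->|up] /orP[/eqP ->|vp]; first by constructor.
  - by constructor 2; exact: (allP h).
  - by constructor 3; exact: (allP h).
  - exact: (IH w).
have rf := mt_refl mt.
have [|||g [go gp]] := @homogeneous _ _ _ _ _ ta ((o, o) :: p).
- exact: mem_head.
- move=> u v up vp; have [->|/asboolP[[uv _] _]|/asboolP[[uv _] _]] := tri u v up vp.
  + by left.
  + by left.
  + by right.
- move=> u v up vp; have [->|/asboolP[[uv _] [uv' _]]|/asboolP[h1 h2]] := tri u v up vp.
  + by split.
  + by split.
  + by split=> h; [case: (lt_nle ta h1 h) | case: (lt_nle ta h2 h)].
by exists g; split=> // u up; apply: gp; rewrite inE up orbT.
Qed.

Lemma chain_max (l : seq T) b : l != [::] -> (forall x, x \in l -> le x b) ->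
  exists2 m, m \in l & forall x, x \in l -> le x m.
Proof.
elim: l => [//|x l IH] _ lb; have [l0|ln] := eqVneq l [::].
  by exists x; rewrite ?mem_head // l0 => y; rewrite inE => /eqP ->; exact: (mt_refl mt).
have [|m ml mm] := IH ln; first by move=> y yl; apply: lb; rewrite inE yl orbT.
have [xm|mx] : le x m \/ le m x.
  by apply: (mt_tree mt (z := b)); apply: lb; rewrite inE ?eqxx ?ml ?orbT.
  by exists m => [|y]; rewrite inE ?ml ?orbT // => /orP[/eqP ->|/mm].
exists x => [|y]; rewrite inE ?eqxx // => /orP[/eqP ->|/mm h]; first exact: (mt_refl mt).
exact: (mt_trans mt h).
Qed.

Lemma chain_min (l : seq T) b : l != [::] -> (forall x, x \in l -> le x b) ->
  exists2 m, m \in l & forall x, x \in l -> le m x.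
Proof.
elim: l => [//|x l IH] _ lb; have [l0|ln] := eqVneq l [::].
  by exists x; rewrite ?mem_head // l0 => y; rewrite inE => /eqP ->; exact: (mt_refl mt).
have [|m ml mm] := IH ln; first by move=> y yl; apply: lb; rewrite inE yl orbT.
have [mx|xm] : le m x \/ le x m.
  by apply: (mt_tree mt (z := b)); apply: lb; rewrite inE ?eqxx ?ml ?orbT.
  by exists m => [|y]; rewrite inE ?ml ?orbT // => /orP[/eqP ->|/mm].
exists x => [|y]; rewrite inE ?eqxx // => /orP[/eqP ->|/mm h]; first exact: (mt_refl mt).
exact: (mt_trans mt xm).
Qed.

(* The points whose projection to the segment from [p.1] to [p.2] is an interior point. *)
Definition piece (p : T * T) y := cone p.1 y p.2 /\ ~ le p.2 y.
Definition axis (p : T * T) y := lt p.1 y /\ lt y p.2.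

Lemma lt_dense a b : lt a b -> exists c, axis (a, b) c.
Proof.
move=> [ab nab]; have [z [az zb na nb]] := mt_dense mt ab nab.
by exists z; split; split=> // e; apply: na.
Qed.

Lemma axis_piece p y : axis p y -> piece p y.
Proof.
move=> [py yp]; split; last exact: (lt_nle ta).
by exists y; split=> //; [exact: (mt_refl mt) | case: yp].
Qed.

Lemma piece_lt p y : piece p y -> lt p.1 y.
Proof. by move=> [c _]; exact: (cone_lt ta c). Qed.

Lemma piece_root p : ~ piece p o.
Proof. by move=> /piece_lt/(lt_nle ta); apply; exact: (mt_root mt). Qed.

(** A piece is attached to the rest of the tree at its two ends, so comparisons with outside points
    are decided there. Automorphisms fixing both ends can therefore be cut off outside the piece. *)
Lemma piece_up p x y : piece p x -> ~ piece p y -> (le x y <-> le x p.2 /\ le p.2 y).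
Proof.
move=> [c n] np; split=> [xy|[xp py]]; last exact: (mt_trans mt xp).
have py : le p.2 y.
  have [//|ny] := pselect (le p.2 y); case: np; split=> //.
  exact: (cone_trans ta (coneC (cone_le ta (cone_lt ta c) xy)) c).
by split=> //; have [|/n] := mt_tree mt xy py.
Qed.

Lemma piece_down p x y : piece p x -> ~ piece p y -> (le y x <-> le y p.1).
Proof.
move=> [c n] np; have [px _] := cone_lt ta c.
split=> [yx|yp]; last exact: (mt_trans mt yp).
have [//|py] := mt_tree mt yx px.
have [ly|->] := le_lt_or_eq py; last exact: (mt_refl mt).
case: np; split; first exact: (cone_trans ta (cone_le ta ly yx)).
by move=> /(mt_trans mt) h; apply: n; exact: h.
Qed.

Lemma sub_piece p q x : le p.1 q.1 -> le q.2 p.2 -> piece q x -> piece p x.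
Proof.
move=> pq qp [[z [qz zx zq]] n]; split.
  by exists z; split=> //; [exact: (le_lt_trans ta pq) | exact: (mt_trans mt zq)].
by move=> /(mt_trans mt qp).
Qed.

Lemma piece_disj p q x : le p.2 q.1 -> piece p x -> piece q x -> False.
Proof.
move=> pq [_ n] /piece_lt[qx _]; apply: n.
exact: (mt_trans mt pq).
Qed.

Lemma piece_foot p x : piece p x ->
  exists c, [/\ axis p c, le c x & forall z, le z x -> le z p.2 -> le z c].
Proof.
move=> [[z [pz zx zp]] n]; have [c [cx cp cm]] := mt_meet mt x p.2.
exists c; split=> //; split; first exact: (lt_le_trans ta pz (cm _ zx zp)).
by split=> // e; apply: n; rewrite -e.
Qed.

Lemma piece_act g p x : act g o = o -> (piece (act g p.1, act g p.2) (act g x) <-> piece p x).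
Proof.
move=> go; have goV := act_V ta go; split=> -[c n]; split.
- by have := cone_act ta goV c; rewrite !(actK ta).
- by move=> h; apply: n; apply/(le_act ta _ _ go).
- exact: (cone_act ta go c).
- by move=> /(le_act ta _ _ go).
Qed.

Lemma piece_inv g p x : act g o = o -> act g p.1 = p.1 -> act g p.2 = p.2 ->
  (piece p (act g x) <-> piece p x).
Proof. by move=> go g1 g2; have := piece_act p x go; rewrite g1 g2 -surjective_pairing. Qed.

Lemma piece_local p g : act g o = o -> act g p.1 = p.1 -> act g p.2 = p.2 ->
  exists h, [/\ act h o = o, forall x, piece p x -> act h x = act g x &
    forall x, ~ piece p x -> act h x = x].
Proof.
move=> go g1 g2; apply: (restrict ta) => // [x|x y px npy].
  exact: (iff_sym (piece_inv x go g1 g2)).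
have px' : piece p (act g x) by apply/piece_inv.
have h1 := piece_up px npy; have h2 := piece_up px' npy.
have h3 := piece_down px npy; have h4 := piece_down px' npy.
have e : le (act g x) p.2 <-> le x p.2 by have := le_act ta x p.2 go; rewrite g2.
by rewrite h1 h2 h3 h4 e.
Qed.

Record bichain (p : T * T) (s : int -> T) : Prop := Bichain {
  bc_lt : forall z, lt (s z) (s (z + 1)%R);
  bc_axis : forall z, axis p (s z);
  bc_coinit : forall x, axis p x -> exists z, le (s z) x;
  bc_cofin : forall x, axis p x -> exists z, le x (s z) }.

Lemma bichain_lt p s i j : bichain p s -> (i < j)%R -> lt (s i) (s j).
Proof. by move=> bs; apply: int_step; [move=> x y z; exact: lt_trans | exact: (bc_lt bs)]. Qed.

Lemma bichain_le p s i j : bichain p s -> (i <= j)%R -> le (s i) (s j).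
Proof.
move=> bs; rewrite le_eqVlt => /orP[/eqP ->|/(bichain_lt bs)[]//]; exact: (mt_refl mt).
Qed.

Lemma bichain_ltE p s i j : bichain p s -> lt (s i) (s j) -> (i < j)%R.
Proof.
move=> bs sij; rewrite ltNge; apply/negP => /(bichain_le bs) h.
exact: (lt_nle ta sij h).
Qed.

(** The [k]-th step upwards or downwards also passes the [k]-th point of an enumeration of the tree
    whenever that point is on the axis; this gives cofinality at both ends. *)
Lemma bichain_exists p : lt p.1 p.2 -> exists s, bichain p s.
Proof.
case: p => a b /= ab; have [c0 c0P] := lt_dense ab.
pose e n : T := odflt o (unpickle n).
have [|k x [ax xb]|k x [ax xb]|s [sQ sU sD]] := @int_seq T c0 (axis (a, b))
    (fun k x y => lt x y /\ (axis (a, b) (e k) -> le (e k) y))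
    (fun k y x => lt y x /\ (axis (a, b) (e k) -> le y (e k))) => //.
- have [y0 [/= xy y0b]] := lt_dense xb; have ay0 := lt_trans ax xy.
  have [[ae eb]|n] := pselect (axis (a, b) (e k)); last by exists y0.
  have [|y0e|ey0] := mt_tree mt (x := y0) (y := e k) (z := b) (proj1 y0b).
  + exact: (proj1 eb).
  + exists (e k); first by [].
    by split=> [|_]; [exact: (lt_le_trans ta xy y0e) | exact: (mt_refl mt)].
  + by exists y0.
- have [y0 [/= ay y0x]] := lt_dense ax; have y0b := lt_trans y0x xb.
  have [[ae eb]|n] := pselect (axis (a, b) (e k)); last by exists y0.
  have [|y0e|ey0] := mt_tree mt (x := y0) (y := e k) (z := b) (proj1 y0b).
  + exact: (proj1 eb).
  + by exists y0.
  + exists (e k); first by [].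
    by split=> [|_]; [exact: (le_lt_trans ta ey0 y0x) | exact: (mt_refl mt)].
exists s; split=> // [z|x xax|x xax].
- case: z => k; first by have [] := sU k; rewrite -[k.+1]addn1 PoszD.
  have -> : (Negz k + 1 = - k%:R)%R by lia.
  by (have -> : (Negz k = - k.+1%:R)%R by lia); have [] := sD k.
- have [_ h] := sD (pickle x); exists (- (pickle x).+1%:R)%R.
  by move: h; rewrite /e pickleK; apply.
- have [_ h] := sU (pickle x); exists (pickle x).+1.
  by move: h; rewrite /e pickleK; apply.
Qed.

(** The slab of [x] is found from its foot on the axis, which lies between two terms of the
    sequence. *)
Lemma bichain_slab p s x : bichain p s -> piece p x ->
  exists z, le (s z) x /\ ~ le (s (z + 1)%R) x.
Proof.
move=> bs px; have [c [cax cx cm]] := piece_foot px.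
have [i ic] := bc_coinit bs cax; have [j cj] := bc_cofin bs cax.
have ix : le (s i) x by exact: (mt_trans mt ic).
have nj : ~ le (s (j + 1)%R) x.
  move=> h; have [_ [jp _]] := bc_axis bs (j + 1)%R.
  have := cm _ h jp; move=> /(mt_trans mt) /(_ cj).
  exact: (lt_nle ta (bc_lt bs j)).
have ij : (i < j + 1)%R.
  rewrite ltNge; apply/negP => /(bichain_le bs) h; apply: nj.
  exact: (mt_trans mt h).
have ex : exists k : nat, `[< ~ le (s (i + k%:R)%R) x >].
  exists (absz (j + 1 - i)%R); apply/asboolP.
  by have -> : (i + (absz (j + 1 - i)%R)%:R = j + 1)%R by lia.
case: (ex_minnP ex) => -[|k] /asboolP nk kmin; first by rewrite addr0 in nk.
exists (i + k%:R)%R; split; last by rewrite -addrA -natr1 in nk *.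
have [//|n] := pselect (le (s (i + k%:R)%R) x).
by have := kmin k (asboolT n); rewrite ltnn.
Qed.

Lemma slab_uniq p s x z z' : bichain p s -> le (s z) x -> ~ le (s (z + 1)%R) x ->
  le (s z') x -> ~ le (s (z' + 1)%R) x -> z = z'.
Proof.
move=> bs h1 h2 h3 h4.
case: (ltrgtP z z') => // zz; [case: h2|case: h4].
- by apply: (mt_trans mt (bichain_le bs _) h3); lia.
- by apply: (mt_trans mt (bichain_le bs _) h1); lia.
Qed.

Lemma slab_piece p s x z : bichain p s -> le (s z) x -> ~ le (s (z + 1)%R) x -> piece p x.
Proof.
move=> bs h1 h2; have [ps sp] := bc_axis bs z; have [_ [sp1 _]] := bc_axis bs (z + 1)%R.
split; last by move=> /(mt_trans mt sp1).
by exists (s z); split=> //; case: sp.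
Qed.

(* Gluing automorphisms that carry consecutive slabs onto consecutive slabs. *)
Lemma slide p s s' : bichain p s -> bichain p s' -> exists g,
  [/\ act g o = o, forall x, ~ piece p x -> act g x = x & forall z, act g (s z) = s' z].
Proof.
have hom u u' (bu : bichain p u) (bu' : bichain p u') z : exists h,
    [/\ act h o = o, act h (u z) = u' z & act h (u (z + 1)%R) = u' (z + 1)%R].
  have o1 v : bichain p v -> lt o (v z).
    by move=> bv; have [h _] := bc_axis bv z; exact: (le_lt_trans ta (mt_root mt _) h).
  have [|g [go gP]] := @homogeneous_path [:: (u z, u' z); (u (z + 1)%R, u' (z + 1)%R)].
    rewrite /= andbT; apply/andP; split; apply/asboolP; split; try exact: o1.
      exact: (bc_lt bu).
    exact: (bc_lt bu').
  exists g; split=> //; first by apply: (gP (_, _)); rewrite mem_head.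
  by apply: (gP (_, _)); rewrite !inE eqxx orbT.
move=> bs bs'.
have /choice[h hP] z := hom s s' bs bs' z.
have /choice[sl slP] (vx : bool * T) : exists z : int, piece p vx.2 ->
    let v := if vx.1 then s else s' in le (v z) vx.2 /\ ~ le (v (z + 1)%R) vx.2.
  have [px|n] := pselect (piece p vx.2); last by exists 0%R.
  have [|z zP] := @bichain_slab p (if vx.1 then s else s') vx.2 _ px; first by case: vx.1.
  by exists z.
(* Each slab is moved by its own element [h z]. Consecutive elements agree at the common end of
   their slabs, so comparisons across slabs survive. *)
pose F x := if pselect (piece p x) then act (h (sl (true, x))) x else x.
pose F' x := if pselect (piece p x) then act (h (sl (false, x)))^-1%g x else x.
have Fn x : ~ piece p x -> F x = x by rewrite /F; case: pselect.
have F'n x : ~ piece p x -> F' x = x by rewrite /F'; case: pselect.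
have sE z x : le (s z) x -> ~ le (s (z + 1)%R) x -> F x = act (h z) x.
  move=> h1 h2; have px := slab_piece bs h1 h2.
  have [h3 h4] := slP (true, x) px.
  by rewrite /F; case: pselect => //= _; rewrite (slab_uniq bs h3 h4 h1 h2).
have s'E z x : le (s' z) x -> ~ le (s' (z + 1)%R) x -> F' x = act (h z)^-1%g x.
  move=> h1 h2; have px := slab_piece bs' h1 h2.
  have [h3 h4] := slP (false, x) px.
  by rewrite /F'; case: pselect => //= _; rewrite (slab_uniq bs' h3 h4 h1 h2).
have hs z x : le (s z) x -> ~ le (s (z + 1)%R) x ->
    le (s' z) (act (h z) x) /\ ~ le (s' (z + 1)%R) (act (h z) x).
  move=> h1 h2; have [ho e1 e2] := hP z; rewrite -e1 -e2; split.
    exact/(le_act ta _ _ ho).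
  by move=> /(le_act ta _ _ ho).
have hs' z x : le (s' z) x -> ~ le (s' (z + 1)%R) x ->
    le (s z) (act (h z)^-1%g x) /\ ~ le (s (z + 1)%R) (act (h z)^-1%g x).
  move=> h1 h2; have [ho e1 e2] := hP z; rewrite -{1}(actK ta (h z) (s z)) -(actK ta (h z) (s (z + 1)%R)) e1 e2.
  have hVo := act_V ta ho; split; first exact/(le_act ta _ _ hVo).
  by move=> /(le_act ta _ _ hVo).
have K1 : cancel F F'.
  move=> x; have [px|n] := pselect (piece p x); last by rewrite Fn // F'n.
  have [z [h1 h2]] := bichain_slab bs px; have [h3 h4] := hs z x h1 h2.
  by rewrite (sE z) // (s'E z) // (actK ta).
have K2 : cancel F' F.
  move=> x; have [px|n] := pselect (piece p x); last by rewrite F'n // Fn.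
  have [z [h1 h2]] := bichain_slab bs' px; have [h3 h4] := hs' z x h1 h2.
  by rewrite (s'E z) // (sE z) // (actVK ta).
have up v z x : bichain p v -> le (v z) x -> ~ le (v (z + 1)%R) x -> forall y, le (v (z + 1)%R) y ->
    (le x y <-> le x (v (z + 1)%R)).
  move=> bv h1 h2 y h3; split=> [xy|/(mt_trans mt) hh]; last exact: hh.
  by have [|/h2] := mt_tree mt xy h3.
have Fp x : piece p x -> piece p (F x).
  move=> px; have [z [h1 h2]] := bichain_slab bs px; have [h3 h4] := hs z x h1 h2.
  by rewrite (sE z) //; exact: slab_piece h3 h4.
have Fle x y : le x y <-> le (F x) (F y).
  have [px|nx] := pselect (piece p x); last first.
    rewrite (Fn x) //; have [py|ny] := pselect (piece p y); last by rewrite Fn.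
    by rewrite (piece_down py nx) (piece_down (Fp y py) nx).
  have [z [h1 h2]] := bichain_slab bs px; have [h3 h4] := hs z x h1 h2.
  have [ho e1 e2] := hP z.
  have key y1 y2 : le (s (z + 1)%R) y1 -> le (s' (z + 1)%R) y2 -> (le x y1 <-> le (F x) y2).
    move=> k1 k2; rewrite (sE z) // (up _ _ _ bs h1 h2 _ k1) (up _ _ _ bs' h3 h4 _ k2) -e2.
    by rewrite (le_act ta _ _ ho).
  have [py|ny] := pselect (piece p y); last first.
    rewrite (Fn y) // (piece_up px ny) (piece_up (Fp x px) ny).
    have [_ [k1 _]] := bc_axis bs (z + 1)%R; have [_ [k2 _]] := bc_axis bs' (z + 1)%R.
    by rewrite (key _ _ k1 k2).
  have [z' [h1' h2']] := bichain_slab bs py; have [h3' h4'] := hs z' y h1' h2'.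
  case: (ltrgtP z z') => [zz|zz|ez].
  - apply: key; first by apply: (mt_trans mt (bichain_le bs _) h1'); lia.
    rewrite (sE z') //; apply: (mt_trans mt (bichain_le bs' _) h3'); lia.
  - split=> xy.
      case: h2'; apply: (mt_trans mt (bichain_le bs _) (mt_trans mt h1 xy)); lia.
    case: h4'; rewrite -(sE z') //; apply: (mt_trans mt _ xy); rewrite (sE z) //.
    apply: (mt_trans mt (bichain_le bs' _) h3); lia.
  - by subst z'; rewrite !(sE z) // (le_act ta _ _ ho).
have [g gP] := ta_realize ta K1 K2 Fle.
exists g; split=> [|x n|z]; rewrite gP; [apply: Fn; exact: piece_root | exact: Fn |].
have [ho e1 e2] := hP z; rewrite (sE z) //; first exact: (mt_refl mt).
exact: (lt_nle ta (bc_lt bs z)).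
Qed.

End Pieces.

(** * Families of disjoint intervals *)

Section IntervalFamilies.
Variables (T : countType) (le : T -> T -> Prop) (o : T) (G : groupType) (act : G -> T -> T).
Hypothesis ta : tree_action le o act.
Let mt := ta_tree ta.
Local Notation lt := (lt le).
Local Notation cone := (cone le).
Local Notation piece := (piece le).
Local Notation axis := (axis le).
Local Notation bichain := (bichain le).
Local Notation Fix := (Fix act).

(** Requiring the ends to lie outside all pieces makes the group acting inside the pieces fix every
    end. *)
Record interval_family (F : T * T -> Prop) : Prop := IntervalFamily {
  if_lt : forall p, F p -> lt p.1 p.2;
  if_disj : forall p q x, F p -> F q -> piece p x -> piece q x -> p = q;
  if_l : forall p q, F p -> F q -> ~ piece p q.1;
  if_r : forall p q, F p -> F q -> ~ piece p q.2 }.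

Definition ifW (F : T * T -> Prop) x := exists2 p, F p & piece p x.
Definition igroup F := Fix (fun x => ~ ifW F x).

Lemma interval_sub (F F' : T * T -> Prop) : (forall p, F' p -> F p) -> interval_family F -> interval_family F'.
Proof.
move=> s fF; split.
- by move=> p /s; exact: (if_lt fF).
- by move=> p q x /s Fp /s Fq; exact: (if_disj fF).
- by move=> p q /s Fp /s Fq; exact: (if_l fF).
- by move=> p q /s Fp /s Fq; exact: (if_r fF).
Qed.

Lemma subgrp_igroup F : subgrp (igroup F).
Proof. exact: (subgrp_Fix ta). Qed.

Lemma ifW_root F : ~ ifW F o.
Proof. by move=> [p _]; exact: (piece_root ta). Qed.

Lemma ifW_ends F p : interval_family F -> F p -> ~ ifW F p.1 /\ ~ ifW F p.2.
Proof.
by move=> fF Fp; split=> -[q Fq]; [exact: (if_l fF) | exact: (if_r fF)].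
Qed.

Lemma pieces_paste (I : Type) (P : I -> Prop) (pc : I -> T * T) (h : I -> G) :
  (forall i j x, P i -> P j -> piece (pc i) x -> piece (pc j) x -> i = j) ->
  (forall i, P i -> [/\ act (h i) o = o, act (h i) (pc i).1 = (pc i).1 & act (h i) (pc i).2 = (pc i).2]) ->
  exists g, [/\ act g o = o, forall i x, P i -> piece (pc i) x -> act g x = act (h i) x &
    forall x, (forall i, P i -> ~ piece (pc i) x) -> act g x = x].
Proof.
move=> disj hP.
have /choice[h' h'P] i : exists g, P i -> [/\ act g o = o, forall x, piece (pc i) x -> act g x = act (h i) x &
    forall x, ~ piece (pc i) x -> act g x = x].
  have [Pi|n] := pselect (P i); last by exists 1%g.
  by have [h1 h2 h3] := hP i Pi; have [g gP] := piece_local ta h1 h2 h3; exists g.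
have [|i|i x n|g [g1 g2]] := @paste _ _ _ _ _ ta I (fun i x => P i /\ piece (pc i) x)
    (fun i => if pselect (P i) then h' i else 1%g).
- by move=> i j x [Pi pi] [Pj pj]; exact: (disj i j x).
- by case: pselect => [Pi|_] /=; [have [] := h'P i Pi | rewrite (ta_1 ta)].
- case: pselect => [Pi|_] /=; last by rewrite (ta_1 ta).
  by have [_ _ ->] := h'P i Pi => // pi; apply: n.
exists g; split=> [|i x Pi px|x n].
- by apply: g2 => i [_]; exact: (piece_root ta).
- rewrite (g1 i) //; case: pselect => //= _.
  by have [_ hn _] := h'P i Pi; exact: hn.
- by apply: g2 => i [Pi]; exact: n.
Qed.

Lemma Fix_compl_comm R1 R2 p q : (forall x, R1 x -> R2 x -> False) ->
  Fix (fun x => ~ R1 x) p -> Fix (fun x => ~ R2 x) q -> (p * q = q * p)%g.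
Proof. by move=> disj hp hq; apply: (disjoint_supports_commute ta disj). Qed.

Lemma Fix_compl_triv R1 R2 g : (forall x, R1 x -> R2 x -> False) ->
  Fix (fun x => ~ R1 x) g -> Fix (fun x => ~ R2 x) g -> g = 1%g.
Proof.
move=> disj h1 h2; apply: (ta_faithful ta) => x; rewrite (ta_1 ta).
by have [R|n] := pselect (R1 x); [apply: h2 => /(disj _ R) | exact: h1].
Qed.

Lemma igroup_split F F0 F1 : interval_family F -> (forall p, F p <-> F0 p \/ F1 p) ->
  (forall p, F0 p -> F1 p -> False) -> 
  (forall x, ifW F0 x -> ifW F1 x -> False) /\
  forall g, igroup F g <-> exists p q, [/\ igroup F0 p, igroup F1 q & g = (p * q)%g].
Proof.
move=> fF FE F01.
have F0F p : F0 p -> F p by move=> h; apply/FE; left.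
have F1F p : F1 p -> F p by move=> h; apply/FE; right.
have disj x : ifW F0 x -> ifW F1 x -> False.
  move=> [p Fp px] [q Fq qx]; apply: (F01 p) => //.
  by rewrite (if_disj fF (F0F _ Fp) (F1F _ Fq) px qx).
split=> // g; apply: (Fix_prod ta) => //.
- exact: ifW_root.
- move=> x; have [[p /FE[Fp|Fp] px]|n] := pselect (ifW F x); last by constructor 1.
    by constructor 2; exists p.
  by constructor 3; exists p.
- by move=> x n [p Fp px]; apply: n; exists p => //; exact: F0F.
- by move=> x n [p Fp px]; apply: n; exists p => //; exact: F1F.
- move=> h x hZ [p Fp px]; have [l r] := ifW_ends fF (F0F _ Fp).
  by exists p => //; apply/(piece_inv ta); rewrite // hZ //; exact: ifW_root.
- move=> h x hZ [p Fp px]; have [l r] := ifW_ends fF (F1F _ Fp).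
  by exists p => //; apply/(piece_inv ta); rewrite // hZ //; exact: ifW_root.
- move=> x y [p Fp px] wy xy; have [l r] := ifW_ends fF (F0F _ Fp).
  have npy : ~ piece p y by move=> py; apply: (disj y) => //; exists p.
  by exists p.2; have [h1 h2] := proj1 (piece_up ta px npy) xy.
- move=> x y [p Fp px] wy yx; have [l r] := ifW_ends fF (F0F _ Fp).
  have npy : ~ piece p y by move=> py; apply: (disj y) => //; exists p.
  exists p.1; have h := proj1 (piece_down ta px npy) yx.
  by split=> //; have [] := piece_lt ta px.
Qed.

(* Inside its room each piece is pushed to the next position by an element [w] with
   [w q.1 = q.2], so all its translates are disjoint. *)
Lemma room_cobound (A : zmodType) F F0 (room : T * T -> T * T) n (a : seq G -> A) :
  interval_family F ->
  (forall q, F0 q -> [/\ lt o (room q).1, lt (room q).1 q.1, lt q.1 q.2 & lt q.2 (room q).2]) ->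
  (forall q q' x, F0 q -> F0 q' -> piece (room q) x -> piece (room q') x -> q = q') ->
  (forall q x, F0 q -> piece (room q) x -> ifW F x) ->
  (forall j, (0 < j <= n)%N -> exact A (igroup F0) j) ->
  inv_under (igroup F) a -> cocycle a n.+1 -> cobound (igroup F0) a n.+1.
Proof.
move=> fF roomP disj roomF eK ai ac.
(* [h q] preserves the room and carries the lower end of [q] to its upper end; its powers place the
   copies of [q] in successive intervals. *)
have /choice[h hP] q : exists g, F0 q -> [/\ act g o = o, act g (room q).1 = (room q).1,
    act g (room q).2 = (room q).2 & act g q.1 = q.2].
  have [Fq|n'] := pselect (F0 q); last by exists 1%g.
  have [h1 h2 h3 h4] := roomP q Fq.
  have [|g [go gp]] := @homogeneous_path _ _ _ _ _ ta
      [:: ((room q).1, (room q).1); (q.1, q.2); ((room q).2, (room q).2)].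
    rewrite /= andbT; apply/and3P; split; apply/asboolP; split=> //=.
    - exact: (lt_trans ta h2 h3).
    - exact: (lt_trans ta h3 h4).
  exists g; split=> //; first by apply: (gp (_, _)); rewrite mem_head.
    by apply: (gp (_, _)); rewrite !inE eqxx !orbT.
  by apply: (gp (_, _)); rewrite !inE eqxx !orbT.
have [|w [wo w1 w2]] := @pieces_paste _ F0 room h disj.
  by move=> q Fq; have [] := hP q Fq.
have wF : igroup F w.
  by move=> x nx; apply: w2 => q Fq px; apply: nx; exact: (roomF q).
have qroom q : F0 q -> axis (room q) q.1 by move=> Fq; have [? ? h3 h4] := roomP q Fq; split=> //; exact: (lt_trans ta h3).
have wq q : F0 q -> act w q.1 = q.2.
  by move=> Fq; rewrite (w1 q) //; [have [] := hP q Fq | apply: (axis_piece ta); exact: qroom].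
have wroom q x : F0 q -> piece (room q) x -> piece (room q) (act w x).
  move=> Fq px; rewrite (w1 q) //; have [h1 h2 h3 _] := hP q Fq.
  exact/(piece_inv ta).
have subroom q x : F0 q -> piece q x -> piece (room q) x.
  by move=> Fq; have [? [? _] ? [? _]] := roomP q Fq; exact: (sub_piece ta).
pose c (q : T * T) i := iter i (act w) q.1.
have cS q i : F0 q -> lt (c q i) (c q i.+1).
  move=> Fq; elim: i => [|i IH]; first by rewrite /c /= wq //; have [] := roomP q Fq.
  exact: (lt_act ta wo IH).
have cle q i j : F0 q -> (i <= j)%N -> le (c q i) (c q j).
  move=> Fq /subnK <-; elim: (j - i)%N => [|k IH]; first exact: (mt_refl mt).
  by rewrite addSn; apply: (mt_trans mt IH); case: (cS q (k + i)%N Fq).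
have shP i x : shifted act (ifW F0) w i x -> exists q, [/\ F0 q, piece (room q) x & piece (c q i, c q i.+1) x].
  elim: i x => [|i IH] x.
    move=> [q Fq px]; exists q; split=> //; first exact: subroom.
    by rewrite /c /= wq // -surjective_pairing.
  rewrite /shifted iterSr => /IH[q [Fq rx px]]; exists q.
  rewrite -(actVK ta w x); split=> //; first exact: wroom.
  exact/(piece_act ta (c q i, c q i.+1) _ wo).
have sh_lt i j x : (i < j)%N -> shifted act (ifW F0) w i x -> shifted act (ifW F0) w j x -> False.
  move=> ij /shP[q [Fq rx px]] /shP[q' [Fq' rx' px']].
  have e := disj _ _ _ Fq Fq' rx rx'; subst q'.
  by apply: (piece_disj ta _ px px'); exact: cle.
have F0F x : ifW F0 x -> ifW F x by move=> [q Fq /(subroom _ _ Fq)]; exact: roomF.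
apply: (displaced_cobound ta (R := ifW F0) (w := w) (subgrp_igroup F0) (subgrp_igroup F) _ _ _ wF _ _ eK ai ac).
- by move=> k; apply: Fix_sub => x n' /F0F.
- by move=> g gF; apply: gF; exact: ifW_root.
- by move=> k x kF; exact: kF.
- move=> i j x hi hj; case: (ltngtP i j) => // ij; first by case: (sh_lt i j x).
  by case: (sh_lt j i x).
move=> k g _ _ g2 x nx; apply: g2 => i /shP[q [Fq rx _]]; apply: nx; exact: (roomF q).
Qed.

Section Cuts.
Variable F : T * T -> Prop.
Hypothesis fF : interval_family F.

(** The value [o] off [F] makes such a function determined by its sequences, so that fixing all the
    marks fixes the function. *)
Definition good (s : T * T -> int -> T) :=
  (forall p, F p -> bichain p (s p)) /\ forall p z, ~ F p -> s p z = o.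

Definition allgood (u : seq (T * T -> int -> T)) := forall s, List.In s u -> good s.

Definition vact g (s : T * T -> int -> T) : T * T -> int -> T := fun p z => act g (s p z).

Definition marks (u : seq (T * T -> int -> T)) p x := exists2 s, List.In s u & exists z, x = s p z.

Definition cuts u (q : T * T) := exists p, [/\ F p, marks u p q.1, marks u p q.2, lt q.1 q.2 &
  forall x, marks u p x -> ~ (lt q.1 x /\ lt x q.2)].

(** What hangs from the marks: the cones at a mark that do not lead towards the upper end of the
    interval. *)
Definition stem u x := exists p c, [/\ F p, marks u p c, lt c x & ~ cone c x p.2].

Lemma marks_axis u p x : allgood u -> F p -> marks u p x -> axis p x.
Proof. by move=> gu Fp [s su [z ->]]; have [h _] := gu s su; exact: (bc_axis (h p Fp)). Qed.

Lemma marks_cmp u p x y : allgood u -> F p -> marks u p x -> marks u p y -> le x y \/ le y x.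
Proof.
move=> gu Fp /(marks_axis gu Fp)[_ [xp _]] /(marks_axis gu Fp)[_ [yp _]].
exact: (mt_tree mt xp yp).
Qed.

Lemma cuts_sub u p x q : allgood u -> F p -> marks u p q.1 -> marks u p q.2 -> piece q x -> piece p x.
Proof.
move=> gu Fp /(marks_axis gu Fp)[[h1 _] _] /(marks_axis gu Fp)[_ [h2 _]].
exact: (sub_piece ta).
Qed.

Lemma cuts_marks u q p y : allgood u -> cuts u q -> F p -> marks u p y -> ~ piece q y.
Proof.
move=> gu [p' [Fp' m1 m2 _ cons]] Fp my qy.
have py := axis_piece ta (marks_axis gu Fp my).
have e := if_disj fF Fp Fp' py (cuts_sub gu Fp' m1 m2 qy); subst p'.
apply: (cons y my); split; first exact: (piece_lt ta qy).
have [_ ny] := qy; have [h|/ny//] := marks_cmp gu Fp my m2.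
by split=> // e; apply: ny; rewrite e; exact: (mt_refl mt).
Qed.

Lemma cuts_family u : allgood u -> interval_family (cuts u).
Proof.
move=> gu; split.
- by move=> q [p []].
- move=> q q' x [p [Fp m1 m2 ltq cons]] [p' [Fp' m1' m2' ltq' cons']] qx qx'.
  have e := if_disj fF Fp Fp' (cuts_sub gu Fp m1 m2 qx) (cuts_sub gu Fp' m1' m2' qx'); subst p'.
  have key (r r' : T * T) : marks u p r.2 -> marks u p r'.1 ->
      (forall x, marks u p x -> ~ (lt r.1 x /\ lt x r.2)) -> piece r x -> piece r' x -> le r.1 r'.1 -> r.1 = r'.1.
    move=> n2 n1' rc rx rx' /le_lt_or_eq[rr|//].
    have [_ ne] := rx; have [l1 _] := piece_lt ta rx'.
    have [h|h] := marks_cmp gu Fp n1' n2; last by case: ne; exact: (mt_trans mt h).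
    have [h'|h'] := le_lt_or_eq h; first by case: (rc _ n1').
    by case: ne; rewrite -h'.
  have e1 : q.1 = q'.1.
    by have [h|h] := marks_cmp gu Fp m1 m1'; [exact: (key q q') | apply/esym; exact: (key q' q)].
  have e2 : q.2 = q'.2.
    have [/le_lt_or_eq[h|//]|/le_lt_or_eq[h|//]] := marks_cmp gu Fp m2 m2'.
      by case: (cons' _ m2); split=> //; rewrite -e1.
    by case: (cons _ m2'); split=> //; rewrite e1.
  by rewrite [q]surjective_pairing e1 e2 -surjective_pairing.
- by move=> q q' cq [p [Fp m1 _ _ _]]; exact: cuts_marks m1.
- by move=> q q' cq [p [Fp _ m2 _ _]]; exact: cuts_marks m2.
Qed.

(** Each sequence has one slab around [c]; the nearest marks are the greatest lower end and the
    least upper end of these finitely many slabs. *)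
Lemma marks_nearest u p c : allgood u -> u != [::] -> F p -> axis p c -> ~ marks u p c ->
  exists d e, [/\ marks u p d, marks u p e, lt d c, lt c e &
    forall x, marks u p x -> le x d \/ le e x].
Proof.
move=> gu + Fp cax; elim: u gu => [//|s u IH] gu _ nc.
have [sg _] := gu s (or_introl erefl); have bs := sg p Fp.
have [z [z1 z2]] := bichain_slab ta bs (axis_piece ta cax).
have ms i : marks (s :: u) p (s p i) by exists s; [left | exists i].
have nz i : s p i <> c by move=> e; apply: nc; rewrite -e.
have lz : lt (s p z) c by split.
have [_ [cp _]] := cax; have [_ [zp _]] := bc_axis bs (z + 1)%R.
have lz1 : lt c (s p (z + 1)%R).
  by have [h|/z2//] := mt_tree mt cp zp; split=> // e; exact: (nz (z + 1)%R).
have sP i : le (s p i) (s p z) \/ le (s p (z + 1)%R) (s p i).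
  have [iz|zi] := lerP i z; first by left; exact: (bichain_le ta bs).
  by right; apply: (bichain_le ta bs); lia.
have [u0|un] := eqVneq u [::].
  exists (s p z), (s p (z + 1)%R); split=> // x [s' [<-|]]; last by rewrite u0.
  by move=> [i ->].
have gu' : allgood u by move=> v vu; apply: gu; right.
have mu y : marks u p y -> marks (s :: u) p y by move=> [v vu h]; exists v => //; right.
have [|d [e [md me dc ce de]]] := IH gu' un; first by move=> /mu.
have [d' [md' d'c dd' zd']] : exists d', [/\ marks (s :: u) p d', lt d' c, le d d' & le (s p z) d'].
  have [dz|zd] := mt_tree mt (proj1 dc) z1.
    by exists (s p z); split=> //; exact: (mt_refl mt).
  by exists d; split=> //; [exact: mu | exact: (mt_refl mt)].
have [e' [me' ce' ee' ze']] : exists e', [/\ marks (s :: u) p e', lt c e', le e' e & le e' (s p (z + 1)%R)].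
  have [_ [ep _]] := marks_axis gu' Fp me.
  have [ez|ze] := mt_tree mt ep zp.
    by exists e; split=> //; [exact: mu | exact: (mt_refl mt)].
  by exists (s p (z + 1)%R); split=> //; exact: (mt_refl mt).
exists d', e'; split=> // x [v [<-|vu] [i ->]].
  by case: (sP i) => h; [left; exact: (mt_trans mt h) | right; exact: (mt_trans mt ze')].
have : marks u p (v p i) by exists v => //; exists i.
by move=> /de[h|h]; [left; exact: (mt_trans mt h) | right; exact: (mt_trans mt ee')].
Qed.

Lemma stem_piece u p c x : allgood u -> F p -> marks u p c -> lt c x -> ~ cone c x p.2 -> piece p x.
Proof.
move=> gu Fp /(marks_axis gu Fp)[pc [cp ncp]] cx nc; split.
  by exists c; split=> //; case: cx.
move=> px; apply: nc; exists p.2; split=> //; exact: (mt_refl mt).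
Qed.

Lemma stem_uniq u p c p' c' x : allgood u -> F p -> marks u p c -> lt c x -> ~ cone c x p.2 ->
  F p' -> marks u p' c' -> lt c' x -> ~ cone c' x p'.2 -> p = p' /\ c = c'.
Proof.
move=> gu Fp mc cx nc Fp' mc' cx' nc'.
have e := if_disj fF Fp Fp' (stem_piece gu Fp mc cx nc) (stem_piece gu Fp' mc' cx' nc'); subst p'.
split=> //.
have key a b : marks u p b -> lt a x -> lt b x -> ~ cone a x p.2 -> le a b -> a = b.
  move=> mb ax bx na /le_lt_or_eq[ab|//]; case: na; exists b; split=> //; first by case: bx.
  by have [_ []] := marks_axis gu Fp mb.
have [h|h] := marks_cmp gu Fp mc mc'; first exact: key h.
by apply/esym; exact: key h.
Qed.

Lemma stem_marks u p y : allgood u -> F p -> marks u p y -> ~ stem u y.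
Proof.
move=> gu Fp my [p' [c [Fp' mc cy nc]]].
have e := if_disj fF Fp Fp' (axis_piece ta (marks_axis gu Fp my)) (stem_piece gu Fp' mc cy nc); subst p'.
apply: nc; exists y; split=> //; first exact: (mt_refl mt).
by have [_ []] := marks_axis gu Fp my.
Qed.

(** Elements supported on the stems fix the marks and the upper ends, so they permute the cones at
    each mark separately. Colouring a point by its mark encodes exactly this. *)
Lemma stem_star u : allgood u -> exists2 base, star_family le (stem u) base base &
  (forall g, Fix (fun x => ~ stem u x) g <-> star_group act (stem u) base g).
Proof.
move=> gu.
have /choice[base bP] x : exists c, stem u x -> exists p, [/\ F p, marks u p c, lt c x & ~ cone c x p.2].
  have [[p [c h]]|n] := pselect (stem u x); last by exists o.
  by exists c => _; exists p.
have bE x p c : F p -> marks u p c -> lt c x -> ~ cone c x p.2 -> base x = c.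
  move=> Fp mc cx nc; have [|p' [Fp' mc' cx' nc']] := bP x; first by exists p, c.
  by have [_ ->] := stem_uniq gu Fp mc cx nc Fp' mc' cx' nc'.
have cone_stem x y : stem u x -> cone (base x) x y -> stem u y /\ base y = base x.
  move=> sx cxy; have [p [Fp mc cx nc]] := bP x sx.
  have cy := cone_lt ta (coneC cxy).
  have ncy : ~ cone (base x) y p.2 by move=> h; apply: nc; exact: (cone_trans ta cxy).
  by split; [exists p, (base x) | exact: (bE y p)].
exists base.
  split=> //.
  - by move=> x /bP[p []].
  - by move=> x y sx /(cone_stem x y sx)[].
  - move=> x l sx; have [p [Fp mc cx nc]] := bP x sx.
    have [y [cy ncy h]] := mt_branch mt (base x) (p.2 :: l).
    have cy' : lt (base x) y by split=> // e; exact: ncy.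
    have nl z : z \in p.2 :: l -> ~ cone (base x) z y.
      by move=> zl [v [[bv nv] vz vy]]; apply: (h z v zl) => // e; exact: nv.
    have nb : ~ cone (base x) y p.2 by move=> /coneC; apply: nl; exact: mem_head.
    exists y; split; [by exists p, (base x) | exact: (bE y p) |].
    by move=> z zl; apply: nl; rewrite inE zl orbT.
  - move=> x y sx _ xy; have [p [Fp mc cx nc]] := bP x sx.
    by have [_ ->] := cone_stem x y sx (cone_le ta cx xy).
move=> g; split=> [gf|[gf _]] //; split=> // x sx.
have [p [Fp mc cx nc]] := bP x sx.
have gc : act g (base x) = base x by apply: gf; exact: stem_marks mc.
have gp : act g p.2 = p.2.
  apply: gf => -[p' [c' [Fp' mc' cx' nc']]]; apply: (if_r fF Fp' Fp).
  exact: stem_piece mc' cx' nc'.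
have go : act g o = o.
  by apply: gf => -[p' [c' [_ _ /(lt_nle ta)]]]; case; exact: (mt_root mt).
apply: (bE _ p) => //; first by rewrite -{1}gc; exact: (lt_act ta).
move=> /(cone_act ta (act_V ta go)); rewrite (actK ta) !(act_V ta) //.
Qed.

Lemma map_id_In (X : Type) (f : X -> X) (u : seq X) :
  map f u = u <-> forall s, List.In s u -> f s = s.
Proof.
elim: u => [|x u IH] /=; first by split.
split=> [[e /IH h] s [<-//|/h]//|h].
by rewrite h; [congr cons; apply/IH => s su; apply: h; right | left].
Qed.

(** The foot of a point on its axis is either a mark, and the point is that mark or on a stem, or it
    lies strictly between two nearest marks, and the point is in a cut. *)
Lemma stab_split u : allgood u -> u != [::] ->
  (forall x, ifW (cuts u) x -> stem u x -> False) /\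
  forall g, stab (igroup F) vact u g <-> exists p q,
    [/\ igroup (cuts u) p, Fix (fun x => ~ stem u x) q & g = (p * q)%g].
Proof.
move=> gu un.
have disj x : ifW (cuts u) x -> stem u x -> False.
  move=> [q [p [Fp m1 m2 qq cons]] qx] [p' [c [Fp' mc cx nc]]].
  have e := if_disj fF Fp Fp' (cuts_sub gu Fp m1 m2 qx) (stem_piece gu Fp' mc cx nc); subst p'.
  have [[z [qz zx zq]] nqx] := qx; have [_ [q2 _]] := marks_axis gu Fp m2.
  have [cq|/le_lt_or_eq[qc|e]] := marks_cmp gu Fp mc m1.
  - apply: nc; exists z; split=> //; last exact: (mt_trans mt zq).
    exact: (le_lt_trans ta cq).
  - have [h|h] := marks_cmp gu Fp mc m2; last by apply: nqx; apply: (mt_trans mt h); case: cx.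
    have [h'|e] := le_lt_or_eq h; first by apply: (cons c).
    by apply: nqx; rewrite -e; case: cx.
  - apply: nc; exists z; split=> //; last exact: (mt_trans mt zq).
    by rewrite -e.
split=> // g.
pose Z x := ~ ifW F x \/ exists2 p, F p & marks u p x.
have -> : stab (igroup F) vact u g <-> Fix Z g.
  split=> [[gF /map_id_In gu'] x [|[p Fp [s su [z ->]]]]|gZ].
  - exact: gF.
  - by have := congr1 (fun s => s p z) (gu' s su).
  - split=> [x n|]; first by apply: gZ; left.
    apply/map_id_In => s su; apply/funext => p; apply/funext => z.
    apply: gZ; have [Fp|n] := pselect (F p); first by right; exists p => //; exists s => //; exists z.
    by left; have [_ ->] := gu s su; [exact: ifW_root | ].
have cutsF x : ifW (cuts u) x -> ifW F x.
  by move=> [q [p [Fp m1 m2 _ _]] qx]; exists p => //; exact: (cuts_sub gu Fp m1 m2 qx).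
have stemF x : stem u x -> ifW F x.
  by move=> [p [c [Fp mc cx nc]]]; exists p => //; exact: (stem_piece gu Fp mc cx nc).
have Zo : Z o by left; exact: ifW_root.
have cov x : [\/ Z x, ifW (cuts u) x | stem u x].
  have [[p Fp px]|n] := pselect (ifW F x); last by constructor; left.
  have [c [cax cx cm]] := piece_foot ta px; have [_ [cp _]] := cax.
  have [mc|nc] := pselect (marks u p c).
    have [lcx|<-] := le_lt_or_eq cx; last by constructor; right; exists p.
    constructor 3; exists p, c; split=> // -[z [cz zx zp]].
    exact: (lt_nle ta cz (cm z zx zp)).
  have [d [e [md me dc ce de]]] := marks_nearest gu un Fp cax nc.
  constructor 2; exists (d, e).
    exists p; split=> //=; first exact: (lt_trans ta dc).
    by move=> y /de[h|h] [h1 h2]; [exact: (lt_nle ta h1) | exact: (lt_nle ta h2)].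
  split; first by exists c; split=> //; case: ce.
  move=> /= ex; apply: (lt_nle ta ce); apply: cm => //.
  by have [_ []] := marks_axis gu Fp me.
apply: (Fix_prod ta (Z := Z)) => //.
- move=> x [n|[p Fp mx]]; first by move=> /cutsF.
  by move=> [q cq]; exact: (cuts_marks gu cq Fp mx).
- move=> x [n|[p Fp mx]]; first by move=> /stemF.
  exact: (stem_marks gu Fp mx).
- move=> h x hZ [q cq qx]; exists q => //; have [p [Fp m1 m2 _ _]] := cq.
  by apply/(piece_inv ta) => //; apply: hZ => //; right; exists p.
- move=> h x hZ [p [c [Fp mc cx nc]]]; exists p, c.
  have hc : act h c = c by apply: hZ; right; exists p.
  have hp : act h p.2 = p.2 by apply: hZ; left; have [] := ifW_ends fF Fp.
  have ho := hZ o Zo.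
  split=> //; first by rewrite -hc; exact: (lt_act ta).
  move=> /(cone_act ta (act_V ta ho)); rewrite (actK ta) !(act_V ta) //.
- move=> x y [q cq qx] sy xy; have [p [Fp m1 m2 _ _]] := cq.
  have nqy : ~ piece q y by move=> qy; apply: (disj y) => //; exists q.
  have [h1 h2] := proj1 (piece_up ta qx nqy) xy.
  by exists q.2; split=> //; right; exists p.
- move=> x y [q cq qx] sy yx; have [p [Fp m1 m2 _ _]] := cq.
  have nqy : ~ piece q y by move=> qy; apply: (disj y) => //; exists q.
  exists q.1; split; [by right; exists p | exact: (proj1 (piece_down ta qx nqy)) |].
  by have [] := piece_lt ta qx.
Qed.

End Cuts.
End IntervalFamilies.

(** * Acyclicity of the interval groups *)

Lemma mem_map_In (X : Type) (Y : eqType) (f : X -> Y) (w : seq X) y :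
  y \in map f w <-> exists2 x, List.In x w & y = f x.
Proof.
elim: w => [|x w IH] /=; first by split=> // -[].
rewrite inE; split=> [/orP[/eqP ->|/IH[z zw ->]]|[z [<-|zw] e]].
- by exists x => //; left.
- by exists z => //; right.
- by rewrite e eqxx.
- by apply/orP; right; apply/IH; exists z.
Qed.

Lemma eventually_In (X : Type) (P : X -> int -> Prop) (w : seq X) :
  (forall x, List.In x w -> exists y0, forall y, (y0 <= y)%R -> P x y) ->
  exists y0, forall y, (y0 <= y)%R -> forall x, List.In x w -> P x y.
Proof.
elim: w => [|x w IH] h; first by exists 0%R.
have [|y0 y0P] := IH; first by move=> z zw; apply: h; right.
have [y1 y1P] := h x (or_introl erefl).
exists (Order.max y0 y1) => y; rewrite ge_max => /andP[h0 h1] z [<-|zw]; first exact: y1P.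
exact: y0P.
Qed.

Lemma int_step_add (n : int -> int) : (forall z, (n z < n (z + 1))%R) ->
  forall z (k : nat), (n z + k%:R <= n (z + k%:R))%R.
Proof.
move=> st z; elim=> [|k IH]; first by rewrite !addr0.
have := st (z + k%:R)%R; rewrite -natr1 !addrA => h; rewrite lezD1; exact: Order.POrderTheory.le_lt_trans IH h.
Qed.

Section Prisms.
Variables (A : zmodType) (S S' : Type) (phi phi' : S -> S').

Lemma prism_act (h : S -> S) (h' : S' -> S') (f : seq S' -> A) s :
  (forall x, phi (h x) = h' (phi x)) -> (forall x, phi' (h x) = h' (phi' x)) ->
  prism phi phi' f (map h s) = prism phi phi' (fun u => f (map h' u)) s.
Proof.
move=> e e'; elim: s f => [//|x s IH] f /=.
rewrite e e' -!map_comp (eq_map (f := phi' \o h) (g := h' \o phi')) //.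
by congr (_ - _)%R; exact: IH.
Qed.

(** The lists on which [prism] evaluates its argument, recorded for the finite dependence that
    [local_contraction] demands. *)
Fixpoint prism_faces (s : seq S) : seq (seq S') :=
  if s is x :: s' then (phi x :: phi' x :: map phi' s') :: map (cons (phi x)) (prism_faces s')
  else [::].

Lemma prism_faces_In s u : List.In u (prism_faces s) -> size u = (size s).+1 /\
  forall v, List.In v u -> exists2 x, List.In x s & v = phi x \/ v = phi' x.
Proof.
elim: s u => [//|x s IH] u /= [<-|].
  split; first by rewrite /= size_map.
  move=> v [<-|[<-|/List.in_map_iff[y [<- ys]]]].
  - by exists x; left.
  - by exists x; [left | right].
  - by exists y; right.
move=> /List.in_map_iff[v [<- /IH[sv vP]]]; split; first by rewrite /= sv.
move=> w [<-|/vP[y ys h]]; first by exists x; left.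
by exists y => //; right.
Qed.

Lemma prism_dep (f g : seq S' -> A) s : (forall u, List.In u (prism_faces s) -> f u = g u) ->
  prism phi phi' f s = prism phi phi' g s.
Proof.
elim: s f g => [//|x s IH] f g e /=; congr (_ - _)%R; first by apply: e; left.
by apply: IH => u us; apply: e; right; apply/List.in_map_iff; exists u.
Qed.
End Prisms.

Section IntervalGroupsAcyclic.
Variables (T : countType) (le : T -> T -> Prop) (o : T) (G : groupType) (act : G -> T -> T).
Hypothesis ta : tree_action le o act.
Let mt := ta_tree ta.
Local Notation lt := (lt le).
Local Notation cone := (cone le).
Local Notation piece := (piece le).
Local Notation axis := (axis le).
Local Notation bichain := (bichain le).
Local Notation igroup := (igroup le act).
Local Notation vact := (vact act).
Variable A : zmodType.

Section OneFamily.
Variable F : T * T -> Prop.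
Hypothesis fF : interval_family le F.
Local Notation good := (good le o F).
Local Notation allgood := (allgood le o F).
Local Notation V := (T * T -> int -> T)%type.

Lemma vact1 s : vact 1%g s = s.
Proof. by apply/funext => p; apply/funext => z; exact: (ta_1 ta). Qed.

Lemma vactM g h s : vact (g * h)%g s = vact g (vact h s).
Proof. by apply/funext => p; apply/funext => z; exact: (ta_M ta). Qed.

Lemma igroup_fix g : igroup F g -> act g o = o /\ forall p, F p -> act g p.1 = p.1 /\ act g p.2 = p.2.
Proof.
move=> gF; split=> [|p Fp]; first by apply: gF; exact: (ifW_root ta).
by have [h1 h2] := ifW_ends fF Fp; split; apply: gF.
Qed.

Lemma good_act g s : igroup F g -> good s -> good (vact g s).
Proof.
move=> gF [sg so]; have [go gE] := igroup_fix gF; have goV := act_V ta go.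
split=> [p Fp|p z nF]; last by rewrite /vact so.
have [g1 g2] := gE p Fp; have bs := sg p Fp.
have gax h x : act h o = o -> act h p.1 = p.1 -> act h p.2 = p.2 -> axis p x -> axis p (act h x).
  move=> ho h1 h2 [px xp]; have := lt_act ta ho px; have := lt_act ta ho xp.
  by rewrite h1 h2.
split=> [z|z|x xax|x xax].
- exact: (lt_act ta go (bc_lt bs z)).
- by apply: gax => //; exact: (bc_axis bs).
- have [|z zx] := bc_coinit bs (x := act g^-1%g x); first by apply: gax => //; exact: (act_V ta).
  by exists z; rewrite -(actVK ta g x); apply/(le_act ta _ _ go).
- have [|z zx] := bc_cofin bs (x := act g^-1%g x); first by apply: gax => //; exact: (act_V ta).
  by exists z; rewrite -(actVK ta g x); apply/(le_act ta _ _ go).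
Qed.

Lemma allgood_act g u : igroup F g -> allgood u -> allgood (map (vact g) u).
Proof. by move=> gF gu s /List.in_map_iff[v [<- /gu]]; exact: good_act. Qed.

Lemma good_exists : exists s, good s.
Proof.
have /choice[s sP] p : exists s, F p -> bichain p s.
  have [Fp|n] := pselect (F p); last by exists (fun=> o).
  by have [s sP] := bichain_exists ta (if_lt fF Fp); exists s.
exists (fun p => if pselect (F p) then s p else fun=> o).
by split=> [p Fp|p z n]; case: pselect => //= _; exact: sP.
Qed.

Section Parity.
Variable s : V.
Hypothesis gs : good s.

(** Every other slab of the sequence: even indices for [b = 0], odd ones for [b = 1]. *)
Definition half (b : int) (q : T * T) := exists p k, F p /\ q = (s p (2 * k + b)%R, s p (2 * k + b + 1)%R).

Lemma single_good : allgood [:: s]. Proof. by move=> v [<-|//]. Qed.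

Lemma marks1 p x : marks [:: s] p x <-> exists z, x = s p z.
Proof. by split=> [[v [<-//|//]]|h]; exists s => //; left. Qed.

Lemma cuts_half q : cuts le F [:: s] q <-> half 0 q \/ half 1 q.
Proof.
have [sg _] := gs; split.
  move=> [p [Fp /marks1[i e1] /marks1[j e2] lq cons]]; have bs := sg p Fp.
  rewrite e1 e2 in lq; have ij := bichain_ltE ta bs lq.
  have ej : j = (i + 1)%R.
    case: (ltrgtP (i + 1)%R j) => // h; last by lia.
    case: (cons (s p (i + 1)%R)); first by apply/marks1; exists (i + 1)%R.
    by rewrite e1 e2; split; [exact: (bc_lt bs) | exact: (bichain_lt ta bs)].
  have [k ek] : exists k : int, i = (2 * k + 0)%R \/ i = (2 * k + 1)%R.
    by exists (i %/ 2)%Z; lia.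
  rewrite [q]surjective_pairing e1 e2 ej.
  by case: ek => ->; [left | right]; exists p, k.
have key b : half b q -> cuts le F [:: s] q.
  move=> [p [k [Fp ->]]]; have bs := sg p Fp; exists p; split=> //=.
  - by apply/marks1; exists (2 * k + b)%R.
  - by apply/marks1; exists (2 * k + b + 1)%R.
  - exact: (bc_lt bs).
  - move=> x /marks1[z ->] [/(bichain_ltE ta bs) h1 /(bichain_ltE ta bs) h2]; lia.
by case=> /key.
Qed.

Lemma half_family b : b = 0%R \/ b = 1%R -> interval_family le (half b).
Proof.
move=> hb; apply: interval_sub (cuts_family ta fF single_good) => p hp.
by apply/cuts_half; case: hb hp => -> hp; [left | right].
Qed.

Lemma half_disj q : half 0 q -> half 1 q -> False.
Proof.
have [sg _] := gs; move=> [p [k [Fp ->]]] [p' [k' [Fp' [e1 e2]]]].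
have bs := sg p Fp; have bs' := sg p' Fp'.
have e : p = p'.
  apply: (if_disj fF Fp Fp' (x := s p (2 * k + 0)%R)); apply: (axis_piece ta).
    exact: (bc_axis bs).
  by rewrite e1; exact: (bc_axis bs').
subst p'; case: (ltrgtP (2 * k + 0)%R (2 * k' + 1)%R) => h; last by lia.
  by have [_] := bichain_lt ta bs h; rewrite e1.
by have [_] := bichain_lt ta bs h; rewrite e1.
Qed.

(** A slab of one parity may spread into its two neighbours of the other parity. Its room ends at
    points [m] chosen inside them, and the rooms remain disjoint. *)
Lemma half_cobound b n (a : seq G -> A) : b = 0%R \/ b = 1%R ->
  (forall j, (0 < j <= n)%N -> exact A (igroup (half b)) j) ->
  inv_under (igroup F) a -> cocycle a n.+1 -> cobound (igroup (half b)) a n.+1.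
Proof.
move=> hb eK ai ac; have [sg _] := gs.
have /choice[m mP] (pi : (T * T) * int) : exists c, F pi.1 -> lt (s pi.1 pi.2) c /\ lt c (s pi.1 (pi.2 + 1)%R).
  have [Fp|n'] := pselect (F pi.1); last by exists o.
  by have [c cP] := lt_dense ta (bc_lt (sg _ Fp) pi.2); exists c.
have mle p i j : F p -> (i <= j)%R -> le (m (p, i)) (m (p, j)).
  move=> Fp; rewrite le_eqVlt => /orP[/eqP ->|ij]; first exact: (mt_refl mt).
  have [_ [h1 _]] := mP (p, i) Fp; have [[h2 _] _] := mP (p, j) Fp.
  apply: (mt_trans mt h1); apply: (mt_trans mt _ h2).
  by apply: (bichain_le ta (sg p Fp)) => /=; lia.
have /choice[r rP] q : exists r, half b q -> exists p k, [/\ F p,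
    q = (s p (2 * k + b)%R, s p (2 * k + b + 1)%R) & r = (m (p, 2 * k + b - 1)%R, m (p, 2 * k + b + 1)%R)].
  have [[p [k [Fp e]]]|n'] := pselect (half b q); last by exists (o, o).
  by exists (m (p, 2 * k + b - 1)%R, m (p, 2 * k + b + 1)%R) => _; exists p, k.
have rF q x : half b q -> piece (r q) x -> exists p k, [/\ F p, q = (s p (2 * k + b)%R, s p (2 * k + b + 1)%R),
    r q = (m (p, 2 * k + b - 1)%R, m (p, 2 * k + b + 1)%R) & piece p x].
  move=> /rP[p [k [Fp eq er]]] rx; exists p, k; split=> //; have bs := sg p Fp.
  have [[h1 _] _] := mP (p, 2 * k + b - 1)%R Fp; have [_ [h2 _]] := mP (p, 2 * k + b + 1)%R Fp.
  apply: (sub_piece ta _ _ rx); rewrite er /=.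
    by have [[h _] _] := bc_axis bs (2 * k + b - 1)%R; exact: (mt_trans mt h).
  by have [_ [h _]] := bc_axis bs (2 * k + b + 1 + 1)%R; exact: (mt_trans mt h2).
apply: (room_cobound ta (F := F) (F0 := half b) (room := r)) => //.
- move=> q /rP[p [k [Fp -> ->]]]; have bs := sg p Fp.
  have [h1 h2] := mP (p, 2 * k + b - 1)%R Fp; have [h3 h4] := mP (p, 2 * k + b + 1)%R Fp.
  rewrite /= subrK in h1 h2 h3 h4 *; split=> //; last exact: (bc_lt bs).
  by have [h _] := bc_axis bs (2 * k + b - 1)%R; apply: (le_lt_trans ta (mt_root mt _) h1).
- move=> q q' x /rF h /rF h' rx rx'.
  have [p [k [Fp eqq er px]]] := h x rx; have [p' [k' [Fp' eqq' er' px']]] := h' x rx'.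
  have e := if_disj fF Fp Fp' px px'; subst p'.
  case: (ltrgtP k k') => [kk|kk|ek]; last by rewrite eqq eqq' ek.
    by case: (piece_disj ta _ rx rx'); rewrite er er'; apply: mle => //; lia.
  by case: (piece_disj ta _ rx' rx); rewrite er er'; apply: mle => //; lia.
- by move=> q x hq rx; have [p [k [Fp _ _ px]]] := rF q x hq rx; exists p.
Qed.
End Parity.

(** The sequences are in step: all terms of index [z] precede all terms of index [z + 1], which
    leaves space for an interleaving sequence. *)
Definition sync (w : seq V) : Prop := allgood w /\ forall (s s' : V) p z, List.In s w -> List.In s' w -> F p ->
  lt (s p z) (s' p (z + 1)%R).

Definition inter (w : seq V) (t : V) : Prop := [/\ allgood w, good t & forall (s : V) p z, List.In s w -> F p ->
  lt (s p z) (t p (z + 1)%R) /\ lt (t p z) (s p z)].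

Lemma chain_bounds (w : seq V) p z b : w != [::] -> (forall s, List.In s w -> le (s p z) b) ->
  (exists2 s, List.In s w & forall s', List.In s' w -> le (s' p z) (s p z)) /\
  exists2 s, List.In s w & forall s', List.In s' w -> le (s p z) (s' p z).
Proof.
move=> wn wb; pose l := map (fun s : V => s p z) w.
have ln : l != [::] by rewrite -size_eq0 size_map size_eq0.
have lb x : x \in l -> le x b by move=> /mem_map_In[s sw ->]; exact: wb.
have wl s : List.In s w -> s p z \in l by move=> sw; apply/mem_map_In; exists s.
split.
  have [m /mem_map_In[s sw ->] h] := chain_max ta ln lb.
  by exists s => // s' /wl/h.
have [m /mem_map_In[s sw ->] h] := chain_min ta ln lb.
by exists s => // s' /wl/h.
Qed.

Lemma allgood_bounds w p z : allgood w -> w != [::] -> F p ->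
  (exists2 s, List.In s w & forall s', List.In s' w -> le (s' p z) (s p z)) /\
  exists2 s, List.In s w & forall s', List.In s' w -> le (s p z) (s' p z).
Proof.
move=> gw wn Fp; apply: (@chain_bounds w p z p.2 wn) => s sw.
have [sg _] := gw s sw.
by have [_ []] := bc_axis (sg p Fp) z.
Qed.

Lemma inter_exists w : sync w -> exists t, inter w t.
Proof.
move=> [gw sw]; have [w0|wn] := eqVneq w [::].
  by have [t gt] := good_exists; exists t; split=> // s p z; rewrite w0.
have /choice[t tP] (pz : (T * T) * int) : exists c, [/\ ~ F pz.1 -> c = o & F pz.1 ->
    forall s, List.In s w -> lt (s pz.1 (pz.2 - 1)%R) c /\ lt c (s pz.1 pz.2)].
  case: pz => p z /=; have [Fp|n] := pselect (F p); last by exists o.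
  have [[s1 s1w h1] _] := allgood_bounds (z - 1)%R gw wn Fp.
  have [_ [s2 s2w h2]] := allgood_bounds z gw wn Fp.
  have [|c [c1 c2]] := @lt_dense _ _ _ _ _ ta (s1 p (z - 1)%R) (s2 p z).
    by have := sw s1 s2 p (z - 1)%R s1w s2w Fp; rewrite subrK.
  exists c; split=> // _ s ssw; split; first exact: (le_lt_trans ta (h1 s ssw)).
  exact: (lt_le_trans ta c2 (h2 s ssw)).
have tP' p z s : F p -> List.In s w -> lt (s p z) (t (p, z + 1)%R) /\ lt (t (p, z)) (s p z).
  move=> Fp ssw; have [_ h] := tP (p, z + 1)%R; have [_ h'] := tP (p, z).
  by have [] := h Fp s ssw; have [] := h' Fp s ssw; rewrite /= addrK.
exists (fun p z => t (p, z)); split=> //; last by move=> s p z ssw Fp; exact: tP'.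
split=> [p Fp|p z nF]; last by have [h _] := tP (p, z); exact: h.
have [s ssw] : exists s, List.In s w by case: (w) wn => [//|s ? _]; exists s; left.
have [sg _] := gw s ssw; have bs := sg p Fp.
split=> [z|z|x xax|x xax].
- by have [h1 h2] := tP' p z s Fp ssw; exact: (lt_trans ta h2 h1).
- have [h1 _] := tP' p (z - 1)%R s Fp ssw; have [_ h2] := tP' p z s Fp ssw; rewrite subrK in h1.
  have [h3 _] := bc_axis bs (z - 1)%R; have [_ h4] := bc_axis bs z.
  by split; [exact: (lt_trans ta h3 h1) | exact: (lt_trans ta h2 h4)].
- have [z zx] := bc_coinit bs xax; exists z; apply: (mt_trans mt _ zx).
  by have [_ []] := tP' p z s Fp ssw.
- have [z xz] := bc_cofin bs xax; exists (z + 1)%R; apply: (mt_trans mt xz).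
  by have [[]] := tP' p z s Fp ssw.
Qed.

(** Both [t p z] and [t' p z] lie after all terms of [w] of index [z - 1] and before all those of
    index [z]. They are matched inside these disjoint intervals by elements fixing the ends; for
    empty [w] the matching is [slide]. *)
Lemma inter_transitive w t t' : inter w t -> inter w t' ->
  exists g, [/\ igroup F g, map (vact g) w = w & vact g t = t'].
Proof.
move=> [gw [gt to] tw] [_ [gt' to'] tw']; have [w0|wn] := eqVneq w [::].
  have /choice[h hP] p : exists g, F p -> [/\ act g o = o, forall x, ~ piece p x -> act g x = x &
      forall z, act g (t p z) = t' p z].
    have [Fp|n] := pselect (F p); last by exists 1%g.
    by have [g gP] := slide ta (gt p Fp) (gt' p Fp); exists g.
  have [||g [go g1 g2]] := @pieces_paste _ _ _ _ _ ta _ F id h.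
  - by move=> p q x Fp Fq; exact: (if_disj fF).
  - move=> p Fp; have [h1 h2 _] := hP p Fp.
    by split=> //; apply: h2; [exact: (if_l fF) | exact: (if_r fF)].
  exists g; split=> [x n||]; first by apply: g2 => p Fp px; apply: n; exists p.
    by rewrite w0.
  apply/funext => p; apply/funext => z; rewrite /vact.
  have [Fp|n] := pselect (F p); last by rewrite to // to'.
  rewrite (g1 p) //; last by apply: (axis_piece ta); exact: (bc_axis (gt p Fp)).
  by have [_ _ ->] := hP p Fp.
have [s0 s0w] : exists s, List.In s w by case: (w) wn => [//|s ? _]; exists s; left.
have bw s p : List.In s w -> F p -> bichain p (s p) by move=> /gw[h _] /h.
pose P (i : (T * T) * int) := F i.1.
have /choice[pc pcP] (i : (T * T) * int) : exists q, P i ->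
    [/\ lt i.1.1 q.1 /\ lt q.2 i.1.2, lt q.1 (t i.1 i.2) /\ lt (t i.1 i.2) q.2,
      lt q.1 (t' i.1 i.2) /\ lt (t' i.1 i.2) q.2 &
      forall s, List.In s w -> le (s i.1 (i.2 - 1)%R) q.1 /\ le q.2 (s i.1 i.2)].
  case: i => p z; have [Fp|n] := pselect (F p); last by exists (o, o).
  have [[s1 s1w h1] _] := allgood_bounds (z - 1)%R gw wn Fp.
  have [_ [s2 s2w h2]] := allgood_bounds z gw wn Fp.
  exists (s1 p (z - 1)%R, s2 p z) => _ /=; split=> //.
  - by have [? _] := bc_axis (bw _ _ s1w Fp) (z - 1)%R; have [_ ?] := bc_axis (bw _ _ s2w Fp) z.
  - by have [] := tw s1 p (z - 1)%R s1w Fp; have [] := tw s2 p z s2w Fp; rewrite subrK.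
  - by have [] := tw' s1 p (z - 1)%R s1w Fp; have [] := tw' s2 p z s2w Fp; rewrite subrK.
  - by move=> s sw; split; [exact: h1 | exact: h2].
have subp i x : P i -> piece (pc i) x -> piece i.1 x.
  by move=> /pcP[[[h1 _] [h2 _]] _ _ _]; exact: (sub_piece ta).
have /choice[h hP] i : exists g, P i -> [/\ act g o = o, act g (pc i).1 = (pc i).1,
    act g (pc i).2 = (pc i).2 & act g (t i.1 i.2) = t' i.1 i.2].
  have [Fi|n] := pselect (P i); last by exists 1%g.
  have [[h1 h2] [h3 h4] [h5 h6] _] := pcP i Fi.
  have [|g [go gp]] := @homogeneous_path _ _ _ _ _ ta
      [:: ((pc i).1, (pc i).1); (t i.1 i.2, t' i.1 i.2); ((pc i).2, (pc i).2)].
    have o1 := le_lt_trans ta (mt_root mt _) h1.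
    by rewrite /= andbT; apply/and3P; split; apply/asboolP; split.
  exists g; split=> //; first by apply: (gp (_, _)); rewrite mem_head.
    by apply: (gp (_, _)); rewrite !inE eqxx !orbT.
  by apply: (gp (_, _)); rewrite !inE eqxx !orbT.
have [||g [go g1 g2]] := @pieces_paste _ _ _ _ _ ta _ P pc h.
- move=> [p z] [p' z'] x Pi Pj xi xj.
  have e : p = p' := if_disj fF Pi Pj (subp _ _ Pi xi) (subp _ _ Pj xj); subst p'.
  have key y y' : (y < y')%R -> le (pc (p, y)).2 (pc (p, y')).1.
    move=> yy; have [_ _ _ h1] := pcP (p, y) Pi; have [_ _ _ h2] := pcP (p, y') Pi.
    have [_ k1] := h1 s0 s0w; have [k2 _] := h2 s0 s0w.
    apply: (mt_trans mt k1 (mt_trans mt _ k2)); apply: (bichain_le ta (bw _ _ s0w Pi)) => /=; lia.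
  case: (ltrgtP z z') => [zz|zz|-> //].
    by case: (piece_disj ta (key _ _ zz) xi xj).
  by case: (piece_disj ta (key _ _ zz) xj xi).
- by move=> i Pi; have [] := hP i Pi.
have gF : igroup F g.
  by move=> x n; apply: g2 => i Pi xi; apply: n; exists i.1 => //; exact: subp.
exists g; split=> //.
  apply/map_id_In => s sw; apply/funext => p; apply/funext => z; rewrite /vact.
  have [Fp|n] := pselect (F p); last by have [_ ->] := gw s sw.
  have bs := bw _ _ sw Fp.
  apply: g2 => -[p' z'] Pi xi.
  have e : p' = p := if_disj fF Pi Fp (subp _ _ Pi xi) (axis_piece ta (bc_axis bs z)); subst p'.
  have [_ _ _ hs] := pcP (p, z') Pi; have [/= k1 k2] := hs s sw.
  have [_ nx] := xi; have px := piece_lt ta xi.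
  have [zz|zz] := lerP z (z' - 1)%R.
    apply: (lt_nle ta px); apply: (mt_trans mt _ k1); exact: (bichain_le ta bs).
  by apply: nx; apply: (mt_trans mt k2); apply: (bichain_le ta bs); lia.
apply/funext => p; apply/funext => z; rewrite /vact.
have [Fp|n] := pselect (F p); last by rewrite to // to'.
have [_ h3 _ _] := pcP (p, z) Fp.
by rewrite (g1 (p, z)) //; [have [] := hP (p, z) Fp | exact: (axis_piece ta)].
Qed.

Definition re (n : T * T -> int -> int) (s : V) : V := fun p z => s p (n p z).
Definition increasing (n : T * T -> int -> int) := forall p z, (n p z < n p (z + 1))%R.

Lemma good_re n s : increasing n -> good s -> good (re n s).
Proof.
move=> ni [sg so]; split=> [p Fp|p z nF]; last exact: so.
have bs := sg p Fp; split=> [z|z|x xax|x xax].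
- by apply: (bichain_lt ta bs); exact: ni.
- exact: (bc_axis bs).
- have [i ix] := bc_coinit bs xax.
  have [a ha] : exists a : nat, (n p 0 - i <= a%:R)%R by exists (absz (n p 0 - i)%R); lia.
  exists (- a%:R)%R; apply: (mt_trans mt (bichain_le ta bs _) ix).
  have := int_step_add (ni p) (- a%:R)%R a.
  by rewrite addNr -lerBrDr => h; apply: (Order.POrderTheory.le_trans h); rewrite lerBlDl -lerBlDr.
- have [i ix] := bc_cofin bs xax.
  have [a ha] : exists a : nat, (i - n p 0 <= a%:R)%R by exists (absz (i - n p 0)%R); lia.
  exists (a%:R)%R; apply: (mt_trans mt ix (bichain_le ta bs _)).
  have := int_step_add (ni p) 0%R a.
  by rewrite add0r => h; apply: (Order.POrderTheory.le_trans _ h); rewrite -lerBlDl.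
Qed.

(** Pass to sparse indices: by cofinality at both ends the next index can be taken so far out that
    every sequence has passed the current terms of all the others. *)
Lemma sync_re w : allgood w -> exists2 n, increasing n & sync (map (re n) w).
Proof.
move=> gw.
pose R p x y := (x < y)%R /\ (F p -> forall s s', List.In s w -> List.In s' w -> lt (s p x) (s' p y)).
have up p x : exists y, R p x y.
  have [Fp|n] := pselect (F p); last by exists (x + 1)%R; split=> //; lia.
  have [|y0 y0P] := @eventually_In V (fun s y => forall s', List.In s' w -> lt (s p x) (s' p y)) w.
    move=> s sw; have [sg _] := gw s sw.
    apply: (@eventually_In V (fun s' y => lt (s p x) (s' p y))) => s' sw'.
    have [sg' _] := gw s' sw'; have [z xz] := bc_cofin (sg' p Fp) (bc_axis (sg p Fp) x).
    exists (z + 1)%R => y zy; apply: (le_lt_trans ta xz); apply: (bichain_lt ta (sg' p Fp)); lia.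
  exists (Order.max y0 (x + 1)%R); split=> [|_ s s' sw sw']; last by apply: y0P => //; rewrite le_max lexx.
  by rewrite lt_max; apply/orP; right; lia.
have dn p x : exists y, R p y x.
  have [Fp|n] := pselect (F p); last by exists (x - 1)%R; split=> //; lia.
  have [|y0 y0P] := @eventually_In V (fun s y => forall s', List.In s' w -> lt (s p (- y)%R) (s' p x)) w.
    move=> s sw; have [sg _] := gw s sw.
    apply: (@eventually_In V (fun s' y => lt (s p (- y)%R) (s' p x))) => s' sw'.
    have [sg' _] := gw s' sw'; have [z xz] := bc_coinit (sg p Fp) (bc_axis (sg' p Fp) x).
    exists (1 - z)%R => y zy; apply: (lt_le_trans ta _ xz); apply: (bichain_lt ta (sg p Fp)); lia.
  have ym : (y0 <= Order.max y0 (1 - x))%R by rewrite le_max lexx.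
  have ym' : (1 - x <= Order.max y0 (1 - x))%R by rewrite le_max lexx orbT.
  exists (- Order.max y0 (1 - x))%R; split=> [|_ s s' sw sw']; last exact: (y0P _ ym).
  by move: ym'; set m := Order.max _ _; lia.
have /choice[n nP] p : exists s : int -> int, forall z, R p (s z) (s (z + 1)%R).
  have [|k x _|k x _|s [_ sU sD]] := @int_seq int 0%R (fun=> True) (fun=> R p) (fun=> R p) => //.
  - by have [y h] := up p x; exists y.
  - by have [y h] := dn p x; exists y.
  exists s; case=> k; first by (have -> : (Posz k + 1)%R = k.+1 by lia); exact: sU.
  have -> : (Negz k + 1 = - k%:R)%R by lia.
  by (have -> : (Negz k = - k.+1%:R)%R by lia); exact: sD.
have ni : increasing n by move=> p z; have [] := nP p z.
exists n => //; split=> [s|s s' p z] /List.in_map_iff[v [<- vw]].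
  by apply: good_re => //; exact: gw.
move=> /List.in_map_iff[v' [<- vw']] Fp.
by have [_ h] := nP p z; exact: h.
Qed.

Local Open Scope ring_scope.

(** An invariant contraction: reindexing along a sparse [n] is homotopic to the identity by a prism
    and puts finitely many lists in step, after which an interleaving sequence serves as cone point.
    All interleaving sequences are conjugate over the list, so the cone is invariant. *)
Lemma interval_bottom m (f : seq V -> A) : invV (igroup F) vact f ->
  (forall u, allgood u -> size u = m.+2 -> delta f u = 0) ->
  exists2 b, invV (igroup F) vact b & forall u, allgood u -> size u = m.+1 -> f u = delta b u.
Proof.
move=> fi fc; have sG : subgrp (igroup F) by exact: (subgrp_igroup ta).
have [s0 gs0] := good_exists; have [pick pickP] := picker s0.
pose N := {n | increasing n}.
have n0 : N by exists (fun _ => id) => p z; lia.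
pose E (u u' : seq V) := exists2 g, igroup F g & u' = map (vact g) u.
have EV g s : igroup F g -> inter (map (vact g) s) = inter (map (vact g) s) by [].
pose tf w := pick (inter w).
have tfP w : (exists t, inter w t) -> inter w (tf w) by exact: pickP.
pose cf (H : seq V -> A) w := if `[< exists t, inter w t >] then H (tf w :: w) else 0.
pose k (n : N) (H : seq V -> A) u := cf H (map (re (sval n)) u) - prism id (re (sval n)) H u.
have inter_act g w t : igroup F g -> inter w t -> inter (map (vact g) w) (vact g t).
  move=> gF [gw gt tw]; have [go _] := igroup_fix gF; split.
  - exact: allgood_act.
  - exact: good_act.
  - move=> s p z /List.in_map_iff[v [<- vw]] Fp; have [h1 h2] := tw v p z vw Fp.
    by split; exact: (lt_act ta go).
have vactK g s : vact g^-1%g (vact g s) = s by rewrite -vactM mulVg vact1.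
have mapK g w : map (vact g^-1%g) (map (vact g) w) = w.
  by rewrite -map_comp (eq_map (vactK g)) map_id.
have inter_sub u1 x u2 t : inter (u1 ++ x :: u2) t -> inter (u1 ++ u2) t.
  move=> [gw gt tw]; have sub s : List.In s (u1 ++ u2) -> List.In s (u1 ++ x :: u2).
    by move=> /List.in_app_iff[h|h]; apply/List.in_app_iff; [left | right; right].
  by split=> // [s /sub/gw//|s p z /sub]; exact: tw.
have cf_inv H w t : inv_rel E H -> inter w t -> cf H w = H (t :: w).
  move=> HI wt; rewrite /cf; case: asboolP => [ex|[]]; last by exists t.
  have [g [gF gw gt]] := inter_transitive (tfP w ex) wt.
  by apply: HI; exists g => //=; rewrite gw gt.
have Ydel u1 x u2 : allgood (u1 ++ x :: u2) -> allgood (u1 ++ u2).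
  move=> gu s /List.in_app_iff[h|h]; apply: gu; apply/List.in_app_iff; [by left | by right; right].
have [|||||||H [HI H0 HP]] := @local_contraction A V N n0 allgood E k.
- exact: Ydel.
- by move=> s s' [g _ ->]; rewrite size_map.
- move=> H HI s s' [g gF ->]; rewrite -delta_map; apply: eq_delta => u _.
  by apply: HI; exists g.
- move=> n H HI s s' [g gF ->]; rewrite /k; congr (_ - _).
    have e : map (re (sval n)) (map (vact g) s) = map (vact g) (map (re (sval n)) s).
      by rewrite -!map_comp.
    rewrite e; set w := map _ s; have [ex|nex] := pselect (exists t, inter w t).
      have wt := tfP w ex; rewrite (cf_inv H w _ HI wt) (cf_inv H _ _ HI (inter_act g _ _ gF wt)).
      by apply: HI; exists g.
    rewrite /cf; case: asboolP => // _; case: asboolP => // -[t wt]; case: nex.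
    by exists (vact g^-1%g t); rewrite -(mapK g w); apply: inter_act => //; exact: (subgrpV sG).
  rewrite (@prism_act A V V id (re (sval n)) (vact g) (vact g)) //; congr (prism _ _ _ _).
  by apply/funext => u; apply: HI; exists g.
- move=> n H H' s; rewrite /k prismB /cf; case: asboolP => _; zmod.
- move=> n s gs.
  pose w := map (re (sval n)) s.
  have gre v : List.In v s -> good (re (sval n) v) by move=> /gs; apply: good_re; exact: (svalP n).
  exists ((if `[< exists t, inter w t >] then [:: tf w :: w] else [::]) ++ prism_faces id (re (sval n)) s).
  split=> [u /List.in_app_iff[|/prism_faces_In[su uP]]|H H' e].
  - case: asboolP => [ex [<-|//]|//]; split; last by rewrite /= size_map.
    by have [gw gt _] := tfP w ex => v [<-//|/gw].
  - by split=> // v /uP[x xs [->|->]]; [exact: gs | exact: gre].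
  - rewrite /k (prism_dep (g := H')) => [|u us]; last by apply: e; apply/List.in_app_iff; right.
    congr (_ - _); rewrite /cf -/w; case: asboolP e => // ex e.
    by apply: e; left.
- move=> L gL; pose w := flatten L.
  have In_flat (u : seq V) s : List.In u L -> List.In s u -> List.In s w.
    rewrite /w; elim: (L) => [//|v L' IH] /= [->|/IH h] su; apply/List.in_app_iff; first by left.
    by right; exact: h.
  have gw : allgood w.
    rewrite /w; elim: (L) gL => [//|v L' IH] gL /= s /List.in_app_iff[sv|].
      exact: (gL v (or_introl erefl)).
    by apply: IH => u uL; apply: gL; right.
  have [n ni [gn sn]] := sync_re gw.
  exists (exist _ n ni) => u uL F' FI; rewrite /k /=.
  have su : sync (map (re n) u).
    have sub s : List.In s (map (re n) u) -> List.In s (map (re n) w).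
      move=> /List.in_map_iff[v [<- vu]]; apply/List.in_map_iff; exists v; split=> //.
      exact: In_flat vu.
    by split=> [s /sub/gn//|s s' p z /sub h /sub h']; exact: sn.
  have [t ut] := inter_exists su.
  have dFI : inv_rel E (delta F').
    move=> s s' [g gF ->]; rewrite -delta_map; apply: eq_delta => v _; apply: FI; by exists g.
  rewrite (cf_inv (delta F') _ t dFI ut) /= (deltaB (fun v => cf F' (map (re n) v))).
  rewrite (delta_map (re n) (cf F')).
  rewrite (@eq_delta_del _ _ (cf F') (fun v => F' (t :: v)) (map (re n) u)); last first.
    by move=> u1 x u2 e; apply: cf_inv => //; apply: (inter_sub u1 x u2); rewrite -e.
  have := prismP id (re n) F' u; rewrite map_id => e.
  have -> : F' u = F' (map (re n) u) -
      (prism id (re n) (delta F') u + delta (prism id (re n) F') u) by rewrite e; zmod.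
  by zmod.
have fE : inv_rel E f by move=> s s' [g gF ->]; rewrite fi.
exists (H f) => [g u gF|u gu su]; first by apply/esym; apply: HI => //; exists g.
rewrite [LHS](HP f u) // H0 ?add0r // => v gv sv; apply: fc => //.
by rewrite sv su.
Qed.

End OneFamily.

Lemma stem_exact F u : interval_family le F -> allgood le o F u -> forall j, (0 < j)%N ->
  exact A (Fix act (fun x => ~ stem le F u x)) j.
Proof.
move=> fF gu j j0; have [base sb bE] := stem_star ta fF gu.
have -> : Fix act (fun x => ~ stem le F u x) = star_group act (stem le F u) base.
  by apply/funext => g; apply/propext; exact: bE.
by apply: (star_group_exact ta sb (n := j)); rewrite j0 leqnn.
Qed.

(** Bi-infinite sequences need no genericity, so the rows are cones. The stabilizer of one sequence
    is the product of its even slabs, its odd slabs and its stems: slabs are displaced inside the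
    full group, and stems form a star group. *)
Theorem igroup_exact n F : interval_family le F -> forall j, (0 < j <= n)%N -> exact A (igroup F) j.
Proof.
elim: n F => [|n IH] F fF j; first by case: j.
rewrite [X in _ && X]leq_eqVlt ltnS => /andP[j0 /orP[/eqP ej|jn]]; last by apply: (IH F) => //; rewrite j0.
rewrite {}ej => a ai ac {j j0}; have sG : subgrp (igroup F) by exact: (subgrp_igroup ta).
have [s0 gs0] := good_exists fF.
have Y0 : allgood le o F [:: s0] by move=> s [<-|//].
apply: (equivariant_vanishing sG (act := vact) (Y := allgood le o F) _ _ _ _ ai Y0) => //.
- exact: vact1.
- by move=> g h s _ _; exact: vactM.
- by move=> u1 x u2 gu s /List.in_app_iff[h|h]; apply: gu; apply/List.in_app_iff; [left | right; right].
- by move=> g u gF; exact: allgood_act.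
- by move=> i _; apply: (@row_exact_cone _ _ _ s0) => u gu s [<-//|]; exact: gu.
- move=> [//|s [|//]] gu _; have [disj HE] := stab_split ta fF gu isT.
  have fc := cuts_family ta fF gu.
  have aiH : inv_under (stab (igroup F) vact [:: s]) a by apply: inv_sub ai => g [].
  apply: (kunneth (subgrp_igroup ta _) (subgrp_Fix ta _) _ _ HE (IH _ fc) aiH ac).
  + by move=> p q; exact: (Fix_compl_comm ta disj).
  + by move=> g; exact: (Fix_compl_triv ta disj).
  + have gs : good le o F s by apply: gu; left.
    have [disj' HE'] := igroup_split ta fc (cuts_half gs) (half_disj fF gs).
    have h0 := half_family fF gs (or_introl erefl); have h1 := half_family fF gs (or_intror erefl).
    have aiC : inv_under (igroup (cuts le F [:: s])) a.
      apply: inv_sub aiH => g gC; apply/HE; exists g, 1%g; rewrite mulg1; split=> //.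
      exact: (subgrp1 (subgrp_Fix ta _)).
    apply: (kunneth (subgrp_igroup ta _) (subgrp_igroup ta _) _ _ HE' (IH _ h0) aiC ac).
    * by move=> p q; exact: (Fix_compl_comm ta disj').
    * by move=> g; exact: (Fix_compl_triv ta disj').
    * exact: (half_cobound fF gs (or_introl erefl) (IH _ h0) ai ac).
    * exact: (half_cobound fF gs (or_intror erefl) (IH _ h1) ai ac).
  + apply: (stem_exact fF gu (ltn0Sn n)) => //.
    apply: inv_sub aiH => g gC; apply/HE; exists 1%g, g; rewrite mul1g; split=> //.
    exact: (subgrp1 (subgrp_igroup ta _)).
- move=> [//|s u] j gu _ jn; have [disj HE] := stab_split ta fF gu isT.
  apply: (exact_prod (subgrp_igroup ta _) (subgrp_Fix ta _) _ _ HE _ _ jn).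
  + by move=> p q; exact: (Fix_compl_comm ta disj).
  + by move=> g; exact: (Fix_compl_triv ta disj).
  + exact: IH (cuts_family ta fF gu).
  + by move=> i /andP[i0 _]; exact: stem_exact.
- by move=> f fi fc; exact: (interval_bottom fF fi fc).
Qed.

End IntervalGroupsAcyclic.

(** * Stabilizers of finite chains *)

Section ChainStabilizers.
Variables (T : countType) (le : T -> T -> Prop) (o : T) (G : groupType) (act : G -> T -> T).
Hypothesis ta : tree_action le o act.
Let mt := ta_tree ta.
Local Notation lt := (lt le).
Local Notation cone := (cone le).
Local Notation piece := (piece le).
Local Notation Fix := (Fix act).
Variable A : zmodType.
Variable u : seq T.
Hypotheses (uo : o \in u) (utot : forall x y, x \in u -> y \in u -> le x y \/ le y x).

Lemma chain_top : exists2 m, m \in u & forall x, x \in u -> le x m.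
Proof.
have un : u != [::] by apply/eqP => e; have := uo; rewrite e.
suff h (l : seq T) : l != [::] -> (forall x y, x \in l -> y \in l -> le x y \/ le y x) ->
    exists2 m, m \in l & forall x, x \in l -> le x m by exact: h un utot.
elim: l => [//|x l IH] _ tot; have [l0|ln] := eqVneq l [::].
  by exists x; rewrite ?mem_head // l0 => y; rewrite inE => /eqP ->; exact: (mt_refl mt).
have [|m ml mm] := IH ln; first by move=> y z yl zl; apply: tot; rewrite inE ?yl ?zl orbT.
have [xm|mx] : le x m \/ le m x by apply: tot; rewrite inE ?eqxx ?ml ?orbT.
  by exists m => [|y]; rewrite inE ?ml ?orbT // => /orP[/eqP ->|/mm].
exists x => [|y]; rewrite inE ?eqxx // => /orP[/eqP ->|/mm h]; first exact: (mt_refl mt).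
exact: (mt_trans mt h).
Qed.

Definition gaps (q : T * T) := [/\ q.1 \in u, q.2 \in u, lt q.1 q.2 &
  forall x, x \in u -> ~ (lt q.1 x /\ lt x q.2)].

Lemma gaps_mem q y : gaps q -> y \in u -> ~ piece q y.
Proof.
move=> [q1 q2 _ cons] yu qy; apply: (cons y yu); split; first exact: (piece_lt ta qy).
have [_ ny] := qy; have [h|/ny//] := utot yu q2.
by split=> // e; apply: ny; rewrite e; exact: (mt_refl mt).
Qed.

Lemma gaps_family : interval_family le gaps.
Proof.
split.
- by move=> q [].
- move=> q q' x [m1 m2 ltq cons] [m1' m2' ltq' cons'] qx qx'.
  have key (r r' : T * T) : r.2 \in u -> r'.1 \in u ->
      (forall x, x \in u -> ~ (lt r.1 x /\ lt x r.2)) -> piece r x -> piece r' x -> le r.1 r'.1 -> r.1 = r'.1.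
    move=> n2 n1' rc rx rx' /le_lt_or_eq[rr|//].
    have [_ ne] := rx; have [l1 _] := piece_lt ta rx'.
    have [h|h] := utot n1' n2; last by case: ne; exact: (mt_trans mt h).
    have [h'|h'] := le_lt_or_eq h; first by case: (rc _ n1').
    by case: ne; rewrite -h'.
  have e1 : q.1 = q'.1.
    by have [h|h] := utot m1 m1'; [exact: (key q q') | apply/esym; exact: (key q' q)].
  have e2 : q.2 = q'.2.
    have [/le_lt_or_eq[h|//]|/le_lt_or_eq[h|//]] := utot m2 m2'.
      by case: (cons' _ m2); split=> //; rewrite -e1.
    by case: (cons _ m2'); split=> //; rewrite e1.
  by rewrite [q]surjective_pairing e1 e2 -surjective_pairing.
- by move=> q q' cq [m1 _ _ _]; exact: gaps_mem m1.
- by move=> q q' cq [_ m2 _ _]; exact: gaps_mem m2.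
Qed.

(** The tree splits along the chain into the gaps between consecutive points and the cones leaving
    the chain, among them all those above its top. The stabilizer is thus the product of an interval
    group and a star group. *)
Theorem chain_exact j : (0 < j)%N -> exact A (Fix (fun x => x \in u)) j.
Proof.
move=> j0; have [top topu topP] := chain_top.
pose W x := exists c, [/\ c \in u, lt c x & ~ cone c x top].
have uniq c c' x : c \in u -> c' \in u -> lt c x -> ~ cone c x top -> lt c' x -> ~ cone c' x top -> c = c'.
  have key a b : b \in u -> lt a x -> lt b x -> ~ cone a x top -> le a b -> a = b.
    move=> bu ax bx na /le_lt_or_eq[ab|//]; case: na; exists b; split=> //; first by case: bx.
    exact: topP.
  move=> cu cu' cx nc cx' nc'; have [h|h] := utot cu cu'; first exact: key h.
  by apply/esym; exact: key h.
have uW y : y \in u -> ~ W y.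
  move=> yu [c [cu cy nc]]; apply: nc; exists y; split=> //; first exact: (mt_refl mt).
  exact: topP.
have /choice[base bP] x : exists c, W x -> [/\ c \in u, lt c x & ~ cone c x top].
  have [[c h]|n] := pselect (W x); last by exists o.
  by exists c => _.
have bE x c : c \in u -> lt c x -> ~ cone c x top -> base x = c.
  move=> cu cx nc; have [|cu' cx' nc'] := bP x; first by exists c.
  exact: (uniq _ _ x).
have cone_W x y : W x -> cone (base x) x y -> W y /\ base y = base x.
  move=> sx cxy; have [cu cx nc] := bP x sx.
  have cy := cone_lt ta (coneC cxy).
  have ncy : ~ cone (base x) y top by move=> h; apply: nc; exact: (cone_trans ta cxy).
  by split; [exists (base x) | exact: bE].
have sf : star_family le W base base.
  split=> //.
  - by move=> x /bP[].
  - by move=> x y sx /(cone_W x y sx)[].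
  - move=> x l sx; have [cu cx nc] := bP x sx.
    have [y [cy ncy h]] := mt_branch mt (base x) (top :: l).
    have cy' : lt (base x) y by split=> // e; exact: ncy.
    have nl z : z \in top :: l -> ~ cone (base x) z y.
      by move=> zl [v [[bv nv] vz vy]]; apply: (h z v zl) => // e; exact: nv.
    have nb : ~ cone (base x) y top by move=> /coneC; apply: nl; exact: mem_head.
    exists y; split; [by exists (base x) | exact: bE |].
    by move=> z zl; apply: nl; rewrite inE zl orbT.
  - move=> x y sx _ xy; have [cu cx nc] := bP x sx.
    by have [_ ->] := cone_W x y sx (cone_le ta cx xy).
have FixW : Fix (fun x => ~ W x) = star_group act W base.
  apply/funext => g; apply/propext; split=> [gf|[gf _]] //; split=> // x sx.
  have [cu cx nc] := bP x sx.
  have gc : act g (base x) = base x by apply: gf; exact: uW.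
  have gp : act g top = top by apply: gf; exact: uW.
  have go : act g o = o by apply: gf; exact: uW.
  apply: bE => //; first by have := lt_act ta go cx; rewrite gc.
  move=> /(cone_act ta (act_V ta go)); rewrite (actK ta) !(act_V ta) //.
have disj x : ifW le gaps x -> W x -> False.
  move=> [q [m1 m2 qq cons] qx] [c [cu cx nc]].
  have [[z [qz zx zq]] nqx] := qx; have q2 := topP _ m2.
  have [cq|/le_lt_or_eq[qc|e]] := utot cu m1.
  - apply: nc; exists z; split=> //; last exact: (mt_trans mt zq).
    exact: (le_lt_trans ta cq).
  - have [h|h] := utot cu m2; last by apply: nqx; apply: (mt_trans mt h); case: cx.
    have [h'|e] := le_lt_or_eq h; first by apply: (cons c).
    by apply: nqx; rewrite -e; case: cx.
  - apply: nc; exists z; split=> //; last exact: (mt_trans mt zq).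
    by rewrite -e.
have cov x : [\/ x \in u, ifW le gaps x | W x].
  have [c [cx cp cm]] := mt_meet mt x top.
  have [cu|/negP nc] := boolP (c \in u).
    have [lcx|<-] := le_lt_or_eq cx; last by constructor.
    constructor 3; exists c; split=> // -[z [cz zx zp]].
    exact: (lt_nle ta cz (cm z zx zp)).
  have nearest : exists d e, [/\ d \in u, e \in u, lt d c, lt c e &
      forall y, y \in u -> le y d \/ le e y].
    have cmp y : y \in u -> lt y c \/ lt c y.
      move=> yu; have nyc : y <> c by move=> e; apply: nc; rewrite -e.
      by have [h|h] := mt_tree mt (topP y yu) cp; [left | right]; split=> // e; apply: nyc.
    have oc : lt o c by split; [exact: (mt_root mt) | move=> e; apply: nc; rewrite -e].
    have ct : lt c top by split=> // e; apply: nc; rewrite e.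
    have [||d] := @chain_max _ _ _ _ _ ta [seq y <- u | `[< lt y c >]] c.
    - by apply/eqP => e; have : o \in [seq y <- u | `[< lt y c >]]; [rewrite mem_filter uo andbT; apply/asboolP | rewrite e].
    - by move=> y; rewrite mem_filter => /andP[/asboolP[]].
    rewrite mem_filter => /andP[/asboolP dc du] dP.
    have [||e] := @chain_min _ _ _ _ _ ta [seq y <- u | `[< lt c y >]] top.
    - by apply/eqP => e; have : top \in [seq y <- u | `[< lt c y >]]; [rewrite mem_filter topu andbT; apply/asboolP | rewrite e].
    - by move=> y; rewrite mem_filter => /andP[_ /topP].
    rewrite mem_filter => /andP[/asboolP ce eu] eP.
    exists d, e; split=> // y yu; have [h|h] := cmp y yu; [left | right].
      by apply: dP; rewrite mem_filter yu andbT; apply/asboolP.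
    by apply: eP; rewrite mem_filter yu andbT; apply/asboolP.
  have [d [e [du eu dc ce de]]] := nearest.
  constructor 2; exists (d, e).
    split=> //=; first exact: (lt_trans ta dc).
    by move=> y /de[h|h] [h1 h2]; [exact: (lt_nle ta h1) | exact: (lt_nle ta h2)].
  split; first by exists c; split=> //; case: ce.
  move=> /= ex; apply: (lt_nle ta ce); apply: cm => //.
  exact: topP.
have HE : forall g, Fix (fun x => x \in u) g <-> exists p q,
    [/\ igroup le act gaps p, Fix (fun x => ~ W x) q & g = (p * q)%g].
  apply: (Fix_prod ta (Z := fun x => x \in u)) => //.
  - by move=> x xu [q cq]; exact: gaps_mem.
  - move=> h x hZ [q cq qx]; exists q => //; have [m1 m2 _ _] := cq.
    by apply/(piece_inv ta) => //; exact: hZ.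
  - move=> h x hZ [c [cu cx nc]]; exists c; have ho := hZ o uo.
    split=> //; first by have := lt_act ta ho cx; rewrite hZ.
    move=> /(cone_act ta (act_V ta ho)); rewrite (actK ta) !(act_V ta) //; exact: hZ.
  - move=> x y [q cq qx] sy xy; have [m1 m2 _ _] := cq.
    have nqy : ~ piece q y by move=> qy; apply: (disj y) => //; exists q.
    by have [h1 h2] := proj1 (piece_up ta qx nqy) xy; exists q.2.
  - move=> x y [q cq qx] sy yx; have [m1 m2 _ _] := cq.
    have nqy : ~ piece q y by move=> qy; apply: (disj y) => //; exists q.
    exists q.1; split=> //; first exact: (proj1 (piece_down ta qx nqy)).
    by have [] := piece_lt ta qx.
apply: (exact_prod (n := j) (subgrp_igroup ta _) (subgrp_Fix ta _) _ _ HE _ _); last by rewrite j0 leqnn.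
- by move=> p q; exact: (Fix_compl_comm ta disj).
- by move=> g; exact: (Fix_compl_triv ta disj).
- exact: (igroup_exact ta gaps_family).
- by rewrite FixW; exact: (star_group_exact ta sf).
Qed.

End ChainStabilizers.

(** * Weak order types up to reversal *)

Section WeakOrders.
Variable A : zmodType.
Implicit Types (F : seq int -> A) (w : seq int).
Local Open Scope ring_scope.

(* Functions of the weak order type of a list, embedded in the integers. *)
Definition pattern F := forall (phi : int -> int) w,
  {in w &, forall x y, (x <= y) = (phi x <= phi y)} -> F (map phi w) = F w.

Definition neg w := [seq - x | x <- w].

Lemma pattern_neg F : pattern F -> pattern (fun w => F (neg w)).
Proof.
move=> pF phi w mon; rewrite /neg -(pF (fun x => - phi (- x)) [seq - x | x <- w]).
  by rewrite -!map_comp; congr F; apply: eq_map => x /=; rewrite opprK.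
move=> _ _ /mapP[x xw ->] /mapP[y yw ->]; rewrite !opprK !lerN2.
exact: mon.
Qed.

Lemma patternB F F' : pattern F -> pattern F' -> pattern (fun w => F w - F' w).
Proof. by move=> p p' phi w mon; rewrite p // p'. Qed.

Lemma pattern_sg e F : pattern F -> pattern (fun w => sg e (F w)).
Proof. by move=> p phi w mon; rewrite p. Qed.

Lemma pattern_delta F : pattern F -> pattern (delta F).
Proof.
move=> p phi w mon; rewrite -delta_map; apply: eq_delta_del => u1 x u2 e.
by apply: p => y z yu zu; apply: mon; rewrite e mem_cat inE orbCA -mem_cat ?yu ?zu orbT.
Qed.

(** A strict lower bound; by [cone_lowE] a [pattern] function does not see which one is taken. *)
Definition low w : int := foldr Num.min 0 w - 1.

Lemma lowP w x : x \in w -> low w < x.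
Proof.
rewrite /low; suff h : x \in w -> foldr Num.min 0 w <= x by move=> /h; lia.
by elim: w => [//|y w IH] /=; rewrite inE ge_min => /orP[/eqP ->|/IH ->]; rewrite ?lexx ?orbT.
Qed.

Definition cone_low F w := F (low w :: w).

Lemma cone_lowE F t w : pattern F -> (forall x, x \in w -> t < x) -> cone_low F w = F (t :: w).
Proof.
move=> p tw; pose phi x := if x == t then low w else x.
have e : map phi w = w.
  rewrite -[RHS]map_id; apply/eq_in_map => x xw; rewrite /phi.
  by have := tw x xw; case: eqP => // ->; rewrite ltxx.
rewrite /cone_low -(p phi (t :: w)) /= ?e; first by rewrite /phi eqxx.
have ep x : x \in w -> phi x = x.
  by move=> xw; rewrite /phi; have := tw x xw; case: eqP => // ->; rewrite ltxx.
have et : phi t = low w by rewrite /phi eqxx.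
move=> x y; rewrite !inE => /orP[/eqP ->|xw] /orP[/eqP ->|yw]; rewrite ?et ?ep ?lexx //.
- by have := tw y yw; have := lowP yw; lia.
- by have := tw x xw; have := lowP xw; lia.
Qed.

Lemma pattern_cone_low F : pattern F -> pattern (cone_low F).
Proof.
move=> p phi w mon; pose phi' x := if x == low w then low (map phi w) else phi x.
have ep x : x \in w -> phi' x = phi x.
  by move=> xw; rewrite /phi'; have := lowP xw; case: eqP => // ->; rewrite ltxx.
have et : phi' (low w) = low (map phi w) by rewrite /phi' eqxx.
rewrite /cone_low -(p phi' (low w :: w)) /= ?et.
  by congr (F (_ :: _)); apply/eq_in_map => x xw; rewrite ep.
have lowP' x : x \in w -> low (map phi w) < phi x by move=> xw; apply: lowP; exact: map_f.
move=> x y; rewrite !inE => /orP[/eqP ->|xw] /orP[/eqP ->|yw]; rewrite ?et ?ep ?lexx //.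
- by have := lowP yw; have := lowP' y yw; lia.
- by have := lowP xw; have := lowP' x xw; lia.
- exact: mon.
Qed.

(** Of a nonconstant list and its negative exactly one is rising, which selects one element in each
    pair of opposite lists. *)
Definition rising w := if w is x :: w' then
  if [seq y <- w' | y != x] is z :: _ then x < z else false else false.

Lemma rising_const j c : rising (nseq j c) = false.
Proof.
case: j => [//|j] /=; rewrite (_ : [seq y <- nseq j c | y != c] = [::]) //.
by elim: j => //= j ->; rewrite eqxx.
Qed.

Lemma const_or_rising w : w = nseq (size w) (head 0 w) \/ rising (neg w) = ~~ rising w.
Proof.
case: w => [|x w] /=; first by left.
have -> : [seq y <- neg w | y != - x] = [seq - y | y <- w & y != x].
  by elim: w => //= y w IH; rewrite eqr_opp; case: eqP => //= _; rewrite -IH.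
case E: [seq y <- w | y != x] => [|z l] /=; last first.
  right; have : z \in [seq y <- w | y != x] by rewrite E mem_head.
  by rewrite mem_filter => /andP[zx _]; rewrite -leNgt ltrN2; lia.
left; congr cons; elim: w E => //= y w IH; case: eqP => //= -> /IH e.
by rewrite {1}e.
Qed.

Lemma rising_map (phi : int -> int) w : {in w &, forall x y, (x <= y) = (phi x <= phi y)} ->
  rising (map phi w) = rising w.
Proof.
case: w => [//|x w] mon /=.
have inj y : y \in w -> (phi y != phi x) = (y != x).
  move=> yw; have h1 := mon x y (mem_head _ _); have h2 := mon y x.
  rewrite !inE eqxx yw orbT in h1 h2; have {}h1 := h1 isT; have {}h2 := h2 isT isT.
  by rewrite !eq_le h1 h2.
have -> : [seq y <- map phi w | y != phi x] = map phi [seq y <- w | y != x].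
  rewrite filter_map; congr map; apply: eq_in_filter => y yw /=; exact: inj.
case E: [seq y <- w | y != x] => [//|z l] /=.
have : z \in [seq y <- w | y != x] by rewrite E mem_head.
rewrite mem_filter => /andP[_ zw].
by rewrite !ltNge (mon z x) // inE ?zw ?eqxx ?orbT.
Qed.

Lemma negK w : neg (neg w) = w.
Proof. by rewrite /neg -map_comp -[RHS]map_id; apply: eq_map => x /=; rewrite opprK. Qed.

Lemma sgK e (a : A) : sg e (sg e a) = a. Proof. by case: e => /=; rewrite ?opprK. Qed.

Lemma sgB e (a b : A) : sg e (a - b) = sg e a - sg e b.
Proof. by case: e => //=; rewrite opprD. Qed.

(* The complex of weak order types is contracted by adding a new minimum. The defect of
   symmetry of the contraction is a cocycle of the opposite symmetry, one degree lower;
   its primitive is desymmetrized by restricting it to rising lists, which is possible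
   if it vanishes on constant lists. *)
Lemma symmetric_exact e j F : pattern F -> (forall c, F (nseq j c) = 0) ->
  (forall w, size w = j -> F (neg w) = sg e (F w)) ->
  (forall w, size w = j.+1 -> delta F w = 0) ->
  exists b, [/\ pattern b, forall c, b (nseq j.-1 c) = 0,
    forall w, size w = j.-1 -> b (neg w) = sg e (b w) & forall w, size w = j -> F w = delta b w].
Proof.
elim: j e F => [|j IH] e F pF F0 Fe Fc.
  exists (fun=> 0); split=> // [w _|[|//] _]; first by case: (e); rewrite /= ?oppr0.
  by rewrite /= -(F0 0).
pose ka := cone_low F (nseq j 0).
have kaE c : cone_low F (nseq j c) = ka.
  have mn : map (fun=> c) (nseq j (0 : int)) = nseq j c by rewrite map_nseq.
  rewrite /ka -mn; apply: (pattern_cone_low pF (phi := fun=> c)) => x y.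
  by rewrite !mem_nseq => /andP[_ /eqP ->] /andP[_ /eqP ->]; rewrite !lexx.
have hE w : size w = j.+1 -> F w = delta (cone_low F) w.
  move=> sw; have /eqP := Fc (low w :: w) (congr1 S sw); rewrite /= subr_eq0 => /eqP ->.
  apply: eq_delta_del => u1 x u2 ew; apply/esym; apply: cone_lowE => // y yu.
  by apply: lowP; rewrite ew mem_cat inE orbCA -mem_cat yu orbT.
have ka0 : ~~ odd j -> ka = 0.
  move=> ej; have := hE (nseq j.+1 0) (size_nseq _ _); rewrite F0.
  rewrite (@eq_delta_del _ _ _ (fun=> ka)) ?delta_const ?size_nseq /= ?ej // => u1 x u2 eu.
  have {}eu : nseq j.+1 0 = u1 ++ x :: u2 := eu.
  rewrite -(kaE 0); congr cone_low; have <- : size (u1 ++ u2) = j.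
    by have := congr1 size eu; rewrite !size_cat /= size_nseq addnS => -[->].
  apply/all_pred1P/allP => z zu.
  by have : z \in nseq j.+1 0; [rewrite eu mem_cat inE orbCA -mem_cat zu orbT | rewrite mem_nseq => /andP[]].
(* A coboundary is subtracted so that the primitive vanishes on constant lists, where [rising]
   cannot distinguish a list from its negative. *)
pose h1 w := cone_low F w - delta (fun=> ka) w.
have ph1 : pattern h1.
  apply: patternB; first exact: pattern_cone_low.
  by move=> phi w _; rewrite !delta_const size_map.
have h1E w : size w = j.+1 -> delta h1 w = F w by move=> sw; rewrite deltaB delta_delta subr0 -hE.
have h10 c : h1 (nseq j c) = 0.
  rewrite /h1 kaE delta_const size_nseq; case: ifPn => [_|/ka0 ->]; first by rewrite subrr.
  by rewrite subr0.
pose K w := h1 w - sg e (h1 (neg w)).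
have nnseq c i : neg (nseq i c) = nseq i (- c) by rewrite /neg map_nseq.
have [|c|w sw|w sw|k [pk k0 ks kE]] := IH (~~ e) K.
- by apply: patternB => //; apply: pattern_sg; exact: pattern_neg.
- by rewrite /K nnseq !h10; case: (e); rewrite /= !oppr0 addr0.
- by rewrite /K negK; case: (e) => /=; zmod.
- rewrite deltaB delta_sg (delta_map -%R h1) !h1E ?size_map // Fe // sgK subrr //.
(* In length [j.-1], [k] is [y] minus the signed reflection of [y]: the defect is split in two
   without dividing by 2. *)
pose y w := if rising w then k w else 0.
have py : pattern y.
  by move=> phi w mon; rewrite /y rising_map // pk.
have yE w : size w = j.-1 -> y (neg w) = sg e (y w - k w).
  move=> sw; rewrite /y; have [ew|er] := const_or_rising w.
    move: ew; set c := head 0 w; rewrite sw => ->.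
    by rewrite nnseq !rising_const k0; case: (e); rewrite /= ?subr0 ?oppr0.
  by rewrite er; case: (rising w) => /=; rewrite ?subrr ?ks //; case: (e) => /=; zmod.
exists (fun w => h1 w - delta y w); split.
- by apply: patternB => //; exact: pattern_delta.
- move=> c /=; rewrite h10 (@eq_delta_del _ _ _ (fun=> 0)) ?delta0 ?subrr // => u1 x u2 eu.
  have -> : u1 ++ u2 = nseq j.-1 c; last by rewrite /y rising_const.
  have <- : size (u1 ++ u2) = j.-1.
    by have := congr1 size eu; rewrite !size_cat /= size_nseq addnS => ->.
  apply/all_pred1P/allP => z zu.
  by have : z \in nseq j c; [rewrite eu mem_cat inE orbCA -mem_cat zu orbT | rewrite mem_nseq => /andP[]].
- move=> w /= sw; have eK : h1 (neg w) = sg e (h1 w - K w) by rewrite /K sgB; case: (e) => /=; zmod.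
  rewrite eK -(delta_map -%R y).
  have -> : delta (fun u => y (map -%R u)) w = delta (fun v => sg e (y v - k v)) w.
    by apply: eq_delta => u su; apply: yE; rewrite -sw -su.
  rewrite delta_sg (deltaB y k) -kE //; move: (h1 w) (K w) (delta y w) => a1 a2 a3.
  by rewrite !sgB; zmod.
- by move=> w sw; rewrite deltaB delta_delta subr0 h1E.
Qed.

(** Reduction to cochains vanishing on constant lists: the value [ka] taken there is a coboundary or
    zero, by parity. *)
Lemma weak_order_exact n F : pattern F -> (forall w, F (neg w) = F w) ->
  (forall w, size w = n.+2 -> delta F w = 0) ->
  exists B, [/\ pattern B, forall w, B (neg w) = B w & forall w, size w = n.+1 -> F w = delta B w].
Proof.
move=> pF Fn Fc; pose ka := F (nseq n.+1 0).
have kaE c : F (nseq n.+1 c) = ka.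
  have mn : map (fun=> c) (nseq n.+1 (0 : int)) = nseq n.+1 c by rewrite map_nseq.
  rewrite /ka -mn; apply: (pF (fun=> c)) => x y.
  by rewrite !mem_nseq => /andP[_ /eqP ->] /andP[_ /eqP ->]; rewrite !lexx.
have ka0 : odd n -> ka = 0.
  move=> on; have := Fc (nseq n.+2 0) (size_nseq _ _).
  rewrite (@eq_delta_del _ _ _ (fun=> ka)) ?delta_const ?size_nseq /= ?negbK ?on // => u1 x u2 eu.
  have {}eu : nseq n.+2 0 = u1 ++ x :: u2 := eu.
  rewrite -(kaE 0); congr F; have <- : size (u1 ++ u2) = n.+1.
    by have := congr1 size eu; rewrite !size_cat /= size_nseq addnS => -[->].
  apply/all_pred1P/allP => z zu.
  by have : z \in nseq n.+2 0; [rewrite eu mem_cat inE orbCA -mem_cat zu orbT | rewrite mem_nseq => /andP[]].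
have [||w sw|w sw|b [pb _ bs bE]] := @symmetric_exact false n.+1 (fun w => F w - delta (fun=> ka) w).
- by apply: patternB => // phi w _; rewrite !delta_const size_map.
- move=> c; rewrite kaE delta_const size_nseq /=; case: ifPn => [_|]; first by rewrite subrr.
  by rewrite negbK => /ka0 ->; rewrite subr0.
- by rewrite Fn !delta_const size_map.
- by rewrite deltaB delta_delta subr0 Fc.
exists (fun w => if size w == n then b w + ka else 0); split.
- by move=> phi w mon; rewrite size_map pb.
- by move=> w; rewrite size_map; case: eqP => // sw; rewrite bs.
- move=> w sw; rewrite (@eq_delta _ _ _ (fun w => b w + ka)) => [|u].
    by rewrite (deltaD b) -bE // subrK.
  by rewrite sw => -[->]; rewrite eqxx.
Qed.

End WeakOrders.

(* [btw a x b]: the point [x] lies on the arc from [a] to [b]. *)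
Record tree_symmetry (T : countType) (btw : T -> T -> T -> Prop) (G : groupType)
    (act : G -> T -> T) : Prop := TreeSymmetry {
  ts_root : forall o, tree_action (btw o) o act;
  ts_sym : forall a x b, btw a x b -> btw b x a;
  ts_act : forall g a x b, btw a x b -> btw (act g a) (act g x) (act g b);
  ts_split : forall o a b x, btw a x b -> btw o x a \/ btw o x b;
  ts_med : forall o a b p, is_meet (btw o) a b p <-> [/\ btw o p a, btw o p b & btw a p b] }.

(** * Lists contained in an arc *)

Section LinearLists.
Variables (T : countType) (btw : T -> T -> T -> Prop) (G : groupType) (act : G -> T -> T).
Hypothesis ts : tree_symmetry btw act.
Let ta o := ts_root ts o.
Let mt o := ta_tree (ta o).
Variable A : zmodType.
Implicit Types (u v : seq T) (w : seq int).

Definition linear u := exists a b, forall x, x \in u -> btw a x b.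
Definition chain o u := forall x y, x \in u -> y \in u -> btw o x y \/ btw o y x.

Lemma btw_rebase a o x y : btw a o x -> btw a o y -> (btw a x y <-> btw o x y).
Proof.
move=> ox oy; split=> xy.
  have [h|//] := ts_split ts o xy.
  by rewrite (mt_anti (mt a) (ts_sym ts h) ox); exact: (mt_root (mt o)).
have [h|//] := ts_split ts a xy.
by rewrite (mt_anti (mt a) h ox).
Qed.

(** Rooting the tree at the entry nearest to one end of the arc turns the list into a chain, the
    form required by [chain_exact]. *)
Lemma linear_root u : linear u -> u != [::] -> exists2 o, o \in u & chain o u.
Proof.
move=> [a [b ub]] un; have [o ou oP] := chain_min (ta a) un ub.
exists o => // x y xu yu.
rewrite -(btw_rebase (oP x xu) (oP y yu)) -(btw_rebase (oP y yu) (oP x xu)).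
exact: (mt_tree (mt a) (ub x xu) (ub y yu)).
Qed.

Lemma chain_cons o m u : chain o u -> (forall x, x \in u -> btw o m x) -> chain o (m :: u).
Proof.
move=> cu mu x y; rewrite !inE => /orP[/eqP ->|xu] /orP[/eqP ->|yu]; last exact: cu.
- by left; exact: (mt_refl (mt o)).
- by left; exact: mu.
- by right; exact: mu.
Qed.

Lemma chain_linear o u : chain o u -> linear (o :: u).
Proof.
move=> cu; have cou := chain_cons cu (fun x _ => mt_root (mt o) x).
have [m mu mP] := chain_top (ta o) (mem_head o u) cou.
by exists o, m.
Qed.

Lemma linear_sub u v : {subset v <= u} -> linear u -> linear v.
Proof. by move=> s [a [b h]]; exists a, b => x /s/h. Qed.

Lemma sub_del u1 (x : T) u2 : {subset u1 ++ u2 <= u1 ++ x :: u2}.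
Proof. by move=> y yu; rewrite mem_cat inE orbCA -mem_cat yu orbT. Qed.

Definition fork o u m := exists x y, [/\ x \in u, y \in u, ~ (btw o x y \/ btw o y x) & is_meet (btw o) x y m].

Lemma fork_exists o u : ~ chain o u -> exists m, fork o u m.
Proof.
move=> nc; have [[x [y [xu yu n]]]|n] := pselect (exists x y, [/\ x \in u, y \in u & ~ (btw o x y \/ btw o y x)]).
  by have [m h] := mt_meet (mt o) x y; exists m, x, y.
case: nc => x y xu yu; have [//|n'] := pselect (btw o x y \/ btw o y x).
by case: n; exists x, y.
Qed.

Lemma meet_uniq o x y m m' : is_meet (btw o) x y m -> is_meet (btw o) x y m' -> m = m'.
Proof. by move=> [h1 h2 h3] [h4 h5 h6]; apply: (mt_anti (mt o)); [exact: h6 | exact: h3]. Qed.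

(* The incomparable pairs of a linear list all have the same meet, the projection of the
   root to an arc containing the list. *)
Lemma fork_linear o u m : linear u -> fork o u m -> [/\ linear (m :: u),
  forall x, x \in u -> btw o m x & forall m', fork o u m' -> m' = m].
Proof.
move=> [a [b uab]] [x0 [y0 [xu yu nxy hm]]]; have [p hp] := mt_meet (mt o) a b.
have [pa pb pab] := (ts_med ts o a b p).1 hp.
have low z : z \in u -> btw o p z.
  move=> zu; have zab := uab z zu.
  have key c d : btw o p c -> btw o z c -> btw o p d -> is_meet (btw o) c d p -> btw c z d -> btw o p z.
    move=> pc zc pd mcd czd; have [//|zp] := mt_tree (mt o) pc zc.
    have mz : is_meet (btw o) c d z by apply/(ts_med ts); split=> //; exact: (mt_trans (mt o) zp).
    by rewrite (meet_uniq mcd mz); exact: (mt_refl (mt o)).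
  have [h|h] := ts_split ts o zab; first exact: (key a b).
  by apply: (key b a) => //; [exact: is_meetC | exact: (ts_sym ts)].
have meetE x y z : x \in u -> y \in u -> ~ (btw o x y \/ btw o y x) -> is_meet (btw o) x y z -> z = p.
  move=> {}xu {}yu n hz; apply: (meet_uniq hz); split; [exact: low | exact: low |] => t tx ty.
  have [_ _ pmax] := hp.
  have [xa|xb] := ts_split ts o (uab x xu); have [ya|yb] := ts_split ts o (uab y yu).
  - by case: n; exact: (mt_tree (mt o) xa ya).
  - by apply: pmax; [exact: (mt_trans (mt o) tx) | exact: (mt_trans (mt o) ty)].
  - by apply: pmax; [exact: (mt_trans (mt o) ty) | exact: (mt_trans (mt o) tx)].
  - by case: n; exact: (mt_tree (mt o) xb yb).
have -> : m = p by exact: (meetE x0 y0).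
split=> // [|m' [x [y [? ? ? ?]]]]; last exact: (meetE x y).
by exists a, b => x; rewrite inE => /orP[/eqP ->|/uab].
Qed.

Local Open Scope ring_scope.


Variable o : T.

(* [b1] corrects [f] so that it vanishes on chains; then coning from the fork is
   consistent, since it kills the faces that are chains. *)
Lemma linear_row_exact i : row_exact A linear i.
Proof.
move=> f fc; have [pick pickP] := picker o; pose m u := pick (fork o u).
have mP u : ~ chain o u -> fork o u (m u) by move=> nc; apply: pickP; exact: fork_exists.
pose b1 u := if `[< chain o u >] then f (o :: u) else 0.
pose f1 u := f u - delta b1 u.
pose b2 u := if `[< chain o u >] then 0 else f1 (m u :: u).
have f1c u : linear u -> size u = i.+1 -> delta f1 u = 0.
  by move=> Lu su; rewrite deltaB delta_delta subr0 fc.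
have chain_sub u v : {subset v <= u} -> chain o u -> chain o v.
  by move=> s c x y /s xu /s yu; exact: c.
have f1_chain u : chain o u -> size u = i -> f1 u = 0.
  move=> cu su; have /eqP := fc (o :: u) (chain_linear cu) (congr1 S su).
  rewrite /= subr_eq0 => /eqP fE; rewrite /f1 fE -deltaB.
  rewrite (@eq_delta_del _ _ _ (fun=> 0)) ?delta0 // => u1 x u2 eu.
  by rewrite /b1 asboolT ?subrr //; apply: (chain_sub u) => //; rewrite eu; exact: sub_del.
suff h u : linear u -> size u = i -> f1 u = delta b2 u.
  exists (fun u => b1 u + b2 u) => u Lu su; rewrite deltaD -h //.
  by rewrite /f1 addrC subrK.
move=> Lu su; have [cu|nc] := pselect (chain o u).
  rewrite f1_chain // (@eq_delta_del _ _ _ (fun=> 0)) ?delta0 // => u1 x u2 eu.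
  by rewrite /b2 asboolT //; apply: (chain_sub u) => //; rewrite eu; exact: sub_del.
have [Lm low un] := fork_linear Lu (mP u nc).
have /eqP := f1c (m u :: u) Lm (congr1 S su); rewrite /= subr_eq0 => /eqP ->.
apply: eq_delta_del => u1 x u2 eu.
have sub : {subset u1 ++ u2 <= u} by rewrite eu; exact: sub_del.
rewrite /b2; case: asboolP => [cv|nv].
  apply: f1_chain; last by rewrite /= -su eu !size_cat /= addnS.
  by apply: chain_cons => // y /sub; exact: low.
have [y [z [/sub yu /sub zu n h]]] := mP _ nv.
by rewrite (un (m (u1 ++ u2))) //; exists y, z.
Qed.

Lemma linear_stab_exact u j : linear u -> u != [::] -> (0 < j)%N ->
  exact A (stab (fun=> True) act u) j.
Proof.
move=> Lu un j0; have [c cu ch] := linear_root Lu un.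
have -> : stab (fun=> True) act u = Fix act (fun x => x \in u).
  apply/funext => g; apply/propext; split=> [[_ /eqP]|gu].
    rewrite -[X in _ == X]map_id => /eqP/eq_in_map h x xu; exact: h.
  by split=> //; rewrite -[RHS]map_id; apply/eq_in_map => x xu; exact: gu.
by apply: (chain_exact (ta c) cu ch).
Qed.

(** Root the tree at a third point [z]: both [x] and [y] are then strictly above the root, and
    [homogeneous2] applies. *)
Lemma act_transitive x y : exists g, act g x = y.
Proof.
have [z [_ zx h]] := mt_branch (mt x) x [:: y].
have zy : z <> y.
  move=> e; apply: (h y z (mem_head _ _)) => //; rewrite ?e; try exact: (mt_refl (mt x)).
  exact: (mt_root (mt x)).
have zl t : z <> t -> lt (btw z) z t by move=> n; split=> //; exact: (mt_root (mt z)).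
have zx' : z <> x := zx.
by have [g [_ _ gxy]] := homogeneous2 (ta z) (zl x zx') (zl y zy); exists g.
Qed.

(** Back-and-forth yields an isomorphism between two rootings. Followed by an element carrying [o2]
    back to [o1], it becomes an automorphism of one rooted tree, which the group realizes. *)
Lemma chain_transport o1 o2 (p : seq (T * T)) : (o1, o2) \in p ->
  (forall q r : T * T, q \in p -> r \in p -> btw o1 q.1 r.1 \/ btw o1 r.1 q.1) ->
  (forall q r : T * T, q \in p -> r \in p -> (btw o1 q.1 r.1 <-> btw o2 q.2 r.2)) ->
  exists g, forall q : T * T, q \in p -> act g q.1 = q.2.
Proof.
move=> op tot iso.
have [f [f' [fK f'K fle fp]]] := back_and_forth (mt o1) (mt o2) (chain_piso (mt o1) (mt o2) op tot iso).
have [g0 g0o] := act_transitive o1 o2.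
have [x|x|x y|g gP] := ta_realize (ta o1) (f := fun x => act g0^-1%g (f x)) (f' := fun x => f' (act g0 x)).
- by rewrite /= (actVK (ta o)) fK.
- by rewrite /= f'K (actK (ta o)).
- have e : act g0^-1%g o2 = o1 by rewrite -g0o (actK (ta o)).
  rewrite fle; split=> [/(ts_act ts g0^-1%g)|]; first by rewrite e.
  by rewrite -{1}e => /(ts_act ts g0); rewrite !(actVK (ta o)).
exists (g0 * g)%g => u up; rewrite (ta_M (ta o)) gP (actVK (ta o)); exact: fp.
Qed.

Variable s : int -> T.
Hypothesis s_lt : forall i j, i < j -> lt (btw o) (s i) (s j).

Lemma s_inj : injective s.
Proof. by move=> i j e; case: (ltrgtP i j) => // /s_lt[_]; rewrite e. Qed.

Lemma s_le i j : i <= j -> btw o (s i) (s j).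
Proof.
rewrite le_eqVlt => /orP[/eqP ->|/s_lt[]//]; exact: (mt_refl (mt o)).
Qed.

Lemma s_btwE i j k : btw (s i) (s j) (s k) <-> (i <= j <= k) \/ (k <= j <= i).
Proof.
have up a b c : a <= b -> b <= c -> btw (s a) (s b) (s c).
  by move=> ab bc; apply/(btw_rebase (s_le ab) (s_le (le_trans ab bc))); exact: s_le.
have out a b c : a < b -> b <= c -> ~ btw (s b) (s a) (s c).
  move=> ab bc h; have h1 := up a b c (ltW ab) bc.
  have /s_inj e := mt_anti (mt (s c)) (ts_sym ts h) (ts_sym ts h1).
  by rewrite e ltxx in ab.
split; last by case=> /andP[h1 h2]; [exact: up | apply: (ts_sym ts); exact: up].
move=> h; have h' := ts_sym ts h.
have [ik|ki] := leP i k.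
  left; apply/andP; split; rewrite leNgt; apply/negP => lt1; first exact: (out j i k).
  have h1 := up i k j ik (ltW lt1).
  have /s_inj e := mt_anti (mt (s i)) h h1.
  by rewrite e ltxx in lt1.
right; apply/andP; split; rewrite leNgt; apply/negP => lt1; first exact: (out j k i lt1 (ltW ki)).
have h1 := up k i j (ltW ki) (ltW lt1).
have /s_inj e := mt_anti (mt (s k)) h' h1.
by rewrite e ltxx in lt1.
Qed.

Lemma min_In w : w != [::] -> exists2 x, x \in w & forall y, y \in w -> x <= y.
Proof.
elim: w => [//|x w IH] _; have [->|wn] := eqVneq w [::].
  by exists x; rewrite ?mem_head // => y; rewrite inE => /eqP ->.
have [m mw mP] := IH wn; have [xm|mx] := leP x m.
  exists x; rewrite ?mem_head // => y; rewrite inE => /orP[/eqP -> //|/mP]; exact: le_trans.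
exists m; rewrite ?inE ?mw ?orbT // => y; rewrite inE => /orP[/eqP ->|/mP//]; exact: ltW.
Qed.

(** Rooted at its least entry the source list is a chain; on the target side the arc may be read
    from either end. This is where reversal enters. *)
Lemma s_transport w (psi : int -> int) :
  {in w &, forall x y, (x <= y) = (psi x <= psi y)} \/ {in w &, forall x y, (x <= y) = (psi y <= psi x)} ->
  exists g, map (act g) (map s w) = map s (map psi w).
Proof.
have [-> _|wn] := eqVneq w [::]; first by exists 1%g.
have [x0 x0w x0P] := min_In wn => mon.
have [||u v|g gP] := @chain_transport (s x0) (s (psi x0)) [seq (s x, s (psi x)) | x <- w].
- by apply/mapP; exists x0.
- move=> u v /mapP[x xw ->] /mapP[y yw ->] /=; rewrite !s_btwE.
  by have := x0P x xw; have := x0P y yw; case: (leP x y) => h h1 h2; [left | right]; left; lia.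
- move=> /mapP[x xw ->] /mapP[y yw ->] /=; rewrite !s_btwE.
  have h1 := x0P x xw; have h2 := x0P y yw; case: mon => mon.
    have := mon x0 x x0w xw; have := mon x0 y x0w yw; have := mon x y xw yw; have := mon y x yw xw.
    lia.
  have := mon x0 x x0w xw; have := mon x0 y x0w yw; have := mon x y xw yw; have := mon y x yw xw.
  lia.
exists g; rewrite -!map_comp; apply/eq_in_map => x xw /=.
by apply: (gP (s x, s (psi x))); apply/mapP; exists x.
Qed.

(** Betweenness determines a linear order up to reversal; the images of the two extreme entries
    decide which direction occurs. *)
Lemma s_orbit (B : seq int -> A) g w w' : pattern B -> (forall w, B (neg w) = B w) ->
  map (act g) (map s w) = map s w' -> B w' = B w.
Proof.
move=> pB Bn e.
have /choice[psi psiP] x : exists y, x \in w -> act g (s x) = s y.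
  have [xw|nx] := boolP (x \in w); last by exists 0.
  have : act g (s x) \in map s w' by rewrite -e; do 2 apply: map_f.
  by move=> /mapP[y _ ->]; exists y.
have -> : w' = map psi w.
  apply: (inj_map s_inj); rewrite -e -!map_comp; apply/eq_in_map => x xw /=; exact: psiP.
have [->//|wn] := eqVneq w [::].
have [x0 x0w x0P] := min_In wn.
have [|x1' /mapP[x1 x1w ->] x1P] := @min_In (neg w); first by rewrite -size_eq0 size_map size_eq0.
have {}x1P y : y \in w -> y <= x1.
  by move=> yw; have := x1P (- y); rewrite lerN2; apply; apply/mapP; exists y.
have pinj x y : x \in w -> y \in w -> psi x = psi y -> x = y.
  by move=> xw yw exy; apply: s_inj; apply: (act_inj (ta o) (g := g)); rewrite !psiP // exy.
have mid x y z : x \in w -> y \in w -> z \in w -> x <= y <= z ->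
    (psi x <= psi y <= psi z) \/ (psi z <= psi y <= psi x).
  move=> xw yw zw xyz; apply/s_btwE; rewrite -!psiP //; apply: (ts_act ts); apply/s_btwE; by left.
have [le01|lt10] := leP (psi x0) (psi x1).
  apply: pB => x y xw yw; apply/idP/idP.
    move=> xy; have := mid x0 x y x0w xw yw; have := mid x0 y x1 x0w yw x1w; have := mid x0 x x1 x0w xw x1w.
    have := x0P x xw; have := x0P y yw; have := x1P x xw; have := x1P y yw; lia.
  move=> pxy; rewrite leNgt; apply/negP => yx.
  suff : psi x = psi y by move=> /(pinj _ _ xw yw) exy; rewrite exy ltxx in yx.
  have := mid x0 y x x0w yw xw; have := mid x0 y x1 x0w yw x1w; have := mid x0 x x1 x0w xw x1w.
  have := x0P x xw; have := x0P y yw; have := x1P x xw; have := x1P y yw; lia.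
have -> : map psi w = neg (map (fun x => - psi x) w).
  by rewrite /neg -map_comp; apply: eq_map => x /=; rewrite opprK.
rewrite Bn; apply: pB => x y xw yw; rewrite lerN2; apply/idP/idP.
  move=> xy; have := mid x0 x y x0w xw yw; have := mid x0 y x1 x0w yw x1w; have := mid x0 x x1 x0w xw x1w.
  have := x0P x xw; have := x0P y yw; have := x1P x xw; have := x1P y yw; lia.
move=> pxy; rewrite leNgt; apply/negP => yx.
suff : psi x = psi y by move=> /(pinj _ _ xw yw) exy; rewrite exy ltxx in yx.
have := mid x0 y x x0w yw xw; have := mid x0 y x1 x0w yw x1w; have := mid x0 x x1 x0w xw x1w.
have := x0P x xw; have := x0P y yw; have := x1P x xw; have := x1P y yw; lia.
Qed.

Lemma count_lt (X : eqType) (P Q : pred X) (l : seq X) x : (forall z, P z -> Q z) -> x \in l ->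
  Q x -> ~~ P x -> (count P l < count Q l)%N.
Proof.
move=> PQ + Qx nPx; elim: l => [//|y l IH]; rewrite inE => /orP[/eqP <-|/IH h] /=.
  rewrite Qx (negbTE nPx) add0n ltnS; exact: sub_count.
rewrite -addnS; apply: leq_add => //; case E: (P y) => //; by rewrite (PQ _ E).
Qed.

(** Each entry is sent to its rank, the number of entries below it in the order rooted at an end of
    the list. *)
Lemma linear_ints u : linear u -> exists g w, map (act g) u = map s w.
Proof.
move=> Lu; have [->|un] := eqVneq u [::]; first by exists 1%g, [::].
have [c cu ch] := linear_root Lu un.
pose r x : int := count (fun y => `[< btw c y x >]) u.
have rE x y : x \in u -> y \in u -> (btw c x y <-> r x <= r y).
  move=> xu yu; split=> [xy|].
    rewrite lez_nat; apply: sub_count => z /asboolP zx; apply/asboolP.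
    exact: (mt_trans (mt c) zx).
  move=> rxy; have [//|yx] := ch x y xu yu; have [<-|nxy] := eqVneq x y; first exact: (mt_refl (mt c)).
  move: rxy; rewrite lez_nat leqNgt => /negP; case.
  apply: (@count_lt _ _ _ _ x) => //.
  - by move=> z /asboolP zy; apply/asboolP; exact: (mt_trans (mt c) zy).
  - by apply/asboolP; exact: (mt_refl (mt c)).
  - apply/asboolP => xy; case/eqP: nxy; exact: (mt_anti (mt c)).
have rc x : x \in u -> r c <= r x by move=> xu; apply/rE => //; exact: (mt_root (mt c)).
have [||v v'|g gP] := @chain_transport c (s (r c)) [seq (x, s (r x)) | x <- u].
- by apply/mapP; exists c.
- by move=> v v' /mapP[x xu ->] /mapP[y yu ->] /=; exact: ch.
- move=> /mapP[x xu ->] /mapP[y yu ->] /=; rewrite s_btwE rE //.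
  by have := rc x xu; have := rc y yu; move: (r x) (r y) (r c) => a b d; lia.
exists g, (map r u); rewrite -map_comp; apply/eq_in_map => x xu /=.
by apply: (gP (x, s (r x))); apply/mapP; exists x.
Qed.

(** Invariant cochains on linear lists amount to reversal-invariant functions of the weak order
    type: every orbit contains a list of terms of [s], and [s_orbit] makes the choice of that list
    immaterial. *)
Lemma linear_bottom n (f : seq T -> A) : invV (fun=> True) act f ->
  (forall u, linear u -> size u = n.+2 -> delta f u = 0) ->
  exists2 b, invV (fun=> True) act b & forall u, linear u -> size u = n.+1 -> f u = delta b u.
Proof.
move=> fi fc; have Ls w : linear (map s w).
  have [->|wn] := eqVneq w [::]; first by exists o, o.
  have ch : chain o (map s w).
    move=> x y /mapP[i _ ->] /mapP[j _ ->]; case: (lerP i j) => h; [left; exact: s_le|right].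
    by apply: s_le; exact: ltW.
  by apply: linear_sub (chain_linear ch) => x xs; rewrite inE xs orbT.
have [||w sw|B [pB Bn BE]] := @weak_order_exact A n (fun w => f (map s w)).
- move=> phi w mon; have [|g <-] := @s_transport w phi; first by left.
  by rewrite fi.
- move=> w; have [|g ge] := @s_transport w -%R; last by rewrite -[in RHS](fi g) // ge.
  by right=> x y _ _; rewrite lerN2.
- by rewrite delta_map fc // size_map.
have [pick pickP] := picker ([::] : seq int).
pose P u w := exists g, map (act g) u = map s w.
pose b u := B (pick (P u)).
have actc g h u : map (act g) (map (act h) u) = map (act (g * h)%g) u.
  by rewrite -map_comp; apply: eq_map => x /=; rewrite (ta_M (ta o)).
have act1 u : map (act 1%g) u = u by rewrite (eq_map (ta_1 (ta o))) map_id.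
have bi : invV (fun=> True) act b.
  move=> h u _; rewrite /b; congr B; congr pick; apply/funext => w; apply/propext.
  split=> -[g ge]; first by exists (g * h)%g; rewrite -actc.
  by exists (g * h^-1)%g; rewrite actc -mulgA mulVg mulg1.
have bs w : b (map s w) = B w.
  have [g ge] : P (map s w) (pick (P (map s w))) by apply: pickP; exists w, 1%g.
  exact: s_orbit ge.
exists b => // u Lu su; have [g [w ge]] := linear_ints Lu.
have sw : size w = n.+1 by rewrite -(size_map s) -ge size_map.
rewrite -(fi g) // ge BE //.
have -> : delta b u = delta b (map s w).
  by rewrite -ge -delta_map; apply: eq_delta => v _; rewrite bi.
by rewrite -delta_map; apply: eq_delta => v _; rewrite bs.
Qed.

End LinearLists.

Local Open Scope ring_scope.

Theorem tree_symmetry_exact (T : countType) (btw : T -> T -> T -> Prop) (G : groupType)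
    (act : G -> T -> T) (A : zmodType) (o : T) :
  tree_symmetry btw act -> forall j, (0 < j)%N -> exact A (fun _ : G => True) j.
Proof.
move=> ts [//|n] _ a ai ac; have ta := ts_root ts o.
have [b [_ ob _]] := mt_branch (ta_tree ta) o [::].
(* Any sequence increasing along an arc serves as a model of the integers. *)
have [|s [slt _ _ _]] := @bichain_exists _ _ _ _ _ ta (o, b).
  by split; [exact: (mt_root (ta_tree ta)) | move=> e; apply: ob].
have s_lt i j : i < j -> lt (btw o) (s i) (s j).
  by apply: (int_step (lt := lt (btw o))) => // x y z; exact: (lt_trans ta).
have sG : subgrp (fun _ : G => True) by [].
have Y0 : linear btw [:: o].
  by exists o, o => x; rewrite inE => /eqP ->; exact: (mt_refl (ta_tree ta)).
apply: (equivariant_vanishing sG (act := act) (Y := linear btw) _ _ _ _ ai Y0) => //.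
- exact: (ta_1 ta).
- by move=> g h x _ _; exact: (ta_M ta).
- by move=> u1 x u2; apply: linear_sub; exact: sub_del.
- move=> g u _ [c [d uP]]; exists (act g c), (act g d) => _ /mapP[x xu ->].
  by apply: (ts_act ts); exact: uP.
- by move=> i _; exact: (linear_row_exact ts o).
- move=> u Lu su; apply: (linear_stab_exact ts) => //; first by case: u su {Lu}.
  exact: inv_sub ai.
- move=> u j Lu su /andP[j0 _]; apply: (linear_stab_exact ts) => //; by case: u su {Lu}.
- by move=> f fi fc; exact: (linear_bottom ts s_lt fi fc).
Qed.

(** * Branch points of the dendrite *)

Local Open Scope classical_set_scope.
Local Open Scope ring_scope.

Lemma homeo_same (X : topologicalType) (g : Homeo X) (t x y : X) : same t x y -> same (g t) (g x) (g y).
Proof.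
move=> [K [Kx Kt Kc] Ky]; have [_ gK _] := homeo_inv_funP g.
apply: (@same_conn _ (g @` K)); [|move=> [z Kz]|by exists x|by exists y].
  by apply: connected_continuous_connected => //; apply: continuous_subspaceT; exact: homeo_cont.
by move/(congr1 (homeo_inv_fun g)); rewrite !gK => zt; apply: (Kt z).
Qed.

Lemma homeo_sameE (X : topologicalType) (g : Homeo X) (t x y : X) :
  same (g t) (g x) (g y) <-> same t x y.
Proof.
split; last exact: homeo_same.
by have [_ gK _] := homeo_inv_funP g; move/(homeo_same (homeo_inv g)); rewrite /= !gK.
Qed.

Lemma homeo_branch (X : topologicalType) (g : Homeo X) (t : X) : branch_point t -> branch_point (g t).
Proof.
have [_ gK _] := homeo_inv_funP g; have gi := can_inj gK.
move=> /branchP[x [y [z [[xt yt zt] [xy xz yz]]]]]; apply/branchP; exists (g x), (g y), (g z).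
by split; split; first [by move/gi | by move/homeo_sameE].
Qed.

(** * The tree of branch points and the extension of its automorphisms *)

Section BranchTree.
Variables (R : realType) (X : topologicalType).
Hypothesis hX : wazewski_dendrite R X.
Variables (T : countType) (i : T -> X).
Hypotheses (ii : injective i) (iP : forall x, branch_point x <-> exists n, i n = x).

Let Xk := waz_connected hX. Let Xc := waz_compact hX. Let lc := waz_lc hX. Let hd := waz_hausdorff hX.

Definition btwT a x b := ~ same (i x) (i a) (i b).

Lemma btwT_median (a b c : T) : exists m, median (i a) (i b) (i c) (i m).
Proof.
have [m mm] := waz_median hX (i a) (i b) (i c).
have bm : branch_point m.
  have br c' : m = i c' -> branch_point m by move=> ->; apply/iP; exists c'.
  have [/br //|ma] := pselect (m = i a); have [/br //|mb] := pselect (m = i b).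
  by have [/br //|mc] := pselect (m = i c); exact: median_branch mm ma mb mc.
by have [n e] := (iP m).1 bm; exists n; rewrite e.
Qed.

Lemma btwT_meet o a b p : is_meet (btwT o) a b p <-> median (i a) (i b) (i o) (i p).
Proof.
split=> [[pa pb h]|mp].
  have [m mm] := btwT_median a b o; case: (mm) => ma mb mab.
  suff -> : p = m by [].
  apply: ii; apply: (btw_anti hd lc Xk (o := i o)); last exact: h.
  exact: (median_meet hd lc Xk mm).
by case: (mp) => pa pb _; split=> // z za zb; exact: (median_meet hd lc Xk mp).
Qed.

Lemma btwT_mtree o : mtree (btwT o) o.
Proof.
split.
- by move=> x /same_ner.
- by move=> x y xy yx; apply: ii; exact: (btw_anti hd lc Xk xy yx).
- by move=> y x z xy yz; exact: (btw_trans hd lc Xk xy yz).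
- by move=> x /same_nel.
- by move=> x y z xz yz; exact: (btw_tree hd lc Xk xz yz).
- by move=> x y; have [m /btwT_meet mm] := btwT_median x y o; exists m.
- move=> x y xy ne; have [|z [bz zx zy zxy]] := cut hX (a := i x) (b := i y); first by move/ii.
  have [|xoz zoy] := btw_between hd lc Xk xy _ zx zy zxy; first by move/ii.
  by have [n e] := (iP z).1 bz; exists n; rewrite /btwT e; split=> // en; [apply: zx|apply: zy]; rewrite -e en.
- move=> a l; have ba : branch_point (i a) by apply/iP; exists a.
  have [x [bx xa xl]] := branch_avoid hX (i o :: map i l) ba.
  have [n e] := (iP x).1 bx; exists n; split.
  + by rewrite /btwT e => /same_sym; apply: xl; rewrite mem_head.
  + by move=> en; apply: xa; rewrite -e en.
  move=> y z yl az za zn zy; rewrite /btwT e in zn.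
  apply: (btw_branch hd lc Xk (o := i o) (a := i a) (x := x) (y := i y) (z := i z)) => //.
  + by apply: xl; rewrite mem_head.
  + by apply: xl; rewrite inE map_f ?orbT.
  + by move/ii.
Qed.

Lemma nbhs_branch (x : X) (V : set X) : nbhs x V -> exists n, V (i n).
Proof.
rewrite nbhsE => -[O [oO Ox] OV].
have [z Oz /iP[n e]] := open_branch hX oO (ex_intro _ x Ox).
by exists n; apply: OV; rewrite e.
Qed.

Lemma same_branch t x : x <> t -> exists n, same t x (i n).
Proof.
move=> xt; apply: (@nbhs_branch x).
by apply: open_nbhs_nbhs; split; [exact: same_open | exact: same_refl].
Qed.

Lemma cut_branch x y : x <> y -> exists n, [/\ i n <> x, i n <> y & ~ same (i n) x y].
Proof. by move/(cut hX) => [z [/iP[n <-] ? ? ?]]; exists n. Qed.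

Lemma nbhs_same (l : seq (T * T)) (x : X) : (forall p, p \in l -> same (i p.1) (i p.2) x) ->
  nbhs x [set y | forall p, p \in l -> same (i p.1) (i p.2) y].
Proof.
elim: l => [|q l IH] lx; first by apply: filterS (filterT : nbhs x setT) => y _ p.
have h1 := IH (fun p pl => lx p (@mem_behead _ (q :: l) p pl)).
have h2 : nbhs x (same (i q.1) (i q.2)).
  by apply: open_nbhs_nbhs; split; [exact: same_open | apply: lx; rewrite mem_head].
apply: filterS (filterI h2 h1) => y [qy ly] p; rewrite inE => /orP[/eqP ->|] //; exact: ly.
Qed.

Section Extension.

Definition respects (f f' : T -> T) := [/\ cancel f f', cancel f' f &
  forall t s s', same (i t) (i s) (i s') <-> same (i (f t)) (i (f s)) (i (f s'))].

Lemma respects_inv f f' : respects f f' -> respects f' f.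
Proof.
move=> [fK f'K h]; split=> // t s s'.
by have := h (f' t) (f' s) (f' s'); rewrite !f'K => ->.
Qed.

(* The value at [x] of a homeomorphism that acts on branch points as [f] can only be [y]. *)
Definition extends (f : T -> T) x y := forall t s, same (i t) (i s) x -> cell (i (f t)) (i (f s)) y.

Variables (f f' : T -> T).
Hypothesis ff : respects f f'.

(** Finitely many closed constraints on the value at [x]; closed cells are used instead of
    components so that compactness applies. *)
Let K (l : seq (T * T)) : set X := \bigcap_(p in [set p | p \in l]) cell (i (f p.1)) (i (f p.2)).
Let D x : set (seq (T * T)) := [set l | forall p, p \in l -> same (i p.1) (i p.2) x].

Let cellS_compact x (S : set X) : compact S -> (forall l, D x l -> S `&` K l !=set0) ->
  exists2 y, S y & extends f x y.
Proof.
move=> cS SK; have [||//||y Sy yK] := @directed_compact X (seq (T * T)) (D x) K S cS.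
- by exists [::].
- by move=> l _; apply: closed_bigI => p _; exact: cell_closed.
- move=> l l' Dl Dl'; exists (l ++ l').
    by move=> p; rewrite mem_cat => /orP[/Dl|/Dl'].
  by move=> y yK; split=> p /= pl; apply: yK => /=; rewrite mem_cat pl ?orbT.
exists y => // t s tsx; have Dl : D x [:: (t, s)] by move=> p; rewrite inE => /eqP ->.
exact: (yK _ Dl (t, s) (mem_head _ _)).
Qed.

Let DK x l : D x l -> exists n, K l (i n).
Proof.
move=> /nbhs_same /nbhs_branch[n nl]; exists (f n) => p /= /nl h; left.
by have [_ _ fS] := ff; exact: (fS _ _ _).1 h.
Qed.

Lemma extends_exists x : exists y, extends f x y.
Proof.
have [|y _ xy] := @cellS_compact x setT Xc; last by exists y.
by move=> l /DK[n nl]; exists (i n).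
Qed.

Lemma extends_branch t y : extends f (i t) y -> y = i (f t).
Proof.
move=> ty; apply: contrapT => /cut_branch[n [ny nt]]; apply.
have [fK f'K _] := ff.
have tn : same (i (f' n)) (i t) (i t) by apply: same_refl => /ii e; apply: nt; rewrite e f'K.
have [h|/= h] := ty _ _ tn; rewrite f'K in h; first exact: same_sym.
by case: ny.
Qed.

(** A branch point strictly between [y] and [y'] is the image of some branch point. The component of
    [x] at the latter prescribes on which side the value lies, and the case where [x] is that point
    is settled by [extends_branch]. *)
Lemma extends_uniq x y y' : extends f x y -> extends f x y' -> y = y'.
Proof.
move=> xy xy'; apply: contrapT => /cut_branch[n [ny ny']]; apply.
have [fK f'K _] := ff.
have [e|xn] := pselect (x = i (f' n)).
  by case: ny; rewrite e in xy; rewrite (extends_branch xy) f'K.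
have [s xs] := same_branch xn.
have [h|/= h] := xy _ _ (same_sym xs); have [h'|/= h'] := xy' _ _ (same_sym xs); rewrite f'K in h h'.
- by apply: (same_trans (same_sym h)).
- by case: ny'; rewrite h'.
- by case: ny; rewrite h.
- by case: ny; rewrite h.
Qed.

(** Uniqueness and compactness give continuity: otherwise the closed complement of a neighbourhood
    of [F x] would contain a second admissible value at [x]. *)
Lemma extends_continuous F : (forall x, extends f x (F x)) -> continuous F.
Proof.
move=> FE x O; rewrite nbhsE => -[U [oU Ux] UO].
have [[l Dl lU]|n] := pselect (exists2 l, D x l & K l `<=` U).
  apply: filterS (nbhs_same Dl) => y ly; apply/UO/lU => p /= pl.
  by apply: FE; exact: ly.
have [|l Dl|y nUy xy] := @cellS_compact x (~` U).
- by apply: (subclosed_compact _ Xc) => //; rewrite closedC.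
- apply: contrapT => ne; apply: n; exists l => // y Ky.
  by apply: contrapT => nU; apply: ne; exists y.
by case: nUy; rewrite (extends_uniq xy (FE x)).
Qed.

End Extension.

Lemma extends_cancel f f' x y x' : respects f f' -> extends f x y -> extends f' y x' -> x' = x.
Proof.
move=> ff xy yx'; have [fK f'K _] := ff; have ff' := respects_inv ff.
apply: contrapT => /cut_branch[n [nx' nx]]; apply.
have [|s xs] := same_branch (t := i n) (x := x); first by move/esym.
have [h|/= h] := xy _ _ (same_sym xs); last first.
  rewrite h in yx'; have := extends_branch ff' yx'; rewrite fK => e.
  by case: nx'.
have [h'|/= e] := yx' _ _ h; last by case: nx'; rewrite e fK.
by rewrite !fK in h'; apply: same_sym; exact: same_trans h'.
Qed.

Lemma respects_homeo f f' : respects f f' -> exists g : Homeo X, forall n, g (i n) = i (f n).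
Proof.
move=> ff; have ff' := respects_inv ff.
have /choice[F FP] := extends_exists ff; have /choice[F' FP'] := extends_exists ff'.
have Fh : is_homeo F.
  apply/asboolP; split; first exact: (extends_continuous ff).
  exists F'; split; first exact: (extends_continuous ff').
    by move=> x; exact: (extends_cancel ff (FP x) (FP' _)).
  by move=> x; exact: (extends_cancel ff' (FP' x) (FP _)).
by exists (MkHomeo Fh) => n; exact: (extends_branch ff (FP _)).
Qed.

(** [btw_median] expresses betweenness through the rooted order and medians, and medians with the
    root are meets, hence preserved. *)
Lemma root_respects o f f' : cancel f f' -> cancel f' f ->
  (forall x y, btwT o x y <-> btwT o (f x) (f y)) -> respects f f'.
Proof.
move=> fK f'K fle; split=> // x a b.
have [m mm] := btwT_median a b o.
have fo : f o = o.
  apply: ii; apply: (btw_anti hd lc Xk (o := i o)); last exact: (mt_root (btwT_mtree o) (f o)).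
  by have /fle := mt_root (btwT_mtree o) (f' o); rewrite f'K.
have fm : median (i (f a)) (i (f b)) (i o) (i (f m)).
  have /btwT_meet[ma mb h] := mm; apply/btwT_meet; split; [exact: (fle _ _).1|exact: (fle _ _).1|].
  move=> z za zb; rewrite -(f'K z); apply: (fle _ _).1; apply: h; apply: (fle _ _).2; by rewrite f'K.
have e1 := btw_median hd lc Xk (i x) mm; have e2 := btw_median hd lc Xk (i (f x)) fm.
have e : ~ same (i x) (i a) (i b) <-> ~ same (i (f x)) (i (f a)) (i (f b)).
  rewrite e1 e2; have := fle m x; have := fle x a; have := fle x b; rewrite /btwT.
  by move=> h1 h2 h3; split=> -[h4 h5]; split; [exact/h3|case: h5 => h5; [left|right]|exact/h3|case: h5 => h5; [left|right]];
    by [apply/h1|apply/h2].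
by split=> h; apply: contrapT => /e.
Qed.

Section Action.
Variable act : Homeo X -> T -> T.
Hypothesis actE : forall g n, i (act g n) = g (i n).

(** If two homeomorphisms differ at [x], a branch point separates the two values; it also separates
    the values at any branch point close enough to [x]. *)
Lemma homeo_faithful g h : (forall x, act g x = act h x) -> g = h.
Proof.
move=> gh; apply/val_inj/funext => x /=; apply: contrapT => /cut_branch[n [ng nh]]; apply.
have pre (k : Homeo X) : i n <> k x -> nbhs x (k @^-1` same (i n) (k x)).
  move=> nk; apply: homeo_cont; apply: open_nbhs_nbhs; split; first exact: same_open.
  by apply: same_refl => /esym.
have [s [/= gs hs]] := nbhs_branch (filterI (pre g ng) (pre h nh)).
by rewrite -actE gh actE in gs; apply: (same_trans gs); exact: same_sym.
Qed.

Lemma branch_tree_symmetry : tree_symmetry btwT act.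
Proof.
split.
- move=> o; split.
  + exact: btwT_mtree.
  + by move=> x; apply: ii; rewrite actE.
  + by move=> g h x; apply: ii; rewrite !actE.
  + exact: homeo_faithful.
  + by move=> g x y go; rewrite /btwT -{2}go !actE => xy /homeo_sameE.
  move=> f f' fK f'K /(root_respects fK f'K)/respects_homeo[g gP].
  by exists g => n; apply: ii; rewrite actE gP.
- by move=> a x b ab /same_sym.
- by move=> g a x b ab; rewrite /btwT !actE => /homeo_sameE.
- by move=> o a b x; exact: btw_split.
- exact: btwT_meet.
Qed.

End Action.
End BranchTree.

Theorem theorem1p5 (R : realType) (X : topologicalType)
    (hX : wazewski_dendrite R X) : acyclic (Homeo X).
Proof.
have [T [i [ii iP]]] := branch_enum hX.
have /choice[act actP] (gn : Homeo X * T) : exists m, i m = gn.1 (i gn.2).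
  by apply/iP/homeo_branch/iP; exists gn.2.
have ts := branch_tree_symmetry hX ii iP (act := fun g n => act (g, n)) (fun g n => actP (g, n)).
have [_ [x0 _] _ _] := hX.
have [o _] := nbhs_branch hX iP (filterT : nbhs x0 setT).
by apply: acyclic_of_exact => A j j0; exact: (tree_symmetry_exact o ts j0).
Qed.
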